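(* Let $p>1$ and let $\Omega$ be any bounded domain in $\mathbb R^2$. The lower optimal constant $\Lambda^{\min}(\Omega)$ is always positive and given by $$\Lambda^{\min}(\Omega)=\inf_{\theta\in[0,2\pi]}\lambda_{1,p}(0,2L_\theta).$$ Moreover, the infimum is attained if and only if $\Omega$ has optimal anisotropic design. In this case, if $\theta_0$ is a global maximum point of the function $\theta\mapsto L_\theta$, then all (positive) multiples of $-\Delta_p^{H_0}$, with $$H_0(x,y)=(x\cos\theta_0+y\sin\theta_0)^+,$$ are extremal operators for the inequality $$\Lambda^{\min}(\Omega)\,\|H\|^p\le\lambda_1(-\Delta_p^H),$$ and they do not belong to $\mathcal E(\Omega)$.
   Context: $t^+=\max\{t,0\}$. $\mathscr H$ is the set of functions $H:\mathbb R^2\to\mathbb R$ that are non-negative, convex and positively $1$-homogeneous ($H(tx)=tH(x)$ for $t>0$); $\|H\|:=\max_{|x|=1}H(x)$. For $H\in\mathscr H$, $-\Delta_p^Hu=-\mathrm{div}(H^{p-1}(\nabla u)\nabla H(\nabla u))$ and $$\lambda_p^H(\Omega):=\inf\Big\{\int_\Omega H^p(\nabla u)\,dx:\ u\in W_0^{1,p}(\Omega),\ \|u\|_{L^p(\Omega)}=1\Big\}.$$ For an interval, $\lambda_{1,p}(0,\ell)=\inf\{\int_0^\ell|u'|^p:\ u\in W_0^{1,p}(0,\ell),\ \int_0^\ell|u|^p=1\}$. $\mathcal E(\Omega)$ is the set of operators $-\Delta_p^H$, $H\in\mathscr H\setminus\{0\}$, such that $\lambda_p^H(\Omega)$ is a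 fundamental frequency, i.e. there is a non-zero $u_p\in W_0^{1,p}(\Omega)$ such that $\nabla H(\nabla u_p)$ is well-defined a.e. and measurable and $\int_\Omega H^{p-1}(\nabla u_p)\nabla H(\nabla u_p)\cdot\nabla\varphi=\lambda_p^H(\Omega)\int_\Omega|u_p|^{p-2}u_p\varphi$ for all $\varphi\in W_0^{1,p}(\Omega)$ (with $H^{p-1}\nabla H$ understood as $0$ where $H=0$, well-definedness being required only where $H(\nabla u_p)\neq 0$). For such operators $\lambda_1(-\Delta_p^H):=\lambda_p^H(\Omega)$, and $$\Lambda^{\min}(\Omega)=\inf\{\lambda_1(-\Delta_p^H):\ -\Delta_p^H\in\mathcal E(\Omega),\ \|H\|=1\}.$$ An operator $-\Delta_p^H$, $H\in\mathscr H\setminus\{0\}$ (not necessarily in $\mathcal E(\Omega)$), is extremal for the inequality if $\lambda_p^H(\Omega)=\Lambda^{\min}(\Omega)\|H\|^p$; multiples of $-\Delta_p^{H_0}$ are the operators $-\Delta_p^{\alpha H_0}$, $\alpha>0$. The width function is $$L_\theta:=\sup_{(x,y)\in\mathbb R^2}\sup\{|J|:\ J\subset\{t(\cos\theta,\sin\theta)+(x,y):t\in\mathbb R\}\cap\Omega,\ J\text{ connected}\},$$ where $|J|$ is the length of $J$ (note $L_{\theta+\pi}=L_\theta$). $\Omega$ is said to have an optimal anisotropic design if $\theta\mapsto L_\theta$ has a global maximum on $[0,\pi]$. *)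

(* Defs.v *)
From HB Require Import structures.
From mathcomp Require Import all_boot all_order all_algebra.
From mathcomp Require Import all_classical all_reals all_analysis.

Set Implicit Arguments.
Unset Strict Implicit.
Unset Printing Implicit Defensive.

Import Order.TTheory GRing.Theory Num.Theory.
Import numFieldTopology.Exports numFieldNormedType.Exports.

Local Open Scope classical_set_scope.
Local Open Scope ring_scope.

Section Lebesgue_spaces.
Context {d} {T : measurableType d} {R : realType}.
Variable mu : {measure set T -> \bar R}.

Definition Lpnorm (D : set T) (p : R) (f : T -> R) : \bar R :=
  'N[mu]_p%:E[EFin \o (f \_ D)]%E.

Definition Lp (D : set T) (p : R) (f : T -> R) : Prop :=
  measurable_fun D f /\ (Lpnorm D p f < +oo)%E.

End Lebesgue_spaces.

Section one_dimension.
Context {R : realType}.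
Local Notation mu := (@lebesgue_measure R).

Definition test_function1 (I : set R) (phi : R -> R) : Prop :=
  [/\ forall (n : nat) (x : R), derivable (derive1n n phi) x 1,
      compact (closure [set x | phi x != 0]) &
      closure [set x | phi x != 0] `<=` I].

Definition weak_derivative1 (I : set R) (u g : R -> R) : Prop :=
  forall phi, test_function1 I phi ->
    (\int[mu]_(x in I) (u x * derive1 phi x)%:E =
     - \int[mu]_(x in I) (g x * phi x)%:E)%E.

(* [u] is in W_0^{1,p}(I) with weak derivative [g]: [u] is in W^{1,p}(I) and is
   a limit of test functions in the W^{1,p} norm. A Sobolev function is carried
   together with a representative of its weak derivative. *)
Definition W01p1 (I : set R) (p : R) (u g : R -> R) : Prop :=
  [/\ Lp mu I p u, Lp mu I p g, weak_derivative1 I u g &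
    exists phi : nat -> R -> R,
      [/\ forall n, test_function1 I (phi n),
          Lpnorm mu I p (fun x => phi n x - u x) @[n --> \oo] --> 0%E &
          Lpnorm mu I p (fun x => derive1 (phi n) x - g x) @[n --> \oo] --> 0%E]].

Definition lambda1p (p l : R) : \bar R :=
  ereal_inf [set v | exists u g : R -> R,
    [/\ W01p1 `]0, l[ p u g,
        (\int[mu]_(x in `]0%R, l[) (`|u x| `^ p)%:E = 1)%E &
        v = (\int[mu]_(x in `]0%R, l[) (`|g x| `^ p)%:E)%E]].

End one_dimension.

Section two_dimensions.
Context {R : realType}.
Local Notation plane := (R * R)%type.
Local Notation mu1 := (@lebesgue_measure R).
Local Notation mu := (mu1 \x mu1)%E.

Definition dot (v w : plane) : R := v.1 * w.1 + v.2 * w.2.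

Definition enorm (v : plane) : R := Num.sqrt (v.1 ^+ 2 + v.2 ^+ 2).

Definition domain (Omega : set plane) : Prop :=
  [/\ open Omega, connected Omega & Omega !=set0].

Definition basis_vector (b : bool) : plane := if b then (0, 1) else (1, 0).

Definition partial (b : bool) (f : plane -> R) : plane -> R :=
  fun x => 'D_(basis_vector b) f x.

Definition grad (f : plane -> R) : plane -> plane :=
  fun x => (partial false f x, partial true f x).

Definition smooth (f : plane -> R) : Prop :=
  forall s : seq bool,
    continuous (foldr partial f s) /\
    forall b x, derivable (foldr partial f s) x (basis_vector b).

Definition test_function (Omega : set plane) (phi : plane -> R) : Prop :=
  [/\ smooth phi,
      compact (closure [set x | phi x != 0]) &
      closure [set x | phi x != 0] `<=` Omega].

Definition weak_gradient (Omega : set plane) (u : plane -> R)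
    (g : plane -> plane) : Prop :=
  forall phi, test_function Omega phi ->
    (\int[mu]_(x in Omega) (u x * (grad phi x).1)%:E =
     - \int[mu]_(x in Omega) ((g x).1 * phi x)%:E)%E /\
    (\int[mu]_(x in Omega) (u x * (grad phi x).2)%:E =
     - \int[mu]_(x in Omega) ((g x).2 * phi x)%:E)%E.

(* [u] is in W_0^{1,p}(Omega) with weak gradient [g]. *)
Definition W01p (Omega : set plane) (p : R) (u : plane -> R)
    (g : plane -> plane) : Prop :=
  [/\ Lp mu Omega p u,
      Lp mu Omega p (fun x => (g x).1) /\ Lp mu Omega p (fun x => (g x).2),
      weak_gradient Omega u g &
    exists phi : nat -> plane -> R,
      [/\ forall n, test_function Omega (phi n),
          Lpnorm mu Omega p (fun x => phi n x - u x) @[n --> \oo] --> 0%E,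
          Lpnorm mu Omega p (fun x => (grad (phi n) x).1 - (g x).1)
            @[n --> \oo] --> 0%E &
          Lpnorm mu Omega p (fun x => (grad (phi n) x).2 - (g x).2)
            @[n --> \oo] --> 0%E]].

Definition anisotropy (H : plane -> R) : Prop :=
  [/\ forall x, 0 <= H x,
      convex_function [set: convex_lmodType plane] H &
      forall (t : R) x, 0 < t -> H (t *: x) = t * H x].

(* A maximum for [anisotropy H]: [H] is then continuous. *)
Definition Hnorm (H : plane -> R) : R := sup [set H x | x in [set x | enorm x = 1]].

Definition lambdaH (Omega : set plane) (p : R) (H : plane -> R) : \bar R :=
  ereal_inf [set v | exists u g,
    [/\ W01p Omega p u g, Lpnorm mu Omega p u = 1%E &
        v = (\int[mu]_(x in Omega) (H (g x) `^ p)%:E)%E]].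

(* [grad H (g x)] is only meaningful where [H (g x) != 0]; elsewhere the flux
   vanishes because [0 `^ (p - 1) = 0] for [p > 1]. The factor
   [`|u x| `^ (p - 2) * u x] likewise vanishes where [u x = 0]. *)
Definition eigenfunction (Omega : set plane) (p : R) (H : plane -> R)
    (u : plane -> R) (g : plane -> plane) : Prop :=
  [/\ ~ {ae mu, forall x, Omega x -> u x = 0},
      {ae mu, forall x, Omega x -> H (g x) != 0 -> differentiable H (g x)},
      measurable_fun (Omega `&` [set x | H (g x) != 0])
        (fun x => grad H (g x)) &
      forall phi dphi, W01p Omega p phi dphi ->
        (\int[mu]_(x in Omega)
           (H (g x) `^ (p - 1) * dot (grad H (g x)) (dphi x))%:E =
         lambdaH Omega p H *
         \int[mu]_(x in Omega) (`|u x| `^ (p - 2) * u x * phi x)%:E)%E].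

(* The operator -Delta_p^H is represented by [H]; this is membership in the
   class E(Omega) of operators for which [lambdaH] is a fundamental
   frequency. *)
Definition fundamental (Omega : set plane) (p : R) (H : plane -> R) : Prop :=
  [/\ anisotropy H, H <> (fun=> 0) &
      exists u g, W01p Omega p u g /\ eigenfunction Omega p H u g].

Definition Lambda_min (Omega : set plane) (p : R) : \bar R :=
  ereal_inf [set lambdaH Omega p H |
             H in [set H | fundamental Omega p H /\ Hnorm H = 1]].

Definition extremal (Omega : set plane) (p : R) (H : plane -> R) : Prop :=
  [/\ anisotropy H, H <> (fun=> 0) &
      lambdaH Omega p H = (Lambda_min Omega p * (Hnorm H `^ p)%:E)%E].

Definition line_param (theta : R) (a : plane) (t : R) : plane :=
  t *: (cos theta, sin theta) + a.

(* The length of a subset of a line is the Lebesgue measure of its preimage under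
   the arc-length parametrization. The supremum is finite when [Omega] is
   bounded, so that [fine] loses nothing. *)
Definition width (Omega : set plane) (theta : R) : R :=
  fine (ereal_sup [set l | exists (a : plane) (J : set plane),
    [/\ J `<=` range (line_param theta a) `&` Omega, connected J &
        l = mu1 (line_param theta a @^-1` J)]]).

Definition max_width_angle (Omega : set plane) (theta0 : R) : Prop :=
  forall theta, theta \in `[0, pi] -> width Omega theta <= width Omega theta0.

Definition optimal_design (Omega : set plane) : Prop :=
  exists2 theta0, theta0 \in `[0, pi] & max_width_angle Omega theta0.

Definition H0 (theta0 : R) (x : plane) : R :=
  Num.max (x.1 * cos theta0 + x.2 * sin theta0) 0.

End two_dimensions.

(* Main.v *)
Require Import Defs.
From HB Require Import structures.
From mathcomp Require Import all_boot all_order all_algebra.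
From mathcomp Require Import all_classical all_reals all_analysis.
From mathcomp Require Import measurable_realfun ring lra.
Import Order.TTheory GRing.Theory Num.Theory.
Import numFieldTopology.Exports numFieldNormedType.Exports.

(** On an interval of length at most [L], a function [u] vanishing at the ends
    satisfies [lambda (2 L) * int |u|^p <= int (u'^+)^p], because the even
    reflection of an antiderivative of [u'^+] is admissible on an interval of
    length [2 L]. Integrating over the lines of direction [theta] gives
    [lambdaH (H0 theta) >= lambda (2 L_theta)], and test functions supported in
    thin tubes around long segments give the equality. A supporting functional
    of [H] at a point of the circle where [H] is almost maximal shows that [H]
    almost dominates some [H0 theta], whence the lower bound for [Lambda_min].
    For the upper bound, [H0^p] is perturbed into
    [al * H0^p + be * (|x_1|^p + |x_2|^p)]: a minimizer exists by compactness
    and uniform convexity, and it is an eigenfunction. The one-sided inequality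
    has a remainder involving [u'^-]; for an eigenfunction of [H0 theta] it
    forces the directional derivative to be non-negative, hence zero as its
    integral vanishes, hence [u = 0]. *)

Set Implicit Arguments.
Unset Strict Implicit.
Unset Printing Implicit Defensive.

Local Open Scope classical_set_scope.
Local Open Scope ring_scope.

(** * Smooth functions on the line *)

(** The one-sided energy does not see descents: a function may rise over a length [L] and drop for
    free, which is why [2 L] appears. The delicate point is the remainder in u'^-, which must
    survive slicing and L^p limits without any regularity of the slices of a Sobolev function.
    Young's inequality against a fixed test function psi makes it linear: p * int u'^- psi is gained
    at a cost proportional to int |psi'|^q, with q = p / (p - 1). For tau * psi the gain is of order
    tau and the cost of order tau^q with q > 1, so equality in the inequality forces int u'^- psi =
    0. Sign changes of u are treated by the symmetry u(x) -> -u(-x), which preserves the one-sided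
    derivative, so that the negative part obeys the same inequality as the positive part. Since
    [Lambda_min] ranges over fundamental operators only, and [H0 theta] is not one of them, the
    upper bound has to be approached from outside the one-sided family; adding p-th powers keeps the
    perturbation convex and homogeneous, and controls the whole gradient. *)

Section smooth_functions_of_one_variable.
Context {R : realType}.
Implicit Types (f g phi : R -> R) (x a b c e : R) (n k : nat).

Variant smooth1 f : Prop := Smooth1 of forall n x, derivable (derive1n n f) x 1.

(** Recursion on the derivative gives the order-by-order form in which stability under sums,
    products and compositions is an induction. *)
Fixpoint smooth1_upto n f : Prop :=
  if n is m.+1 then (forall x, derivable f x 1) /\ smooth1_upto m (derive1 f)
  else True.

Lemma smooth1P f : smooth1 f <-> forall n, smooth1_upto n f.
Proof.
split.
  case=> sf n; elim: n f sf => //= n IH f sf; split; first exact: (sf 0%N).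
  by apply: IH => k x; rewrite -derive1Sn; exact: (sf k.+1).
move=> sf; split=> n; elim: n f sf => [|n IH] f sf x; first by case: (sf 1%N).
by rewrite derive1Sn; apply: IH => k; case: (sf k.+1).
Qed.

Lemma smooth1_uptoW n f : smooth1_upto n.+1 f -> smooth1_upto n f.
Proof. by elim: n f => // n IH f [df sf]; split => //; exact: IH. Qed.

Lemma smooth1_derivable f x : smooth1 f -> derivable f x 1.
Proof. by case=> /(_ 0%N x). Qed.

Lemma smooth1_is_derive f x : smooth1 f -> is_derive x 1 f (derive1 f x).
Proof.
by move=> sf; rewrite derive1E; apply/derivableP; exact: smooth1_derivable.
Qed.

Lemma smooth1_derive1 f : smooth1 f -> smooth1 (derive1 f).
Proof. by move=> [sf]; split=> n x; rewrite -derive1Sn; exact: (sf n.+1). Qed.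

Lemma derivable1_continuous f : (forall x, derivable f x 1) -> continuous f.
Proof.
by move=> df x; apply: differentiable_continuous; apply/derivable1_diffP.
Qed.

Lemma smooth1_continuous f : smooth1 f -> continuous f.
Proof. by move=> sf; apply: derivable1_continuous => x; exact: smooth1_derivable. Qed.

Lemma is_derive1D f g x a b : is_derive x 1 f a -> is_derive x 1 g b ->
  is_derive x 1 (fun y => f y + g y) (a + b).
Proof. by move=> F G; exact: (@is_deriveD _ _ _ f g x 1 a b F G). Qed.

Lemma is_derive1M f g x a b : is_derive x 1 f a -> is_derive x 1 g b ->
  is_derive x 1 (fun y => f y * g y) (f x * b + g x * a).
Proof. by move=> F G; exact: (@is_deriveM _ _ f g x 1 a b F G). Qed.

Lemma is_derive1Z c f x a : is_derive x 1 f a ->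
  is_derive x 1 (fun y => c * f y) (c * a).
Proof. by move=> F; exact: (@is_deriveZ _ _ _ f c x 1 a F). Qed.

Lemma is_derive1_compE f g x a b : is_derive (g x) 1 f a -> is_derive x 1 g b ->
  is_derive x 1 (fun y => f (g y)) (a * b).
Proof. by move=> F G; exact: (@is_derive1_comp _ f g x a b F G). Qed.

Lemma is_derive1_derive1 f x a : is_derive x 1 f a -> derive1 f x = a.
Proof. by move=> H; rewrite derive1E; case: H. Qed.

Lemma derivable_is_derive1 f x : derivable f x 1 -> is_derive x 1 f (derive1 f x).
Proof. by move=> H; rewrite derive1E; exact/derivableP. Qed.

Lemma derive1_of_is_derive f g : (forall x, is_derive x 1 f (g x)) -> derive1 f = g.
Proof. by move=> H; apply/funext => x; exact: is_derive1_derive1. Qed.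

Lemma is_derive1_eq f x a b : is_derive x 1 f a -> a = b -> is_derive x 1 f b.
Proof. by move=> H <-. Qed.

Lemma smooth1_upto_cst n c : smooth1_upto n (fun=> c).
Proof.
elim: n c => //= n IH c; split; first by move=> x; exact: derivable_cst.
have -> : derive1 (fun=> c : R) = (fun=> 0) by apply/funext => x; exact: derive1_cst.
exact: IH.
Qed.

Lemma smooth1_uptoD n f g : smooth1_upto n f -> smooth1_upto n g ->
  smooth1_upto n (fun x => f x + g x).
Proof.
elim: n f g => // n IH f g [df sf] [dg sg].
have H x := is_derive1D (derivable_is_derive1 (df x)) (derivable_is_derive1 (dg x)).
split; first by move=> x; case: (H x).
by rewrite (derive1_of_is_derive H); exact: IH.
Qed.

Lemma smooth1_uptoM n f g : smooth1_upto n f -> smooth1_upto n g ->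
  smooth1_upto n (fun x => f x * g x).
Proof.
elim: n f g => // n IH f g F G; have [df sf] := F; have [dg sg] := G.
have H x := is_derive1M (derivable_is_derive1 (df x)) (derivable_is_derive1 (dg x)).
split; first by move=> x; case: (H x).
rewrite (derive1_of_is_derive H).
apply: (@smooth1_uptoD n (fun x => f x * derive1 g x) (fun x => g x * derive1 f x)).
  by apply: IH => //; exact: smooth1_uptoW.
by apply: IH => //; exact: smooth1_uptoW.
Qed.

Lemma derive1_compE f g x : derivable f (g x) 1 -> derivable g x 1 ->
  is_derive x 1 (fun y => f (g y)) (derive1 f (g x) * derive1 g x).
Proof.
by move=> df dg; rewrite !derive1E; apply: is_derive1_comp; exact/derivableP.
Qed.

Lemma smooth1_upto_comp n f g : smooth1_upto n f -> smooth1_upto n g ->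
  smooth1_upto n (fun x => f (g x)).
Proof.
elim: n f g => // n IH f g F G.
have H x : is_derive x 1 (fun y => f (g y)) (derive1 f (g x) * derive1 g x).
  by apply: derive1_compE; [case: F|case: G].
split; first by move=> x; case: (H x).
rewrite (derive1_of_is_derive H).
apply: (@smooth1_uptoM n (fun x => derive1 f (g x)) (derive1 g)); last by case: G.
by apply: IH; [case: F|exact: smooth1_uptoW].
Qed.

Lemma smooth1_cst c : smooth1 (fun=> c).
Proof. by apply/smooth1P => n; exact: smooth1_upto_cst. Qed.

Lemma smooth1D f g : smooth1 f -> smooth1 g -> smooth1 (fun x => f x + g x).
Proof.
by move=> /smooth1P F /smooth1P G; apply/smooth1P => n; exact: smooth1_uptoD.
Qed.

Lemma smooth1M f g : smooth1 f -> smooth1 g -> smooth1 (fun x => f x * g x).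
Proof.
by move=> /smooth1P F /smooth1P G; apply/smooth1P => n; exact: smooth1_uptoM.
Qed.

Lemma smooth1_comp f g : smooth1 f -> smooth1 g -> smooth1 (fun x => f (g x)).
Proof.
by move=> /smooth1P F /smooth1P G; apply/smooth1P => n; exact: smooth1_upto_comp.
Qed.

Lemma smooth1_id : smooth1 (fun x => x).
Proof.
apply/smooth1P => -[|n] //; split; first by move=> x; exact: derivable_id.
have -> : derive1 (fun x : R => x) = (fun=> 1).
  by apply/funext => x; rewrite derive1E derive_id.
exact: smooth1_upto_cst.
Qed.

Lemma smooth1_affine a b : smooth1 (fun x => a * x + b).
Proof.
apply: (@smooth1D (fun x => a * x) (fun=> b)); last exact: smooth1_cst.
apply: (@smooth1M (fun=> a) (fun x => x)); [exact: smooth1_cst|exact: smooth1_id].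
Qed.

Lemma derive1_affine a b x : is_derive x 1 (fun y => a * y + b) a.
Proof.
apply: (is_derive1_eq (is_derive1D (is_derive1Z a (is_derive_id x 1)) (is_derive_cst b x 1))).
by rewrite addr0 mulr1.
Qed.

Lemma derive1_comp_affine f a b x : derivable f (a * x + b) 1 ->
  is_derive x 1 (fun y => f (a * y + b)) (a * derive1 f (a * x + b)).
Proof.
move=> df; rewrite mulrC.
exact: (@is_derive1_compE f (fun y => a * y + b) x _ _ (derivable_is_derive1 df) (derive1_affine a b x)).
Qed.

Lemma smooth1_antiderivative f g : (forall x, is_derive x 1 f (g x)) ->
  smooth1 g -> smooth1 f.
Proof.
move=> H sg; apply/smooth1P => -[|n] //; split; first by move=> x; case: (H x).
by rewrite (derive1_of_is_derive H); move/smooth1P: sg.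
Qed.

(* This family spans a space stable under differentiation: its members are
   smooth at zero. *)
Definition flat e k x := if 0 < x then x ^- k * expR (- (e / x)) else 0.

Lemma flat_le0 e k x : x <= 0 -> flat e k x = 0.
Proof. by rewrite /flat ltNge => ->. Qed.

Lemma flat_gt0 e k x : 0 < x -> flat e k x = x ^- k * expR (- (e / x)).
Proof. by rewrite /flat => ->. Qed.

Lemma flat_ge0 e k x : 0 <= flat e k x.
Proof.
rewrite /flat; case: ifPn => // x0.
by rewrite mulr_ge0 ?expR_ge0// invr_ge0 exprn_ge0// ltW.
Qed.

(** [expR (e / x)] is the power of order [k.+2] of [expR (e / (k.+2%:R * x))], whose base exceeds
    [e / (k.+2%:R * x)]. The left-hand side is the difference quotient of [flat e k] at 0, so the
    bound gives a zero derivative there. *)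
Lemma flat_bound e k x : 0 < e -> 0 < x ->
  x ^- k.+1 * expR (- (e / x)) <= (k.+2%:R / e) ^+ k.+2 * x.
Proof.
move=> e0 x0.
have y0 : 0 < e / (k.+2%:R * x) by rewrite divr_gt0// mulr_gt0.
have : (e / (k.+2%:R * x)) ^+ k.+2 <= expR (e / x).
  have -> : e / x = k.+2%:R * (e / (k.+2%:R * x)).
    by field; rewrite !gt_eqF// pnatr_eq0.
  rewrite expRM_natl lerXn2r ?nnegrE ?expR_ge0// 1?ltW//.
  by apply: lt_le_trans (expR_ge1Dx _); rewrite ltrDr.
rewrite expRN => H.
have -> : (k.+2%:R / e) ^+ k.+2 * x = x ^- k.+1 * ((e / (k.+2%:R * x)) ^+ k.+2)^-1.
  have -> : e / (k.+2%:R * x) = (k.+2%:R / e * x)^-1.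
    by field; rewrite ?gt_eqF ?pnatr_eq0//; lra.
  rewrite exprVn invrK [(_ * x) ^+ _]exprMn (exprS x k.+1).
  have : x ^+ k.+1 != 0 by rewrite expf_neq0// gt_eqF.
  by move: (x ^+ _) (_ ^+ k.+2) => u v u0; field.
rewrite ler_pM2l ?invr_gt0 ?exprn_gt0// lef_pV2// posrE ?expR_gt0//.
by rewrite exprn_gt0.
Qed.

Lemma flat_is_derive e k x : 0 < e ->
  is_derive x 1 (flat e k) (- k%:R * flat e k.+1 x + e * flat e k.+2 x).
Proof.
move=> e0; case: (ltgtP x 0) => x0.
- rewrite !flat_le0 ?ltW// !mulr0 addr0.
  have Hn : \near x, (fun=> 0) x = flat e k x.
    by near=> y; rewrite flat_le0// ltW//; near: y; exact: lt_nbhsl.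
  exact: (near_eq_is_derive Hn (is_derive_cst 0 x 1)).
- have xn0 : x != 0 by rewrite gt_eqF.
  rewrite !flat_gt0//.
  have Hn : \near x, (fun y => y ^- k * expR (- (e / y))) x = flat e k x.
    by near=> y; rewrite flat_gt0//; near: y; exact: lt_nbhsr.
  apply: (near_eq_is_derive Hn).
  have d1 : is_derive x 1 (fun y : R => y^-1) (- x ^- 2).
    apply: (is_derive1_eq (is_deriveV xn0 (is_derive_id x 1))).
    by rewrite [LHS]mulr1.
  have d2 := @is_deriveX _ _ (fun y : R => y^-1) k x 1 _ d1.
  have d3 := is_derive1Z (- e) d1.
  have d4 := @is_derive1_compE expR (fun y => - e * y^-1) x _ _ (is_derive_expR _) d3.
  have -> : (fun y : R => y ^- k * expR (- (e / y))) =
      (fun y : R => ((fun y : R => y^-1) ^+ k) y * expR (- e * y^-1)).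
    by apply/funext => y; rewrite fctE /= exprVn mulNr.
  apply: (is_derive1_eq (is_derive1M d2 d4)).
  rewrite -![_ *: _]/(_ * _) /= !fctE mulNr.
  have -> : k%:R * x^-1 ^+ k.-1 * - x ^- 2 = - (k%:R * (x^-1 ^+ k * x^-1)).
    case: k {d2 d4 Hn} => [|k]; first by rewrite !mul0r oppr0.
    by rewrite /= (exprS _ k) -exprVn expr2 mulrN -!mulrA (mulrCA x^-1).
  rewrite mulNr -!exprVn (exprSr _ k) (exprSr _ k.+1) (exprSr _ k).
  by move: (expR _) (x^-1 ^+ k) => u v; rewrite exprVn; field.
- have -> : x = 0 by [].
  rewrite !flat_le0// !mulr0 addr0.
  pose C := (k.+2%:R / e) ^+ k.+2.
  have C0 : 0 <= C by rewrite exprn_ge0// divr_ge0// ltW.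
  have lim0 : h^-1 *: ((flat e k \o shift 0) (h *: 1) - flat e k 0) @[h --> 0^'] --> 0.
    apply/cvgrPdist_le => eps eps0.
    near=> h.
    rewrite /= sub0r normrN addr0 [flat e k 0]flat_le0// subr0.
    rewrite -[_ *: 1]/(h * 1) mulr1 -[_ *: _]/(_ * _).
    case: (ltP 0 h) => h0; last by rewrite flat_le0// mulr0 normr0 ltW.
    rewrite flat_gt0// mulrA -invfM -exprS.
    rewrite ger0_norm; last by rewrite mulr_ge0 ?expR_ge0// invr_ge0 exprn_ge0// ltW.
    apply: (le_trans (flat_bound k e0 h0)).
    (* [C + 1] is visibly positive, as the division that follows requires. *)
    rewrite -/C; apply: (@le_trans _ _ ((C + 1) * h)); first by rewrite ler_pM2r// lerDl.
    rewrite -ler_pdivlMl ?ltr_wpDl// ltW//.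
    rewrite -[h]ger0_norm ?ltW//.
    near: h; apply: dnbhs0_lt; rewrite mulr_gt0// invr_gt0 ltr_wpDl//.
  split; first by apply/cvg_ex; exists 0.
  exact: cvg_lim lim0.
Unshelve. all: by end_near. Qed.

Lemma flat_smooth e k : 0 < e -> smooth1 (flat e k).
Proof.
move=> e0; apply/smooth1P => n; elim: n k => // n IH k; split.
  by move=> x; case: (flat_is_derive k x e0).
rewrite (derive1_of_is_derive (fun x => flat_is_derive k x e0)).
by apply: smooth1_uptoD; apply: smooth1_uptoM; by [exact: smooth1_upto_cst|exact: IH].
Qed.

End smooth_functions_of_one_variable.

Section smooth_positive_part.
Context {R : realType}.
Implicit Types (e x y s : R).

(* A smooth nondecreasing approximation of the positive part as [e] tends to 0. *)
Definition rho e x := x * flat e 0 x.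
Definition drho e x := flat e 0 x + e * flat e 1 x.

Lemma rho_le0 e x : x <= 0 -> rho e x = 0.
Proof. by move=> x0; rewrite /rho flat_le0// mulr0. Qed.

Lemma drho_le0 e x : x <= 0 -> drho e x = 0.
Proof. by move=> x0; rewrite /drho !flat_le0// mulr0 addr0. Qed.

Lemma rho_gt0 e x : 0 < x -> rho e x = x * expR (- (e / x)).
Proof. by move=> x0; rewrite /rho flat_gt0// expr0 invr1 mul1r. Qed.

Lemma drho_gt0 e x : 0 < x -> drho e x = (1 + e / x) * expR (- (e / x)).
Proof. by move=> x0; rewrite /drho !flat_gt0// expr0 expr1 invr1; ring. Qed.

Lemma rho_is_derive e x : 0 < e -> is_derive x 1 (rho e) (drho e x).
Proof.
move=> e0.
apply: (is_derive1_eq (is_derive1M (is_derive_id x 1) (flat_is_derive 0 x e0))).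
rewrite mulr1 mulNr mul0r oppr0 add0r /drho addrC; congr (_ + _).
case: (leP x 0) => x0; first by rewrite !flat_le0// !mulr0.
by rewrite !flat_gt0//; field; rewrite gt_eqF.
Qed.

Lemma rho_smooth e : 0 < e -> smooth1 (rho e).
Proof.
by move=> e0; apply: (@smooth1M _ (fun x => x)); [exact: smooth1_id|exact: flat_smooth].
Qed.

Lemma rho_ge0 e x : 0 <= rho e x.
Proof.
case: (leP x 0) => x0; first by rewrite rho_le0.
by rewrite rho_gt0// mulr_ge0 ?expR_ge0// ltW.
Qed.

Lemma rho_le e x : 0 < e -> rho e x <= Num.max x 0.
Proof.
move=> e0; case: (leP x 0) => x0; first by rewrite rho_le0.
rewrite rho_gt0// ger_pMr// -expR0 ler_expR oppr_le0 divr_ge0// ltW//.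
Qed.

(** From 1 - t <= exp (- t) with t = e / x. The error is uniform in [x], which is what makes the
    primitives of [rho] converge. *)
Lemma rho_lb e x : 0 < e -> Num.max x 0 - e <= rho e x.
Proof.
move=> e0; case: (leP x 0) => x0; first by rewrite rho_le0// sub0r oppr_le0 ltW.
rewrite rho_gt0//; have := expR_ge1Dx (- (e / x)); rewrite -(ler_pM2l x0).
by apply: le_trans; rewrite mulrDr mulr1 mulrN mulrCA mulfV ?gt_eqF// mulr1.
Qed.

Lemma drho_ge0 e x : 0 < e -> 0 <= drho e x.
Proof. by move=> e0; rewrite addr_ge0// ?mulr_ge0// ?flat_ge0// ltW. Qed.

(** With t = e / x the value is (1 + t) exp (- t). *)
Lemma drho_le1 e x : 0 < e -> drho e x <= 1.
Proof.
move=> e0; case: (leP x 0) => x0; first by rewrite drho_le0.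
by rewrite drho_gt0// expRN ler_pdivrMr ?expR_gt0// mul1r expR_ge1Dx.
Qed.

Lemma cvg_harmonic_mul x : (@harmonic R n * x) @[n --> \oo] --> 0.
Proof. by rewrite -[X in _ --> X](mul0r x); apply: cvgM; [exact: cvg_harmonic|exact: cvg_cst]. Qed.

Lemma cvg_expR_harmonic x : expR (- (@harmonic R n / x)) @[n --> \oo] --> (1 : R).
Proof.
rewrite -expR0; apply: continuous_cvg; first exact: continuous_expR.
by rewrite -oppr0; apply: cvgN; exact: cvg_harmonic_mul.
Qed.

Lemma rho_cvg x : rho (harmonic n) x @[n --> \oo] --> Num.max x 0.
Proof.
case: (leP x 0) => x0.
  by under eq_fun do rewrite rho_le0//; exact: cvg_cst.
under eq_fun do rewrite rho_gt0//.
rewrite -[x in nbhs x]mulr1; apply: cvgM; [exact: cvg_cst|exact: cvg_expR_harmonic].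
Qed.

Lemma drho_cvg x : drho (harmonic n) x @[n --> \oo] --> ((0 < x)%R%:R : R).
Proof.
case: (ltP 0 x) => x0; last first.
  by under eq_fun do rewrite drho_le0//; exact: cvg_cst.
under eq_fun do rewrite drho_gt0//.
rewrite -[X in nbhs X]mulr1; apply: cvgM; last exact: cvg_expR_harmonic.
rewrite -[X in _ --> X]addr0; apply: cvgD; first exact: cvg_cst.
exact: cvg_harmonic_mul.
Qed.

Lemma harmonic_pos n : 0 < @harmonic R n.
Proof. by rewrite /harmonic /= invr_gt0. Qed.

Lemma harmonic_mono m n : (m <= n)%N -> @harmonic R n <= harmonic m.
Proof. by move=> mn; rewrite /harmonic /= lef_pV2 ?posrE// ler_nat. Qed.

End smooth_positive_part.

Section positive_power.
Context {R : realType}.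
Implicit Types (p q s t : R).

Definition pospow p s := Num.max s 0 `^ p.

Lemma pospow_ge0 p s : 0 <= pospow p s.
Proof. exact: powR_ge0. Qed.

Lemma pospow_le0 p s : p != 0 -> s <= 0 -> pospow p s = 0.
Proof. by move=> p0 s0; rewrite /pospow max_r// powR0. Qed.

Lemma pospow_pos p s : 0 <= s -> pospow p s = s `^ p.
Proof. by move=> s0; rewrite /pospow max_l. Qed.

Lemma powR_normE p s : p != 0 -> `|s| `^ p = pospow p s + pospow p (- s).
Proof.
move=> p0; case: (leP s 0) => s0.
  by rewrite pospow_le0// add0r pospow_pos ?oppr_ge0// ler0_norm.
by rewrite gtr0_norm// [X in _ + X]pospow_le0 ?oppr_le0 ?ltW// addr0 pospow_pos// ltW.
Qed.

Lemma pospow_le p s t : 0 <= p -> s <= t -> pospow p s <= pospow p t.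
Proof.
move=> p0 st; have : Num.max s 0 <= Num.max t 0 by rewrite ge_max !le_max st lexx !orbT.
by apply: ge0_ler_powR => //; rewrite nnegrE le_max lexx orbT.
Qed.

Lemma pospow_is_derive_gt0 p s : 0 < s ->
  is_derive s 1 (pospow p) (p * pospow (p - 1) s).
Proof.
move=> s0; rewrite pospow_pos ?ltW//.
have Hn : \near s, s `^ p = pospow p s.
  by near=> y; rewrite pospow_pos//; apply: ltW; near: y; exact: lt_nbhsr.
exact: (near_eq_is_derive Hn (is_derive1_powR p s0)).
Unshelve. all: by end_near. Qed.

Lemma pospow_continuous p : 0 < p -> continuous (pospow p).
Proof.
move=> p0 s; case: (ltgtP s 0) => s0.
- apply: (@near_cst_continuous _ _ 0).
  by near=> y; rewrite pospow_le0 ?gt_eqF// ltW//; near: y; exact: lt_nbhsl.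
- apply: differentiable_continuous; apply/derivable1_diffP.
  by case: (pospow_is_derive_gt0 p s0).
- rewrite s0; apply/cvgrPdist_lt => e e0.
  rewrite pospow_le0 ?gt_eqF//; near=> y.
  rewrite sub0r normrN ger0_norm ?pospow_ge0//.
  case: (leP y 0) => y0; first by rewrite pospow_le0 ?gt_eqF.
  rewrite pospow_pos ?ltW//.
  have -> : e = (e `^ p^-1) `^ p by rewrite -powRrM mulVf ?gt_eqF// powRr1// ltW.
  apply: gt0_ltr_powR => //; rewrite ?nnegrE ?powR_ge0 ?ltW//.
  rewrite -[y]gtr0_norm// -[y]subr0 distrC.
  near: y; apply: cvgr_dist_lt; [exact: cvg_id|by rewrite powR_gt0].
Unshelve. all: by end_near. Qed.

Lemma pospow_is_derive p s : 1 < p ->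
  is_derive s 1 (pospow p) (p * pospow (p - 1) s).
Proof.
move=> p1; have p0 : p != 0 by rewrite gt_eqF// (lt_trans ltr01).
have q0 : 0 < p - 1 by rewrite subr_gt0.
case: (ltgtP s 0) => s0.
- rewrite [pospow (p - 1) s]pospow_le0 ?gt_eqF ?ltW// mulr0.
  have Hn : \near s, (fun=> 0) s = pospow p s.
    by near=> y; rewrite pospow_le0// ltW//; near: y; exact: lt_nbhsl.
  exact: (near_eq_is_derive Hn (is_derive_cst 0 s 1)).
- exact: pospow_is_derive_gt0.
- rewrite s0 [pospow (p - 1) 0]pospow_le0 ?gt_eqF// mulr0.
  have lim0 : h^-1 *: ((pospow p \o shift 0) (h *: 1) - pospow p 0) @[h --> 0^'] --> 0.
    have -> : (fun h => h^-1 *: ((pospow p \o shift 0) (h *: 1) - pospow p 0)) = pospow (p - 1).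
      apply/funext => h; rewrite /= [pospow p 0]pospow_le0// subr0 addr0.
      rewrite -[_ *: 1]/(h * 1) mulr1 -[_ *: _]/(_ * _).
      case: (leP h 0) => h0; first by rewrite !pospow_le0 ?mulr0// gt_eqF.
      rewrite !pospow_pos ?ltW// -(mulr_powRB1 (ltW h0)) ?(lt_trans ltr01)//.
      by rewrite mulKf// gt_eqF.
    have := pospow_continuous q0 (x := 0).
    rewrite /continuous_at [in X in _ --> X]pospow_le0 ?gt_eqF//.
    by apply: cvg_trans; apply: cvg_app; exact: nbhs_dnbhs.
  split; first by apply/cvg_ex; exists 0.
  exact: cvg_lim lim0.
Unshelve. all: by end_near. Qed.

Lemma powR_norm_continuous p : 0 < p -> continuous (fun s : R => `|s| `^ p).
Proof.
move=> p0; under eq_fun do rewrite powR_normE ?gt_eqF//.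
move=> x; apply: cvgD; first exact: pospow_continuous.
by apply: continuous_comp; [exact: opp_continuous|exact: pospow_continuous].
Qed.

(** Each of the two powers is at most its base times (s + t)^(p - 1). *)
Lemma powRD_ge p s t : 1 <= p -> 0 <= s -> 0 <= t -> s `^ p + t `^ p <= (s + t) `^ p.
Proof.
move=> p1 s0 t0.
have p0 : 0 < p by exact: lt_le_trans ltr01 p1.
have H u : 0 <= u -> u <= s + t -> u `^ p <= u * (s + t) `^ (p - 1).
  move=> u0 ut; rewrite -(mulr_powRB1 u0)//; apply: ler_wpM2l => //.
  by apply: ge0_ler_powR; rewrite ?nnegrE ?subr_ge0 ?addr_ge0.
apply: (@le_trans _ _ (s * (s + t) `^ (p - 1) + t * (s + t) `^ (p - 1))).
  by apply: lerD; apply: H; rewrite ?lerDl ?lerDr.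
by rewrite -mulrDl mulr_powRB1// addr_ge0.
Qed.

End positive_power.

Section compact_support.
Context {R : realType}.

(** Any compact set outside of which [f] vanishes is allowed, so that sums, derivatives and changes
    of variable never have to compute the closure of a support; [csuppP] gives the equivalence. *)
Definition csupp {T : topologicalType} (O : set T) (f : T -> R) :=
  exists K, [/\ compact K, K `<=` O & forall x, ~ K x -> f x = 0].

Lemma csuppP {T : topologicalType} (O : set T) (f : T -> R) : hausdorff_space T ->
  csupp O f <-> compact (closure [set x | f x != 0]) /\
                closure [set x | f x != 0] `<=` O.
Proof.
move=> hT; split=> [[K [cK KO f0]]|[cK KO]]; last first.
  exists (closure [set x | f x != 0]); split => // x nx.
  by apply/eqP; apply: contrapT => fx; apply: nx; apply: subset_closure; apply/negP.
have sub : closure [set x | f x != 0] `<=` K.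
  rewrite [X in _ `<=` X](closure_id K).1; last exact: compact_closed.
  apply: closure_subset => x /= fx; apply: contrapT => /f0 fx0.
  by rewrite fx0 eqxx in fx.
split; last exact: subset_trans sub KO.
by apply: subclosed_compact cK sub; exact: closed_closure.
Qed.

Lemma csupp_sub {T : topologicalType} (O : set T) (f g : T -> R) :
  (forall x, f x = 0 -> g x = 0) -> csupp O f -> csupp O g.
Proof. by move=> fg [K [cK KO f0]]; exists K; split => // x /f0; exact: fg. Qed.

Lemma csupp_subset {T : topologicalType} (O1 O2 : set T) (f : T -> R) :
  O1 `<=` O2 -> csupp O1 f -> csupp O2 f.
Proof. by move=> OO [K [cK KO f0]]; exists K; split => //; exact: subset_trans OO. Qed.

Lemma csuppD {T : topologicalType} (O : set T) (f g : T -> R) :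
  csupp O f -> csupp O g -> csupp O (fun x => f x + g x).
Proof.
move=> [K [cK KO f0]] [L [cL LO g0]]; exists (K `|` L); split.
- exact: compactU.
- by rewrite subUset.
- by move=> x /not_orP[/f0 -> /g0 ->]; rewrite addr0.
Qed.

Lemma csupp0 {T : topologicalType} (O : set T) : csupp O (fun=> 0).
Proof. by exists set0; split => //; exact: compact0. Qed.

Lemma csupp_out {T : topologicalType} (O : set T) (f : T -> R) x :
  csupp O f -> ~ O x -> f x = 0.
Proof. by move=> [K [cK KO f0]] nO; apply: f0 => /KO. Qed.

Implicit Types (f g : R -> R) (a b c d x : R).

Lemma test_function1P (O : set R) f :
  test_function1 O f <-> smooth1 f /\ csupp O f.
Proof.
have h : hausdorff_space R^o by exact: norm_hausdorff.
split=> [[sf cf Of]|[[sf] /(csuppP _ _ h)[? ?]]]; last by split.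
by split => //; apply/(csuppP _ _ h).
Qed.

Lemma csupp_derive1 (O : set R) f : csupp O f -> csupp O (derive1 f).
Proof.
move=> [K [cK KO f0]]; exists K; split => // x nK.
apply: is_derive1_derive1.
have : open (~` K) by apply: closed_openC; apply: compact_closed => //; exact: norm_hausdorff.
rewrite openE => /(_ x nK) nbx.
have Hn : \near x, (fun=> 0) x = f x by near=> y; rewrite f0//; near: y.
exact: (near_eq_is_derive Hn (is_derive_cst 0 x 1)).
Unshelve. all: by end_near. Qed.

Lemma csupp_itv a b f : a < b -> csupp `]a, b[ f ->
  exists c d, [/\ a < c, c < d, d < b & forall x, x <= c \/ d <= x -> f x = 0].
Proof.
move=> ab [K [cK KO f0]].
have [K0|/set0P K0] := eqVneq K set0.
  exists ((a + a + b) / 3), ((a + b + b) / 3); split; try by lra.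
  by move=> x _; apply: f0; rewrite K0.
have [d dK dmax] := compact_EVT_max K0 cK (@continuous_subspaceT _ _ K id (fun=> cvg_id)).
have cN : continuous (fun x : R => - x) by move=> x; exact: opp_continuous.
have [c cKK cmax] := compact_EVT_max K0 cK (@continuous_subspaceT _ _ K _ cN).
move: dK cKK; rewrite !inE => dK cKK.
have /KO := dK; have /KO := cKK; rewrite /= !in_itv /= => /andP[ac cb] /andP[ad db].
have cd : c <= d by apply: dmax; rewrite inE.
(* Half way between the compact set and the ends, so that the two points differ even when the
   compact set is a single point. *)
exists ((a + c) / 2), ((d + b) / 2); split; try by lra.
move=> x H; apply: f0 => Kx.
have := cmax x; have := dmax x; rewrite inE => /(_ Kx) ? /(_ Kx) ?.
by case: H => ?; lra.
Qed.

Lemma csupp_bounded (O : set R) f : csupp O f ->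
  exists M : R, 0 < M /\ csupp (`]- M, M[%classic : set R) f.
Proof.
move=> [K [cK KO f0]].
have [M0 [rM0 HM]] := compact_bounded cK.
exists (`|M0| + 2); split; first by rewrite ltr_wpDl.
exists K; split => // x Kx.
have /(HM (`|M0| + 1)) : M0 < `|M0| + 1.
  by rewrite (le_lt_trans (ler_norm _))// ltrDl.
move=> /(_ x Kx); rewrite /= in_itv /= => H; rewrite -ltr_norml.
by apply: le_lt_trans H _; rewrite ltrD2l; lra.
Qed.

End compact_support.

Section one_dimensional_integrals.
Context {R : realType}.
Local Notation mu := (@lebesgue_measure R).
Implicit Types (f g F G : R -> R) (a b c d x : R).

Lemma is_derive_continuous F f : (forall x, is_derive x 1 F (f x)) -> continuous F.
Proof. by move=> H; apply: derivable1_continuous => x; case: (H x). Qed.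

Lemma integral_itv_derive F f a b : a <= b ->
  (forall x, is_derive x 1 F (f x)) -> continuous f ->
  (\int[mu]_(x in `[a, b]) (f x)%:E = (F b - F a)%:E)%E.
Proof.
move=> ab dF cf; move: ab; rewrite le_eqVlt => /predU1P[->|ab].
  by rewrite set_itv1 integral_set1 subrr.
rewrite (@continuous_FTC2 _ f F)//.
- exact: continuous_subspaceT.
- have cF := is_derive_continuous dF; split.
  + by move=> x _; case: (dF x).
  + by apply: cvg_at_right_filter; exact: cF.
  + by apply: cvg_at_left_filter; exact: cF.
- by move=> x _; apply: is_derive1_derive1.
Qed.

Lemma continuous_itv_integrable f a b : continuous f ->
  mu.-integrable `[a, b] (EFin \o f).
Proof.
by move=> cf; apply: continuous_compact_integrable;
  [exact: segment_compact|exact: continuous_subspaceT].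
Qed.

Lemma integral_support (d : measure_display) (T : measurableType d)
    (m : {measure set T -> \bar R}) (D : set T) (f : T -> \bar R) :
  (forall z, ~ D z -> f z = 0%E) -> (\int[m]_z f z = \int[m]_(z in D) f z)%E.
Proof.
move=> f0; rewrite [RHS]integral_mkcond; apply: eq_integral => x _.
by rewrite patchE; case: ifPn => //; rewrite notin_setE => /f0.
Qed.

Lemma continuous_csupp_integrable (O : set R) f : continuous f -> csupp O f ->
  mu.-integrable setT (EFin \o f).
Proof.
move=> cf /csupp_bounded[M [M0 cs]].
have := continuous_itv_integrable (- M) M cf.
rewrite integrable_mkcond//; apply: eq_integrable => // x _.
rewrite patchE; case: ifPn => //; rewrite notin_setE /= in_itv /= => nx.
rewrite (csupp_out cs)//= in_itv /= => /andP[h1 h2].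
by apply: nx; rewrite !ltW.
Qed.

Lemma integral_derive_eq0 (O : set R) F f : (forall x, is_derive x 1 F (f x)) ->
  continuous f -> csupp O F -> (\int[mu]_x (f x)%:E = 0)%E.
Proof.
move=> dF cf /csupp_bounded[M [M0 cF]].
have cf' : csupp (`]- M, M[%classic : set R) f by rewrite -(derive1_of_is_derive dF); exact: csupp_derive1.
transitivity (\int[mu]_(x in `[(- M)%R, M]) (f x)%:E)%E.
  apply: integral_support => x nx; congr EFin; rewrite (csupp_out cf')//= in_itv /= => /andP[h1 h2].
  by apply: nx; rewrite /= in_itv /= !ltW.
rewrite (integral_itv_derive _ dF cf); last by lra.
by rewrite !(csupp_out cF) ?subrr// /= in_itv /= ltxx ?andbF.
Qed.

Lemma fun_continuous_measurable (D : set R) f : continuous f -> measurable_fun D f.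
Proof. by move=> /continuous_measurable_fun; exact: measurable_funS. Qed.

(** The push-forward of Lebesgue measure by [x |-> a * x + b], multiplied by |a|, has the right
    value on the half-open intervals, which determine Lebesgue measure. *)
Lemma integral_affine (f : R -> \bar R) a b : a != 0 ->
  measurable_fun setT f -> (forall x, 0 <= f x)%E ->
  (\int[mu]_x f x = `|a|%:E * \int[mu]_x f (a * x + b)%R)%E.
Proof.
move=> a0 mf f0.
pose h : measurableTypeR R -> measurableTypeR R := fun x => a * x + b.
have ch : continuous h.
  by move=> x; apply: cvgD; [apply: cvgM; [exact: cvg_cst|exact: cvg_id]|exact: cvg_cst].
have mh : measurable_fun setT h by exact: fun_continuous_measurable.
pose m1 : {measure set (measurableTypeR R) -> \bar R} := pushforward mu h.
pose k : {nonneg R} := NngNum (normr_ge0 a).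
pose m2 : {measure set (measurableTypeR R) -> \bar R} := mscale k (m1 mh).
have E A : measurable A -> mu A = m2 A.
  have U := @lebesgue_measure_unique R m2.

  move: A; apply: U => _ [[u v] _ <-] /=.
  rewrite /m2 /mscale /m1 /pushforward /=.
  have uv2 : mu `]u, v] = (Num.max (v - u) 0)%:E.
    rewrite lebesgue_measure_itv /= lte_fin; case: (ltP u v) => uv.
      by rewrite max_l// subr_ge0 ltW.
    by rewrite max_r// subr_le0.
  rewrite uv2 -[X in (_ * X)%E]/(mu (h @^-1` `]u, v])).
  have [ap|an|/eqP] := ltgtP a 0; last by rewrite (negbTE a0).
  - have -> : h @^-1` `]u, v] = `[(v - b) / a, (u - b) / a[%classic.
      apply/seteqP; split => x /=; rewrite !in_itv /= /h => /andP[h1 h2]; apply/andP; split.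
      + by rewrite ler_ndivrMr// mulrC; lra.
      + by rewrite ltr_ndivlMr// mulrC; lra.
      + by move: h2; rewrite ltr_ndivlMr// mulrC; lra.
      + by move: h1; rewrite ler_ndivrMr// mulrC; lra.
    rewrite lebesgue_measure_itv /= lte_fin ltr_nM2r ?invr_lt0// ltrD2r.
    case: (ltP u v) => uv; last by rewrite mule0 max_r// subr_le0.
    rewrite -EFinB -EFinM ltr0_norm// max_l ?subr_ge0 ?ltW//; congr EFin.
    by field; rewrite lt_eqF.
  - have -> : h @^-1` `]u, v] = `](u - b) / a, (v - b) / a]%classic.
      apply/seteqP; split => x /=; rewrite !in_itv /= /h => /andP[h1 h2]; apply/andP; split.
      + by rewrite ltr_pdivrMr// mulrC; lra.
      + by rewrite ler_pdivlMr// mulrC; lra.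
      + by move: h1; rewrite ltr_pdivrMr// mulrC; lra.
      + by move: h2; rewrite ler_pdivlMr// mulrC; lra.
    rewrite lebesgue_measure_itv /= lte_fin ltr_pM2r ?invr_gt0// ltrD2r.
    case: (ltP u v) => uv; last by rewrite mule0 max_r// subr_le0.
    rewrite -EFinB -EFinM gtr0_norm// max_l ?subr_ge0 ?ltW//; congr EFin.
    by field; rewrite gt_eqF.
rewrite (@eq_measure_integral _ _ _ _ m2); last by move=> A mA _; rewrite -E.
rewrite ge0_integral_mscale//; congr (_ * _)%E.
by rewrite ge0_integral_pushforward// preimage_setT.
Qed.

(** Every simple function below the extension of [f] by 0 is below that of [g], so the two suprema
    compare. *)
Lemma le_integral_ge0 (d : measure_display) (T : measurableType d)
    (m : {measure set T -> \bar R}) (D : set T) (f g : T -> \bar R) :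
  (forall z, D z -> 0 <= f z)%E -> (forall z, D z -> f z <= g z)%E ->
  (\int[m]_(z in D) f z <= \int[m]_(z in D) g z)%E.
Proof.
move=> f0 fg.
rewrite [leLHS]integral_mkcond [leRHS]integral_mkcond.
have f0' z : (0 <= (f \_ D) z)%E.
  by rewrite patchE; case: ifPn => // /set_mem; exact: f0.
have fg' z : ((f \_ D) z <= (g \_ D) z)%E.
  by rewrite !patchE; case: ifPn => // /set_mem; exact: fg.
rewrite !ge0_integralTE//; last by move=> x; exact: le_trans (fg' x).
apply: le_ereal_sup => _ [h Hh <-]; exists h => // x.
exact: le_trans (Hh x) (fg' x).
Qed.

(** It is 0 for [x < a], where the interval is empty; if [f] vanishes up to some [c > a], it is
    therefore an antiderivative on the whole line. *)
Definition primitive a f x : R := \int[mu]_(t in `[a, x]) f t.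

Lemma primitive_is_derive a c f x : a < c -> (forall x, x <= c -> f x = 0) ->
  continuous f -> is_derive x 1 (primitive a f) (f x).
Proof.
move=> ac f0 cf; case: (leP x a) => xa.
  rewrite f0 ?(le_trans xa) ?ltW//.
  have Hn : \near x, (fun=> 0) x = primitive a f x.
    near=> y; rewrite /primitive /Rintegral integral0_eq//.
    move=> t /=; rewrite in_itv /= => /andP[_ ty]; rewrite f0//.
    apply: (le_trans ty); apply: ltW; near: y; apply: lt_nbhsl.
    exact: le_lt_trans ac.
  exact: (near_eq_is_derive Hn (is_derive_cst 0 x 1)).
have xu : x < x + 1 by rewrite ltrDl.
have [d1 d2] := continuous_FTC1_closed xu (continuous_itv_integrable a (x + 1) cf) xa (cf x).
by rewrite -d2; exact: derivable_is_derive1.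
Unshelve. all: by end_near. Qed.

Lemma primitive_le a c f x : a < c -> (forall x, x <= c -> f x = 0) ->
  x <= c -> primitive a f x = 0.
Proof.
move=> ac f0 xc; rewrite /primitive /Rintegral integral0_eq//.
by move=> t /=; rewrite in_itv /= => /andP[_ ty]; rewrite f0// (le_trans ty).
Qed.

Lemma is_derive_ge0_le F f a b : (forall x, is_derive x 1 F (f x)) ->
  (forall x, 0 <= f x) -> a <= b -> F a <= F b.
Proof.
move=> dF f0 ab.
have H := @ger0_derive1_le_cc _ F a b.
apply: H => //; rewrite ?in_itv /= ?lexx ?ab//.
- by move=> x _; rewrite (is_derive1_derive1 (dF x)).
- by apply: continuous_subspaceT; exact: is_derive_continuous dF.
Qed.

End one_dimensional_integrals.

(** * Lebesgue spaces and the one-dimensional eigenvalue *)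

Lemma cvg0_le (R : realType) (u v : nat -> R) : (forall n, 0 <= u n <= v n) ->
  v n @[n --> \oo] --> 0 -> u n @[n --> \oo] --> 0.
Proof.
move=> uv /cvgrPdist_le cv; apply/cvgrPdist_le => e e0; move: (cv e e0).
apply: filterS => n; have /andP[u0 le] := uv n.
by rewrite !sub0r !normrN !ger0_norm// ?(le_trans u0)//; exact: le_trans.
Qed.

Lemma limn_einf_le (R : realType) (u : nat -> \bar R) k c :
  (forall n, (k <= n)%N -> (u n <= c)%E) -> (limn_einf u <= c)%E.
Proof.
move=> uc; rewrite limn_einf_lim; apply: lime_le; first exact: is_cvg_einfs.
exists k => // n /= kn; apply: le_trans (uc n kn).
by apply: ereal_inf_lbound; exists n => //=.
Qed.

Section Lp_functions.
Context {d : measure_display} {T : measurableType d} {R : realType}.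
Variables (mu : {measure set T -> \bar R}) (D : set T) (mD : measurable D).
Variables (p : R) (p1 : 1 < p).
Implicit Types (f g h : T -> R) (c : R).

Let p0 : 0 < p. Proof. exact: lt_trans ltr01 p1. Qed.
Let pN0 : p != 0. Proof. by rewrite gt_eqF. Qed.

Local Notation N := (Lpnorm mu D p).
Local Notation I f := (\int[mu]_(x in D) (`|f x| `^ p)%:E)%E.

Lemma powR_le_cancel (s t : R) : 0 <= s -> 0 <= t -> s `^ p <= t `^ p -> s <= t.
Proof.
by move=> s0 t0; apply: contraTT; rewrite -!ltNge => ts; exact: gt0_ltr_powR.
Qed.

Definition nrm f : R := fine (N f).

Lemma Lpnorm_pow f : (N f `^ p = I f)%E.
Proof.
rewrite /Lpnorm poweR_Lnorm// (integral_mkcond D).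
congr integral; apply/funext => x.
rewrite patchE -[(EFin \o _) x]/((f \_ D) x)%:E patchE; case: ifPn => _ //.
by rewrite -[RHS]/(0 : \bar R) -[point]/(0 : R) abse0 poweR_EFin powR0.
Qed.

Lemma LpnormE f : (N f = I f `^ p^-1)%E.
Proof.
by rewrite -Lpnorm_pow -poweRrM mulfV// poweRe1//; exact: Lnorm_ge0.
Qed.

Lemma Lp_energy_ge0 f : (0 <= I f)%E.
Proof. by apply: integral_ge0 => x _; rewrite lee_fin powR_ge0. Qed.

Lemma Lpnorm_ge0 f : (0 <= N f)%E.
Proof. exact: Lnorm_ge0. Qed.

Lemma nrm_ge0 f : 0 <= nrm f.
Proof. by rewrite fine_ge0// Lpnorm_ge0. Qed.

Lemma LpE f : Lp mu D p f <-> measurable_fun D f /\ (I f < +oo)%E.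
Proof.
rewrite /Lp -Lpnorm_pow; split => -[mf]; split => //; first exact: poweR_lty.
exact: (lty_poweRy pN0).
Qed.

Lemma Lp_norm f : Lp mu D p f -> N f = (nrm f)%:E.
Proof. by move=> [_ fi]; rewrite fineK// ge0_fin_numE// Lpnorm_ge0. Qed.

Lemma Lp_energy f : Lp mu D p f -> I f = (nrm f `^ p)%:E.
Proof. by move=> Lf; rewrite -Lpnorm_pow Lp_norm// poweR_EFin. Qed.

Lemma Lp_measurable f : Lp mu D p f -> measurable_fun D f.
Proof. by case. Qed.

Lemma eq_Lpnorm f g : (forall x, D x -> f x = g x) -> N f = N g.
Proof.
move=> fg; rewrite !LpnormE; congr poweR; apply: eq_integral => x /set_mem Dx.
by rewrite fg.
Qed.

Lemma LpnormD f g : measurable_fun D f -> measurable_fun D g ->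
  (N (fun x => f x + g x)%R <= N f + N g)%E.
Proof.
move=> mf mg; have mf' := (measurable_restrictT f mD).1 mf.
have mg' := (measurable_restrictT g mD).1 mg.
have := @minkowski_EFin _ _ _ mu (f \_ D) (g \_ D) p mf' mg' (ltW p1).
rewrite /Lpnorm; congr (_ <= _)%E; apply: eq_Lnorm => x /=.
by rewrite !patchE; case: ifPn => // _; rewrite addr0.
Qed.

Lemma LpD f g : Lp mu D p f -> Lp mu D p g -> Lp mu D p (fun x => f x + g x).
Proof.
move=> [mf fi] [mg gi]; split; first exact: measurable_funD.
by apply: le_lt_trans (LpnormD mf mg) _; rewrite lte_add_pinfty.
Qed.

Lemma nrmD f g : Lp mu D p f -> Lp mu D p g ->
  nrm (fun x => f x + g x) <= nrm f + nrm g.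
Proof.
move=> Lf Lg; rewrite -lee_fin EFinD -!Lp_norm//; last exact: LpD.
by apply: LpnormD; [case: Lf|case: Lg].
Qed.

Lemma energyZ c f : measurable_fun D f ->
  I (fun x => c * f x) = ((`|c| `^ p)%:E * I f)%E.
Proof.
move=> mf; under eq_integral do rewrite normrM powRM// EFinM.
rewrite ge0_integralZl_EFin ?powR_ge0//.
- apply/measurable_EFinP; apply: (measurableT_comp (measurable_powR _)).
  exact: measurableT_comp.
Qed.

Lemma LpnormZ c f : measurable_fun D f -> (N (fun x => c * f x)%R = `|c|%:E * N f)%E.
Proof.
move=> mf; rewrite !LpnormE energyZ// poweRM ?Lp_energy_ge0 ?lee_fin ?powR_ge0//.
by rewrite poweR_EFin -powRrM mulfV// powRr1.
Qed.

Lemma LpZ c f : Lp mu D p f -> Lp mu D p (fun x => c * f x).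
Proof.
move=> [mf fi]; split; first exact: measurable_funM.
by rewrite LpnormZ// lte_mul_pinfty.
Qed.

Lemma nrmZ c f : Lp mu D p f -> nrm (fun x => c * f x) = `|c| * nrm f.
Proof.
move=> Lf; apply: EFin_inj; rewrite EFinM -!Lp_norm//; last exact: LpZ.
by rewrite LpnormZ//; case: Lf.
Qed.

Lemma LpB f g : Lp mu D p f -> Lp mu D p g -> Lp mu D p (fun x => f x - g x).
Proof.
move=> Lf Lg; have := LpD Lf (LpZ (-1) Lg).
by under [in X in X -> _]eq_fun do rewrite mulN1r.
Qed.

Lemma nrm_eq f g : (forall x, D x -> f x = g x) -> nrm f = nrm g.
Proof. by move=> fg; rewrite /nrm (eq_Lpnorm fg). Qed.

Lemma nrmBC f g : Lp mu D p f -> Lp mu D p g ->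
  nrm (fun x => f x - g x) = nrm (fun x => g x - f x).
Proof.
move=> Lf Lg; have := nrmZ (-1) (LpB Lf Lg); rewrite normrN1 mul1r => <-.
by apply: nrm_eq => x _; rewrite mulN1r opprB.
Qed.

Lemma nrm_triangle f g h : Lp mu D p f -> Lp mu D p g -> Lp mu D p h ->
  nrm (fun x => f x - h x) <= nrm (fun x => f x - g x) + nrm (fun x => g x - h x).
Proof.
move=> Lf Lg Lh; apply: le_trans (nrmD (LpB Lf Lg) (LpB Lg Lh)).
by rewrite (@nrm_eq _ (fun x => f x - h x))// => x _; rewrite addrA subrK.
Qed.

Lemma nrm_sub_le f g : Lp mu D p f -> Lp mu D p g ->
  `|nrm f - nrm g| <= nrm (fun x => f x - g x).
Proof.
move=> Lf Lg; rewrite ler_norml; apply/andP; split.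
  rewrite lerNl opprB lerBlDr nrmBC//.
  apply: le_trans (nrmD (LpB Lg Lf) Lf).
  by rewrite (@nrm_eq _ g)// => x _; rewrite subrK.
rewrite lerBlDr; apply: le_trans (nrmD (LpB Lf Lg) Lg).
by rewrite (@nrm_eq _ f)// => x _; rewrite subrK.
Qed.

Lemma Lp_le f g : measurable_fun D f -> Lp mu D p g ->
  (forall x, D x -> `|f x| <= `|g x|) -> Lp mu D p f /\ nrm f <= nrm g.
Proof.
move=> mf Lg fg.
have H : (I f <= I g)%E.
  apply: le_integral_ge0 => x Dx; first by rewrite lee_fin powR_ge0.
  by rewrite lee_fin ge0_ler_powR ?nnegrE ?(ltW p0)// fg.
have Lf : Lp mu D p f.
  by apply/LpE; split => //; apply: le_lt_trans H _; case/LpE: Lg.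
split => //; rewrite -lee_fin -!Lp_norm// !LpnormE.
by apply: gt0_ler_poweR; rewrite ?invr_ge0 ?(ltW p0) ?in_itv /= ?Lp_energy_ge0 ?leey.
Qed.

Definition Lp_cvg (f_ : nat -> T -> R) f :=
  nrm (fun x => f_ n x - f x) @[n --> \oo] --> (0 : R).

Lemma Lp_cvgP (f_ : nat -> T -> R) f : (forall n, Lp mu D p (f_ n)) -> Lp mu D p f ->
  Lp_cvg f_ f <-> N (fun x => f_ n x - f x) @[n --> \oo] --> 0%E.
Proof.
move=> Lf_ Lf.
have E n : N (fun x => f_ n x - f x) = (nrm (fun x => f_ n x - f x))%:E.
  by apply: Lp_norm; exact: LpB.
under [in X in _ <-> X]eq_fun do rewrite E.
split; first by move=> H; apply: cvg_EFin => //; exact: nearW.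
by move=> /fine_cvgP[_].
Qed.

Lemma Lp_cvg_nrm (f_ : nat -> T -> R) f : (forall n, Lp mu D p (f_ n)) -> Lp mu D p f ->
  Lp_cvg f_ f -> nrm (f_ n) @[n --> \oo] --> nrm f.
Proof.
move=> Lf_ Lf cf; apply/cvgrPdist_le => e e0.
move/cvgrPdist_le : cf => /(_ e e0); apply: filterS => n.
rewrite sub0r normrN ger0_norm ?nrm_ge0// => H.
by apply: le_trans (nrm_sub_le Lf (Lf_ n)) _; rewrite nrmBC.
Qed.

Lemma Lp_cvg_energy (f_ : nat -> T -> R) f : (forall n, Lp mu D p (f_ n)) -> Lp mu D p f ->
  Lp_cvg f_ f -> I (f_ n) @[n --> \oo] --> I f.
Proof.
move=> Lf_ Lf cf; rewrite Lp_energy//.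
under eq_fun do rewrite Lp_energy//.
apply: cvg_EFin; first exact: nearW.
have H : continuous (fun s : R => `|s| `^ p) by exact: powR_norm_continuous.
have {H} : `|nrm (f_ n)| `^ p @[n --> \oo] --> `|nrm f| `^ p.
  exact: (cvg_comp _ _ (Lp_cvg_nrm Lf_ Lf cf) (H (nrm f))).
rewrite ger0_norm ?nrm_ge0//; apply: cvg_trans; apply: near_eq_cvg.
by near=> n; rewrite /= ger0_norm// nrm_ge0.
Unshelve. all: by end_near.
Qed.

Lemma Lp_cvgD (f_ g_ : nat -> T -> R) f g :
  (forall n, Lp mu D p (f_ n)) -> Lp mu D p f ->
  (forall n, Lp mu D p (g_ n)) -> Lp mu D p g ->
  Lp_cvg f_ f -> Lp_cvg g_ g ->
  Lp_cvg (fun n x => f_ n x + g_ n x) (fun x => f x + g x).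
Proof.
move=> Lf_ Lf Lg_ Lg cf cg.
have H : nrm (fun x => f_ n x - f x) + nrm (fun x => g_ n x - g x) @[n --> \oo] --> (0 : R).
  by rewrite -[X in _ --> X]addr0; exact: cvgD.
apply: (cvg0_le _ H) => n; rewrite nrm_ge0 /=.
apply: le_trans (nrmD (LpB (Lf_ n) Lf) (LpB (Lg_ n) Lg)).
rewrite [leRHS](@nrm_eq _ (fun x => f_ n x + g_ n x - (f x + g x)))// => x _.
by rewrite opprD addrACA.
Qed.

Lemma Lp_cvgZ c (f_ : nat -> T -> R) f :
  (forall n, Lp mu D p (f_ n)) -> Lp mu D p f -> Lp_cvg f_ f ->
  Lp_cvg (fun n x => c * f_ n x) (fun x => c * f x).
Proof.
move=> Lf_ Lf cf.
have : `|c| * nrm (fun x => f_ n x - f x) @[n --> \oo] --> `|c| * 0.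
  by apply: cvgM; [exact: cvg_cst|].
rewrite mulr0; under eq_fun => n.
  rewrite -nrmZ; last exact: LpB.
  rewrite (@nrm_eq _ (fun x => c * f_ n x - c * f x)); last by move=> x _; rewrite mulrBr.
  over.
by [].
Qed.

Lemma energy_measurable f : measurable_fun D f ->
  measurable_fun D (fun x => (`|f x| `^ p)%:E).
Proof.
move=> mf; apply/measurable_EFinP; apply: (measurableT_comp (measurable_powR _)).
exact: measurableT_comp.
Qed.

(** Riesz-Fischer. Along a subsequence with increments of norm at most 2^-k, monotone convergence
    makes the sum of the absolute increments finite almost everywhere; the pointwise limit is the
    limit in norm by Fatou's lemma. *)
Lemma Lp_complete (f_ : nat -> T -> R) : (forall n, Lp mu D p (f_ n)) ->
  (forall e, 0 < e -> exists n0 : nat, forall m n, (n0 <= m)%N -> (n0 <= n)%N ->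
     nrm (fun x => f_ m x - f_ n x) <= e) ->
  exists2 f, Lp mu D p f & Lp_cvg f_ f.
Proof.
move=> Lf_ cauchy.
have half0 k : (0 : R) < 2^-1 ^+ k by rewrite exprn_gt0// invr_gt0.
have /choice[n_ Hn] : forall k, exists n0 : nat, forall m n, (n0 <= m)%N -> (n0 <= n)%N ->
     nrm (fun x => f_ m x - f_ n x) <= 2^-1 ^+ k.
  by move=> k; exact: cauchy.
(* The running maximum puts every later index beyond all the earlier thresholds. *)
pose N_ k := (\max_(i < k.+1) n_ i)%N.
have N_ge k j : (j <= k)%N -> (n_ j <= N_ k)%N.
  by move=> jk; exact: (@leq_bigmax _ (fun i : 'I_k.+1 => n_ i) (Ordinal (jk : (j < k.+1)%N))).
pose g k := f_ (N_ k).
have Lg k : Lp mu D p (g k) by exact: Lf_.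
have gC k j : (k <= j)%N -> nrm (fun x => g j x - g k x) <= 2^-1 ^+ k.
  by move=> kj; apply: Hn; exact: N_ge.
pose h k x := `|g k.+1 x - g k x|.
pose S m x := \sum_(k < m) h k x.
have Lh k : Lp mu D p (h k) /\ nrm (h k) <= 2^-1 ^+ k.
  have LB := LpB (Lg k.+1) (Lg k).
  have [||H1 H2] := @Lp_le (h k) _ _ LB.
  - by apply: measurableT_comp => //; case: LB.
  - by move=> x _; rewrite /h normr_id.
  by split => //; apply: le_trans H2 _; exact: gC.
have LS m : Lp mu D p (S m) /\ nrm (S m) <= 2 - 2 * 2^-1 ^+ m.
  elim: m => [|m [IH1 IH2]].
    have E x : S 0%N x = 0 by rewrite /S big_ord0.
    split; last first.
      by rewrite /nrm LpnormE; under eq_integral do rewrite E normr0 powR0//;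
         rewrite integral0 poweR0r ?invr_eq0// expr0 mulr1 subrr.
    apply/LpE; split; first by rewrite (_ : S 0%N = cst 0)//; apply/funext.
    by under eq_integral do rewrite E normr0 powR0//; rewrite integral0.
  have E : S m.+1 = (fun x => S m x + h m x).
    by apply/funext => x; rewrite /S big_ord_recr.
  have [Lhm nhm] := Lh m.
  rewrite E; split; first exact: LpD.
  apply: (le_trans (nrmD IH1 Lhm)); apply: (le_trans (lerD IH2 nhm)).
  by rewrite (exprS _ m); lra.
have Smono x : {homo (fun m => S m x) : m n / (m <= n)%N >-> m <= n}.
  apply/nondecreasing_seqP => m; rewrite /S big_ord_recr /= lerDl; exact: normr_ge0.
have S0 m x : 0 <= S m x by apply: sumr_ge0 => i _; exact: normr_ge0.
have Slim : (\int[mu]_(x in D) limn (fun m => (`|S m x| `^ p)%:E) <= (2 `^ p)%:E)%E.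
  have H : (\int[mu]_(x in D) (`|S m x| `^ p)%:E)%E @[m --> \oo] --> (\int[mu]_(x in D) limn (fun m => (`|S m x| `^ p)%:E))%E.
    apply: cvg_monotone_convergence => // [m|x _ m n mn].
    - exact: energy_measurable (Lp_measurable (LS m).1).
    - by rewrite lee_fin ge0_ler_powR ?nnegrE ?(ltW p0)// !ger0_norm//; exact: Smono.
  rewrite -(cvg_lim _ H)//; apply: lime_le; first by apply/cvg_ex; eexists; exact: H.
  near=> m; rewrite Lp_energy ?lee_fin; last exact: (LS m).1.
  rewrite ge0_ler_powR ?nnegrE ?nrm_ge0 ?(ltW p0)//.
  apply: (le_trans (LS m).2); rewrite lerBlDr lerDl mulr_ge0// ltW//.
pose Sl x := limn (fun m => (`|S m x| `^ p)%:E).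
have Snd x : {homo (fun m => (`|S m x| `^ p)%:E) : m n / (m <= n)%N >-> (m <= n)%E}.
  move=> m n mn; rewrite lee_fin ge0_ler_powR ?nnegrE ?(ltW p0)// !ger0_norm//.
  exact: Smono.
have Scvg x : (`|S m x| `^ p)%:E @[m --> \oo] --> Sl x.
  exact: ereal_nondecreasing_is_cvgn (Snd x).
have mSl : measurable_fun D Sl.
  apply: (@emeasurable_fun_cvg _ _ _ D (fun m x => (`|S m x| `^ p)%:E)).
    by move=> m; exact: energy_measurable (Lp_measurable (LS m).1).
  by move=> x _; exact: Scvg.
have Sl0 x : (0 <= Sl x)%E.
  apply: lime_ge; first by apply/cvg_ex; eexists; exact: Scvg.
  by apply: nearW => m; rewrite lee_fin powR_ge0.
have iSl : mu.-integrable D Sl.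
  apply/integrableP; split => //.
  under eq_integral do rewrite gee0_abs//.
  by apply: le_lt_trans Slim _; exact: ltry.
(* The increments are absolutely summable on [E], and [D] minus [E] is negligible because [Sl] is
   integrable. *)
pose E := D `&` Sl @^-1` [set r | r \is a fin_num].
have mE : measurable E by exact: emeasurable_fin_num.
have ED : E `<=` D by move=> x [].
have DE0 : mu (D `\` E) = 0%E.
  have /negligibleP : mu.-negligible (D `\` E).
    apply: negligibleS (integrable_ae mD iSl) => x [Dx nE] /=.
    by move=> H; apply: nE; split => //=; exact: H.
  by apply; exact: measurableD.
have gcvg x : E x -> cvgn (fun k => g k x).
  move=> [Dx Slx].
  have Sb m : S m x <= fine (Sl x) `^ p^-1.
    have H : (`|S m x| `^ p <= fine (Sl x)).
      rewrite -lee_fin fineK//; apply: lime_ge; first by apply/cvg_ex; eexists; exact: Scvg.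
      by exists m => // n /= mn; exact: Snd.
    have -> : S m x = (`|S m x| `^ p) `^ p^-1.
      by rewrite -powRrM mulfV// powRr1// ger0_norm.
    by rewrite ge0_ler_powR ?nnegrE ?powR_ge0 ?invr_ge0 ?(ltW p0) ?fine_ge0.
  pose u k := g k.+1 x - g k x.
  have cu : cvgn (series u).
    apply: normed_cvg; rewrite (_ : [normed series u] = S ^~ x); last first.
      by rewrite /normed_series_of seriesEord.
    apply: nondecreasing_is_cvgn; first exact: Smono.
    by exists (fine (Sl x) `^ p^-1) => _ [m _ <-].
  rewrite (_ : (fun k => g k x) = (fun k => g 0%N x + series u k)).
    by apply: is_cvgD => //; exact: is_cvg_cst.
  apply/funext => k; rewrite /series /=; elim: k => [|k IH]; first by rewrite big_geq ?addr0.
  by rewrite big_nat_recr//= addrA -IH /u addrC subrK.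
pose f x := if x \in E then limn (fun k => g k x) else 0.
have mf : measurable_fun D f.
  apply: (@measurable_fun_cvg _ _ _ D (fun k => (g k) \_ E)).
    move=> k; apply/(measurable_restrict (g k) mE mD).
    by rewrite (setIidr ED); apply: measurable_funS (Lp_measurable (Lg k)).
  move=> x _; rewrite /f; under eq_fun do rewrite patchE.
  by case: ifPn => [/set_mem/gcvg //|_]; exact: cvg_cst.
have fg k : (I (fun x => f x - g k x) <= ((2^-1 ^+ k) `^ p)%:E)%E.
  have mfk : measurable_fun D (fun x => f x - g k x).
    by apply: measurable_funB => //; exact: Lp_measurable.
  rewrite (@ge0_negligible_integral _ _ _ mu D (D `\` E))//; [|exact: measurableD|exact: energy_measurable].
  rewrite setDD setIidr//.
  have E1 x : E x -> (`|f x - g k x| `^ p)%:E = limn_einf (fun m => (`|g m x - g k x| `^ p)%:E).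
    move=> Ex; apply/esym; apply: (cvg_limn_einf_sup _).1; apply: cvg_EFin; first exact: nearW.
    have H : continuous (fun s : R => `|s| `^ p) by exact: powR_norm_continuous.
    have cg : g m x - g k x @[m --> \oo] --> f x - g k x.
      apply: cvgB; last exact: cvg_cst.
      by rewrite /f mem_set//; exact: gcvg.
    exact: (cvg_comp _ _ cg (H _)).
  rewrite (eq_integral (fun x => limn_einf (fun m => (`|g m x - g k x| `^ p)%:E))); last first.
    by move=> x /set_mem; exact: E1.
  have mgE m : measurable_fun E (fun x => (`|g m x - g k x| `^ p)%:E).
    apply: (measurable_funS mD ED); apply: energy_measurable.
    by apply: measurable_funB; exact: Lp_measurable.
  have mg0 (m : nat) x : E x -> (0 <= (`|g m x - g k x| `^ p)%:E)%E.
    by move=> _; rewrite lee_fin powR_ge0.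
  apply: (le_trans (fatou mu mE mgE mg0)).
  apply: (@limn_einf_le _ _ k) => m km.
  apply: (@le_trans _ _ (I (fun x => g m x - g k x))).
    apply: ge0_subset_integral => //.
    by apply: energy_measurable; apply: measurable_funB; exact: Lp_measurable.
  rewrite Lp_energy; last exact: LpB.
  by rewrite lee_fin ge0_ler_powR ?nnegrE ?nrm_ge0 ?(ltW p0) ?(ltW (half0 k))// gC.
have Lfk k : Lp mu D p (fun x => f x - g k x).
  apply/LpE; split; first by apply: measurable_funB => //; exact: Lp_measurable.
  exact: le_lt_trans (fg k) (ltry _).
have nfk k : nrm (fun x => f x - g k x) <= 2^-1 ^+ k.
  have := fg k; rewrite Lp_energy// lee_fin => H.
  by apply: powR_le_cancel H; [exact: nrm_ge0|exact: ltW].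
have Lf : Lp mu D p f.
  have -> : f = (fun x => (f x - g 0%N x) + g 0%N x) by apply/funext => x; rewrite subrK.
  exact: LpD.
exists f => //; apply/cvgrPdist_le => e e0.
have [k ke] : exists k, 2^-1 ^+ k + 2^-1 ^+ k <= e.
  have /cvgrPdist_le/(_ (e / 2)) : (2^-1 : R) ^+ k @[k --> \oo] --> (0 : R).
    by apply: cvg_expr; rewrite ger0_norm ?invf_lt1// ltr1n.
  rewrite divr_gt0// => /(_ isT)[k _ /(_ k (leqnn k))].
  by rewrite sub0r normrN ger0_norm ?(ltW (half0 k))// => H; exists k; lra.
exists (n_ k) => // n /= kn.
rewrite sub0r normrN ger0_norm ?nrm_ge0//; apply: le_trans ke.
apply: (le_trans (nrm_triangle (Lf_ n) (Lg k) Lf)).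
apply: lerD; first by apply: Hn => //; exact: N_ge.
by rewrite nrmBC.
Unshelve. all: by end_near. Qed.

End Lp_functions.

(** Provides the real threshold on which [lambda1p_approx] and [test_approx] operate. *)
Lemma ereal_between (R : realType) (x y : \bar R) : (0 <= x)%E -> (x < y)%E ->
  exists r : R, (x < r%:E)%E /\ (r%:E <= y)%E.
Proof.
case: x => [x| |] // x0; case: y => [y| |] // xy; first by exists y.
by exists (x + 1); rewrite lte_fin ltrDl leey.
Qed.

Section power_mean.
Context {d : measure_display} {T : measurableType d} {R : realType}.
Variables (mu : {measure set T -> \bar R}) (D : set T) (mD : measurable D).
Variables (p : R) (p1 : 1 < p) (M : R).
Hypothesis muD : mu D = M%:E.

(** Hoelder's inequality against the indicator of [D], whose norm for the conjugate exponent is M^(1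
    - 1/p). *)
Lemma integral_le_nrm (f : T -> R) : Lp mu D p f ->
  (\int[mu]_(x in D) `|f x|%:E <= (nrm mu D p f * M `^ (1 - p^-1))%:E)%E.
Proof.
move=> Lf; have p0 : 0 < p by exact: lt_trans ltr01 p1.
have M0 : 0 <= M by rewrite -lee_fin -muD measure_ge0.
pose q := (1 - p^-1)^-1.
have q0 : 0 < q by rewrite invr_gt0 subr_gt0 invf_lt1.
have pq : p^-1 + q^-1 = 1 by rewrite invrK addrC subrK.
have mf' : measurable_fun setT (f \_ D).
  by apply/(measurable_restrictT f mD); exact: Lp_measurable Lf.
have m1 : measurable_fun setT (\1_D : T -> R) by exact: measurable_indic.
have := hoelder mu mf' m1 p0 q0 pq.
rewrite Lnorm1 -/(Lpnorm mu D p f) (Lp_norm Lf) EFinM.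
have -> : ('N[mu]_q%:E[EFin \o (\1_D : T -> R)] = (M `^ (1 - p^-1))%:E)%E.
  rewrite unlock; have -> : q^-1 = 1 - p^-1 by rewrite invrK.
  rewrite -poweR_EFin -muD; congr poweR.
  rewrite -[RHS]mul1e -integral_cst// (integral_mkcond D).
  congr integral; apply/funext => x; rewrite patchE /= indicE.
  case: ifPn => _; first by rewrite normr1 powR1.
  by rewrite -[RHS]/(0 : \bar R) normr0 powR0 ?gt_eqF.
apply: le_trans; rewrite integral_mkcond; apply: le_integral_ge0 => // x _.
  by rewrite patchE; case: ifPn.
rewrite patchE /= patchE indicE; case: ifPn => _; first by rewrite mulr1.
by rewrite mulr0 normr0.
Qed.

Lemma Lp_integrable (f : T -> R) : Lp mu D p f -> mu.-integrable D (EFin \o f).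
Proof.
move=> Lf; apply/integrableP; split.
  by apply/measurable_EFinP; exact: Lp_measurable Lf.
under eq_integral do rewrite /= -/(`|_|%:E).
by apply: le_lt_trans (integral_le_nrm Lf) _; exact: ltry.
Qed.

End power_mean.

Section continuous_functions.
Context {R : realType} {T : topologicalType}.
Implicit Types f g : T -> R.

Lemma continuous_comp1 f (g : R -> R) :
  continuous f -> continuous g -> continuous (fun x => g (f x)).
Proof. by move=> cf cg x; apply: (@continuous_comp _ _ _ f g); [exact: cf|exact: cg]. Qed.

Lemma continuous_add f g : continuous f -> continuous g -> continuous (fun x => f x + g x).
Proof. by move=> cf cg x; apply: cvgD; [exact: cf|exact: cg]. Qed.

Lemma continuous_mul f g : continuous f -> continuous g -> continuous (fun x => f x * g x).
Proof. by move=> cf cg x; apply: cvgM; [exact: cf|exact: cg]. Qed.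

End continuous_functions.

Section one_dimensional_eigenvalue.
Context {R : realType}.
Variables (p : R) (p1 : 1 < p).
Local Notation mu := (@lebesgue_measure R).
Local Notation E1 f := (\int[mu]_x (`|f x| `^ p)%:E)%E.
Implicit Types (f g phi psi : R -> R) (O : set R) (a b c l x y : R).

Let p0 : 0 < p. Proof. exact: lt_trans ltr01 p1. Qed.
Let pN0 : p != 0. Proof. by rewrite gt_eqF. Qed.

Lemma csupp_integral_lty O f : continuous f -> csupp O f -> (forall x, 0 <= f x) ->
  (\int[mu]_x (f x)%:E < +oo)%E.
Proof.
move=> cf sf f0; have /integrableP[_] := continuous_csupp_integrable cf sf.
by under eq_integral do rewrite gee0_abs ?lee_fin ?f0//.
Qed.

Lemma csupp_energy_lty O f : continuous f -> csupp O f -> (E1 f < +oo)%E.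
Proof.
move=> cf sf; apply: (@csupp_integral_lty O (fun x => `|f x| `^ p)).
- exact: (@continuous_comp1 _ _ f (fun s => `|s| `^ p) cf (powR_norm_continuous p0)).
- by apply: csupp_sub sf => x ->; rewrite normr0 powR0.
- by move=> x; exact: powR_ge0.
Qed.

Lemma energy_support O f : csupp O f ->
  (\int[mu]_(x in O) (`|f x| `^ p)%:E = E1 f)%E.
Proof.
move=> sf; apply/esym/integral_support => x nO.
by rewrite (csupp_out sf nO) normr0 powR0.
Qed.

Lemma csupp_Lp O f : measurable (O : set (measurableTypeR R)) -> continuous f -> csupp O f -> Lp mu O p f.
Proof.
move=> mO cf sf; apply/(LpE mu O p1 f); split; first exact: fun_continuous_measurable.
by rewrite energy_support//; exact: csupp_energy_lty cf sf.
Qed.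

Lemma smooth1_cont f : smooth1 f -> continuous (derive1 f).
Proof. by move=> sf; exact/smooth1_continuous/smooth1_derive1. Qed.

Lemma integration_by_parts1 O f g : smooth1 f -> smooth1 g -> csupp O g ->
  (\int[mu]_x (f x * derive1 g x)%:E = - \int[mu]_x (derive1 f x * g x)%:E)%E.
Proof.
move=> sf sg cg.
have cfg : csupp O (fun x => f x * derive1 g x).
  by apply: csupp_sub (csupp_derive1 cg) => x ->; rewrite mulr0.
have cgf : csupp O (fun x => derive1 f x * g x).
  by apply: csupp_sub cg => x ->; rewrite mulr0.
have c1 : continuous (fun x => f x * derive1 g x).
  exact: smooth1_continuous (smooth1M sf (smooth1_derive1 sg)).
have c2 : continuous (fun x => derive1 f x * g x).
  exact: smooth1_continuous (smooth1M (smooth1_derive1 sf) sg).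
have i1 := continuous_csupp_integrable c1 cfg.
have i2 := continuous_csupp_integrable c2 cgf.
have dfg x : is_derive x 1 (fun y => f y * g y) (f x * derive1 g x + derive1 f x * g x).
  apply: (is_derive1_eq (is_derive1M (smooth1_is_derive x sf) (smooth1_is_derive x sg))).
  by rewrite (mulrC (g x)).
have := integral_derive_eq0 dfg _ _ (O := O).
under eq_integral do rewrite EFinD; rewrite integralD//= => H.
have {H} : (\int[mu]_x (f x * derive1 g x)%:E + \int[mu]_x (derive1 f x * g x)%:E = 0)%E.
  apply: H; first exact: continuous_add.
  by apply: csupp_sub cg => x ->; rewrite mulr0.
have /fineK <- := integrable_fin_num measurableT i1.
have /fineK <- := integrable_fin_num measurableT i2.
by rewrite -EFinD -EFinN => -[H]; congr EFin; apply/eqP; rewrite -addr_eq0 H.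
Qed.

Lemma test_function1_itv a b phi : test_function1 `]a, b[ phi <->
  smooth1 phi /\ csupp (`]a, b[%classic : set R) phi.
Proof. exact: test_function1P. Qed.

Lemma csuppZ O c f : csupp O f -> csupp O (fun x => c * f x).
Proof. by apply: csupp_sub => x ->; rewrite mulr0. Qed.

Lemma smooth1Z c f : smooth1 f -> smooth1 (fun x => c * f x).
Proof. by move=> sf; exact: (@smooth1M _ (fun=> c) f (smooth1_cst c) sf). Qed.

Lemma derive1Z c f : smooth1 f -> derive1 (fun x => c * f x) = (fun x => c * derive1 f x).
Proof.
by move=> sf; apply: derive1_of_is_derive => x; exact: is_derive1Z (smooth1_is_derive x sf).
Qed.

Lemma test_W01p1 a b phi : smooth1 phi -> csupp (`]a, b[%classic : set R) phi ->
  W01p1 `]a, b[ p phi (derive1 phi).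
Proof.
move=> sf cf.
have mI : measurable (`]a, b[%classic : set (measurableTypeR R)) by exact: measurable_itv.
have cf' := csupp_derive1 cf.
have L1 : Lp mu `]a, b[ p phi by apply: csupp_Lp => //; exact: smooth1_continuous.
have L2 : Lp mu `]a, b[ p (derive1 phi) by apply: csupp_Lp => //; exact: smooth1_cont.
have N0 f : Lpnorm mu `]a, b[ p (fun x => f x - f x) = 0%E.
  rewrite LpnormE//; under eq_integral do rewrite subrr normr0 powR0//.
  by rewrite integral0 poweR0r// invr_eq0.
split => //.
- move=> psi /test_function1_itv[spsi cpsi].
  have E1 : (\int[mu]_(x in `]a, b[) (phi x * derive1 psi x)%:E = \int[mu]_x (phi x * derive1 psi x)%:E)%E.
    by apply/esym/integral_support => x nI; rewrite (csupp_out cf)// mul0r.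
  have E2 : (\int[mu]_(x in `]a, b[) (derive1 phi x * psi x)%:E = \int[mu]_x (derive1 phi x * psi x)%:E)%E.
    by apply/esym/integral_support => x nI; rewrite (csupp_out cf')// mul0r.
  by rewrite E1 E2; exact: integration_by_parts1 cpsi.
- exists (fun=> phi); split.
  + by move=> _; apply/test_function1_itv.
  + by rewrite N0; exact: cvg_cst.
  + by rewrite N0; exact: cvg_cst.
Qed.

(** Dividing [phi] by its norm makes it admissible in the infimum; the case of zero norm is separate
    since [lambda1p] could be infinite. *)
Lemma lambda1p_le l phi : smooth1 phi -> csupp (`]0, l[%classic : set R) phi ->
  (lambda1p p l * E1 phi <= E1 (derive1 phi))%E.
Proof.
move=> sf cf.
have cphi := smooth1_continuous sf.
have E0 : (0 <= E1 phi)%E by apply: integral_ge0 => x _; rewrite lee_fin powR_ge0.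
have fE : E1 phi \is a fin_num by rewrite ge0_fin_numE//; exact: csupp_energy_lty cphi cf.
move: fE E0; case E : (E1 phi) => [r| |] // _; rewrite lee_fin le_eqVlt => /predU1P[<-|r0].
  by rewrite mule0; apply: integral_ge0 => x _; rewrite lee_fin powR_ge0.
pose c := r `^ (- p^-1).
have c0 : 0 <= c by exact: powR_ge0.
have cp : c `^ p = r^-1 by rewrite -powRrM mulNr mulVf// powR_inv1// ltW.
have EZ f : continuous f -> E1 (fun x => c * f x) = (r^-1%:E * E1 f)%E.
  move=> cnf; rewrite energyZ//; last exact: fun_continuous_measurable.
  by rewrite ger0_norm// cp.
have H : (lambda1p p l <= r^-1%:E * E1 (derive1 phi))%E.
  apply: ereal_inf_lbound; exists (fun x => c * phi x), (derive1 (fun x => c * phi x)).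
  have sZ : smooth1 (fun x => c * phi x) by exact: smooth1Z.
  have cZ := csuppZ c cf; split; first exact: test_W01p1.
  - by rewrite energy_support// EZ// E -EFinM mulVf// gt_eqF.
  - rewrite energy_support; last exact: csupp_derive1.
    by rewrite derive1Z// EZ//; exact: smooth1_cont.
rewrite -lee_pdivlMr// muleC; exact: H.
Qed.

(** An admissible function is a limit of test functions in norm together with its derivative, so
    both integrals converge and the strict inequality holds for a late term of the sequence. *)
Lemma lambda1p_approx l y : (lambda1p p l < y%:E)%E ->
  exists phi, [/\ smooth1 phi, csupp (`]0, l[%classic : set R) phi,
    (0 < E1 phi)%E & (E1 (derive1 phi) < y%:E * E1 phi)%E].
Proof.
move=> /ereal_inf_lt[_ [u [g [[Lu Lg _ [phi [tphi cu cg]]] u1 ->]]]] gy.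
have mI : measurable (`]0, l[%classic : set (measurableTypeR R)) by exact: measurable_itv.
have sphi n : smooth1 (phi n) by case/test_function1_itv: (tphi n).
have cphi n : csupp (`]0, l[%classic : set R) (phi n) by case/test_function1_itv: (tphi n).
have Lphi n : Lp mu `]0, l[ p (phi n).
  by apply: csupp_Lp => //; exact: smooth1_continuous.
have Ldphi n : Lp mu `]0, l[ p (derive1 (phi n)).
  by apply: csupp_Lp => //; [exact: smooth1_cont|exact: csupp_derive1].
have E1phi := Lp_cvg_energy mI p1 Lphi Lu ((Lp_cvgP mI p1 Lphi Lu).2 cu).
have Edphi := Lp_cvg_energy mI p1 Ldphi Lg ((Lp_cvgP mI p1 Ldphi Lg).2 cg).
move: E1phi Edphi gy; rewrite u1 (Lp_energy p1 Lg).
have -> : (fun n => (\int[mu]_(x in `]0%R, l[) (`|phi n x| `^ p)%:E)%E) =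
    (fun n => (nrm mu `]0, l[ p (phi n) `^ p)%:E).
  by apply/funext => n; rewrite (Lp_energy p1 (Lphi n)).
have -> : (fun n => (\int[mu]_(x in `]0%R, l[) (`|derive1 (phi n) x| `^ p)%:E)%E) =
    (fun n => (nrm mu `]0, l[ p (derive1 (phi n)) `^ p)%:E).
  by apply/funext => n; rewrite (Lp_energy p1 (Ldphi n)).
move=> /fine_cvgP[_ c1] /fine_cvgP[_ c2]; rewrite lte_fin /= => gy.
set b := nrm mu _ p g `^ p in c2 gy.
have c3 : y * nrm mu `]0, l[ p (phi n) `^ p - nrm mu `]0, l[ p (derive1 (phi n)) `^ p
    @[n --> \oo] --> y * 1 - b.
  by apply: cvgB => //; apply: cvgM => //; exact: cvg_cst.
have H1 : \forall n \near \oo, 0 < nrm mu `]0, l[ p (phi n) `^ p.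
  by apply: (cvgr_gt _ c1); exact: ltr01.
have H2 : \forall n \near \oo, 0 < y * nrm mu `]0, l[ p (phi n) `^ p - nrm mu `]0, l[ p (derive1 (phi n)) `^ p.
  by apply: (cvgr_gt _ c3); rewrite mulr1 subr_gt0.
have [n [n1 n2]] := filter_ex (filterI H1 H2).
exists (phi n); split => //.
- by rewrite -(energy_support (cphi n)) (Lp_energy p1 (Lphi n)) lte_fin.
- rewrite -(energy_support (cphi n)) -(energy_support (csupp_derive1 (cphi n))).
  rewrite (Lp_energy p1 (Lphi n)) (Lp_energy p1 (Ldphi n)) -EFinM lte_fin.
  by rewrite -subr_gt0.
Qed.

Lemma integral_gt0 f x : continuous f -> (forall y, 0 <= f y) -> 0 < f x ->
  (0 < \int[mu]_x (f x)%:E)%E.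
Proof.
move=> cf f0 fx.
have /cvgrPdist_lt/(_ (f x / 2)) := cf x.
rewrite divr_gt0// => /(_ isT)/nbhs_ballP[e /= e0 He].
have fy y : `]x - e / 2, x + e / 2[%classic y -> f x / 2 <= f y.
  rewrite /= in_itv /= => /andP[h1 h2].
  have : ball x e y by rewrite /ball /= ltr_norml; apply/andP; split; lra.
  by move=> /He /=; rewrite ltr_norml => /andP[h3 h4]; lra.
pose I := `]x - e / 2, x + e / 2[%classic : set (measurableTypeR R).
have mI : measurable I by exact: measurable_itv.
apply: (@lt_le_trans _ _ (\int[mu]_(y in I) (f x / 2)%:E)%E).
  have muI : mu I = e%:E.
    by rewrite lebesgue_measure_itv /= lte_fin ifT -?EFinB; [congr EFin; lra|lra].
  by rewrite integral_cst//= muI -EFinM lte_fin mulr_gt0 ?divr_gt0.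
apply: (@le_trans _ _ (\int[mu]_(y in I) (f y)%:E)%E).
  by apply: le_integral_ge0 => y Iy; rewrite lee_fin ?fy// divr_ge0// ltW.
apply: ge0_subset_integral => //.
- by apply/measurable_EFinP; exact: fun_continuous_measurable.
- by move=> y _; rewrite lee_fin.
Qed.

Definition bump a b x : R := flat 1 0 (x - a) * flat 1 0 (b - x).

Lemma bump_ge0 a b x : 0 <= bump a b x.
Proof. by rewrite mulr_ge0// flat_ge0. Qed.

Lemma bump_gt0 a b x : a < x -> x < b -> 0 < bump a b x.
Proof.
by move=> ax xb; rewrite mulr_gt0// flat_gt0 ?subr_gt0// mulr_gt0 ?expR_gt0//
  invr_gt0 exprn_gt0// subr_gt0.
Qed.

Lemma bump_out a b x : ~ (a < x < b) -> bump a b x = 0.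
Proof.
move=> /negP; rewrite negb_and -!leNgt => /orP[h|h]; rewrite /bump.
  by rewrite flat_le0 ?mul0r// subr_le0.
by rewrite [X in _ * X]flat_le0 ?mulr0// subr_le0.
Qed.

Lemma smooth1_shift f c : smooth1 f -> smooth1 (fun x => f (x - c)).
Proof.
move=> sf; apply: (@smooth1_comp _ f (fun x => x - c)) => //.
exact: (@smooth1D _ _ (fun=> - c) (@smooth1_id R) (@smooth1_cst R (- c))).
Qed.

Lemma smooth1_opp_shift f c : smooth1 f -> smooth1 (fun x => f (c - x)).
Proof.
move=> sf; rewrite (_ : (fun x => _) = (fun x => f (- 1 * x + c))); last first.
  by apply/funext => x; rewrite mulN1r addrC.
exact: (@smooth1_comp _ f (fun x => - 1 * x + c) sf (smooth1_affine _ _)).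
Qed.

Lemma bump_smooth a b : smooth1 (bump a b).
Proof.
apply: (@smooth1M _ (fun x => flat 1 0 (x - a)) (fun x => flat 1 0 (b - x))).
- by apply: smooth1_shift; exact: flat_smooth.
- by apply: smooth1_opp_shift; exact: flat_smooth.
Qed.

Lemma bump_csupp a b c d : c < a -> b < d -> csupp (`]c, d[%classic : set R) (bump a b).
Proof.
move=> ca bd; exists `[a, b]%classic; split; first exact: segment_compact.
- by move=> x /=; rewrite !in_itv /= => /andP[h1 h2]; apply/andP; split; lra.
- by move=> x nx; apply: bump_out => /andP[h1 h2]; apply: nx; rewrite /= in_itv /= !ltW.
Qed.

Lemma lambda1p_lty l : 0 < l -> (lambda1p p l < +oo)%E.
Proof.
move=> l0; pose b := bump (l / 4) (3 * l / 4).
have sb : smooth1 b by exact: bump_smooth.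
have cb : csupp (`]0, l[%classic : set R) b by apply: bump_csupp; lra.
have H := lambda1p_le sb cb.
have fin := csupp_energy_lty (smooth1_cont sb) (csupp_derive1 cb).
rewrite ltNge leye_eq; apply/negP => /eqP E; move: H; rewrite E.
rewrite gt0_mulye; first by rewrite leye_eq => /eqP F; rewrite F in fin.
apply: (@integral_gt0 (fun x => `|b x| `^ p) (l / 2)).
- exact: (@continuous_comp1 _ _ b (fun s => `|s| `^ p) (smooth1_continuous sb) (powR_norm_continuous p0)).
- by move=> y; exact: powR_ge0.
- by rewrite powR_gt0// normr_gt0 gt_eqF// bump_gt0//; lra.
Qed.

Lemma lambda1p_ge0 l : (0 <= lambda1p p l)%E.
Proof.
apply: le_ereal_inf_tmp => _ [u [g [_ _ ->]]].
by apply: integral_ge0 => x _; rewrite lee_fin powR_ge0.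
Qed.

(** The explicit lower bound is l^(- p): a test function is the integral of its derivative, hence
    bounded by l^(1 - 1/p) times the norm of the derivative, and integrating the p-th power over the
    interval costs one more factor [l]. *)
Lemma lambda1p_gt0 l : 0 < l -> (0 < lambda1p p l)%E.
Proof.
move=> l0; apply: (@lt_le_trans _ _ (l `^ (- p))%:E); first by rewrite lte_fin powR_gt0.
rewrite leNgt; apply/negP => /lambda1p_approx[phi [sphi cphi]].
set I := `]0, l[%classic : set (measurableTypeR R).
have mI : measurable I by exact: measurable_itv.
have muI : mu I = l%:E by rewrite lebesgue_measure_itv /= lte_fin l0 sube0.
have Ld : Lp mu I p (derive1 phi).
  by apply: csupp_Lp => //; [exact: smooth1_cont|exact: csupp_derive1].
rewrite -(energy_support cphi) -(energy_support (csupp_derive1 cphi)) -/I => _.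
rewrite (Lp_energy p1 Ld) ltNge => /negP; apply.
set A := nrm mu I p (derive1 phi) * l `^ (1 - p^-1).
have A0 : 0 <= A by rewrite mulr_ge0 ?nrm_ge0 ?powR_ge0.
have HA x : `|phi x| <= A.
  case: (pselect (I x)) => [Ix|nI]; last by rewrite (csupp_out cphi)// normr0.
  move: Ix; rewrite /I /= in_itv /= => /andP[x0 xl].
  have := integral_itv_derive (ltW x0) (fun x => smooth1_is_derive x sphi) (smooth1_cont sphi).
  rewrite [phi 0](csupp_out cphi) ?subr0 ?/= ?in_itv /= ?ltxx// => H.
  rewrite -lee_fin -abse_EFin -H.
  have ci := continuous_itv_integrable 0 x (smooth1_cont sphi).
  apply: (le_trans (le_abse_integral mu _ _)) => //.
    by case/integrableP: ci.
  apply: le_trans (integral_le_nrm mI p1 muI Ld).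
  rewrite [leLHS]integral_mkcond [leRHS]integral_mkcond.
  apply: le_integral_ge0 => y _; first by rewrite patchE; case: ifPn.
  rewrite !patchE; case: ifPn => [_|_]; last by case: ifPn => // _; rewrite lee_fin.
  case: ifPn => //.
  rewrite notin_setE /I /= in_itv /= => ny.
  by rewrite (csupp_out (csupp_derive1 cphi)) ?normr0.
have : (\int[mu]_(x in I) (`|phi x| `^ p)%:E <= (A `^ p * l)%:E)%E.
  rewrite EFinM -muI -integral_cst//; apply: le_integral_ge0 => x _.
    by rewrite lee_fin powR_ge0.
  by rewrite lee_fin ge0_ler_powR ?nnegrE ?(ltW p0).
move=> H; apply: (@le_trans _ _ ((l `^ (- p))%:E * (A `^ p * l)%:E)%E).
  by apply: lee_wpmul2l => //; rewrite lee_fin powR_ge0.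
rewrite -EFinM lee_fin /A powRM ?nrm_ge0 ?powR_ge0// -powRrM mulrBl mul1r mulVf//.
rewrite -(mulrA _ _ l) [_ * l]mulrC (mulr_powRB1 (ltW l0) p0) mulrCA powRN mulVf ?mulr1//.
by rewrite gt_eqF// powR_gt0.
Qed.

Lemma lambda1p_mono l l' : l <= l' -> (lambda1p p l' <= lambda1p p l)%E.
Proof.
move=> ll'; rewrite leNgt; apply/negP => /(ereal_between (lambda1p_ge0 l))[r [lr rl']].
have [phi [sphi cphi _]] := lambda1p_approx lr.
rewrite ltNge => /negP; apply.
have cphi' : csupp (`]0, l'[%classic : set R) phi.
  apply: csupp_subset cphi => x /=; rewrite !in_itv /= => /andP[-> h] /=.
  exact: lt_le_trans h ll'.
apply: le_trans (lambda1p_le sphi cphi').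
by apply: lee_wpmul2r => //; apply: integral_ge0 => x _; rewrite lee_fin powR_ge0.
Qed.

Lemma energy_affine f a b : a != 0 -> continuous f ->
  (E1 f = `|a|%:E * E1 (fun x => f (a * x + b)))%E.
Proof.
move=> a0 cf; rewrite (@integral_affine _ (fun x => (`|f x| `^ p)%:E) a b a0)//.
apply/measurable_EFinP; apply: fun_continuous_measurable.
exact: (@continuous_comp1 _ _ f (fun s => `|s| `^ p) cf (powR_norm_continuous p0)).
Qed.

Lemma derive1_affineE f a b : smooth1 f ->
  derive1 (fun x => f (a * x + b)) = (fun x => a * derive1 f (a * x + b)).
Proof.
move=> sf; apply: derive1_of_is_derive => x.
by apply: derive1_comp_affine; exact: smooth1_derivable.
Qed.

Lemma smooth1_comp_affine f a b : smooth1 f -> smooth1 (fun x => f (a * x + b)).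
Proof. by move=> sf; exact: (smooth1_comp sf (smooth1_affine a b)). Qed.

Lemma energy_comp g f a b : a != 0 -> continuous f -> g = (fun x => f (a * x + b)) ->
  (E1 g = (`|a|^-1)%:E * E1 f)%E.
Proof.
move=> a0 cf ->; rewrite (energy_affine b a0 cf) muleA -EFinM mulVf ?mul1e//.
by rewrite normr_eq0.
Qed.

Lemma energy_derive1_comp g f a b : a != 0 -> smooth1 f -> g = (fun x => f (a * x + b)) ->
  (E1 (derive1 g) = (`|a| `^ p * `|a|^-1)%:E * E1 (derive1 f))%E.
Proof.
move=> a0 sf ->; rewrite derive1_affineE// EFinM -muleA.
rewrite -(@energy_comp (fun x => derive1 f (a * x + b)) (derive1 f) a b a0 (smooth1_cont sf) erefl).
rewrite energyZ//; apply: fun_continuous_measurable.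
exact: smooth1_continuous (smooth1_comp_affine _ _ (smooth1_derive1 sf)).
Qed.

Lemma csupp_comp_affine O f a b : a != 0 -> csupp O f ->
  csupp ((fun x => a * x + b) @^-1` O) (fun x => f (a * x + b)).
Proof.
move=> a0 [K [cK KO f0]].
exists ((fun y => a^-1 * y - a^-1 * b) @` K); split.
- apply: continuous_compact => //; apply: continuous_subspaceT.
  by apply: smooth1_continuous; exact: (smooth1_affine a^-1 (- (a^-1 * b))).
- move=> _ [y Ky <-] /=; rewrite mulrBr !mulVKf// subrK; exact: KO.
- move=> x nx; apply: f0 => Kx; apply: nx; exists (a * x + b) => //.
  by rewrite mulrDr mulKf// addrK.
Qed.

(** Bookkeeping of a stretching by [c]: [f1] and [f2] are the integrals of the stretched function
    and of its derivative, [e1] and [e2] those of the original. *)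
Lemma rayleigh_scale c r (L e1 e2 f1 f2 : \bar R) : 0 < c -> (0 <= e1)%E ->
  f1 = ((`|c^-1|^-1)%:E * e1)%E -> f2 = ((`|c^-1| `^ p * `|c^-1|^-1)%:E * e2)%E ->
  (L * f1 <= f2)%E -> (r%:E <= (c `^ p)%:E * L)%E -> (r%:E * e1 <= e2)%E.
Proof.
move=> c0 e0 -> ->; have cV : 0 < c^-1 by rewrite invr_gt0.
rewrite gtr0_norm// invrK => H rL.
apply: le_trans (lee_wpmul2r e0 rL) _.
have -> : e2 = ((c `^ p * c^-1)%:E * ((c^-1 `^ p * c)%:E * e2))%E.
  rewrite muleA -EFinM mulrCA -mulrA mulVf ?gt_eqF// mulr1.
  by rewrite -powRM ?(ltW c0) ?(ltW cV)// mulVf ?gt_eqF// powR1 mul1e.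
apply: le_trans (lee_wpmul2l _ H); last by rewrite lee_fin mulr_ge0 ?powR_ge0 ?ltW.
rewrite [(L * _)%E]muleA [(L * c%:E)%E]muleC !muleA -EFinM.
by rewrite mulfVK ?gt_eqF.
Qed.

(** Stretching by [c = l' / l] gives c^p * lambda(l') <= lambda(l), and c^p > 1 while lambda(l') is
    positive and finite. Strictness is what turns an attained infimum into a maximal width. *)
Lemma lambda1p_strict l l' : 0 < l -> l < l' -> (lambda1p p l' < lambda1p p l)%E.
Proof.
move=> l0 ll'; have l'0 : 0 < l' by exact: lt_trans ll'.
pose c := l' / l; have c1 : 1 < c by rewrite ltr_pdivlMr// mul1r.
have c0 : 0 < c by exact: lt_trans ltr01 c1.
have cV : 0 < c^-1 by rewrite invr_gt0.
have key : ((c `^ p)%:E * lambda1p p l' <= lambda1p p l)%E.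
  rewrite leNgt; apply/negP => /(ereal_between (lambda1p_ge0 l))[r [lr rl']].
  have [phi [sphi cphi phi0]] := lambda1p_approx lr.
  rewrite ltNge => /negP; apply.
  have [psi psiE] : {psi : R -> R | psi = (fun x => phi (c^-1 * x + 0))} by eexists.
  have spsi : smooth1 psi by rewrite psiE; exact: smooth1_comp_affine.
  have cpsi : csupp (`]0, l'[%classic : set R) psi.
    rewrite psiE.
    have := csupp_comp_affine 0 (lt0r_neq0 cV) cphi; apply: csupp_subset => x /=.
    rewrite !in_itv /= addr0 /c invf_div => /andP[h1 h2]; apply/andP; split.
      by move: h1; rewrite pmulr_rgt0// divr_gt0.
    by move: h2; rewrite mulrAC ltr_pdivrMr// ltr_pM2l.
  apply: (rayleigh_scale c0 (ltW phi0) _ _ (lambda1p_le spsi cpsi) rl').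
    exact: energy_comp (lt0r_neq0 cV) (smooth1_continuous sphi) psiE.
  exact: energy_derive1_comp (lt0r_neq0 cV) sphi psiE.
apply: lt_le_trans key; rewrite lte_pmull.
- have := @gt0_ltr_powR _ p p0 1 c; rewrite powR1 lte_fin; apply => //;
    by rewrite nnegrE ?ler01 ?(ltW c0).
- by rewrite ge0_fin_numE ?lambda1p_ge0// lambda1p_lty.
- exact: lambda1p_gt0.
Qed.

End one_dimensional_eigenvalue.

(** * The one-sided inequality on the line *)

Section one_sided_inequality.
Context {R : realType}.
Variables (p : R) (p1 : 1 < p) (L lam : R) (L0 : 0 < L) (lam0 : 0 < lam).
Local Notation mu := (@lebesgue_measure R).
Local Notation E1 f := (\int[mu]_x (`|f x| `^ p)%:E)%E.
Implicit Types (f g h phi psi v : R -> R) (O : set R) (a b c x y : R).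

(** Later instantiated with the value of [lambda1p p (2 * L)], by [lambda1p_le]. *)
Hypothesis Hlam : forall phi, smooth1 phi -> csupp (`]0, 2 * L[%classic : set R) phi ->
  (lam%:E * E1 phi <= E1 (derive1 phi))%E.

Let p0 : 0 < p. Proof. exact: lt_trans ltr01 p1. Qed.
Let pN0 : p != 0. Proof. by rewrite gt_eqF. Qed.

Lemma rayleigh_shift a phi : smooth1 phi ->
  csupp (`]a, a + 2 * L[%classic : set R) phi ->
  (lam%:E * E1 phi <= E1 (derive1 phi))%E.
Proof.
move=> sphi cphi.
have [psi psiE] : {psi : R -> R | psi = (fun x => phi (1 * x + a))} by eexists.
have spsi : smooth1 psi by rewrite psiE; exact: smooth1_comp_affine.
have cpsi : csupp (`]0, 2 * L[%classic : set R) psi.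
  rewrite psiE; have := csupp_comp_affine a (oner_neq0 R) cphi.
  apply: csupp_subset => x /=; rewrite !in_itv /= mul1r => /andP[h1 h2].
  by apply/andP; split; lra.
have arith (l e1 e2 f1 f2 : \bar R) : f1 = ((`|1 : R|^-1)%:E * e1)%E ->
    f2 = ((`|1 : R| `^ p * `|1 : R|^-1)%:E * e2)%E -> (l * f1 <= f2)%E -> (l * e1 <= e2)%E.
  by move=> -> ->; rewrite normr1 powR1 mul1r invr1 !mul1e.
have E1p := energy_comp p1 (oner_neq0 R) (smooth1_continuous sphi) psiE.
have E2p := energy_derive1_comp p1 (oner_neq0 R) sphi psiE.
exact: (arith _ _ _ _ _ E1p E2p (Hlam spsi cpsi)).
Qed.

Lemma integralD_ge0T (f g : R -> \bar R) : measurable_fun setT f ->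
  (forall x, 0 <= f x)%E -> measurable_fun setT g -> (forall x, 0 <= g x)%E ->
  (\int[mu]_x (f x + g x) = \int[mu]_x f x + \int[mu]_x g x)%E.
Proof. by move=> mf f0 mg g0; exact: ge0_integralD. Qed.

Lemma max0B (s : R) : Num.max s 0 - Num.max (- s) 0 = s.
Proof.
have [s0|s0] := leP s 0; first by rewrite max_l ?oppr_ge0// sub0r opprK.
by rewrite max_r ?subr0// oppr_le0 ltW.
Qed.

Lemma ge0_integralD_cont f g : continuous f -> continuous g ->
  (forall x, 0 <= f x) -> (forall x, 0 <= g x) ->
  (\int[mu]_x (f x + g x)%:E = \int[mu]_x (f x)%:E + \int[mu]_x (g x)%:E)%E.
Proof.
move=> cf cg f0 g0.
by rewrite -(@integralD_ge0T (EFin \o f) (EFin \o g))//;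
  apply/measurable_EFinP; exact: fun_continuous_measurable.
Qed.

Lemma ge0_integralZ_cont c f : 0 <= c -> continuous f -> (forall x, 0 <= f x) ->
  (\int[mu]_x (c * f x)%:E = c%:E * \int[mu]_x (f x)%:E)%E.
Proof.
move=> c0 cf f0.
rewrite -(@ge0_integralZl_EFin _ _ _ mu setT measurableT (EFin \o f))//.
- by move=> x _; rewrite /= lee_fin.
- by apply/measurable_EFinP; exact: fun_continuous_measurable.
Qed.

Lemma patch_itv (F : R -> \bar R) a b x :
  (F \_ `[a, b[) x = if a <= x < b then F x else 0%E.
Proof.
rewrite patchE; case: ifPn; first by rewrite inE /= in_itv /= => ->.
by rewrite notin_setE /= in_itv /= => /negP/negbTE ->.
Qed.

Lemma measurable_energy f : continuous f ->
  measurable_fun setT (fun x => (`|f x| `^ p)%:E : \bar R).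
Proof.
move=> cf; apply/measurable_EFinP; apply: fun_continuous_measurable.
exact: (@continuous_comp1 _ _ f (fun s => `|s| `^ p) cf (powR_norm_continuous p0)).
Qed.

Lemma integral_reflect (k : R -> \bar R) c : measurable_fun setT k ->
  (forall x, 0 <= k x)%E -> (\int[mu]_x k (c - x)%R = \int[mu]_x k x)%E.
Proof.
move=> mk k0; have N10 : (-1 : R) != 0 by rewrite oppr_eq0 oner_neq0.
rewrite [RHS](integral_affine c N10 mk k0) normrN1 mul1e.
by apply: eq_integral => x _; rewrite mulN1r addrC.
Qed.

(** Reflection counts both sides twice; halving is done by contradiction, as the values may be
    infinite. *)
Lemma double_arith (l e1 e2 e3 : \bar R) : (0 <= l)%E -> (0 <= e1)%E ->
  (e1 + e1 <= e2)%E -> (l * e2 <= e3 + e3)%E -> (l * e1 <= e3)%E.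
Proof.
move=> l0 e10 h1 h2.
have : (l * (e1 + e1) <= e3 + e3)%E by apply: le_trans h2; exact: lee_wpmul2l.
rewrite ge0_muleDr//; have := mule_ge0 l0 e10; move: (l * e1)%E => u u0 H.
rewrite leNgt; apply/negP => eu; move: H; rewrite leNgt => /negP; apply.
exact: lteD.
Qed.

(* The even reflection of the antiderivative of [h] about [a + L] is a test
   function on an interval of length [2 * L]. *)
Lemma primitive_inequality a h : smooth1 h -> (forall x, 0 <= h x) ->
  csupp (`]a, a + L[%classic : set R) h ->
  (lam%:E * \int[mu]_(x in `[a, (a + L)%R[) (`|primitive a h x| `^ p)%:E <= E1 h)%E.
Proof.
move=> sh h0 ch.
have aL : a < a + L by rewrite ltrDl.
have [c [d [ac cd db hout]]] := csupp_itv aL ch.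
set b := a + L in aL db *.
(* The derivative of the even reflection about [b]; since [h] vanishes near [b], the reflected
   function is smooth there. *)
pose H2 x := h x - h (2 * b - x).
have sH2 : smooth1 H2.
  apply: (@smooth1D _ h (fun x => - h (2 * b - x))) => //.
  rewrite (_ : (fun x => _) = (fun x => -1 * h (2 * b - x))); last first.
    by apply/funext => x; rewrite mulN1r.
  by apply: smooth1Z; exact: smooth1_opp_shift.
have H2c x : x <= c -> H2 x = 0 by move=> xc; rewrite /H2 !hout ?subrr; lra.
have dG x := primitive_is_derive x ac H2c (smooth1_continuous sH2).
set G := primitive a H2 in dG.
have sG : smooth1 G by exact: smooth1_antiderivative dG sH2.
have G0 x : x <= c -> G x = 0 by exact: primitive_le ac H2c.
have Gsym x : G (2 * b - x) = G x.
  have dD y : is_derive y 1 (fun z => G (- 1 * z + 2 * b) + - 1 * G z) 0.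
    have d1 : is_derive y 1 (fun z => G (- 1 * z + 2 * b)) (- 1 * derive1 G (- 1 * y + 2 * b)).
      by apply: derive1_comp_affine; exact: smooth1_derivable.
    apply: (is_derive1_eq (is_derive1D d1 (is_derive1Z (-1) (dG y)))).
    rewrite (derive1_of_is_derive dG) /H2 !mulN1r.
    by rewrite (_ : 2 * b - (- y + 2 * b) = y) ?(addrC (- y)); lra.
  have := is_derive_0_is_cst x b dD.
  by rewrite !mulN1r (addrC (- x)) (_ : - b + 2 * b = b) ?subrr; [move/eqP; rewrite subr_eq0 => /eqP|lra].
have cG : csupp (`]a, a + 2 * L[%classic : set R) G.
  exists `[c, 2 * b - c]%classic; split; first exact: segment_compact.
  - by move=> x /=; rewrite !in_itv /= /b => /andP[h1 h2]; apply/andP; split; rewrite /b in db *; lra.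
  - move=> x; rewrite /= in_itv /= => /negP; rewrite negb_and -!ltNge => /orP[xc|xc].
      by rewrite G0 ?ltW.
    by rewrite -Gsym G0//; lra.
have GF x : x < b -> G x = primitive a h x.
  move=> xb; rewrite /G /primitive; apply: eq_Rintegral => t.
  rewrite inE /= in_itv /= => /andP[_ tx]; rewrite /H2 [h (2 * b - t)]hout ?subr0//; right; lra.
have main := rayleigh_shift sG cG.
clearbody G.
rewrite (derive1_of_is_derive dG) in main.
(* The interval is half-open at [b], so that [k] and its reflection never live at the same point. *)
pose k x : \bar R := ((fun x => (`|primitive a h x| `^ p)%:E) \_ `[a, b[) x.
have hc x : x <= c -> h x = 0 by move=> xc; rewrite hout; [|left].
have dF x := primitive_is_derive x ac hc (smooth1_continuous sh).
have cF := is_derive_continuous dF.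
have mk : measurable_fun setT k.
  apply/(measurable_restrictT _ (measurable_itv _)); apply: measurable_funTS.
  exact: measurable_energy.
have kE x : k x = if a <= x < b then (`|primitive a h x| `^ p)%:E else 0%E by exact: patch_itv.
have e3 : (\int[mu]_x k x = \int[mu]_(x in `[a, b[) (`|primitive a h x| `^ p)%:E)%E.
  by rewrite [RHS]integral_mkcond.
clearbody k.
have k0 x : (0 <= k x)%E by rewrite kE; case: ifPn => // _; rewrite lee_fin powR_ge0.
have mE := measurable_energy (smooth1_continuous sh).
have e1 : (\int[mu]_x k x + \int[mu]_x k (2 * b - x)%R <= E1 G)%E.
  have mk' : measurable_fun setT (fun x => k (2 * b - x)).
    apply: (measurableT_comp mk); apply: fun_continuous_measurable.
    by apply: smooth1_continuous; exact: (smooth1_opp_shift (2 * b) (@smooth1_id R)).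
  rewrite -(integralD_ge0T mk k0 mk' (fun x => k0 _)).
  apply: le_integral_ge0 => x _; first by rewrite adde_ge0// k0.
  rewrite (kE x).
  rewrite (kE (2 * b - x)).
  have [/andP[xa xb]|xn] := boolP (a <= x < b).
    have /negbTE -> : ~~ (a <= 2 * b - x < b) by apply/negP => /andP[h1 h2]; lra.
    by rewrite adde0 GF.
  rewrite add0e.
  have [/andP[h1 h2]|_] := boolP (a <= 2 * b - x < b); last by rewrite lee_fin powR_ge0.
  by rewrite -GF// Gsym.
have e2 : (E1 H2 = E1 h + E1 h)%E.
  have sh' := smooth1_opp_shift (2 * b) sh.
  have E0 f x : (0 <= (`|f x| `^ p)%:E)%E by rewrite lee_fin powR_ge0.
  rewrite -[X in (_ + X)%E](integral_reflect (2 * b) mE (E0 h)).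
  rewrite -(integralD_ge0T mE (E0 h) (measurable_energy (smooth1_continuous sh')) (E0 _)).
  apply: eq_integral => x _; rewrite -EFinD /H2; congr EFin.
  case: (leP d x) => xd.
    by rewrite hout ?sub0r ?normrN ?normr0 ?powR0 ?add0r//; right.
  rewrite [h (2 * b - x)]hout ?subr0 ?normr0 ?powR0 ?addr0//; right; lra.
rewrite (integral_reflect (2 * b) mk k0) e3 in e1.
apply: (double_arith _ _ e1); first by rewrite lee_fin ltW.
  by apply: integral_ge0 => x _; rewrite lee_fin powR_ge0.
by rewrite -e2.

Qed.

Lemma max_continuous f : continuous f -> continuous (fun x => Num.max (f x) 0).
Proof.
move=> cf; have -> : (fun x => Num.max (f x) 0) = (fun x => 2^-1 * (f x + `|f x|)).
  apply/funext => x; case: (leP (f x) 0) => fx; first by rewrite ler0_norm// subrr mulr0.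
  by rewrite gtr0_norm//; lra.
apply: (@continuous_mul _ _ (fun=> 2^-1) (fun x => f x + `|f x|)).
  by move=> x; exact: cvg_cst.
apply: (@continuous_add _ _ f (fun x => `|f x|)) => //.
by apply: (@continuous_comp1 _ _ f (fun s => `|s|)) => //; exact: norm_continuous.
Qed.

(** The positive part of v' is not smooth: [primitive_inequality] is applied to [rho (harmonic n)]
    of v', which lies below it, and Fatou's lemma gives the limit. *)
Lemma positive_variation_inequality a v : smooth1 v ->
  csupp (`]a, a + L[%classic : set R) v ->
  (\int[mu]_(x in `[a, (a + L)%R[)
     (primitive a (fun t => Num.max (derive1 v t) 0) x `^ p)%:E <=
   lam^-1%:E * \int[mu]_x (pospow p (derive1 v x))%:E)%E.
Proof.
move=> sv cv.
have aL : a < a + L by rewrite ltrDl.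
have cdv := csupp_derive1 cv.
have sdv := smooth1_derive1 sv.
have [c [d [ac cd db dvout]]] := csupp_itv aL cdv.
pose h n x := rho (harmonic n) (derive1 v x).
have sh n : smooth1 (h n).
  by apply: (@smooth1_comp _ (rho (harmonic n))) => //; apply: rho_smooth; exact: harmonic_pos.
have ch n : csupp (`]a, a + L[%classic : set R) (h n).
  by apply: csupp_sub cdv => x E; rewrite /h E rho_le0.
have h0 n x : 0 <= h n x by exact: rho_ge0.
have hc n x : x <= c -> h n x = 0 by move=> xc; rewrite /h dvout ?rho_le0//; left.
pose w x := Num.max (derive1 v x) 0.
have cw : continuous w by apply: max_continuous; exact: smooth1_continuous.
have wc x : x <= c -> w x = 0 by move=> xc; rewrite /w dvout ?maxxx//; left.
have hw n x : h n x <= w x by apply: rho_le; exact: harmonic_pos.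
have wh n x : w x - harmonic n <= h n x by apply: rho_lb; exact: harmonic_pos.
have dV x := primitive_is_derive x ac wc cw.
have dF n x := primitive_is_derive x ac (@hc n) (smooth1_continuous (sh n)).
have V0 : primitive a w a = 0 by apply: (primitive_le ac wc); exact: ltW.
have F0 n : primitive a (h n) a = 0 by apply: (primitive_le ac (@hc n)); exact: ltW.
have key n : (\int[mu]_(x in `[a, (a + L)%R[) (`|primitive a (h n) x| `^ p)%:E <=
     lam^-1%:E * \int[mu]_x (pospow p (derive1 v x))%:E)%E.
  have := primitive_inequality (sh n) (h0 n) (ch n).
  rewrite muleC -lee_pdivlMr// => H; apply: (le_trans H); rewrite muleC.
  apply: lee_wpmul2l; first by rewrite lee_fin invr_ge0 ltW.
  apply: le_integral_ge0 => x _; first by rewrite lee_fin powR_ge0.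
  by rewrite lee_fin ger0_norm// ge0_ler_powR ?nnegrE ?(ltW p0)// ?hw// (le_trans (h0 n x)).
(* The difference of the primitives is squeezed between 0 and [harmonic n * (x - a)] by comparing
   derivatives. *)
have FV x : a <= x -> primitive a (h n) x @[n --> \oo] --> primitive a w x.
  move=> ax.
  have lb n : 0 <= primitive a w x - primitive a (h n) x.
    have dD y : is_derive y 1 (fun z => primitive a w z + -1 * primitive a (h n) z) (w y + -1 * h n y).
      exact: is_derive1D (dV y) (is_derive1Z (-1) (dF n y)).
    have := is_derive_ge0_le dD _ ax; rewrite V0 F0 !mulN1r subrr; apply.
    by move=> y; rewrite mulN1r subr_ge0.
  have ub n : primitive a w x - primitive a (h n) x <= harmonic n * (x - a).
    have dD y : is_derive y 1 (fun z => (harmonic n * z + 0) + (-1 * primitive a w z + primitive a (h n) z))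
         (harmonic n + (-1 * w y + h n y)).
      exact: is_derive1D (derive1_affine _ _ y) (is_derive1D (is_derive1Z (-1) (dV y)) (dF n y)).
    have := is_derive_ge0_le dD _ ax; rewrite V0 F0 !mulN1r !addr0 oppr0 !addr0 mulrBr => H.
    have {}H := H (fun y => _).
    have : harmonic n * a <= harmonic n * x + (- primitive a w x + primitive a (h n) x).
      by apply: H => y; rewrite mulN1r; have := wh n y; lra.
    by lra.
  apply/cvgrPdist_le => e e0.
  have /cvgrPdist_le/(_ e e0) := cvg_harmonic_mul (x - a).
  apply: filterS => n; rewrite sub0r normrN => H.
  rewrite ger0_norm//; apply: (le_trans (ub n)); apply: le_trans H; exact: ler_norm.
have mI : measurable (`[a, (a + L)%R[%classic : set (measurableTypeR R)) by exact: measurable_itv.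
have mF n : measurable_fun `[a, (a + L)%R[ (fun x => (`|primitive a (h n) x| `^ p)%:E).
  by apply: measurable_funTS; apply: measurable_energy; exact: is_derive_continuous (dF n).
have F1 n (x : R) : `[a, (a + L)%R[%classic x -> (0 <= (`|primitive a (h n) x| `^ p)%:E)%E.
  by move=> _; rewrite lee_fin powR_ge0.
apply: (le_trans _ (le_trans (fatou mu mI mF F1) (limn_einf_le (k := 0%N) (fun n _ => key n)))).
apply: le_integral_ge0 => x; rewrite /= in_itv /= => /andP[ax _]; first by rewrite lee_fin powR_ge0.
rewrite (cvg_limn_einf_sup (l := (primitive a w x `^ p)%:E) _).1//.
apply: cvg_EFin; first exact: nearW.
have Vx0 : 0 <= primitive a w x.
  have := is_derive_ge0_le dV _ ax; rewrite V0; apply => y.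
  by apply: le_trans (hw 0%N y).
rewrite -(ger0_norm Vx0).
have H : `|primitive a (h n) x| `^ p @[n --> \oo] --> `|primitive a w x| `^ p.
  have Hc : continuous (fun s : R => `|s| `^ p) by exact: powR_norm_continuous.
  exact: (cvg_comp _ _ (FV x ax) (Hc _)).
exact: H.
Qed.

Let q := p / (p - 1).

(** Young's inequality multiplied by [p], with p / q = p - 1. *)
Lemma young_pq (s t : R) : 0 <= s -> 0 <= t ->
  p * (s * t) <= s `^ p + (p - 1) * t `^ q.
Proof.
move=> s0 t0; have pm : 0 < p - 1 by rewrite subr_gt0.
have q0 : 0 < q by rewrite divr_gt0.
have pq : p^-1 + q^-1 = 1 by rewrite /q invf_div; field; rewrite gt_eqF.
have := @conjugate_powR _ s t p q s0 t0 p0 q0 pq.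
rewrite -(ler_pM2l p0) => /le_trans; apply.
rewrite mulrDr mulrCA mulfV// mulr1 lerD2l /q invf_div le_eqVlt; apply/orP; left.
by apply/eqP; field.
Qed.

(** [g] is the multiplier of Young's inequality. After integration by parts the negative variation,
    a non-local quantity, appears only through the local term max (- f', 0) * g; [cost] collects the
    energy and the price paid for [g]. *)
Definition gain (f g : R -> R) x : R :=
  lam * (`|f x| `^ p + p * (Num.max (- derive1 f x) 0 * g x)).

Definition cost (f g : R -> R) x : R :=
  pospow p (derive1 f x) + lam * (p - 1) * `|derive1 g x| `^ q.

Lemma qgt0 : 0 < q.
Proof. by rewrite divr_gt0// subr_gt0. Qed.

Lemma gain_continuous v psi : smooth1 v -> smooth1 psi -> continuous (gain v psi).
Proof.
move=> sv spsi; apply: (@continuous_mul _ _ (fun=> lam)); first by move=> x; exact: cvg_cst.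
apply: (@continuous_add _ _ (fun x => `|v x| `^ p)).
  exact: (@continuous_comp1 _ _ v (fun s => `|s| `^ p) (smooth1_continuous sv) (powR_norm_continuous p0)).
apply: (@continuous_mul _ _ (fun=> p)); first by move=> x; exact: cvg_cst.
apply: (@continuous_mul _ _ (fun x => Num.max (- derive1 v x) 0)); last exact: smooth1_continuous.
apply: max_continuous; have := smooth1_cont sv; move: (derive1 v) => f cf x.
exact: cvgN (cf x).
Qed.

Lemma cost_continuous v psi : smooth1 v -> smooth1 psi -> continuous (cost v psi).
Proof.
move=> sv spsi; apply: (@continuous_add _ _ (fun x => pospow p (derive1 v x))).
  exact: (@continuous_comp1 _ _ (derive1 v) (pospow p) (smooth1_cont sv) (pospow_continuous p0)).
apply: (@continuous_mul _ _ (fun=> lam * (p - 1))); first by move=> x; exact: cvg_cst.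
exact: (@continuous_comp1 _ _ (derive1 psi) (fun s => `|s| `^ q) (smooth1_cont spsi) (powR_norm_continuous qgt0)).
Qed.

Lemma gain_ge0 v psi x : 0 <= psi x -> 0 <= gain v psi x.
Proof.
move=> psi0; rewrite mulr_ge0 ?(ltW lam0)// addr_ge0 ?powR_ge0// mulr_ge0 ?(ltW p0)//.
by rewrite mulr_ge0// le_max lexx orbT.
Qed.

Lemma cost_ge0 v psi x : 0 <= cost v psi x.
Proof.
by rewrite addr_ge0 ?powR_ge0// mulr_ge0 ?powR_ge0// mulr_ge0 ?(ltW lam0)// subr_ge0 ltW.
Qed.

(* Writing [V] for the positive variation of [v] from [a] and [N] for its
   negative variation, [V = v + N], hence [V^p >= v^p + N^p]; Young's inequality
   bounds [N^p] from below by [- p N psi'], which integrates by parts. *)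
Lemma interval_inequality a v psi : smooth1 v -> (forall x, 0 <= v x) ->
  csupp (`]a, a + L[%classic : set R) v ->
  smooth1 psi -> (forall x, 0 <= psi x) ->
  csupp (`]a, a + L[%classic : set R) psi ->
  (\int[mu]_x (gain v psi x)%:E <= \int[mu]_x (cost v psi x)%:E)%E.
Proof.
move=> sv v0 cv spsi psi0 cpsi.
have aL : a < a + L by rewrite ltrDl.
have cdv := csupp_derive1 cv.
have [c [d [ac cd db dvout]]] := csupp_itv aL cdv.
pose w x := Num.max (derive1 v x) 0.
pose m x := Num.max (- derive1 v x) 0.
have cdv' := smooth1_cont sv.
have cw : continuous w by exact: max_continuous.
have cm : continuous m by apply: max_continuous => x; exact: cvgN (cdv' x).
have wc x : x <= c -> w x = 0 by move=> xc; rewrite /w dvout ?maxxx//; left.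
have mc x : x <= c -> m x = 0 by move=> xc; rewrite /m dvout ?oppr0 ?maxxx//; left.
have m0 x : 0 <= m x by rewrite /m le_max lexx orbT.
have wm x : w x - m x = derive1 v x.
  exact: max0B.
have dV x := primitive_is_derive x ac wc cw.
have dN x := primitive_is_derive x ac mc cm.
have V0 : primitive a w a = 0 by apply: (primitive_le ac wc); exact: ltW.
have N0 : primitive a m a = 0 by apply: (primitive_le ac mc); exact: ltW.
have va : v a = 0 by rewrite (csupp_out cv)//= in_itv /= ltxx.
have VN x : primitive a w x = v x + primitive a m x.
  have dD y : is_derive y 1 (fun z => primitive a w z + -1 * (v z + primitive a m z)) 0.
    apply: (is_derive1_eq (is_derive1D (dV y) (is_derive1Z (-1) (is_derive1D (smooth1_is_derive y sv) (dN y))))).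
    by have := wm y; lra.
  have := is_derive_0_is_cst x a dD; rewrite V0 N0 va !mulN1r !addr0 oppr0.
  by rewrite addr0 => /eqP; rewrite subr_eq0 => /eqP.
have Nge0 x : a <= x -> 0 <= primitive a m x.
  by move=> ax; have := is_derive_ge0_le dN m0 ax; rewrite N0.
have pv := positive_variation_inequality sv cv.
move: pv; rewrite -/w.
have cN := is_derive_continuous dN.
set V := primitive a w in V0 VN dV *; set N := primitive a m in N0 VN dN cN Nge0 *.
move=> pv; clearbody V N w.
have mpsi x : is_derive x 1 (fun y => N y * psi y) (N x * derive1 psi x + psi x * m x).
  exact: is_derive1M (dN x) (smooth1_is_derive x spsi).
have cNp : continuous (fun x => N x * derive1 psi x).
  exact: continuous_mul cN (smooth1_cont spsi).
have cpm : continuous (fun x => psi x * m x).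
  exact: continuous_mul (smooth1_continuous spsi) cm.
have sNp : csupp (`]a, a + L[%classic : set R) (fun x => N x * derive1 psi x).
  by apply: csupp_sub (csupp_derive1 cpsi) => x ->; rewrite mulr0.
have spm : csupp (`]a, a + L[%classic : set R) (fun x => psi x * m x).
  by apply: csupp_sub cpsi => x ->; rewrite mul0r.
have iNp := continuous_csupp_integrable cNp sNp.
have ipm := continuous_csupp_integrable cpm spm.
(* [N] is constant, and in general not zero, to the right of the support of v'; it is [psi] that
   makes the product compactly supported. *)
have ibp : (\int[mu]_x (psi x * m x)%:E <= \int[mu]_x (`|N x| * `|derive1 psi x|)%:E)%E.
  have cs : csupp (`]a, a + L[%classic : set R) (fun y => N y * psi y).
    by apply: csupp_sub cpsi => x ->; rewrite mulr0.
  have := integral_derive_eq0 mpsi (continuous_add cNp cpm) cs.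
  under eq_integral do rewrite EFinD.
  rewrite (integralD measurableT iNp ipm) => H.
  have {}H : (\int[mu]_x (psi x * m x)%:E = - \int[mu]_x (N x * derive1 psi x)%:E)%E.
    move: H; have /fineK <- := integrable_fin_num measurableT iNp.
    have /fineK <- := integrable_fin_num measurableT ipm.
    rewrite -EFinD -EFinN => -[H'].
    by congr EFin; apply/eqP; rewrite -addr_eq0 addrC H'.
  have [_ f2] := integrableP _ _ _ iNp.
  rewrite H; apply: le_trans (lee_abs _) _; rewrite abseN.
  apply: le_trans (le_abse_integral mu measurableT (measurable_int _ iNp)) _.
  by apply: le_integral_ge0 => x _; rewrite //= lee_fin normrM.
have cvp : continuous (fun x => `|v x| `^ p).
  exact: (@continuous_comp1 _ _ v (fun s => `|s| `^ p) (smooth1_continuous sv) (powR_norm_continuous p0)).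
have cpq : continuous (fun x => `|derive1 psi x| `^ q).
  exact: (@continuous_comp1 _ _ (derive1 psi) (fun s => `|s| `^ q) (smooth1_cont spsi) (powR_norm_continuous qgt0)).
have cnn : continuous (fun x => `|N x| * `|derive1 psi x|).
  apply: (@continuous_mul _ _ (fun x => `|N x|) (fun x => `|derive1 psi x|)).
    exact: (@continuous_comp1 _ _ N (fun s => `|s|) cN (@norm_continuous _ _)).
  exact: (@continuous_comp1 _ _ _ (fun s => `|s|) (smooth1_cont spsi) (@norm_continuous _ _)).
have pm0 : 0 <= p - 1 by rewrite subr_ge0 ltW.
have cst_cont (r : R) : continuous (fun _ : R => r) by move=> x; exact: cvg_cst.
pose I := `[a, (a + L)%R[%classic : set (measurableTypeR R).
have mI : measurable I by exact: measurable_itv.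
have cV := is_derive_continuous dV.
have e1 : (\int[mu]_x (gain v psi x)%:E = lam%:E * (\int[mu]_x (`|v x| `^ p)%:E + p%:E * \int[mu]_x (psi x * m x)%:E))%E.
  rewrite -ge0_integralZ_cont ?(ltW p0)//; last by move=> x; rewrite mulr_ge0.
  rewrite -ge0_integralD_cont//.
  - rewrite -ge0_integralZ_cont ?(ltW lam0)//.
    + by apply: eq_integral => x _; rewrite /gain -/(m x) (mulrC (psi x)).
    + exact: (@continuous_add _ _ _ (fun x => p * (psi x * m x)) cvp (continuous_mul (cst_cont p) cpm)).
    + by move=> x; rewrite addr_ge0 ?powR_ge0// mulr_ge0 ?(ltW p0)// mulr_ge0.
  - exact: (continuous_mul (cst_cont p) cpm).
  - by move=> x; rewrite mulr_ge0 ?(ltW p0)// mulr_ge0.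
have e3 : (\int[mu]_x (cost v psi x)%:E = \int[mu]_x (pospow p (derive1 v x))%:E + (lam * (p - 1))%:E * \int[mu]_x (`|derive1 psi x| `^ q)%:E)%E.
  have lp0 : 0 <= lam * (p - 1) by rewrite mulr_ge0 ?(ltW lam0).
  rewrite -ge0_integralZ_cont//.
  rewrite -ge0_integralD_cont//.
  - exact: (@continuous_comp1 _ _ (derive1 v) (pospow p) (smooth1_cont sv) (pospow_continuous p0)).
  - exact: (@continuous_mul _ _ (fun=> lam * (p - 1)) _ (cst_cont _) cpq).
  - by move=> x; exact: powR_ge0.
  - by move=> x; rewrite mulr_ge0// powR_ge0.
(* Pointwise on [I]: Young's inequality bounds p * N * |psi'| by N^p + (p - 1) |psi'|^q, and v^p +
   N^p <= (v + N)^p = V^p. *)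
have e2 : (\int[mu]_x (`|v x| `^ p)%:E + p%:E * \int[mu]_x (`|N x| * `|derive1 psi x|)%:E
   <= \int[mu]_(x in I) (V x `^ p)%:E + (p - 1)%:E * \int[mu]_x (`|derive1 psi x| `^ q)%:E)%E.
  rewrite -(ge0_integralZ_cont (ltW p0) cnn (fun x => mulr_ge0 (normr_ge0 _) (normr_ge0 _))).
  rewrite -(ge0_integralZ_cont pm0 cpq (fun x => powR_ge0 _ _)).
  rewrite -ge0_integralD_cont//; last 2 first.
  - exact: (continuous_mul (cst_cont p) cnn).
  - by move=> x; rewrite mulr_ge0 ?(ltW p0)// mulr_ge0.
  have -> : (\int[mu]_x (`|v x| `^ p + p * (`|N x| * `|derive1 psi x|))%:E =
      \int[mu]_(x in I) (`|v x| `^ p + p * (`|N x| * `|derive1 psi x|))%:E)%E.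
    apply: integral_support => x nI.
    have nI' : ~ `]a, (a + L)[%classic x.
      by move=> /=; rewrite in_itv /= => /andP[h1 h2]; apply: nI; rewrite /I /= in_itv /= ltW.
    by rewrite (csupp_out cv nI') (csupp_out (csupp_derive1 cpsi) nI') normr0 powR0// !mulr0 addr0.
  have mV : measurable_fun I (fun x => (V x `^ p)%:E).
    apply/measurable_EFinP; apply: (measurableT_comp (measurable_powR _)).
    exact: fun_continuous_measurable.
  have mP : measurable_fun setT (fun x => ((p - 1) * `|derive1 psi x| `^ q)%:E : \bar R).
    apply/measurable_EFinP; apply: fun_continuous_measurable.
    exact: (@continuous_mul _ _ (fun=> p - 1) _ (cst_cont _) cpq).
  apply: (@le_trans _ _ (\int[mu]_(x in I) (V x `^ p)%:E + \int[mu]_(x in I) ((p - 1) * `|derive1 psi x| `^ q)%:E)%E); last first.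
    apply: leeD => //; apply: ge0_subset_integral => // x _.
    by rewrite lee_fin mulr_ge0 ?powR_ge0.
  rewrite -ge0_integralD//; last 3 first.
  - by move=> x _; rewrite lee_fin powR_ge0.
  - by move=> x _; rewrite lee_fin mulr_ge0 ?powR_ge0.
  - exact: measurable_funTS.
  apply: le_integral_ge0 => x; rewrite /I /= in_itv /= => /andP[ax _].
    by rewrite lee_fin addr_ge0 ?powR_ge0// mulr_ge0 ?(ltW p0)// mulr_ge0.
  rewrite -EFinD lee_fin VN.
  have n0 := Nge0 _ ax.
  have Y := young_pq n0 (normr_ge0 (derive1 psi x)).
  have PD := powRD_ge (ltW p1) (v0 x) n0.
  rewrite (ger0_norm n0) (ger0_norm (v0 x)); lra.
rewrite e1 e3.
have I0 f : (forall x, 0 <= f x) -> (0 <= \int[mu]_x (f x)%:E)%E.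
  by move=> f0; apply: integral_ge0 => x _; rewrite lee_fin.
apply: (@le_trans _ _ (lam%:E * (\int[mu]_x (`|v x| `^ p)%:E + p%:E * \int[mu]_x (`|N x| * `|derive1 psi x|)%:E))%E).
  apply: lee_wpmul2l; first by rewrite lee_fin ltW.
  by apply: leeD => //; apply: lee_wpmul2l => //; rewrite lee_fin ltW.
apply: (le_trans (lee_wpmul2l (ltW lam0 : (0 <= lam%:E)%E) e2)).
apply: (@le_trans _ _ (lam%:E * (lam^-1%:E * \int[mu]_x (pospow p (derive1 v x))%:E + (p - 1)%:E * \int[mu]_x (`|derive1 psi x| `^ q)%:E))%E).
  by apply: lee_wpmul2l; [rewrite lee_fin ltW|apply: leeD].
rewrite ge0_muleDr//.
- by rewrite muleA -EFinM mulfV ?gt_eqF// mul1e muleA -EFinM.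
- rewrite mule_ge0 ?lee_fin ?invr_ge0 ?(ltW lam0)//; apply: I0 => x; exact: powR_ge0.
- by rewrite mule_ge0 ?lee_fin//; apply: I0 => x; exact: powR_ge0.
Qed.

End one_sided_inequality.

(** * Restriction of functions to the components of an open set of the line *)

Section cutting.
Context {R : realType}.
Implicit Types (f g h : R -> R) (O C K : set R) (a b c x y : R).

Definition cut C f x : R := if `[< C x >] then f x else 0.

Lemma cutT C f x : C x -> cut C f x = f x.
Proof. by move=> Cx; rewrite /cut asboolT. Qed.

Lemma cutF C f x : ~ C x -> cut C f x = 0.
Proof. by move=> Cx; rewrite /cut asboolF. Qed.

(** [C] is meant to be a component of [O]. The cut function coincides with [f] near a point of [C],
    and with 0 near a point of the open set [O] minus [C]; a point outside [O] is away from [K],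
    where [f] itself is 0. *)
Lemma cut_is_derive O C K f x : open C -> open (O `\` C) -> compact K -> K `<=` O ->
  (forall y, ~ K y -> f y = 0) -> derivable f x 1 ->
  is_derive x 1 (cut C f) (cut C (derive1 f) x).
Proof.
move=> oC oOC cK KO f0 df.
have [Cx|nC] := pselect (C x).
  rewrite cutT//; have : \near x, f x = cut C f x.
    by near=> y; rewrite cutT//; near: y; exact: open_nbhs_nbhs.
  by move/near_eq_is_derive; apply; exact: derivable_is_derive1.
rewrite cutF//.
suff : \near x, (fun=> 0) x = cut C f x.
  by move/near_eq_is_derive; apply; exact: is_derive_cst.
have [Ox|nO] := pselect (O x).
  have : nbhs x (O `\` C) by exact: open_nbhs_nbhs.
  by apply: filterS => y [_ nCy]; rewrite cutF.
have oK : open (~` K).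
  by apply: closed_openC; apply: compact_closed => //; exact: norm_hausdorff.
have : nbhs x (~` K) by apply: open_nbhs_nbhs; split => // /KO.
by apply: filterS => y nK; rewrite /cut; case: ifPn => // _; rewrite f0.
Unshelve. all: by end_near. Qed.

Lemma cut_smooth O C K f : open C -> open (O `\` C) -> compact K -> K `<=` O ->
  (forall y, ~ K y -> f y = 0) -> smooth1 f ->
  smooth1 (cut C f) /\ derive1 (cut C f) = cut C (derive1 f).
Proof.
move=> oC oOC cK KO f0 sf.
have E g : (forall y, ~ K y -> g y = 0) -> smooth1 g ->
    derive1 (cut C g) = cut C (derive1 g).
  move=> g0 sg; apply: derive1_of_is_derive => x.
  by apply: (cut_is_derive oC oOC cK KO g0); exact: smooth1_derivable.
split; last exact: E.
apply/smooth1P => n; elim: n f f0 sf => // n IH f f0 sf; split.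
  move=> x; have df : derivable f x 1 by exact: smooth1_derivable.
  by case: (cut_is_derive oC oOC cK KO f0 df).
rewrite E//; apply: IH; last exact: smooth1_derive1.
move=> y nK; apply: is_derive1_derive1.
have oK : open (~` K).
  by apply: closed_openC; apply: compact_closed => //; exact: norm_hausdorff.
have H : \near y, (fun=> 0) y = f y.
  have : nbhs y (~` K) by exact: open_nbhs_nbhs.
  by apply: filterS => z /f0.
exact: (near_eq_is_derive H (is_derive_cst 0 y 1)).
Qed.

(** Inside [K], the set [C] is the complement of the open set [O] minus [C], hence relatively
    closed. *)
Lemma cut_csupp O C K f : open (O `\` C) -> compact K -> K `<=` O ->
  (forall y, ~ K y -> f y = 0) -> compact (K `&` C) /\ forall y, ~ (K `&` C) y -> cut C f y = 0.
Proof.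
move=> oOC cK KO f0; split.
  have -> : K `&` C = K `&` ~` (O `\` C).
    apply/seteqP; split => x [Kx Cx]; split => //; first by move=> [_].
    by apply: contrapT => nC; apply: Cx; split => //; exact: KO.
  apply: (subclosed_compact _ cK); last by move=> x [].
  apply: closedI; last exact: open_closedC.
  by apply: compact_closed => //; exact: norm_hausdorff.
move=> y nKC; rewrite /cut; case: asboolP => // Cy.
by apply: f0 => Ky; apply: nKC.
Qed.

(** [C] contains an open interval slightly larger than the hull of [K]; its length is at most [L],
    and its left end serves as [a]. *)
Lemma compact_in_short_interval C K (L : R) : 0 < L -> open C -> is_interval C ->
  (forall a b, a < b -> `]a, b[%classic `<=` C -> b - a <= L) ->
  compact K -> K `<=` C -> exists a, K `<=` `]a, a + L[%classic.
Proof.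
move=> L0 oC iC HC cK KC.
have [K0|/set0P K0] := eqVneq K set0; first by exists 0; rewrite K0.
have cid := @continuous_subspaceT _ _ K _ (smooth1_continuous (@smooth1_id R)).
have [d dK dmax] := compact_EVT_max K0 cK cid.
have cN : continuous (fun x : R => - x) by move=> x; exact: opp_continuous.
have [c cKK cmax] := compact_EVT_max K0 cK (@continuous_subspaceT _ _ K _ cN).
move: dK cKK; rewrite !inE => dK cKK.
have cd : c <= d by apply: dmax; rewrite inE.
move: oC; rewrite openE => oC.
have /nbhs_ballP[e1 /= e10 H1] := oC _ (KC _ cKK).
have /nbhs_ballP[e2 /= e20 H2] := oC _ (KC _ dK).
pose e := Num.min e1 e2 / 2.
have m0 : 0 < Num.min e1 e2 by rewrite lt_min e10.
have m1 : Num.min e1 e2 <= e1 by rewrite ge_min lexx.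
have m2 : Num.min e1 e2 <= e2 by rewrite ge_min lexx orbT.
have e0 : 0 < e by rewrite divr_gt0.
have ee : e + e = Num.min e1 e2 by rewrite /e; lra.
have Cc : C (c - e) by apply: H1; rewrite /ball /= opprB addrC subrK ger0_norm; lra.
have Cd : C (d + e) by apply: H2; rewrite /ball /= opprD addNKr normrN ger0_norm; lra.
have /HC : c - e < d + e by lra.
have sub : `]c - e, d + e[%classic `<=` C.
  move=> x /=; rewrite in_itv /= => /andP[h1 h2].
  by apply: (iC _ _ Cc Cd); rewrite !ltW.
move=> /(_ sub) le; exists (c - e) => x Kx.
have xd : x <= d by apply: dmax; rewrite inE.
have xc : - x <= - c by apply: cmax; rewrite inE.
by rewrite /= in_itv /=; apply/andP; split; lra.
Qed.

End cutting.

Section open_sets.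
Context {R : realType}.
Variables (p : R) (p1 : 1 < p) (L lam : R) (L0 : 0 < L) (lam0 : 0 < lam).
Local Notation mu := (@lebesgue_measure R).
Local Notation E1 f := (\int[mu]_x (`|f x| `^ p)%:E)%E.
Implicit Types (f g h phi psi v : R -> R) (O : set R) (a b c x y : R).

Hypothesis Hlam : forall phi, smooth1 phi -> csupp (`]0, 2 * L[%classic : set R) phi ->
  (lam%:E * E1 phi <= E1 (derive1 phi))%E.

Let p0 : 0 < p. Proof. exact: lt_trans ltr01 p1. Qed.
Let pN0 : p != 0. Proof. by rewrite gt_eqF. Qed.

Local Notation gain := (gain p lam).
Local Notation cost := (cost p lam).

Lemma gain_out v psi x : v x = 0 -> psi x = 0 -> gain v psi x = 0.
Proof. by move=> vx px; rewrite /gain vx px normr0 powR0// !mulr0 addr0 mulr0. Qed.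

Lemma cost_out v psi x : derive1 v x = 0 -> derive1 psi x = 0 -> cost v psi x = 0.
Proof.
move=> vx px; rewrite /cost vx px normr0 powR0 ?mulr0 ?addr0; last first.
  by rewrite gt_eqF// qgt0.
by rewrite /pospow maxxx powR0.
Qed.

(** The components of [O] are countably many. The restrictions of [v] and [psi] to each of them
    satisfy [interval_inequality], because a compact subset of a component fits in an interval of
    length [L], and the integrals over the components add up. *)
Lemma open_inequality O v psi : open O ->
  (forall a b, a < b -> `]a, b[%classic `<=` O -> b - a <= L) ->
  smooth1 v -> (forall x, 0 <= v x) -> csupp O v ->
  smooth1 psi -> (forall x, 0 <= psi x) -> csupp O psi ->
  (\int[mu]_x (gain v psi x)%:E <= \int[mu]_x (cost v psi x)%:E)%E.
Proof.
move=> oO HO sv v0 cv spsi psi0 cpsi.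
have [Kv [cKv KvO vK]] := cv; have [Kp [cKp KpO pK]] := cpsi.
pose K := Kv `|` Kp.
have cK : compact K by exact: compactU.
have KO : K `<=` O by rewrite subUset.
have vK' y : ~ K y -> v y = 0 by move=> /not_orP[/vK].
have pK' y : ~ K y -> psi y = 0 by move=> /not_orP[_ /pK].
pose C i := @open_disjoint_itv R O oO i.
have oC i : open (C i) by exact: open_disjoint_itv_open.
have iC i : is_interval (C i) by exact: open_disjoint_itv_is_interval.
have tC : trivIset setT C by exact: open_disjoint_itv_trivIset.
have OC : O = \bigcup_i C i by exact: open_disjoint_itv_bigcup.
have CO i : C i `<=` O by rewrite OC => x Cx; exists i.
have oOC i : open (O `\` C i).
  have -> : O `\` C i = \bigcup_(j in [set j | j != i]) C j.
    apply/seteqP; split => x.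
      rewrite {1}OC => -[[j _ Cj] nCi]; exists j => //=.
      by apply/eqP => ji; apply: nCi; rewrite -ji.
    move=> [j /= ji Cj]; split; first exact: CO Cj.
    move=> Ci; move/trivIsetP: tC => /(_ j i I I ji)/seteqP[/(_ x) H _].
    exact: H.
  by apply: bigcup_open => j _; exact: oC.
have mC i : measurable (C i : set (measurableTypeR R)) by exact: open_measurable.
have sCv i := cut_smooth (oC i) (oOC i) cK KO vK' sv.
have sCp i := cut_smooth (oC i) (oOC i) cK KO pK' spsi.
have Cg i x : gain (cut (C i) v) (cut (C i) psi) x = cut (C i) (gain v psi) x.
  rewrite /gain (sCv i).2; have [Cx|nC] := pselect (C i x); first by rewrite !cutT.
  by rewrite !cutF// normr0 powR0// !mulr0 addr0 mulr0.
have Cc i x : cost (cut (C i) v) (cut (C i) psi) x = cut (C i) (cost v psi) x.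
  have [Cx|nC] := pselect (C i x).
    by rewrite /cost (sCv i).2 (sCp i).2 !cutT.
  by rewrite [RHS]cutF//; apply: cost_out; rewrite ?(sCv i).2 ?(sCp i).2 cutF.
have Ci i : (\int[mu]_(x in C i) (gain v psi x)%:E <= \int[mu]_(x in C i) (cost v psi x)%:E)%E.
  have I f : (\int[mu]_(x in C i) (f x)%:E = \int[mu]_x (cut (C i) f x)%:E)%E.
    transitivity (\int[mu]_(x in C i) (cut (C i) f x)%:E)%E.
      by apply: eq_integral => x /set_mem Cx; rewrite cutT.
    by apply/esym/integral_support => x nC; rewrite cutF.
  rewrite !I; under eq_integral do rewrite -Cg.
  under [leRHS]eq_integral do rewrite -Cc.
  have [cKi vKi] := cut_csupp (oOC i) cK KO vK'.
  have [_ pKi] := cut_csupp (oOC i) cK KO pK'.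
  have HCi a b : a < b -> `]a, b[%classic `<=` C i -> b - a <= L.
    by move=> ab H; apply: HO => //; exact: subset_trans (CO i).
  have [a Ka] : exists a, K `&` C i `<=` `]a, a + L[%classic.
    by apply: (compact_in_short_interval L0 (oC i) (iC i) HCi cKi) => x [].
  apply: (interval_inequality p1 L0 lam0 Hlam (a := a)).
  - exact: (sCv i).1.
  - by move=> x; rewrite /cut; case: ifPn.
  - by exists (K `&` C i).
  - exact: (sCp i).1.
  - by move=> x; rewrite /cut; case: ifPn.
  - by exists (K `&` C i).
have cg : continuous (gain v psi) by exact: gain_continuous.
have cc : continuous (cost v psi) by exact: cost_continuous.
have gO x : ~ O x -> (gain v psi x)%:E = 0%E :> \bar R.
  by move=> nO; rewrite gain_out ?(csupp_out cv) ?(csupp_out cpsi).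
have cO x : ~ O x -> (cost v psi x)%:E = 0%E :> \bar R.
  by move=> nO; rewrite cost_out ?(csupp_out (csupp_derive1 cv)) ?(csupp_out (csupp_derive1 cpsi)).
rewrite (integral_support mu gO) (integral_support mu cO) OC.
have mg f : continuous f -> measurable_fun (\bigcup_i C i : set (measurableTypeR R)) (EFin \o f).
  by move=> cf; apply/measurable_EFinP; exact: fun_continuous_measurable.
rewrite (ge0_integral_bigcup mu mC (mg _ cg))//; last first.
  by move=> x _; rewrite lee_fin; apply: gain_ge0.
rewrite (ge0_integral_bigcup mu mC (mg _ cc))//; last first.
  by move=> x _; rewrite lee_fin; apply: cost_ge0.
apply: lee_nneseries => [i _|i _]; last exact: Ci.
by move=> _; apply: integral_ge0 => x _; rewrite lee_fin; exact: gain_ge0.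
Qed.

Lemma maxMl (r s : R) : 0 <= r -> Num.max (r * s) 0 = r * Num.max s 0.
Proof.
move=> r0; have [s0|s0] := leP s 0; first by rewrite mulr0 max_r// mulr_ge0_le0.
by rewrite max_l// mulr_ge0// ltW.
Qed.

Lemma pospowMl (r s : R) : 0 <= r -> pospow p (r * s) = r `^ p * pospow p s.
Proof. by move=> r0; rewrite /pospow maxMl// powRM// le_max lexx orbT. Qed.

(** A zero with non-zero derivative is isolated. Two such zeros with the same isolation radius 1 /
    (n + 1) and the same integer part of z * (n + 1) coincide. *)
Lemma countable_simple_zeros phi : smooth1 phi ->
  countable [set x | phi x = 0 /\ derive1 phi x != 0].
Proof.
move=> sphi.
pose Z (n : nat) := [set z | phi z = 0 /\ forall y, y != z -> `|y - z| < n.+1%:R^-1 -> phi y != 0].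
apply: (@sub_countable _ _ _ (\bigcup_n Z n)).
  apply: subset_card_le => z /= [phiz dphiz].
  have [e e0 He] : exists2 e : R, 0 < e & forall h : R, `|h| < e -> h != 0 -> phi (h + z) != 0.
    have [Dz Ez] := smooth1_is_derive z sphi.
    have C : (fun h : R => h^-1 *: ((phi \o shift z) (h *: 1) - phi z)) @ 0^' --> derive1 phi z.
      by rewrite -Ez; exact: Dz.
    have : \forall h \near (0 : R)^', h^-1 *: ((phi \o shift z) (h *: 1) - phi z) != 0.
      apply: (C [set y | y != 0]); apply: open_nbhs_nbhs; split => //; exact: open_neq.
    move=> /nbhs_ballP[e /= e0 He]; exists e => // h he h0.
    have := He h; rewrite /ball /= sub0r normrN => /(_ he h0).
    by apply: contraNN => /eqP ph0; rewrite phiz subr0 /GRing.scale /= mulr1 ph0 mulr0.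
  have [n nh] : exists n : nat, n.+1%:R^-1 < e.
    exists (Num.truncn e^-1); rewrite invf_plt ?posrE//.
    by apply: truncnS_gt.
  exists n => //; split => // y yz yn; rewrite -(subrK z y); apply: He.
    exact: lt_trans nh.
  by rewrite subr_eq0.
apply: bigcup_countable => // n _; apply/countable_injP.
exists (fun z => pickle (Num.floor (z * n.+1%:R))) => z w /set_mem[z0 Hz] /set_mem[w0 Hw].
move=> /(pcan_inj pickleK) fe; apply/eqP; apply: contraT => zw.
have := floor_itv (z * n.+1%:R); have := floor_itv (w * n.+1%:R).
rewrite -fe intrD; set k : R := _%:~R => /andP[h1 h2] /andP[h3 h4].
have n0 : 0 < n.+1%:R :> R by [].
have : `|z - w| < n.+1%:R^-1.
  rewrite -(ltr_pM2r n0) mulVf ?gt_eqF// -[X in _ * X]gtr0_norm// -normrM mulrBl.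
  by rewrite ltr_norml; apply/andP; split; lra.
by move=> /(Hw z zw); rewrite z0 eqxx.
Qed.

(** At most one of [drho e s] and [drho e (- s)] is non-zero, and both are at most 1. *)
Lemma drho_split (e s t : R) : 0 < e ->
  drho e s `^ p * pospow p t + drho e (- s) `^ p * pospow p t <= pospow p t.
Proof.
move=> e0; rewrite -mulrDl ler_piMl ?pospow_ge0//.
have H r : drho e r `^ p <= 1.
  have <- : 1 `^ p = 1 by rewrite powR1.
  by apply: ge0_ler_powR; rewrite ?nnegrE ?drho_ge0 ?drho_le1// ltW.
have [s0|s0] := leP s 0; first by rewrite (drho_le0 _ s0) powR0// add0r.
have -> : drho e (- s) = 0 by rewrite drho_le0// oppr_le0 ltW.
by rewrite powR0// addr0.
Qed.

Lemma add2_le (a b c k : R) : a + b <= c -> a + k + (b + k) <= c + 2 * k.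
Proof. by move=> H; rewrite addrACA mulr_natl mulr2n lerD2r. Qed.

Lemma le_sum_chain (a b c c' d d' e e' f g : \bar R) :
  a = b -> b = (c + d)%E -> d = d' -> (c <= e)%E -> (d' <= e')%E ->
  c' = e' -> f = (e + c')%E -> (f <= g)%E -> (a <= g)%E.
Proof. by move=> -> -> -> ce de -> -> ; apply: le_trans; exact: leeD. Qed.

(** [open_inequality] is applied to [rho (harmonic n) (phi x)] on [O], and to the same approximation
    of the positive part of - phi(- x) on the reflected set: the derivative of the latter is phi'(-
    x), so the one-sided energy keeps its sign. The multiplier [psi] is paid for in both
    inequalities, whence the factor 2. *)
Lemma signed_inequality O phi psi : open O ->
  (forall a b, a < b -> `]a, b[%classic `<=` O -> b - a <= L) ->
  smooth1 phi -> csupp O phi ->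
  smooth1 psi -> (forall x, 0 <= psi x) -> csupp O psi ->
  (\int[mu]_x (gain phi psi x)%:E <=
   \int[mu]_x (pospow p (derive1 phi x) + 2 * (lam * (p - 1) * `|derive1 psi x| `^ (p / (p - 1))))%:E)%E.
Proof.
move=> oO HO sphi cphi spsi psi0 cpsi.
pose m x := Num.max (- derive1 phi x) 0.
have m0 x : 0 <= m x by rewrite /m le_max lexx orbT.
pose A n x := lam * (rho (harmonic n) (phi x) `^ p + rho (harmonic n) (- phi x) `^ p
   + p * ((drho (harmonic n) (phi x) + drho (harmonic n) (- phi x)) * (m x * psi x))).
pose B x := pospow p (derive1 phi x) + 2 * (lam * (p - 1) * `|derive1 psi x| `^ (p / (p - 1))).
have e0 := @harmonic_pos R.
pose vp n x := rho (harmonic n) (phi x).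
pose vm n x := rho (harmonic n) (- 1 * phi (-1 * x + 0)).
pose psim x := psi (- 1 * x + 0).
have svp n : smooth1 (vp n) by exact: (smooth1_comp (rho_smooth (e0 n)) sphi).
have sphim : smooth1 (fun x => - 1 * phi (- 1 * x + 0)).
  by apply: smooth1Z; exact: smooth1_comp_affine.
have svm n : smooth1 (vm n) by exact: (smooth1_comp (rho_smooth (e0 n)) sphim).
have spsim : smooth1 psim by exact: smooth1_comp_affine.
have dvp n : derive1 (vp n) = (fun x => drho (harmonic n) (phi x) * derive1 phi x).
  apply: derive1_of_is_derive => x.
  exact: (@is_derive1_compE _ (rho (harmonic n)) phi x _ _ (rho_is_derive (phi x) (e0 n)) (smooth1_is_derive x sphi)).
have dvm n : derive1 (vm n) = (fun x => drho (harmonic n) (- 1 * phi (- 1 * x + 0)) * derive1 phi (- 1 * x + 0)).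
  apply: derive1_of_is_derive => x.
  have d1 : is_derive x 1 (fun y => phi (-1 * y + 0)) (-1 * derive1 phi (- 1 * x + 0)).
    by apply: derive1_comp_affine; exact: smooth1_derivable.
  have d2 := is_derive1Z (-1) d1.
  have d3 : is_derive x 1 (fun y => - 1 * phi (-1 * y + 0)) (derive1 phi (- 1 * x + 0)).
    by apply: is_derive1_eq d2 _; rewrite mulrA mulrNN !mul1r.
  exact: (@is_derive1_compE _ (rho (harmonic n)) (fun y => -1 * phi (- 1 * y + 0)) x _ _ (rho_is_derive _ (e0 n)) d3).
have dpsim : derive1 psim = (fun x => - 1 * derive1 psi (-1 * x + 0)) by exact: derive1_affineE.
pose O' := (fun x : R => - 1 * x + 0) @^-1` O.
have N10 : (-1 : R) != 0 by rewrite oppr_eq0 oner_neq0.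
have oO' : open O'.
  apply: open_comp => // x _; apply: smooth1_continuous.
  exact: smooth1_affine.
have HO' a b : a < b -> `]a, b[%classic `<=` O' -> b - a <= L.
  move=> ab H; have : - a - - b <= L; last by lra.
  apply: HO; first by lra.
  move=> x /=; rewrite in_itv /= => /andP[h1 h2].
  have := H (- x); rewrite /O' /= in_itv /= mulN1r opprK addr0; apply.
  by apply/andP; split; lra.
have vp0 n x : phi x = 0 -> vp n x = 0 by move=> px; rewrite /vp rho_le0 ?px.
have vm0 n x : phi (- 1 * x + 0) = 0 -> vm n x = 0 by move=> px; rewrite /vm rho_le0 ?px ?mulr0.
have ineqp n := open_inequality oO HO (svp n) (fun x => rho_ge0 _ _) (csupp_sub (vp0 n) cphi) spsi psi0 cpsi.
have ineqm n := open_inequality oO' HO' (svm n) (fun x => rho_ge0 _ _) (csupp_sub (vm0 n) (csupp_comp_affine 0 N10 cphi)) spsim (fun x => psi0 _) (csupp_comp_affine 0 N10 cpsi).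
pose gm n x := gain (vm n) psim (0 - x).
pose hm n x := cost (vm n) psim (0 - x).
have AE n x : A n x = gain (vp n) psi x + gm n x.
  rewrite /A /gm /gain dvm dvp /vp /vm /psim sub0r !mulN1r !opprK !addr0.
  rewrite !(ger0_norm (rho_ge0 _ _)) -!mulrN !maxMl ?drho_ge0// -/(m x).
  by clear; set a := rho _ _ `^ _; set b := rho _ _ `^ _; ring.
have HE n x : cost (vp n) psi x + hm n x <= B x.
  rewrite /B /hm /cost dvm dvp dpsim /psim sub0r !mulN1r !opprK !addr0 normrN.
  rewrite !pospowMl ?drho_ge0//.
  by apply: add2_le; apply: drho_split; exact: e0.
have cB0 : continuous (fun x => 0 - x : R) by move=> x; apply: cvgB; [exact: cvg_cst|exact: cvg_id].
have cgp n : continuous (gain (vp n) psi) by exact: gain_continuous.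
have chp n : continuous (cost (vp n) psi) by exact: cost_continuous.
have cgm n : continuous (gain (vm n) psim) by exact: gain_continuous.
have chm n : continuous (cost (vm n) psim) by exact: cost_continuous.
have cgm' n : continuous (gm n) by move=> x; exact: (cvg_comp _ _ (cB0 x) (cgm n _)).
have chm' n : continuous (hm n) by move=> x; exact: (cvg_comp _ _ (cB0 x) (chm n _)).
have cA n : continuous (A n).
  have -> : A n = (fun x => gain (vp n) psi x + gm n x) by apply/funext => x.
  exact: continuous_add.
have gp0 n x : 0 <= gain (vp n) psi x by exact: gain_ge0.
have gm0 n x : 0 <= gm n x by apply: gain_ge0 => //; exact: psi0.
have hp0 n x : 0 <= cost (vp n) psi x by exact: cost_ge0.
have hm0 n x : 0 <= hm n x by exact: cost_ge0.
have A0 n x : 0 <= A n x by rewrite AE addr_ge0.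
have mc f : continuous f -> measurable_fun setT (EFin \o f : R -> \bar R).
  by move=> cf; apply/measurable_EFinP; exact: fun_continuous_measurable.
have AB n : (\int[mu]_x (A n x)%:E <= \int[mu]_x (B x)%:E)%E.
  have S1 := ge0_integralD_cont (cgp n) (cgm' n) (gp0 n) (gm0 n).
  have S2 := ge0_integralD_cont (chp n) (chm' n) (hp0 n) (hm0 n).
  have Eg : (\int[mu]_x (gm n x)%:E = \int[mu]_x (gain (vm n) psim x)%:E)%E.
    apply: (@integral_reflect R (fun x => (gain (vm n) psim x)%:E) 0).
      exact: mc.
    by move=> x; rewrite lee_fin; apply: gain_ge0 => //; exact: psi0.
  have Eh : (\int[mu]_x (hm n x)%:E = \int[mu]_x (cost (vm n) psim x)%:E)%E.
    apply: (@integral_reflect R (fun x => (cost (vm n) psim x)%:E) 0).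
      exact: mc.
    by move=> x; rewrite lee_fin; exact: cost_ge0.
  have EA : (\int[mu]_x (A n x)%:E = \int[mu]_x (gain (vp n) psi x + gm n x)%:E)%E.
    by apply: eq_integral => x _; rewrite AE.
  have le : (\int[mu]_x (cost (vp n) psi x + hm n x)%:E <= \int[mu]_x (B x)%:E)%E.
    apply: le_integral_ge0 => x _.
      by rewrite lee_fin; exact: (addr_ge0 (hp0 n x) (hm0 n x)).
    by rewrite lee_fin; exact: HE.
  exact: (le_sum_chain EA S1 Eg (ineqp n) (ineqm n) Eh S2 le).
have Alim x : A n x @[n --> \oo] --> lam * (`|phi x| `^ p + p * ((phi x != 0)%:R * (m x * psi x))).
  have cpp : continuous (fun s : R => `|s| `^ p) by exact: powR_norm_continuous.
  have Cp (u : nat -> R) l : u n @[n --> \oo] --> l -> `|u n| `^ p @[n --> \oo] --> `|l| `^ p.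
    by move=> ul; exact: (cvg_comp _ _ ul (cpp l)).
  have E n : A n x = lam * (`|rho (harmonic n) (phi x)| `^ p + `|rho (harmonic n) (- phi x)| `^ p
     + p * ((drho (harmonic n) (phi x) + drho (harmonic n) (- phi x)) * (m x * psi x))).
    by rewrite !(ger0_norm (rho_ge0 _ _)).
  under eq_fun do rewrite E.
  have -> : `|phi x| `^ p = `|Num.max (phi x) 0| `^ p + `|Num.max (- phi x) 0| `^ p.
    by rewrite (powR_normE _ pN0) /pospow !ger0_norm// le_max lexx orbT.
  have -> : (phi x != 0)%:R = (0 < phi x)%R%:R + (0 < - phi x)%R%:R :> R.
    by rewrite oppr_gt0; case: (ltgtP (phi x) 0) => _ /=; rewrite ?addr0 ?add0r.
  apply: cvgM; first exact: cvg_cst.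
  apply: cvgD; first apply: cvgD.
  - apply: (Cp (fun n => rho (harmonic n) (phi x))); exact: rho_cvg.
  - apply: (Cp (fun n => rho (harmonic n) (- phi x))); exact: rho_cvg.
  apply: cvgM; first exact: cvg_cst.
  apply: cvgM; last exact: cvg_cst.
  by apply: cvgD; exact: drho_cvg.
have mA n : measurable_fun setT (fun x => (A n x)%:E : \bar R).
  by apply/measurable_EFinP; exact: fun_continuous_measurable.
have F1 (n : nat) (x : R) : [set: R] x -> (0 <= (A n x)%:E)%E by move=> _; rewrite lee_fin.
(* Where [phi] vanishes the limit of [A n] loses its derivative term, so it differs from [gain] at
   most on this countable set. *)
pose Z := [set x | phi x = 0 /\ derive1 phi x != 0].
have cZ : countable Z by exact: countable_simple_zeros.
have mZ : measurable (Z : set (measurableTypeR R)) by exact: countable_measurable.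
have gE : (\int[mu]_x (gain phi psi x)%:E = \int[mu]_(x in setT `\` Z) (gain phi psi x)%:E)%E.
  apply: ge0_negligible_integral => //.
  - by apply: mc; exact: gain_continuous.
  - by move=> x _; rewrite lee_fin; exact: gain_ge0.
  - exact: countable_lebesgue_measure0.
rewrite gE.
have mDZ : measurable (setT `\` Z : set (measurableTypeR R)) by exact: measurableD.
have mA' n : measurable_fun (setT `\` Z : set (measurableTypeR R)) (fun x => (A n x)%:E : \bar R).
  exact: measurable_funS (mA n).
have F2 (n : nat) (x : R) : (setT `\` Z) x -> (0 <= (A n x)%:E)%E by move=> _; rewrite lee_fin.
have AB' n : (\int[mu]_(x in setT `\` Z) (A n x)%:E <= \int[mu]_x (B x)%:E)%E.
  apply: le_trans (AB n); apply: (@ge0_subset_integral _ _ _ mu _ _ mDZ measurableT _ (mA n)) => //.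
  exact: F1.
apply: (le_trans _ (le_trans (fatou mu mDZ mA' F2) (limn_einf_le (k := 0%N) (fun n _ => AB' n)))).
rewrite le_eqVlt; apply/orP; left; apply/eqP; apply: eq_integral => x /set_mem[_ nZ].
have lim : (A n x)%:E @[n --> \oo] --> (lam * (`|phi x| `^ p + p * ((phi x != 0)%:R * (m x * psi x))))%:E.
  by apply: cvg_EFin; [exact: nearW|exact: Alim].
rewrite (cvg_limn_einf_sup lim).1 /gain -/(m x); congr (EFin (lam * (_ + p * _))).
have [phix|phix] := eqVneq (phi x) 0; last by rewrite mul1r.
suff -> : m x = 0 by rewrite mul0r mulr0.
have d0 : derive1 phi x = 0 by apply: contrapT => /eqP d0; apply: nZ; split.
by rewrite /m d0 oppr0 maxxx.
Qed.

End open_sets.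

(** * Test functions in the plane *)

Section smooth_functions_of_two_variables.
Context {R : realType}.
Local Notation plane := (R * R)%type.
Implicit Types (f g : plane -> R) (x y v e a : plane) (b c : R) (i : bool) (n : nat).

Lemma slice_is_derive f e a (t d : R) :
  is_derive t 1 (fun h => f (h *: e + a)) d <-> is_derive (t *: e + a) e f d.
Proof.
suff E : (fun h : R => h^-1 *: ((((fun h => f (h *: e + a)) \o shift t) (h *: 1)) - f (t *: e + a)))
    = (fun h : R => h^-1 *: ((f \o shift (t *: e + a)) (h *: e) - f (t *: e + a))).
  by split=> -[D V]; split; rewrite /derivable /derive ?E// in D V *; rewrite -?E.
apply/funext => h /=; congr (_ *: (f _ - _)).
by rewrite [h *: 1]mulr1 scalerDl addrA.
Qed.

Lemma slice0_is_derive f e a (d : R) :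
  is_derive (0 : R) 1 (fun h => f (h *: e + a)) d <-> is_derive a e f d.
Proof. by rewrite slice_is_derive scale0r add0r. Qed.

Lemma partial_is_derive i f x : derivable f x (basis_vector i) ->
  is_derive x (basis_vector i) f (partial i f x).
Proof. by move=> D; split. Qed.

Lemma is_derive_partial i f x d : is_derive x (basis_vector i) f d -> partial i f x = d.
Proof. by move=> [_ <-]. Qed.

Lemma partialE i f (g : plane -> R) : (forall x, is_derive x (basis_vector i) f (g x)) ->
  partial i f = g.
Proof. by move=> H; apply/funext => x; exact: is_derive_partial. Qed.

(** The increment may have any sign or be 0, so that an intermediate point can be chosen for every
    [h] at once. *)
Lemma mean_value_sign (g dg : R -> R) (h : R) : (forall t : R, is_derive t 1 g (dg t)) ->
  exists2 c, `|c| <= `|h| & g h - g 0 = dg c * h.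
Proof.
move=> dgE; have cg : continuous g by exact: is_derive_continuous dgE.
have [h0|h0|->] := ltgtP h 0; last by exists 0; rewrite ?subrr ?mulr0.
- have [c] := MVT h0 (fun (x : R) _ => dgE x) (continuous_subspaceT cg).
  rewrite in_itv /= => /andP[hc c0] E; exists c.
    by rewrite !ltr0_norm// lerN2 ltW.
  by rewrite -opprB E sub0r mulrN opprK.
- have [c] := MVT h0 (fun (x : R) _ => dgE x) (continuous_subspaceT cg).
  rewrite in_itv /= => /andP[c0 hc] E; exists c.
    by rewrite !gtr0_norm// ltW.
  by rewrite E subr0.
Qed.

Lemma basis_slice (i : bool) f (c t : R) x : (forall y, derivable f y (basis_vector i)) ->
  is_derive t 1 (fun h => f ((h * c) *: basis_vector i + x))
    (partial i f ((t * c) *: basis_vector i + x) * c).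
Proof.
move=> D; have d1 := (slice_is_derive f (basis_vector i) x (t * c) _).2 (partial_is_derive (D _)).
have d2 : is_derive t 1 (fun h : R => h * c) c.
  by have := derive1_affine c 0 t; under [X in is_derive _ _ X _]eq_fun do rewrite addr0 mulrC.
exact: (@is_derive1_compE _ (fun h : R => f (h *: basis_vector i + x)) (fun h => h * c) _ _ _ d1 d2).
Qed.

Lemma subr_chain (s t u b c : R) : s - t = b -> t - u = c -> s - u = b + c.
Proof. by move=> <- <-; rewrite addrA subrK. Qed.

(** The segment from [x] to [x + h v] is replaced by one leg along each axis; the mean value theorem
    applies on each leg, and the intermediate points [P1 h] and [P2 h] tend to [x], where the
    partial derivatives are continuous. *)
Lemma directional_derivative f v x :
  (forall i, continuous (partial i f)) -> (forall i y, derivable f y (basis_vector i)) ->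
  is_derive x v f (dot v (grad f x)).
Proof.
move=> cf df; apply/slice0_is_derive.
have M1 (h : R) := mean_value_sign h (fun t => basis_slice v.1 t (h *: (0, v.2) + x) (df false)).
have M2 (h : R) := mean_value_sign h (fun t => basis_slice v.2 t x (df true)).
have [c1 Hc1] := choice (fun h => let: ex_intro2 c a b := M1 h in ex_intro _ c (conj a b)).
have [c2 Hc2] := choice (fun h => let: ex_intro2 c a b := M2 h in ex_intro _ c (conj a b)).
pose P1 h := (c1 h * v.1) *: basis_vector false + (h *: (0, v.2) + x) : plane.
pose P2 h := (c2 h * v.2) *: basis_vector true + x : plane.
have sq (k : R -> R) : (forall h, `|k h| <= `|h|) -> k h @[h --> (0 : R)^'] --> (0 : R).
  move=> kh; apply/cvgr0Pnorm_le => e e0.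
  have : \forall h \near (0 : R)^', `|h| <= e.
    have : (fun h : R => h) @ (0 : R)^' --> (0 : R) by exact: cvg_within.
    by move/cvgr0Pnorm_le; exact.
  by apply: filterS => h; exact: le_trans.
have sq1 := sq _ (fun h => (Hc1 h).1); have sq2 := sq _ (fun h => (Hc2 h).1).
have sqi := sq id (fun h => lexx _).
have scal (k : R -> R) (w : plane) : k h @[h --> (0 : R)^'] --> (0 : R) ->
    k h *: w @[h --> (0 : R)^'] --> (0 : plane).
  by move=> k0; rewrite -(scale0r w); apply: cvgZr_tmp.
have muls (k : R -> R) (w : R) : k h @[h --> (0 : R)^'] --> (0 : R) ->
    k h * w @[h --> (0 : R)^'] --> (0 : R).
  by move=> k0; rewrite -[X in _ --> X](mul0r w); apply: cvgM => //; exact: cvg_cst.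
have P1x : P1 h @[h --> (0 : R)^'] --> x.
  have E0 : x = (0 : plane) + ((0 : plane) + x) by rewrite !add0r.
  rewrite [X in _ --> X]E0; apply: cvgD.
    by apply: scal; exact: muls.
  by apply: cvgD; [exact: scal|exact: cvg_cst].
have P2x : P2 h @[h --> (0 : R)^'] --> x.
  rewrite -[X in _ --> X](add0r x); apply: cvgD; last exact: cvg_cst.
  by apply: scal; exact: muls.
have L : v.1 * partial false f (P1 h) + v.2 * partial true f (P2 h) @[h --> (0 : R)^']
    --> dot v (grad f x).
  apply: cvgD; (apply: cvgM; first exact: cvg_cst).
    exact: (cvg_comp _ _ P1x (cf false x)).
  exact: (cvg_comp _ _ P2x (cf true x)).
have E : \forall h \near (0 : R)^', v.1 * partial false f (P1 h) + v.2 * partial true f (P2 h)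
    = h^-1 *: (((fun h => f (h *: v + x)) \o shift (0 : R)) (h *: 1) - f ((0 : R) *: v + x)).
  near=> h; have h0 : h != 0 by near: h; exact: nbhs_dnbhs_neq.
  rewrite /= [h *: 1]mulr1 addr0.
  have := (Hc1 h).2; have := (Hc2 h).2; rewrite -/(P1 h) -/(P2 h).
  rewrite !mul0r !scale0r !add0r => E2 E1.
  have -> : h *: v + x = (h * v.1) *: basis_vector false + (h *: (0, v.2) + x).
    case: v {M1 M2 Hc1 Hc2 P1 P2 P1x P2x L E1 E2} => v1 v2; case: x => x1 x2.
    by congr pair; rewrite /= /GRing.scale /= ?mulr0 ?mulr1 ?add0r// addrA.
  have E3 : h *: (0, v.2) + x = (h * v.2) *: basis_vector true + x.
    congr (_ + x); congr pair; rewrite /= /GRing.scale /= ?mulr0// mulr1//.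
  rewrite -E3 in E2.
  have -> : f ((h * v.1) *: basis_vector false + (h *: (0, v.2) + x)) - f x =
      partial false f (P1 h) * v.1 * h + partial true f (P2 h) * v.2 * h.
    exact: subr_chain E1 E2.
  by rewrite [RHS]mulrDr !(mulrC h^-1) !mulfK// (mulrC v.1) (mulrC v.2).
have LL : h^-1 *: (((fun h => f (h *: v + x)) \o shift (0 : R)) (h *: 1)
    - f ((0 : R) *: v + x)) @[h --> (0 : R)^'] --> dot v (grad f x).
  by apply: cvg_trans L; exact: near_eq_cvg.
split; first by apply/cvg_ex; eexists; exact: LL.
by apply/cvg_lim => //; exact: norm_hausdorff.
Unshelve. all: by end_near. Qed.

(** Induction on the order of differentiation, where [smooth] quantifies over words of partial
    derivatives; a product rule doubles the number of terms but lowers the order. *)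
Fixpoint smooth_upto n f : Prop :=
  continuous f /\
  if n is m.+1 then (forall i x, derivable f x (basis_vector i)) /\
    forall i, smooth_upto m (partial i f) else True.

Lemma smoothP f : smooth f <-> forall n, smooth_upto n f.
Proof.
split.
  move=> sf n; elim: n f sf => [|n IH] f sf; first by split=> //; exact: (sf [::]).1.
  split; first exact: (sf [::]).1.
  split; first exact: (sf [::]).2.
  by move=> i; apply: IH => s; have := sf (rcons s i); rewrite foldr_rcons.
move=> H s; elim/last_ind: s f H => [|s i IH] f H.
  by have /= [? [? _]] := H 1%N.
rewrite foldr_rcons; apply: IH => n.
by have /= [_ [_]] := H n.+1; exact.
Qed.

Lemma smooth_uptoW n f : smooth_upto n.+1 f -> smooth_upto n f.
Proof.
elim: n f => [|n IH] f /=; first by move=> [? _].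
by move=> [cf [df H]]; split=> //; split=> // i; exact: IH.
Qed.

Lemma smooth_continuous f : smooth f -> continuous f.
Proof. by move=> sf; exact: (sf [::]).1. Qed.

Lemma smooth_partial i f : smooth f -> smooth (partial i f).
Proof. by move=> sf s; have := sf (rcons s i); rewrite foldr_rcons. Qed.

Lemma smooth_derivable i f x : smooth f -> derivable f x (basis_vector i).
Proof. by move=> sf; exact: (sf [::]).2. Qed.

Lemma smooth_is_derive f v x : smooth f -> is_derive x v f (dot v (grad f x)).
Proof.
move=> sf; apply: directional_derivative => [i|i y]; last exact: smooth_derivable.
exact: smooth_continuous (smooth_partial i sf).
Qed.

Lemma smooth_upto_cst n c : smooth_upto n (fun=> c).
Proof.
elim: n c => [|n IH] c /=; first by split=> // x; exact: cvg_cst.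
split; first by move=> x; exact: cvg_cst.
split=> i; first by move=> x; exact: derivable_cst.
by rewrite (@partialE i _ (fun=> 0)); first exact: IH.
Qed.

Lemma smooth_uptoD n f g : smooth_upto n f -> smooth_upto n g ->
  smooth_upto n (fun x => f x + g x).
Proof.
elim: n f g => [|n IH] f g /= [cf df] [cg dg]; split; rewrite ?andbT//; try exact: continuous_add.
have D i x : is_derive x (basis_vector i) (fun x => f x + g x) (partial i f x + partial i g x).
  by apply: is_deriveD; apply: partial_is_derive; [exact: df.1|exact: dg.1].
split=> i; first by move=> x; case: (D i x).
by rewrite (partialE (D i)); apply: IH; [exact: df.2|exact: dg.2].
Qed.

Lemma smooth_uptoM n f g : smooth_upto n f -> smooth_upto n g ->
  smooth_upto n (fun x => f x * g x).
Proof.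
elim: n f g => [|n IH] f g /= [cf df] [cg dg]; split; rewrite ?andbT//; try exact: continuous_mul.
have D i x : is_derive x (basis_vector i) (fun x => f x * g x)
    (f x * partial i g x + g x * partial i f x).
  by apply: is_deriveM; apply: partial_is_derive; [exact: df.1|exact: dg.1].
split=> i; first by move=> x; case: (D i x).
rewrite (partialE (D i)); apply: smooth_uptoD; apply: IH.
- by apply: smooth_uptoW; split.
- exact: dg.2.
- by apply: smooth_uptoW; split.
- exact: df.2.
Qed.

Lemma smooth_cst c : smooth (fun=> c).
Proof. by apply/smoothP => n; exact: smooth_upto_cst. Qed.

Lemma smoothD f g : smooth f -> smooth g -> smooth (fun x => f x + g x).
Proof.
by move=> /smoothP sf /smoothP sg; apply/smoothP => n; exact: smooth_uptoD.
Qed.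

Lemma smoothM f g : smooth f -> smooth g -> smooth (fun x => f x * g x).
Proof.
by move=> /smoothP sf /smoothP sg; apply/smoothP => n; exact: smooth_uptoM.
Qed.

Lemma smoothZ c f : smooth f -> smooth (fun x => c * f x).
Proof. by move=> sf; apply: smoothM => //; exact: smooth_cst. Qed.

Lemma partialD i f g : smooth f -> smooth g ->
  partial i (fun x => f x + g x) = (fun x => partial i f x + partial i g x).
Proof.
move=> sf sg; apply: partialE => x.
by apply: is_deriveD; apply: partial_is_derive; exact: smooth_derivable.
Qed.

Lemma partialM i f g : smooth f -> smooth g ->
  partial i (fun x => f x * g x) = (fun x => f x * partial i g x + g x * partial i f x).
Proof.
move=> sf sg; apply: partialE => x.
by apply: is_deriveM; apply: partial_is_derive; exact: smooth_derivable.
Qed.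

Lemma partialZ i c f : smooth f -> partial i (fun x => c * f x) = (fun x => c * partial i f x).
Proof.
move=> sf; rewrite (partialM _ (smooth_cst c) sf); apply/funext => x.
by rewrite (@partialE i (fun=> c) (fun=> 0)) ?mulr0 ?addr0.
Qed.

Lemma dot_continuous v : continuous (dot v).
Proof.
move=> x; apply: cvgD; (apply: cvgM; first exact: cvg_cst).
  exact: cvg_fst.
exact: cvg_snd.
Qed.

Lemma linear_is_derive (l v x : plane) (g : R -> R) : (forall t, derivable g t 1) ->
  is_derive x v (fun y => g (dot l y)) (dot l v * derive1 g (dot l x)).
Proof.
move=> dg; apply/slice0_is_derive.
have E : (fun h : R => g (dot l (h *: v + x))) = (fun h => g (dot l v * h + dot l x)).
  by apply/funext => h; rewrite /dot /= /GRing.scale /=; congr g; ring.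
have -> : dot l x = dot l v * 0 + dot l x by rewrite mulr0 add0r.
by rewrite E; exact: derive1_comp_affine.
Qed.

Lemma smooth_linear_comp (l : plane) (g : R -> R) : smooth1 g -> smooth (fun x => g (dot l x)).
Proof.
move=> sg; apply/smoothP => n; elim: n g sg => [|n IH] g sg /=.
  by split=> //; apply: continuous_comp1; [exact: dot_continuous|exact: smooth1_continuous].
split; first by apply: continuous_comp1; [exact: dot_continuous|exact: smooth1_continuous].
have dg t : derivable g t 1 by exact: smooth1_derivable.
split=> i; first by move=> x; case: (linear_is_derive l (basis_vector i) x dg).
rewrite (partialE (fun x => linear_is_derive l (basis_vector i) x dg)).
by apply: smooth_uptoM; [exact: smooth_upto_cst|apply: IH; exact: smooth1_derive1].
Qed.

Lemma smooth_slice f e a : smooth f ->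
  smooth1 (fun t => f (t *: e + a)) /\
  derive1 (fun t => f (t *: e + a)) = (fun t => dot e (grad f (t *: e + a))).
Proof.
have D g (t : R) : smooth g -> is_derive t 1 (fun t => g (t *: e + a)) (dot e (grad g (t *: e + a))).
  by move=> sg; apply/slice_is_derive; exact: smooth_is_derive.
move=> sf; split; last by apply: derive1_of_is_derive => t; exact: D.
apply/smooth1P => n; elim: n f sf => [|n IH] f sf //=; split.
  by move=> t; case: (D f t sf).
rewrite (derive1_of_is_derive (fun t => D f t sf)).
apply: (IH (fun x => e.1 * partial false f x + e.2 * partial true f x)).
by apply: smoothD; apply: smoothZ; exact: smooth_partial.
Qed.

Lemma plane_hausdorff : hausdorff_space plane.
Proof. exact: norm_hausdorff. Qed.

Lemma test_functionP (Omega : set plane) f :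
  test_function Omega f <-> smooth f /\ csupp Omega f.
Proof.
split; first by move=> [sf cf sub]; split=> //; apply/csuppP => //; exact: plane_hausdorff.
by move=> [sf /(csuppP _ _ plane_hausdorff)[? ?]]; split.
Qed.

Lemma csupp_partial (Omega : set plane) i f : csupp Omega f -> csupp Omega (partial i f).
Proof.
move=> [K [cK KO f0]]; exists K; split=> // x nK; apply: is_derive_partial.
have oK : open (~` K) by apply: closed_openC; exact: compact_closed plane_hausdorff cK.
have H : \near x, (fun=> 0) x = f x.
  have : nbhs x (~` K) by exact: open_nbhs_nbhs.
  by apply: filterS => z /f0.
exact: (near_eq_is_derive H (is_derive_cst 0 x (basis_vector i))).
Qed.

End smooth_functions_of_two_variables.

Section continuity.
Context {R : realType}.

Lemma continuous_compf {T U V : topologicalType} (g : T -> U) (f : U -> V) :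
  continuous g -> continuous f -> continuous (fun x => f (g x)).
Proof. by move=> cg cf x; apply: continuous_comp; [exact: cg|exact: cf]. Qed.

Lemma continuous_pair {T U V : topologicalType} (f : T -> U) (g : T -> V) :
  continuous f -> continuous g -> continuous (fun x => (f x, g x)).
Proof. by move=> cf cg x; apply: cvg_pair; [exact: cf|exact: cg]. Qed.

Lemma continuous_fst {U V : topologicalType} : continuous (fun x : U * V => x.1).
Proof. by move=> x; exact: cvg_fst. Qed.

Lemma continuous_snd {U V : topologicalType} : continuous (fun x : U * V => x.2).
Proof. by move=> x; exact: cvg_snd. Qed.

Lemma continuous_scale {T : topologicalType} (k : T -> R) (v : R * R) :
  continuous k -> continuous (fun x => k x *: v).
Proof. by move=> ck x; apply: cvgZr_tmp; exact: ck. Qed.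

Lemma continuous_addv {T : topologicalType} (f g : T -> R * R) :
  continuous f -> continuous g -> continuous (fun x => f x + g x).
Proof. by move=> cf cg x; apply: cvgD; [exact: cf|exact: cg]. Qed.

Lemma continuous_cst {T U : topologicalType} (c : U) : continuous (fun _ : T => c).
Proof. by move=> x; exact: cvg_cst. Qed.

Lemma continuous_id {T : topologicalType} : continuous (fun x : T => x).
Proof. by move=> x; exact: cvg_id. Qed.

End continuity.

(** * Borel sets of the plane and integration in skew coordinates *)

Section plane_measure.
Context {R : realType}.
Local Notation plane := (R * R)%type.
Local Notation mu1 := (@lebesgue_measure R).
Local Notation mu := (mu1 \x mu1)%E.
Local Notation mplane := (measurableTypeR R * measurableTypeR R)%type.
Implicit Types (f g : plane -> R) (x y v e a w : plane).

(** An open set is the countable union of the boxes with rational corners that it contains, and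
    boxes belong to the product sigma-algebra. *)
Lemma open_measurable2 (O : set plane) : open O -> measurable (O : set mplane).
Proof.
move=> oO.
pose box (q : (rat * rat) * (rat * rat)) : set mplane :=
  `]ratr q.1.1, ratr q.1.2[ `*` `]ratr q.2.1, ratr q.2.2[.
pose F q : set mplane := if `[< box q `<=` O >] then box q else set0.
have -> : O = \bigcup_q F q.
  apply/seteqP; split => x; last first.
    by move=> [q _]; rewrite /F; case: asboolP => // H /H.
  move=> Ox; move: oO; rewrite openE => /(_ _ Ox)/nbhs_ballP[e /= e0 He].
  have lt1 (s : R) : s - e < s by lra.
  have lt2 (s : R) : s < s + e by lra.
  have [a /itvP aP] := rat_in_itvoo (lt1 x.1); have [b /itvP bP] := rat_in_itvoo (lt2 x.1).
  have [c /itvP cP] := rat_in_itvoo (lt1 x.2); have [d /itvP dP] := rat_in_itvoo (lt2 x.2).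
  exists ((a, b), (c, d)) => //; rewrite /F asboolT.
    by split; rewrite /= in_itv /= ?aP ?bP ?cP ?dP.
  move=> y [/= ]; rewrite !in_itv /= => /andP[h1 h2] /andP[h3 h4]; apply: He.
  have := aP; have := bP; have := cP; have := dP => d1 c1 b1 a1.
  have [e1 e2 e3 e4] : [/\ x.1 - e < ratr a, ratr b < x.1 + e, x.2 - e < ratr c & ratr d < x.2 + e].
    by rewrite aP bP cP dP.
  by split; rewrite /ball /= ltr_norml; apply/andP; split; lra.
apply: countable_bigcupT_measurable; first exact: countableP.
move=> q; rewrite /F; case: asboolP => // _; apply: measurableX; exact: measurable_itv.
Qed.

Lemma continuous_measurable2 (D : set mplane) f : continuous f ->
  measurable_fun D (f : mplane -> measurableTypeR R).
Proof.
move=> cf; apply: (measurable_funS measurableT) => //.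
apply: (measurability _ (RGenOpens.measurableE R)).
move=> _ [_ [a [b ->] <-]]; rewrite setTI; apply: open_measurable2.
by move/continuousP : cf; apply; exact: interval_open.
Qed.

Lemma continuous_swap f : continuous f -> continuous (fun x : plane => f (x.2, x.1)).
Proof.
move=> cf; apply: (continuous_compf _ cf).
by apply: continuous_pair; [exact: continuous_snd|exact: continuous_fst].
Qed.

Lemma swap_integral f : continuous f -> (forall x, 0 <= f x) ->
  (\int[mu]_x (f x)%:E = \int[mu]_x (f (x.2, x.1))%:E)%E.
Proof.
move=> cf f0.
have cs : continuous (fun x : plane => f (x.2, x.1)).
  exact: continuous_swap.
have mf g : continuous g -> measurable_fun setT (fun x : mplane => (g x)%:E).
  by move=> cg; apply/measurable_EFinP; exact: continuous_measurable2.
rewrite (fubini_tonelli1 _ (mf _ cf)); last by move=> x; rewrite lee_fin.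
by rewrite (fubini_tonelli2 _ (mf _ cs)); last by move=> x; rewrite lee_fin.
Qed.

(** At a fixed height y the horizontal variable is translated by (e.1 / e.2) y, which preserves the
    inner integral; then y = e.2 * t produces the factor. *)
Lemma shear_integral_snd e f : e.2 != 0 -> continuous f -> (forall x, 0 <= f x) ->
  (\int[mu]_x (f x)%:E =
   `|e.2|%:E * \int[mu1]_r \int[mu1]_t (f ((t *: e + r *: (1, 0))%R))%:E)%E.
Proof.
move=> e2 cf f0.
have mf g : continuous g -> measurable_fun setT (fun x : mplane => (g x)%:E).
  by move=> cg; apply/measurable_EFinP; exact: continuous_measurable2.
have mf1 (g : R -> R) : continuous g -> measurable_fun setT (fun x : R => (g x)%:E).
  by move=> cg; apply/measurable_EFinP; exact: fun_continuous_measurable.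
pose f2 (x : plane) := f (x.1 + e.1 / e.2 * x.2, x.2).
have cf2 : continuous f2.
  apply: (continuous_compf _ cf); apply: continuous_pair; last exact: continuous_snd.
  apply: continuous_add; first exact: continuous_fst.
  by apply: continuous_mul; [exact: continuous_cst|exact: continuous_snd].
pose f3 (x : plane) := f (x.2 *: e + x.1 *: (1, 0)).
have cf3 : continuous f3.
  apply: (continuous_compf _ cf); apply: continuous_addv; apply: continuous_scale.
    exact: continuous_snd.
  exact: continuous_fst.
have cpair1 g (s : R) : continuous g -> continuous (fun t : R => g (s, t)).
  move=> cg; apply: (continuous_compf _ cg).
  by apply: continuous_pair; [exact: continuous_cst|exact: continuous_id].
have cpair2 g (s : R) : continuous g -> continuous (fun t : R => g (t, s)).
  move=> cg; apply: (continuous_compf _ cg).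
  by apply: continuous_pair; [exact: continuous_id|exact: continuous_cst].
rewrite (fubini_tonelli2 _ (mf _ cf)); last by move=> x; rewrite lee_fin.
transitivity (\int[mu1]_y \int[mu1]_r (f2 (r, y))%:E)%E.
  apply: eq_integral => y _; rewrite /fubini_G.
  rewrite (integral_affine (e.1 / e.2 * y) (oner_neq0 R) (mf1 _ (cpair2 _ y cf))); last first.
    by move=> x; rewrite lee_fin.
  by rewrite normr1 mul1e; apply: eq_integral => r _; rewrite /f2 /= mul1r.
rewrite -(fubini_tonelli (fun x : mplane => (f2 x)%:E) (mf _ cf2)); last first.
  by move=> x; rewrite lee_fin; exact: f0.
rewrite -ge0_integralZl//.
- apply: eq_integral => r _.
  rewrite (integral_affine 0 e2 (mf1 _ (cpair1 _ r cf2))); last first.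
    by move=> x; rewrite lee_fin; exact: f0.
  congr (_ * _)%E; apply: eq_integral => t _; congr (f _)%:E.
  rewrite [RHS]surjective_pairing; congr pair; rewrite /= /GRing.scale /=.
    by field.
  by ring.
- have F0 (x : mplane) : (0 <= (f3 x)%:E)%E by rewrite lee_fin; exact: f0.
  exact: (measurable_fun_fubini_tonelli_F (fun x : mplane => (f3 x)%:E) (mf _ cf3) F0).
- by move=> r _; apply: integral_ge0 => t _; rewrite lee_fin.
Qed.

(** A shear along a coordinate axis plays the role of a rotation. [lt] and [lr] are the coordinate
    functionals of the basis ([e], [w]), and [k] is the Jacobian; when [e] is horizontal the two
    axes are exchanged. *)
Lemma shear_integral e : e != 0 -> exists (w lt lr : plane) (k : R),
  [/\ 0 < k, [/\ dot lt e = 1, dot lr e = 0, dot lt w = 0 & dot lr w = 1],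
      forall x, x = dot lt x *: e + dot lr x *: w &
      forall f, continuous f -> (forall x, 0 <= f x) ->
      (\int[mu]_x (f x)%:E = k%:E * \int[mu1]_r \int[mu1]_t (f ((t *: e + r *: w)%R))%:E)%E].
Proof.
move=> e0; have [e2|e2] := eqVneq e.2 0; last first.
  exists (1, 0), (0, e.2^-1), (1, - (e.1 / e.2)), `|e.2|.
  split; [by rewrite normr_gt0| | |by move=> f; exact: shear_integral_snd].
    by rewrite /dot /= mul0r add0r mulVf// mul1r mulNr divfK// subrr !mul0r !mulr0 !mulr1 !addr0.
  move=> x; rewrite [LHS]surjective_pairing; congr pair; rewrite /dot /= /GRing.scale /=.
    by field.
  by field.
have e1 : e.1 != 0.
  by apply: contraNneq e0 => e1; rewrite [e]surjective_pairing e1 e2.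
exists (0, 1), (e.1^-1, 0), (- (e.2 / e.1), 1), `|e.1|.
split; first by rewrite normr_gt0.
    by rewrite /dot /= mul0r addr0 mulVf// mul1r mulNr divfK// addrC subrr !mulr0 !mulr1 !add0r.
  move=> x; rewrite [LHS]surjective_pairing; congr pair; rewrite /dot /= /GRing.scale /=.
    by field.
  by field.
move=> f cf f0; rewrite swap_integral//.
rewrite (@shear_integral_snd (e.2, e.1) (fun x => f (x.2, x.1)))//; last first.
  exact: continuous_swap.
Qed.

Lemma bounded_box (Omega : set plane) : bounded_set Omega ->
  exists2 M : R, 0 < M & forall x, Omega x -> `|x.1| <= M /\ `|x.2| <= M.
Proof.
move=> [M [_ HM]]; exists (`|M| + 1); first by rewrite ltr_wpDl.
move=> x Ox; have : `|x| <= `|M| + 1.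
  by apply: HM => //; rewrite (le_lt_trans (ler_norm _))// ltrDl.
by rewrite [`|x|]prod_normE ge_max => /andP[].
Qed.

Lemma bounded_measure (Omega : set plane) : open Omega -> bounded_set Omega ->
  exists M : R, mu Omega = M%:E.
Proof.
move=> oO /bounded_box[M M0 HM].
have mO := open_measurable2 oO.
have mb : measurable (`[- M, M]%classic `*` `[- M, M]%classic : set mplane).
  by apply: measurableX; exact: measurable_itv.
have le : (mu Omega <= mu (`[(- M)%R, M]%classic `*` `[(- M)%R, M]%classic))%E.
  apply: le_measure; rewrite ?inE// => x Ox; have [h1 h2] := HM _ Ox.
  by split; rewrite /= in_itv /= -ler_norml.
exists (fine (mu Omega)); rewrite fineK// ge0_fin_numE//; apply: le_lt_trans le _.
rewrite product_measure1E; [|exact: measurable_itv|exact: measurable_itv].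
have fin : (mu1 `[(- M)%R, M]%classic < +oo)%E.
  by rewrite lebesgue_measure_itv /=; case: ifP => _; rewrite ?ltry// -EFinB ltry.
by apply: lte_mul_pinfty => //; rewrite ge0_fin_numE.
Qed.

End plane_measure.

(** * The width function through open and closed segments *)

Section widths.
Context {R : realType}.
Local Notation plane := (R * R)%type.
Local Notation mu1 := (@lebesgue_measure R).
Implicit Types (x y a : plane) (theta : R).
Variables (Omega : set plane) (oO : open Omega) (bO : bounded_set Omega).

Definition direction theta : plane := (cos theta, sin theta).
Local Notation dir := direction.

Lemma direction_neq0 theta : dir theta != 0.
Proof.
apply/eqP => -[c0 s0]; have := cos2Dsin2 theta.
by rewrite c0 s0 !expr0n addr0 => /eqP; rewrite eq_sym oner_eq0.
Qed.

Lemma dot_dir theta : dot (dir theta) (dir theta) = 1.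
Proof. by rewrite /dot /= -!expr2 cos2Dsin2. Qed.

Lemma dot_linear x (t : R) y a : dot x (t *: y + a) = t * dot x y + dot x a.
Proof. by rewrite /dot /= /GRing.scale /=; ring. Qed.

Lemma interval_measure_le (I : set R) (D : R) : 0 <= D -> is_interval I ->
  (forall c d, I c -> I d -> d - c <= D) -> (mu1 I <= D%:E)%E.
Proof.
move=> D0 iI HD; have [->|/set0P[x Ix]] := eqVneq I set0; first by rewrite measure0 lee_fin.
have ub : ubound I (x + D) by move=> y Iy; have := HD _ _ Ix Iy; lra.
have hs : has_sup I by split; [exists x|exists (x + D)].
have sub : I `<=` `[sup I - D, sup I]%classic.
  move=> y Iy; rewrite /= in_itv /=; apply/andP; split; last exact: ub_le_sup hs.2 _ Iy.
  rewrite lerBlDr; apply: ge_sup; first by exists x.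
  by move=> z Iz; have := HD _ _ Iy Iz; lra.
have -> : D%:E = mu1 `[sup I - D, sup I]%classic.
  rewrite lebesgue_measure_itv /=; case: ifPn => [_|]; first by rewrite -EFinB; congr EFin; lra.
  rewrite lte_fin -leNgt => h; congr EFin; lra.
apply: le_measure; rewrite ?inE//; first exact: is_interval_measurable.
Qed.

Let lens theta := [set l | exists (a : plane) (J : set plane),
  [/\ J `<=` range (line_param theta a) `&` Omega, connected J &
      l = mu1 (line_param theta a @^-1` J)]].

(** On the line, the parametrization is inverted by the continuous function
    [dot (dir theta) x - dot (dir theta) a], so the preimage of a connected set is also a continuous
    image of it. *)
Lemma line_interval theta a (J : set plane) :
  J `<=` range (line_param theta a) -> connected J -> is_interval (line_param theta a @^-1` J).
Proof.
move=> JR cJ; apply/connected_intervalP.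
have E t : dot (dir theta) (line_param theta a t) - dot (dir theta) a = t.
  by rewrite /line_param dot_linear dot_dir mulr1 addrK.
have -> : line_param theta a @^-1` J = (fun x => dot (dir theta) x - dot (dir theta) a) @` J.
  apply/seteqP; split => t /=; first by move=> Jt; exists (line_param theta a t).
  by move=> [x Jx <-]; have [s _ sx] := JR _ Jx; rewrite -sx E sx.
apply: connected_continuous_connected => //; apply: continuous_subspaceT => x.
by apply: cvgB; [exact: dot_continuous|exact: cvg_cst].
Qed.

Lemma dot_dir_le theta x (M : R) : `|x.1| <= M -> `|x.2| <= M -> `|dot (dir theta) x| <= 2 * M.
Proof.
have c1 : `|cos theta| <= 1 by rewrite ler_norml cos_geN1 cos_le1.
have s1 : `|sin theta| <= 1 by rewrite ler_norml sin_geN1 sin_le1.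
move=> h1 h2; rewrite mulr_natl mulr2n; apply: le_trans (ler_normD _ _) _.
have P (c u : R) : `|c| <= 1 -> `|u| <= M -> `|c * u| <= M.
  by move=> hc hu; rewrite normrM; apply: le_trans hu; rewrite ler_piMl.
by apply: lerD; exact: P.
Qed.

Lemma line_diameter : exists2 D : R, 0 < D & forall theta a (t s : R),
  Omega (t *: dir theta + a) -> Omega (s *: dir theta + a) -> t - s <= D.
Proof.
have [M M0 HM] := bounded_box bO; exists (4 * M); first by rewrite mulr_gt0.
move=> theta a t s /HM[h1 h2] /HM[h3 h4].
have -> : t - s = dot (dir theta) (t *: dir theta + a) - dot (dir theta) (s *: dir theta + a).
  by rewrite !dot_linear dot_dir; lra.
have := dot_dir_le theta h1 h2; have := dot_dir_le theta h3 h4.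
set u := dot _ _; set v := dot _ _; clearbody u v.
by rewrite !ler_norml => /andP[a1 a2] /andP[a3 a4]; lra.
Qed.

Lemma lens_le : exists2 D : R, 0 < D & forall theta l, lens theta l -> (l <= D%:E)%E.
Proof.
have [D D0 HD] := line_diameter; exists D => // theta _ [a [J [JR cJ ->]]].
apply: interval_measure_le; first exact: ltW.
  by apply: line_interval => // x /JR[].
by move=> c d Jc Jd; apply: (HD theta a); [exact: (JR _ Jd).2|exact: (JR _ Jc).2].
Qed.

Lemma widthE theta : (width Omega theta)%:E = ereal_sup (lens theta).
Proof.
have [D D0 HD] := lens_le; rewrite /width fineK// ge0_fin_numE.
  by apply: le_lt_trans (ltry D); apply: ub_ereal_sup => l; exact: HD.
apply: ereal_sup_ubound; exists 0, set0; split; [by []|exact: connected0|].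
by rewrite preimage_set0 measure0.
Qed.

Lemma width_bounded : exists2 D : R, 0 < D & forall theta, width Omega theta <= D.
Proof.
have [D D0 HD] := lens_le; exists D => // theta; rewrite -lee_fin widthE.
by apply: ub_ereal_sup => l; exact: HD.
Qed.

Lemma segment_le_width theta a (b c : R) : b < c ->
  (forall t, b < t < c -> Omega (t *: dir theta + a)) -> c - b <= width Omega theta.
Proof.
move=> bc H; rewrite -lee_fin widthE; apply: ereal_sup_ubound.
exists a, (line_param theta a @` `]b, c[%classic); split.
- move=> _ [t /= tbc <-]; split; first by exists t.
  by apply: H; rewrite in_itv in tbc.
- apply: connected_continuous_connected.
    by apply/connected_intervalP; exact: interval_is_interval.
  apply: continuous_subspaceT => t; apply: cvgD; last exact: cvg_cst.
  exact: cvgZr_tmp.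
- have -> : line_param theta a @^-1` (line_param theta a @` `]b, c[%classic) = `]b, c[%classic.
    apply/seteqP; split => t /=; last by move=> h; exists t.
    move=> [s sbc E]; suff <- : s = t by [].
    have := congr1 (dot (dir theta)) E; rewrite /line_param !dot_linear dot_dir !mulr1.
    by move/addIr.
  by rewrite lebesgue_measure_itv /= lte_fin bc.
Qed.

(** An interval of measure greater than [y] contains two points more than [y] apart, and the closed
    segment between them. *)
Lemma width_segment theta (y : R) : 0 <= y -> y < width Omega theta ->
  exists a (b c : R), y < c - b /\ forall t, b <= t <= c -> Omega (t *: dir theta + a).
Proof.
move=> y0; rewrite -lte_fin widthE => /ereal_sup_gt[_ [a [J [JR cJ ->]]] lt].
apply: contrapT => nH; move: lt; rewrite ltNge => /negP; apply.
have iJ : is_interval (line_param theta a @^-1` J) by apply: line_interval => // x /JR[].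
apply: interval_measure_le => // c d Jc Jd; rewrite leNgt; apply/negP => lt.
apply: nH; exists a, c, d; split=> // t /andP[ct td].
by apply: (JR _ _).2; apply: (iJ _ _ Jc Jd); rewrite ct.
Qed.

(** The value [s = 1] serves angles that differ by a multiple of 2 pi, [s = -1] opposite
    directions. *)
Lemma width_sign theta theta' (s : R) : `|s| = 1 -> dir theta' = s *: dir theta ->
  width Omega theta' <= width Omega theta.
Proof.
move=> s1 E; rewrite leNgt; apply/negP => lt.
have w0 : 0 <= width Omega theta.
  rewrite -lee_fin widthE; apply: ereal_sup_ubound; exists 0, set0.
  by split; [by []|exact: connected0|rewrite preimage_set0 measure0].
have [a [b [c [lt2 H]]]] := width_segment w0 lt.
have bc : b < c by lra.
have [s0|s0] := leP 0 s.
  have s1' : s = 1 by rewrite -(ger0_norm s0).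
  suff : c - b <= width Omega theta by lra.
  apply: (segment_le_width (a := a)) => // t /andP[h1 h2].
  by have := H t; rewrite E s1' scale1r; apply; rewrite !ltW.
have s1' : s = - 1 by rewrite -s1 (ltr0_norm s0) opprK.
suff : - b - - c <= width Omega theta by lra.
apply: (segment_le_width (a := a)); first by lra.
move=> t /andP[h1 h2]; have := H (- t); rewrite E s1' scaleN1r scalerN scaleNr opprK; apply.
by apply/andP; split; lra.
Qed.

Lemma width_gt0 theta : Omega !=set0 -> 0 < width Omega theta.
Proof.
move=> [x Ox]; move: (oO); rewrite openE => /(_ _ Ox)/nbhs_ballP[e /= e0 He].
have e2 : - (e / 2) < e / 2 by lra.
suff : e / 2 - - (e / 2) <= width Omega theta by lra.
apply: (segment_le_width (a := x)) => // t /andP[h1 h2]; apply: He.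
have te : `|t| < e by rewrite ltr_norml; apply/andP; split; lra.
have P (c : R) : `|c| <= 1 -> `|t * c| < e.
  by move=> hc; rewrite normrM; apply: le_lt_trans te; rewrite ler_piMr.
split; rewrite /ball /= opprD addrCA subrr addr0 normrN; apply: P.
  by rewrite ler_norml cos_geN1 cos_le1.
by rewrite ler_norml sin_geN1 sin_le1.
Qed.

End widths.

Section pairing.
Context {d : measure_display} {T : measurableType d} {R : realType}.
Variables (mu : {measure set T -> \bar R}) (D : set T) (mD : measurable D).
Variables (p : R) (p1 : 1 < p) (M : R).
Hypothesis muD : mu D = M%:E.
Implicit Types (f g h : T -> R) (c : R).

Local Notation I f := (\int[mu]_(x in D) f x)%R.
Local Notation nr := (nrm mu D p).

Lemma pairing_integrable f h c : Lp mu D p f -> measurable_fun D h ->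
  (forall x, D x -> `|h x| <= c) -> mu.-integrable D (EFin \o (fun x => f x * h x)).
Proof.
move=> Lf mh hc; have iF := Lp_integrable mD p1 muD Lf.
have mf := Lp_measurable Lf.
apply/integrableP; split.
  by apply/measurable_EFinP; exact: measurable_funM.
have iZ : (\int[mu]_(x in D) (`|c|%:E * `|f x|%:E) < +oo)%E.
  rewrite ge0_integralZl_EFin//; last first.
    by apply/measurable_EFinP; exact: measurableT_comp.
  by move/integrableP : iF => [_ lt]; apply: lte_mul_pinfty.
apply: le_lt_trans iZ; apply: le_integral_ge0 => x Dx //=.
rewrite lee_fin normrM mulrC ler_wpM2r//.
by apply: le_trans (hc x Dx) _; exact: ler_norm.
Qed.

Lemma pairing_le f h c : Lp mu D p f -> measurable_fun D h -> 0 <= c ->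
  (forall x, D x -> `|h x| <= c) ->
  `|I (fun x => f x * h x)| <= c * (nr f * M `^ (1 - p^-1)).
Proof.
move=> Lf mh c0 hc; have iF := Lp_integrable mD p1 muD Lf.
have iFh := pairing_integrable Lf mh hc.
have iN : mu.-integrable D (EFin \o (fun x => `|f x|)) by have := integrable_abse iF.
apply: le_trans (le_normr_Rintegral mD iFh) _.
apply: (@le_trans _ _ (I (fun x => c * `|f x|))).
  apply: le_Rintegral => //.
  - by have := integrable_abse iFh.
  - by have := integrableZl mD c iN.
  - by move=> x Dx; rewrite normrM mulrC ler_wpM2r// hc.
rewrite RintegralZl// ler_wpM2l// /Rintegral -lee_fin fineK; last exact: integrable_fin_num.
exact: integral_le_nrm.
Qed.

Lemma pairing_cvg (f_ : nat -> T -> R) f h c : (forall n, Lp mu D p (f_ n)) -> Lp mu D p f ->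
  measurable_fun D h -> (forall x, D x -> `|h x| <= c) -> Lp_cvg mu D p f_ f ->
  I (fun x => f_ n x * h x) @[n --> \oo] --> I (fun x => f x * h x).
Proof.
move=> Lf_ Lf mh hc cf; apply/subr_cvg0.
have hc' x : D x -> `|h x| <= `|c| by move=> Dx; apply: le_trans (hc x Dx) (ler_norm _).
apply: norm_cvg0.
apply: (@cvg0_le _ _ (fun n => `|c| * (nr (fun x => f_ n x - f x) * M `^ (1 - p^-1)))).
  move=> n; rewrite normr_ge0 /= -RintegralB//; [|exact: pairing_integrable hc|exact: pairing_integrable hc].
  have -> : I (fun x => f_ n x * h x - f x * h x) = I (fun x => (f_ n x - f x) * h x).
    by apply: eq_Rintegral => x _; rewrite mulrBl.
  by apply: pairing_le => //; exact: LpB.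
rewrite -[X in _ --> X](mulr0 `|c|); apply: cvgM; first exact: cvg_cst.
rewrite -[X in _ --> X](mul0r (M `^ (1 - p^-1))); apply: cvgM; last exact: cvg_cst.
exact: cf.
Qed.

(** Intended for positive parts of directional derivatives, Lipschitz functions of the two
    components of a gradient. *)
Lemma Lp_cvg_lip (g_ h_ : nat -> T -> R) g h (f_ : nat -> T -> R) f c : 0 <= c ->
  (forall n, Lp mu D p (g_ n)) -> Lp mu D p g ->
  (forall n, Lp mu D p (h_ n)) -> Lp mu D p h ->
  (forall n, measurable_fun D (f_ n)) -> measurable_fun D f ->
  (forall n x, D x -> `|f_ n x - f x| <= c * (`|g_ n x - g x| + `|h_ n x - h x|)) ->
  Lp_cvg mu D p g_ g -> Lp_cvg mu D p h_ h -> Lp_cvg mu D p f_ f.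
Proof.
move=> c0 Lg_ Lg Lh_ Lh mf_ mf H cg ch.
apply: (@cvg0_le _ _ (fun n => c * (nr (fun x => g_ n x - g x) + nr (fun x => h_ n x - h x)))).
  move=> n; rewrite nrm_ge0 /=.
  have LG := LpB mD p1 (Lg_ n) Lg; have LH := LpB mD p1 (Lh_ n) Lh.
  have LA k : Lp mu D p k -> Lp mu D p (fun x => `|k x|) /\ nr (fun x => `|k x|) <= nr k.
    move=> Lk; apply: (Lp_le p1) => //; last by move=> x _; rewrite normr_id.
    by apply: measurableT_comp => //; exact: Lp_measurable Lk.
  have [LG1 nG] := LA _ LG; have [LH1 nH] := LA _ LH.
  have LS := LpD mD p1 LG1 LH1.
  have [_ le1] : Lp mu D p (fun x => f_ n x - f x) /\
      nr (fun x => f_ n x - f x) <= nr (fun x => c * (`|g_ n x - g x| + `|h_ n x - h x|)).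
    apply: (Lp_le p1); [exact: measurable_funB|exact: LpZ|].
    by move=> x Dx; apply: le_trans (H n x Dx) _; exact: ler_norm.
  apply: le_trans le1 _; rewrite nrmZ// (ger0_norm c0) ler_wpM2l//.
  by apply: le_trans (nrmD mD p1 LG1 LH1) _; exact: lerD.
rewrite -[X in _ --> X](mulr0 c); apply: cvgM; first exact: cvg_cst.
by rewrite -[X in _ --> X](addr0 0); apply: cvgD.
Qed.

End pairing.

(** * Sobolev functions as limits of test functions *)

Section plane_test_functions.
Context {R : realType}.
Local Notation plane := (R * R)%type.
Local Notation mu1 := (@lebesgue_measure R).
Local Notation mu := (mu1 \x mu1)%E.
Local Notation mplane := (measurableTypeR R * measurableTypeR R)%type.
Variables (Omega : set plane) (oO : open Omega) (bO : bounded_set Omega).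
Variables (p : R) (p1 : 1 < p).
Implicit Types (f phi psi u v : plane -> R) (g : plane -> plane) (a e l x : plane) (c : R) (i : bool).

Let p0 : 0 < p. Proof. exact: lt_trans ltr01 p1. Qed.
Let mO : measurable (Omega : set mplane). Proof. exact: open_measurable2. Qed.
Local Notation nr := (nrm mu Omega p).
Local Notation LP := (Lp mu Omega p).

Lemma csupp_bound f : continuous f -> csupp Omega f ->
  exists2 c, 0 <= c & forall x, `|f x| <= c.
Proof.
move=> cf [K [cK KO f0]].
have [K0|/set0P K0] := eqVneq K set0.
  by exists 0 => // x; rewrite f0 ?normr0// K0.
have cn : continuous (fun x => `|f x|) by apply: continuous_comp1 => // s; exact: norm_continuous.
have [z _ zmax] := compact_EVT_max K0 cK (continuous_subspaceT cn).
exists `|f z| => // x; have [Kx|nK] := pselect (K x); first by apply: zmax; rewrite inE.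
by rewrite f0// normr0.
Qed.

Lemma support_Omega (F : plane -> \bar R) : (forall x, ~ Omega x -> F x = 0%E) ->
  (\int[mu]_x F x = \int[mu]_(x in Omega) F x)%E.
Proof. by move=> H; exact: (@integral_support R _ _ mu Omega F H). Qed.

Lemma csupp_integrable2 f : continuous f -> csupp Omega f ->
  mu.-integrable setT (EFin \o f).
Proof.
move=> cf sf; have [c c0 fc] := csupp_bound cf sf; have [M muO] := bounded_measure oO bO.
apply/integrableP; split; first by apply/measurable_EFinP; exact: continuous_measurable2.
have Z x : ~ Omega x -> (`|(EFin \o f) x| = 0)%E.
  by move=> nO; rewrite /= (csupp_out sf)// normr0.
rewrite (support_Omega Z).
apply: (@le_lt_trans _ _ (\int[mu]_(x in Omega) c%:E)%E).
  by apply: le_integral_ge0 => x _ //=; rewrite lee_fin.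
by rewrite integral_cst//= muO -EFinM ltry.
Qed.

Lemma csupp_Lp2 f : continuous f -> csupp Omega f -> LP f.
Proof.
move=> cf sf; have [c c0 fc] := csupp_bound cf sf; have [M muO] := bounded_measure oO bO.
apply/(LpE _ _ p1); split; first exact: continuous_measurable2.
apply: (@le_lt_trans _ _ (\int[mu]_(x in Omega) (c `^ p)%:E)%E).
  apply: le_integral_ge0 => x _; first by rewrite lee_fin powR_ge0.
  by rewrite lee_fin; apply: ge0_ler_powR; rewrite ?nnegrE// ltW.
by rewrite integral_cst//= muO -EFinM ltry.
Qed.

Lemma csupp_slice f e a : dot e e = 1 -> csupp Omega f ->
  csupp [set t | Omega (t *: e + a)] (fun t : R => f (t *: e + a)).
Proof.
move=> e1 [K [cK KO f0]].
have cs : continuous (fun t : R => t *: e + a).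
  apply: continuous_addv; last exact: continuous_cst.
  by apply: continuous_scale; exact: continuous_id.
exists [set t | K (t *: e + a)]; split; last by move=> t /= /f0.
  have clK : closed [set t | K (t *: e + a)].
    have := @preimage_closed _ _ (fun t : R => t *: e + a) K; apply.
      by move=> x _; exact: cs.
    exact: compact_closed plane_hausdorff cK.
  have [M M0 HM] := bounded_box (compact_bounded cK).
  pose D := (`|e.1| + `|e.2|) * M + `|dot e a|.
  apply: (@subclosed_compact _ _ `[- D, D]%classic) => //; first exact: segment_compact.
  move=> t /= Kt; rewrite in_itv /= -ler_norml.
  have -> : t = dot e (t *: e + a) - dot e a by rewrite dot_linear e1 mulr1 addrK.
  have [h1 h2] := HM _ Kt; apply: le_trans (ler_normB _ _) _; rewrite lerD2r mulrDl.
  by apply: le_trans (ler_normD _ _) _; rewrite !normrM; apply: lerD; rewrite ler_wpM2l.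
by move=> t /=; exact: KO.
Qed.

Lemma partial_integral_eq0 i f : smooth f -> csupp Omega f ->
  (\int[mu]_x (partial i f x)%:E = 0)%E.
Proof.
move=> sf cf; have iF : mu.-integrable setT (EFin \o partial i f).
  by apply: csupp_integrable2; [exact: smooth_continuous (smooth_partial i sf)|exact: csupp_partial].
have Z a : (\int[mu1]_t (partial i f (t *: basis_vector i + a))%:E = 0)%E.
  have [s1 d1] := smooth_slice (basis_vector i) a sf.
  have bb : dot (basis_vector i) (basis_vector i) = 1 :> R.
    by case: i {iF s1 d1} => /=; rewrite /dot /= !mulr0 !mulr1 ?addr0 ?add0r.
  have db y : dot (basis_vector i) (grad f y) = partial i f y.
    by case: i {iF s1 d1 bb} => /=; rewrite /dot /grad /= mul1r mul0r ?addr0 ?add0r.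
  have E t : partial i f (t *: basis_vector i + a) = derive1 (fun t => f (t *: basis_vector i + a)) t.
    by rewrite d1 db.
  under eq_integral do rewrite E.
  apply: (integral_derive_eq0 _ _ (csupp_slice a bb cf)).
    by move=> t; exact: smooth1_is_derive.
  exact: smooth1_cont.
case: i iF Z => iF Z.
  rewrite -(fubini1 iF); apply: integral0_eq => x _; rewrite /fubini_F /=.
  rewrite -[RHS](Z (x, 0)); apply: eq_integral => t _; congr (partial _ _ _)%:E.
  by congr pair; rewrite /= /GRing.scale /=; ring.
rewrite -(fubini2 iF); apply: integral0_eq => x _; rewrite /fubini_G /=.
rewrite -[RHS](Z (0, x)); apply: eq_integral => t _; congr (partial _ _ _)%:E.
by congr pair; rewrite /= /GRing.scale /=; ring.
Qed.

Lemma csuppMr (f h : plane -> R) : csupp Omega f -> csupp Omega (fun x => h x * f x).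
Proof. by apply: csupp_sub => x ->; rewrite mulr0. Qed.

Lemma Rintegral_support f : csupp Omega f ->
  (\int[mu]_(x in Omega) f x)%R = (\int[mu]_x f x)%R.
Proof.
move=> cf; have Z x : ~ Omega x -> (f x)%:E = 0%E :> \bar R.
  by move=> nO; rewrite (csupp_out cf).
by rewrite /Rintegral (support_Omega Z).
Qed.

Lemma integrable_Omega f : mu.-integrable setT (EFin \o f) -> mu.-integrable Omega (EFin \o f).
Proof. by apply: integrableS. Qed.

Lemma integration_by_parts2 i f h : smooth f -> smooth h -> csupp Omega h ->
  (\int[mu]_(x in Omega) (f x * partial i h x))%R = - (\int[mu]_(x in Omega) (partial i f x * h x))%R.
Proof.
move=> sf sh ch; have cdh := csupp_partial i ch.
have c1 : continuous (fun x => f x * partial i h x).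
  exact: (continuous_mul (smooth_continuous sf) (smooth_continuous (smooth_partial i sh))).
have c2 : continuous (fun x => partial i f x * h x).
  exact: (continuous_mul (smooth_continuous (smooth_partial i sf)) (smooth_continuous sh)).
have i1 := csupp_integrable2 c1 (csuppMr f cdh).
have i2 := csupp_integrable2 c2 (csuppMr (partial i f) ch).
rewrite !Rintegral_support; [|exact: csuppMr|exact: csuppMr].
apply/eqP; rewrite -addr_eq0 -RintegralD//.
have := partial_integral_eq0 i (smoothM sf sh) (csuppMr f ch).
rewrite (partialM i sf sh) => E; apply/eqP.
rewrite /Rintegral; under eq_integral do rewrite [X in _ + X]mulrC.
by rewrite E.
Qed.

Section W01p_theory.

Definition test phi := smooth phi /\ csupp Omega phi.

Lemma test_cont phi : test phi -> continuous phi. Proof. by move=> [/smooth_continuous]. Qed.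

Lemma test_partial i phi : test phi -> test (partial i phi).
Proof. by move=> [s c]; split; [exact: smooth_partial|exact: csupp_partial]. Qed.

Lemma test_Lp phi : test phi -> LP phi.
Proof. by move=> t; apply: csupp_Lp2; [exact: test_cont|exact: t.2]. Qed.

Lemma testD phi psi : test phi -> test psi -> test (fun x => phi x + psi x).
Proof. by move=> [s1 c1] [s2 c2]; split; [exact: smoothD|exact: csuppD]. Qed.

Lemma testZ c phi : test phi -> test (fun x => c * phi x).
Proof. by move=> [s1 c1]; split; [exact: smoothZ|exact: csuppMr]. Qed.

(** [psi] and its partial derivatives are bounded, so both sides of the integration by parts for
    [phi_ n] are continuous in the L^p norm. *)
Lemma weak_gradient_limit i u h (phi_ : nat -> plane -> R) psi :
  LP u -> LP h -> (forall n, test (phi_ n)) -> Lp_cvg mu Omega p phi_ u ->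
  Lp_cvg mu Omega p (fun n => partial i (phi_ n)) h -> test psi ->
  (\int[mu]_(x in Omega) (u x * partial i psi x)%:E = - \int[mu]_(x in Omega) (h x * psi x)%:E)%E.
Proof.
move=> Lu Lh tphi c1 c2 tpsi; have [M muO] := bounded_measure oO bO.
have tdp := test_partial i tpsi.
have [b b0 bp] := csupp_bound (test_cont tpsi) tpsi.2.
have [b' b'0 bp'] := csupp_bound (test_cont tdp) tdp.2.
have m1 : measurable_fun (Omega : set mplane) psi by apply: continuous_measurable2; exact: test_cont.
have m2 : measurable_fun (Omega : set mplane) (partial i psi) by apply: continuous_measurable2; exact: test_cont.
have L1 := pairing_cvg mO p1 muO (fun n => test_Lp (tphi n)) Lu m2 (fun x _ => bp' x) c1.
have L2 := pairing_cvg mO p1 muO (fun n => test_Lp (test_partial i (tphi n))) Lh m1 (fun x _ => bp x) c2.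
have E n : (\int[mu]_(x in Omega) (phi_ n x * partial i psi x))%R =
    - (\int[mu]_(x in Omega) (partial i (phi_ n) x * psi x))%R.
  by apply: integration_by_parts2; [exact: (tphi n).1|exact: tpsi.1|exact: tpsi.2].
have L3 : (\int[mu]_(x in Omega) (phi_ n x * partial i psi x))%R @[n --> \oo]
    --> - (\int[mu]_(x in Omega) (h x * psi x))%R.
  by under eq_fun do rewrite E; exact: cvgN.
have EE := cvg_unique (@norm_hausdorff _ _) L1 L3.
have i1 := pairing_integrable mO p1 muO Lu m2 (fun x _ => bp' x).
have i2 := pairing_integrable mO p1 muO Lh m1 (fun x _ => bp x).
rewrite -(fineK (integrable_fin_num mO i1)) -(fineK (integrable_fin_num mO i2)) -EFinN.
by congr EFin; exact: EE.
Qed.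

(** The weak gradient identity comes with the approximating sequence. *)
Lemma W01p_intro u g (phi_ : nat -> plane -> R) : LP u -> LP (fun x => (g x).1) ->
  LP (fun x => (g x).2) -> (forall n, test (phi_ n)) -> Lp_cvg mu Omega p phi_ u ->
  Lp_cvg mu Omega p (fun n => partial false (phi_ n)) (fun x => (g x).1) ->
  Lp_cvg mu Omega p (fun n => partial true (phi_ n)) (fun x => (g x).2) ->
  W01p Omega p u g.
Proof.
move=> Lu L1 L2 tphi c0 c1 c2; split=> //.
  move=> psi /test_functionP tpsi; split.
    exact: (weak_gradient_limit (i := false) Lu L1 tphi c0 c1 tpsi).
  exact: (weak_gradient_limit (i := true) Lu L2 tphi c0 c2 tpsi).
exists phi_; split.
- by move=> n; apply/test_functionP; exact: tphi.
- by apply/(Lp_cvgP mO p1) => // n; exact: test_Lp.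
- by apply/(Lp_cvgP mO p1) => // n; apply: test_Lp; exact: (@test_partial false).
- by apply/(Lp_cvgP mO p1) => // n; apply: test_Lp; exact: (@test_partial true).
Qed.

Lemma W01p_elim u g : W01p Omega p u g -> exists phi_ : nat -> plane -> R,
  [/\ forall n, test (phi_ n), Lp_cvg mu Omega p phi_ u,
      Lp_cvg mu Omega p (fun n => partial false (phi_ n)) (fun x => (g x).1) &
      Lp_cvg mu Omega p (fun n => partial true (phi_ n)) (fun x => (g x).2)].
Proof.
move=> [Lu [L1 L2] _ [phi_ [tphi c0 c1 c2]]]; exists phi_.
have t n : test (phi_ n) by apply/test_functionP; exact: tphi.
split=> //; apply/(Lp_cvgP mO p1) => // n; first exact: test_Lp.
  by apply: test_Lp; exact: (@test_partial false).
by apply: test_Lp; exact: (@test_partial true).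
Qed.

Lemma W01p_test phi : test phi -> W01p Omega p phi (grad phi).
Proof.
move=> t; have C f : LP f -> Lp_cvg mu Omega p (fun _ : nat => f) f.
  move=> Lf; rewrite /Lp_cvg; have -> : nr (fun x => f x - f x) = 0; last exact: cvg_cst.
  have -> : (fun x => f x - f x) = (fun x => 0 * f x) by apply/funext => x; rewrite subrr mul0r.
  by rewrite nrmZ// normr0 mul0r.
have L0 := test_Lp t; 
have L1 : LP (fun x => (grad phi x).1) := test_Lp (test_partial false t).
have L2 : LP (fun x => (grad phi x).2) := test_Lp (test_partial true t).
have C1 : Lp_cvg mu Omega p (fun _ : nat => partial false phi) (fun x => (grad phi x).1) := C _ L1.
have C2 : Lp_cvg mu Omega p (fun _ : nat => partial true phi) (fun x => (grad phi x).2) := C _ L2.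
refine (@W01p_intro _ _ (fun _ => phi) L0 L1 L2 (fun _ => t) (C _ L0) C1 C2).
Qed.

Lemma W01p_lin u g v h c : W01p Omega p u g -> W01p Omega p v h ->
  W01p Omega p (fun x => u x + c * v x) (fun x => g x + c *: h x).
Proof.
move=> Wu Wv; have [phi_ [tp cp0 cp1 cp2]] := W01p_elim Wu.
have [psi_ [tq cq0 cq1 cq2]] := W01p_elim Wv.
have [Lu [Lg1 Lg2] _ _] := Wu; have [Lv [Lh1 Lh2] _ _] := Wv.
have C (a b : plane -> R) (f_ h_ : nat -> plane -> R) : (forall n, LP (f_ n)) -> LP a -> (forall n, LP (h_ n)) -> LP b ->
    Lp_cvg mu Omega p f_ a -> Lp_cvg mu Omega p h_ b ->
    Lp_cvg mu Omega p (fun n x => f_ n x + c * h_ n x) (fun x => a x + c * b x).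
  move=> *; apply: Lp_cvgD => //; [move=> n; exact: LpZ|exact: LpZ|exact: Lp_cvgZ].
apply: (@W01p_intro _ _ (fun n x => phi_ n x + c * psi_ n x)).
- by apply: LpD => //; exact: LpZ.
- by apply: (LpD mO p1 Lg1); exact: LpZ.
- by apply: (LpD mO p1 Lg2); exact: LpZ.
- by move=> n; apply: testD => //; exact: testZ.
- by apply: C => // n; exact: test_Lp.
- have E : (fun n => partial false (fun x => phi_ n x + c * psi_ n x)) =
      (fun n x => partial false (phi_ n) x + c * partial false (psi_ n) x).
    apply/funext => n; rewrite (partialD _ (tp n).1 (smoothZ c (tq n).1)).
    by rewrite (partialZ _ _ (tq n).1).
  rewrite E; apply: (C (fun x => (g x).1) (fun x => (h x).1)) => // n; apply: test_Lp;
    exact: (@test_partial false).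
- have E : (fun n => partial true (fun x => phi_ n x + c * psi_ n x)) =
      (fun n x => partial true (phi_ n) x + c * partial true (psi_ n) x).
    apply/funext => n; rewrite (partialD _ (tp n).1 (smoothZ c (tq n).1)).
    by rewrite (partialZ _ _ (tq n).1).
  rewrite E; apply: (C (fun x => (g x).2) (fun x => (h x).2)) => // n; apply: test_Lp;
    exact: (@test_partial true).
Qed.

End W01p_theory.
End plane_test_functions.

(** * The directional inequality *)

Lemma ler_cvgn (R : realType) (f g : nat -> R) (l l' : R) : f n @[n --> \oo] --> l ->
  g n @[n --> \oo] --> l' -> (forall n, f n <= g n) -> l <= l'.
Proof. by move=> cf cg fg; apply: (ler_cvg_to cf cg); exact: nearW. Qed.

Section continuity_of_powers.
Context {R : realType} {T : topologicalType}.
Implicit Types f : T -> R.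

Lemma continuous_powR_norm f (s : R) : 0 < s -> continuous f -> continuous (fun x => `|f x| `^ s).
Proof. by move=> s0 cf; exact: (@continuous_comp1 _ _ f (fun t => `|t| `^ s) cf (powR_norm_continuous s0)). Qed.

Lemma continuous_pospow f (s : R) : 0 < s -> continuous f -> continuous (fun x => pospow s (f x)).
Proof. by move=> s0 cf; exact: (@continuous_comp1 _ _ f (pospow s) cf (pospow_continuous s0)). Qed.

Lemma continuous_max0 f : continuous f -> continuous (fun x => Num.max (f x) 0).
Proof.
move=> cf; have H : continuous (fun s : R => Num.max s 0) by exact: (max_continuous (smooth1_continuous (@smooth1_id R))).
exact: (@continuous_comp1 _ _ f (fun s => Num.max s 0) cf H).
Qed.

End continuity_of_powers.

Section directional_inequality.
Context {R : realType}.
Local Notation plane := (R * R)%type.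
Local Notation mu1 := (@lebesgue_measure R).
Local Notation mu := (mu1 \x mu1)%E.
Local Notation mplane := (measurableTypeR R * measurableTypeR R)%type.
Variables (Omega : set plane) (oO : open Omega) (bO : bounded_set Omega) (nO : Omega !=set0).
Variables (p : R) (p1 : 1 < p) (theta : R).
Implicit Types (f phi psi u v : plane -> R) (g : plane -> plane) (a e l x : plane) (c : R) (i : bool).

Let p0 : 0 < p. Proof. exact: lt_trans ltr01 p1. Qed.
Let mO : measurable (Omega : set mplane). Proof. exact: open_measurable2. Qed.
Local Notation nr := (nrm mu Omega p).
Local Notation LP := (Lp mu Omega p).
Local Notation test := (test Omega).
Local Notation dir := (direction theta).
Local Notation W := (width Omega theta).
Local Notation lam := (fine (lambda1p p (2 * W))).
Local Notation q := (p / (p - 1)).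

Definition posdot e x : R := Num.max (dot e x) 0.

Lemma H0E x : H0 theta x = posdot dir x.
Proof. by rewrite /H0 /posdot /dot /= ![cos _ * _]mulrC ![sin _ * _]mulrC. Qed.

Let W0 : 0 < 2 * W. Proof. by rewrite mulr_gt0// width_gt0. Qed.

Lemma lamE : lam%:E = lambda1p p (2 * W).
Proof. by rewrite fineK// ge0_fin_numE ?lambda1p_ge0// lambda1p_lty. Qed.

Lemma lam_gt0 : 0 < lam.
Proof. by rewrite -lte_fin lamE lambda1p_gt0. Qed.

Definition gain2 phi psi x : R :=
  lam * (`|phi x| `^ p + p * (Num.max (- dot dir (grad phi x)) 0 * psi x)).

Definition cost2 phi psi x : R :=
  pospow p (dot dir (grad phi x)) + 2 * (lam * (p - 1) * `|dot dir (grad psi x)| `^ q).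

Lemma dot_grad_cont phi e : test phi -> continuous (fun x => dot e (grad phi x)).
Proof.
move=> t; apply: continuous_add; apply: continuous_mul; try exact: continuous_cst.
  exact: test_cont (test_partial false t).
exact: test_cont (test_partial true t).
Qed.

Lemma dot_grad_csupp phi e : test phi -> csupp Omega (fun x => dot e (grad phi x)).
Proof.
move=> t; apply: csuppD; apply: csuppMr.
  exact: (test_partial false t).2.
exact: (test_partial true t).2.
Qed.

Lemma continuous_oppf f : continuous f -> continuous (fun x => - f x).
Proof. by move=> cf x; apply: cvgN; exact: cf. Qed.

Let q0 : 0 < q. Proof. exact: qgt0. Qed.

Lemma gain2_cont phi psi : test phi -> test psi -> continuous (gain2 phi psi).
Proof.
move=> tf tp; have c1 := continuous_powR_norm p0 (test_cont tf).
have c2 := continuous_max0 (continuous_oppf (dot_grad_cont (e := dir) tf)).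
have c3 := continuous_mul (@continuous_cst plane R p) (continuous_mul c2 (test_cont tp)).
exact: (continuous_mul (@continuous_cst plane R lam) (continuous_add c1 c3)).
Qed.

Lemma cost2_cont phi psi : test phi -> test psi -> continuous (cost2 phi psi).
Proof.
move=> tf tp; have c1 := continuous_pospow p0 (dot_grad_cont (e := dir) tf).
have c2 := continuous_powR_norm q0 (dot_grad_cont (e := dir) tp).
have c3 := continuous_mul (@continuous_cst plane R (lam * (p - 1))) c2.
exact: (continuous_add c1 (continuous_mul (@continuous_cst plane R 2) c3)).
Qed.

Lemma gain2_ge0 phi psi x : 0 <= psi x -> 0 <= gain2 phi psi x.
Proof.
move=> h; apply: mulr_ge0; first exact: ltW lam_gt0.
by rewrite addr_ge0 ?powR_ge0// mulr_ge0 ?(ltW p0)// mulr_ge0// le_max lexx orbT.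
Qed.

Lemma cost2_ge0 phi psi x : 0 <= cost2 phi psi x.
Proof.
rewrite addr_ge0 ?pospow_ge0// !mulr_ge0 ?powR_ge0// ?(ltW lam_gt0)//.
by rewrite subr_ge0 ltW.
Qed.

(** On each line of direction theta the trace of [Omega] is an open set whose intervals have length
    at most [W], so [signed_inequality] holds slice by slice with [L = W]. *)
Lemma plane_inequality phi psi : test phi -> test psi -> (forall x, 0 <= psi x) ->
  (\int[mu]_x (gain2 phi psi x)%:E <= \int[mu]_x (cost2 phi psi x)%:E)%E.
Proof.
move=> tf tp psi0; have [w [lt [lr [k [k0 _ _ shear]]]]] := shear_integral (direction_neq0 theta).
rewrite (shear _ (gain2_cont tf tp) (fun x => gain2_ge0 phi (psi0 x))).
rewrite (shear _ (cost2_cont tf tp) (cost2_ge0 phi psi)).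
apply: lee_wpmul2l; first by rewrite lee_fin ltW.
apply: le_integral_ge0 => r _.
  by apply: integral_ge0 => t _; rewrite lee_fin; exact: gain2_ge0.
have [s1 d1] := smooth_slice dir (r *: w) tf.1.
have [s2 d2] := smooth_slice dir (r *: w) tp.1.
have Hlam (phi1 : R -> R) : smooth1 phi1 -> csupp (`]0, 2 * W[%classic : set R) phi1 ->
  (lam%:E * \int[mu1]_x (`|phi1 x| `^ p)%:E <= \int[mu1]_x (`|derive1 phi1 x| `^ p)%:E)%E.
  by move=> sf cf; rewrite lamE; exact: lambda1p_le.
have oOr : open [set t | Omega (t *: dir + r *: w)].
  apply: (@open_comp _ _ (fun t : R => t *: dir + r *: w) Omega) => // t _.
  apply: continuous_addv; last exact: continuous_cst.
  by apply: continuous_scale; exact: continuous_id.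
have seg (a b : R) : a < b -> `]a, b[%classic `<=` [set t | Omega (t *: dir + r *: w)] -> b - a <= W.
  move=> ab H; apply: (@segment_le_width _ Omega bO theta (r *: w) a b ab) => t tab; apply: H.
  by rewrite /= in_itv.
have := signed_inequality p1 (width_gt0 oO bO theta nO) lam_gt0 Hlam oOr seg s1
  (csupp_slice (r *: w) (dot_dir theta) tf.2) s2 (fun t => psi0 _)
  (csupp_slice (r *: w) (dot_dir theta) tp.2).
by rewrite /gain d1 d2.
Qed.

Definition qcost psi := (\int[mu]_(x in Omega) (`|dot dir (grad psi x)| `^ q))%R.

Lemma Rint_energy f : LP f -> (\int[mu]_(x in Omega) (`|f x| `^ p))%R = nr f `^ p.
Proof. by move=> Lf; rewrite /Rintegral (Lp_energy p1 Lf). Qed.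

Lemma csupp_integrableO f : continuous f -> csupp Omega f -> mu.-integrable Omega (EFin \o f).
Proof. by move=> cf sf; exact: (integrable_Omega oO (csupp_integrable2 oO bO cf sf)). Qed.

Lemma test_inequality phi psi : test phi -> test psi -> (forall x, 0 <= psi x) ->
  lam * nr phi `^ p +
    lam * p * (\int[mu]_(x in Omega) (Num.max (- dot dir (grad phi x)) 0 * psi x))%R <=
  nr (fun x => posdot dir (grad phi x)) `^ p + 2 * (lam * (p - 1)) * qcost psi.
Proof.
move=> tf tp psi0.
pose A x := `|phi x| `^ p; pose B x := Num.max (- dot dir (grad phi x)) 0 * psi x.
pose C x := `|posdot dir (grad phi x)| `^ p; pose D x := `|dot dir (grad psi x)| `^ q.
have pN0 : p != 0 by rewrite gt_eqF.
have qN0 : q != 0 by rewrite gt_eqF.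
have cA : continuous A := continuous_powR_norm p0 (test_cont tf).
have cmin : continuous (fun x => Num.max (- dot dir (grad phi x)) 0) :=
  continuous_max0 (continuous_oppf (dot_grad_cont (e := dir) tf)).
have cB : continuous B := continuous_mul cmin (test_cont tp).
have cpos : continuous (fun x => posdot dir (grad phi x)) :=
  continuous_max0 (dot_grad_cont (e := dir) tf).
have cC : continuous C := continuous_powR_norm p0 cpos.
have cD : continuous D := continuous_powR_norm q0 (dot_grad_cont (e := dir) tp).
have spos : csupp Omega (fun x => posdot dir (grad phi x)).
  by apply: csupp_sub (dot_grad_csupp dir tf) => x dx; rewrite /posdot dx maxxx.
have sA : csupp Omega A by apply: csupp_sub tf.2 => x fx; rewrite /A fx normr0 powR0.
have sB : csupp Omega B by apply: csuppMr; exact: tp.2.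
have sC : csupp Omega C by apply: csupp_sub spos => x fx; rewrite /C fx normr0 powR0.
have sD : csupp Omega D by apply: csupp_sub (dot_grad_csupp dir tp) => x fx; rewrite /D fx normr0 powR0.
have iA := csupp_integrableO cA sA; have iB := csupp_integrableO cB sB.
have iC := csupp_integrableO cC sC; have iD := csupp_integrableO cD sD.
have iBp : mu.-integrable Omega (EFin \o (fun x => p * B x)) by have := integrableZl mO p iB.
have iAB : mu.-integrable Omega (EFin \o (fun x => A x + p * B x)) by have := integrableD mO iA iBp.
have iDk : mu.-integrable Omega (EFin \o (fun x => lam * (p - 1) * D x)).
  by have := integrableZl mO (lam * (p - 1)) iD.
have iD2 : mu.-integrable Omega (EFin \o (fun x => 2 * (lam * (p - 1) * D x))).
  by have := integrableZl mO 2 iDk.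
have Lpos : LP (fun x => posdot dir (grad phi x)) by exact: csupp_Lp2.
have EL : (\int[mu]_(x in Omega) (lam * (A x + p * B x)))%R =
    lam * nr phi `^ p + lam * p * (\int[mu]_(x in Omega) B x)%R.
  rewrite RintegralZl// RintegralD// RintegralZl// Rint_energy; last exact: test_Lp.
  by rewrite mulrDr mulrA.
have ER : (\int[mu]_(x in Omega) (C x + 2 * (lam * (p - 1) * D x)))%R =
    nr (fun x => posdot dir (grad phi x)) `^ p + 2 * (lam * (p - 1)) * qcost psi.
  by rewrite RintegralD// RintegralZl// RintegralZl// Rint_energy// mulrA.
rewrite -EL -ER -lee_fin /Rintegral.
have iG : mu.-integrable Omega (EFin \o (fun x => lam * (A x + p * B x))).
  by have := integrableZl mO lam iAB.
have iH : mu.-integrable Omega (EFin \o (fun x => C x + 2 * (lam * (p - 1) * D x))).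
  by have := integrableD mO iC iD2.
rewrite !fineK; [|exact: integrable_fin_num iH|exact: integrable_fin_num iG].
have Z1 x : ~ Omega x -> (gain2 phi psi x)%:E = 0%E :> \bar R.
  move=> nOx; have /= a0 := csupp_out sA nOx; have /= b0 := csupp_out sB nOx.
  by rewrite /gain2 -/(A x) -/(B x) a0 b0 mulr0 addr0 mulr0.
have Z2 x : ~ Omega x -> (cost2 phi psi x)%:E = 0%E :> \bar R.
  move=> nOx; have /= c0 := csupp_out sC nOx; have /= d0 := csupp_out sD nOx.
  rewrite /cost2 -/(D x) d0 !mulr0 addr0.
  move: c0; rewrite /C /posdot /pospow ger0_norm; last by rewrite le_max lexx orbT.
  by move=> ->.
have := plane_inequality tf tp psi0; rewrite (support_Omega Z1) (support_Omega Z2).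
have E3 x : cost2 phi psi x = C x + 2 * (lam * (p - 1) * D x).
  by rewrite /cost2 /C /pospow /posdot [in RHS]ger0_norm// le_max lexx orbT.
by under [leRHS]eq_integral do rewrite E3.
Qed.

Lemma max0_lip (s t : R) : `|Num.max s 0 - Num.max t 0| <= `|s - t|.
Proof.
rewrite /Num.max; case: (ltP s 0) => s0; case: (ltP t 0) => t0.
- by rewrite subrr normr0.
- by rewrite sub0r normrN (ger0_norm t0) distrC ger0_norm; lra.
- by rewrite subr0 (ger0_norm s0) ger0_norm; lra.
- by [].
Qed.

Lemma dot_measurable g e : LP (fun x => (g x).1) -> LP (fun x => (g x).2) ->
  LP (fun x => dot e (g x)).
Proof. by move=> L1 L2; apply: (LpD mO p1); exact: LpZ. Qed.

Lemma max_Lp f : LP f -> LP (fun x => Num.max (f x) 0).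
Proof.
move=> Lf; have mf := Lp_measurable Lf.
have mm : measurable_fun (Omega : set mplane) (fun x => Num.max (f x) 0).
  by apply: measurable_maxr => //; exact: measurable_cst.
apply: (Lp_le p1 mm Lf _).1 => x _.
by have := max0_lip (f x) 0; rewrite maxxx !subr0.
Qed.

Lemma dot_lip e x y : `|dot e x - dot e y| <= (`|e.1| + `|e.2|) * (`|x.1 - y.1| + `|x.2 - y.2|).
Proof.
have -> : dot e x - dot e y = e.1 * (x.1 - y.1) + e.2 * (x.2 - y.2) by rewrite /dot; ring.
apply: le_trans (ler_normD _ _) _; rewrite !normrM mulrDl !mulrDr.
by apply: lerD; rewrite ?lerDl ?lerDr mulr_ge0.
Qed.

(** The factor [s], equal to 1 or -1, covers the positive and the negative part of the directional
    derivative. *)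
Lemma posdot_cvg e (phi_ : nat -> plane -> R) g (s : R) : (forall n, test (phi_ n)) ->
  LP (fun x => (g x).1) -> LP (fun x => (g x).2) ->
  Lp_cvg mu Omega p (fun n => partial false (phi_ n)) (fun x => (g x).1) ->
  Lp_cvg mu Omega p (fun n => partial true (phi_ n)) (fun x => (g x).2) -> `|s| = 1 ->
  Lp_cvg mu Omega p (fun n x => Num.max (s * dot e (grad (phi_ n) x)) 0)
    (fun x => Num.max (s * dot e (g x)) 0).
Proof.
move=> tphi L1 L2 c1 c2 s1.
have C0 : 0 <= `|e.1| + `|e.2| by rewrite addr_ge0.
have Lt i n : LP (partial i (phi_ n)) by apply: test_Lp => //; exact: test_partial.
apply: (Lp_cvg_lip mO p1 C0 (Lt false) L1 (Lt true) L2 _ _ _ c1 c2).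
- by move=> n; apply: Lp_measurable (max_Lp _); apply: LpZ => //; apply: dot_measurable; exact: Lt.
- by apply: Lp_measurable (max_Lp _); apply: LpZ => //; exact: dot_measurable.
- move=> n x _; apply: le_trans (max0_lip _ _) _.
  by rewrite -mulrBr normrM s1 mul1r; exact: dot_lip.
Qed.

Lemma cvg_powR (s_ : nat -> R) (s : R) : (forall n, 0 <= s_ n) -> 0 <= s ->
  s_ n @[n --> \oo] --> s -> s_ n `^ p @[n --> \oo] --> s `^ p.
Proof.
move=> s_0 s0 cs; have cpow : continuous (fun t : R => `|t| `^ p) by exact: powR_norm_continuous.
have -> : (fun n => s_ n `^ p) = (fun n => `|s_ n| `^ p) by apply/funext => n; rewrite ger0_norm.
by rewrite -[X in X `^ p](ger0_norm s0); exact: (cvg_comp _ _ cs (cpow s)).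
Qed.

(** For a fixed [psi] every term is continuous in the Sobolev norm; in particular the remainder is a
    pairing of the negative part with a bounded function. *)
Lemma W01p_inequality u g psi : W01p Omega p u g -> test psi -> (forall x, 0 <= psi x) ->
  lam * nr u `^ p +
    lam * p * (\int[mu]_(x in Omega) (Num.max (- dot dir (g x)) 0 * psi x))%R <=
  nr (fun x => posdot dir (g x)) `^ p + 2 * (lam * (p - 1)) * qcost psi.
Proof.
move=> Wu tp psi0; have [phi_ [tphi c0 c1 c2]] := W01p_elim oO bO p1 Wu.
have [Lu [L1 L2] _ _] := Wu; have [M muO] := bounded_measure oO bO.
have P0 := posdot_cvg dir tphi L1 L2 c1 c2 (normr1 R).
have N0 := posdot_cvg dir tphi L1 L2 c1 c2 (normrN1 R).
have [b b0 bp] := csupp_bound (test_cont tp) tp.2.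
have mp : measurable_fun (Omega : set mplane) psi by apply: continuous_measurable2; exact: test_cont tp.
have Lt i n : LP (partial i (phi_ n)) by apply: test_Lp => //; exact: test_partial.
have Ln s n : LP (fun x => Num.max (s * dot dir (grad (phi_ n) x)) 0).
  by apply: max_Lp; apply: LpZ => //; apply: dot_measurable; exact: Lt.
have Lg s : LP (fun x => Num.max (s * dot dir (g x)) 0).
  by apply: max_Lp; apply: LpZ => //; exact: dot_measurable.
have A1 : nr (phi_ n) `^ p @[n --> \oo] --> nr u `^ p.
  apply: cvg_powR => [n||]; [exact: nrm_ge0|exact: nrm_ge0|].
  exact: (Lp_cvg_nrm mO p1 (fun n => test_Lp oO bO p1 (tphi n)) Lu c0).
have A2 := pairing_cvg mO p1 muO (Ln (- 1)) (Lg (- 1)) mp (fun x _ => bp x) N0.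
have A3 : nr (fun x => posdot dir (grad (phi_ n) x)) `^ p @[n --> \oo]
    --> nr (fun x => posdot dir (g x)) `^ p.
  apply: cvg_powR => [n||]; [exact: nrm_ge0|exact: nrm_ge0|].
  have H := Lp_cvg_nrm mO p1 (Ln 1) (Lg 1) P0.
  have E h : (fun x => Num.max (1 * dot dir (h x)) 0) = (fun x => posdot dir (h x)).
    by apply/funext => x; rewrite mul1r.
  by move: H; rewrite E; under eq_fun do rewrite E.
have EN h : (\int[mu]_(x in Omega) (Num.max (- 1 * dot dir (h x)) 0 * psi x))%R =
    (\int[mu]_(x in Omega) (Num.max (- dot dir (h x)) 0 * psi x))%R.
  by apply: eq_Rintegral => x _; rewrite mulN1r.
rewrite EN in A2; apply: (ler_cvgn _ _ (fun n => test_inequality (tphi n) tp psi0)).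
- apply: cvgD; first by apply: cvgM A1; exact: cvg_cst.
  apply: cvgM; first exact: cvg_cst.
  by move: A2; under eq_fun do rewrite EN.
- by apply: cvgD A3 _; exact: cvg_cst.
Qed.

Lemma test0 : test (fun=> 0).
Proof. by split; [exact: smooth_cst|exact: csupp0]. Qed.

Lemma grad_cst (c : R) x : grad (fun=> c) x = 0.
Proof.
by rewrite /grad !(@partialE _ _ (fun=> c) (fun=> 0))// => y; exact: is_derive_cst.
Qed.

Lemma qcost0 : qcost (fun=> 0) = 0.
Proof.
rewrite /qcost /Rintegral integral0_eq// => x _.
by rewrite grad_cst /dot /= !mulr0 addr0 normr0 powR0// gt_eqF.
Qed.

Lemma W01p_lower u g : W01p Omega p u g ->
  lam * nr u `^ p <= nr (fun x => posdot dir (g x)) `^ p.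
Proof.
move=> Wu; have := W01p_inequality Wu test0 (fun=> lexx 0).
rewrite qcost0 mulr0 addr0 /Rintegral integral0_eq ?mulr0 ?addr0// => x _.
by rewrite mulr0.
Qed.

(** Domination by a multiple serves three times: for [H0 theta], for its multiples, and for a
    general anisotropy through a supporting functional. *)
Lemma lambdaH_lower (H : plane -> R) c : 0 <= c -> (forall x, c * posdot dir x <= H x) ->
  ((c `^ p)%:E * lambda1p p (2 * W) <= lambdaH Omega p H)%E.
Proof.
move=> c0 HH; apply: le_ereal_inf_tmp => _ [u [g [Wu Nu ->]]].
have [Lu [L1 L2] _ _] := Wu.
have Lpos : LP (fun x => posdot dir (g x)) by apply: max_Lp; exact: dot_measurable.
have nu1 : nr u = 1 by rewrite /nrm Nu.
have := W01p_lower Wu; rewrite nu1 powR1 mulr1 => le.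
apply: (@le_trans _ _ ((c `^ p)%:E * \int[mu]_(x in Omega) (`|posdot dir (g x)| `^ p)%:E)%E).
  rewrite (Lp_energy p1 Lpos) -lamE; apply: lee_wpmul2l; first by rewrite lee_fin powR_ge0.
  by rewrite lee_fin.
have EZ : (\int[mu]_(x in Omega) (`|c * posdot dir (g x)| `^ p)%:E =
    (c `^ p)%:E * \int[mu]_(x in Omega) (`|posdot dir (g x)| `^ p)%:E)%E.
  by rewrite energyZ ?(ger0_norm c0)//; exact: Lp_measurable Lpos.
rewrite -EZ.
apply: le_integral_ge0 => x _; first by rewrite lee_fin powR_ge0.
have h0 : 0 <= c * posdot dir (g x) by rewrite mulr_ge0// le_max lexx orbT.
rewrite lee_fin ger0_norm//; apply: ge0_ler_powR; rewrite ?nnegrE ?(ltW p0)//.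
exact: le_trans (HH _).
Qed.

End directional_inequality.

Section rayleigh.
Context {R : realType}.
Local Notation plane := (R * R)%type.
Local Notation mu1 := (@lebesgue_measure R).
Local Notation mu := (mu1 \x mu1)%E.
Local Notation mplane := (measurableTypeR R * measurableTypeR R)%type.
Variables (Omega : set plane) (oO : open Omega) (bO : bounded_set Omega).
Variables (p : R) (p1 : 1 < p).
Implicit Types (f phi psi u v : plane -> R) (g : plane -> plane) (c : R).
Local Notation nr := (nrm mu Omega p).
Let p0 : 0 < p. Proof. exact: lt_trans ltr01 p1. Qed.
Let mO : measurable (Omega : set mplane). Proof. exact: open_measurable2. Qed.

Lemma W01pZ u g c : W01p Omega p u g -> W01p Omega p (fun x => c * u x) (fun x => c *: g x).
Proof.
move=> Wu; have W0 := W01p_test oO bO p1 (@test0 _ Omega).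
have := W01p_lin oO bO p1 c W0 Wu.
have -> : (fun x => 0 + c * u x) = (fun x => c * u x) by apply/funext => x; rewrite add0r.
by have -> : (fun x => grad (fun=> 0) x + c *: g x) = (fun x => c *: g x)
  by apply/funext => x; rewrite grad_cst add0r.
Qed.

Lemma lambdaH_rayleigh (H : plane -> R) u g : (forall x, 0 <= H x) ->
  (forall (t : R) x, 0 < t -> H (t *: x) = t * H x) ->
  measurable_fun (Omega : set mplane) (fun x => H (g x)) ->
  W01p Omega p u g -> 0 < nr u ->
  (lambdaH Omega p H * (nr u `^ p)%:E <= \int[mu]_(x in Omega) (H (g x) `^ p)%:E)%E.
Proof.
move=> H0 Hh mH Wu u0; have [Lu _ _ _] := Wu.
set I := (\int[mu]_(x in Omega) _)%E.
have le : (lambdaH Omega p H <= ((nr u)^-1 `^ p)%:E * I)%E.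
  apply: ereal_inf_lbound; exists (fun x => (nr u)^-1 * u x), (fun x => (nr u)^-1 *: g x).
  have c0 : 0 < (nr u)^-1 by rewrite invr_gt0.
  split; first exact: W01pZ.
    rewrite LpnormZ//; last exact: Lp_measurable Lu.
    by rewrite (Lp_norm Lu) gtr0_norm// -EFinM mulVf// gt_eqF.
  rewrite /I -ge0_integralZl_EFin ?powR_ge0//; last 2 first.
  - by move=> x _; rewrite lee_fin powR_ge0.
  - have -> : (fun x => (H (g x) `^ p)%:E) = (fun x => (`|H (g x)| `^ p)%:E).
      by apply/funext => x; rewrite ger0_norm.
    exact: energy_measurable.
  by apply: eq_integral => x _; rewrite Hh// powRM// ltW.
have up : 0 < nr u `^ p by rewrite powR_gt0.
apply: (@le_trans _ _ (((nr u)^-1 `^ p)%:E * I * (nr u `^ p)%:E)%E).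
  by apply: lee_wpmul2r => //; rewrite lee_fin ltW.
rewrite muleC muleA -EFinM -powRM ?invr_ge0 ?nrm_ge0// mulfV ?gt_eqF// powR1 mul1e.
exact: lexx.
Qed.

End rayleigh.

(** * Almost optimal one-sided test functions on the line *)

Section one_sided_test_function.
Context {R : realType}.
Variables (p : R) (p1 : 1 < p).
Local Notation mu := (@lebesgue_measure R).
Local Notation E1 f := (\int[mu]_x (`|f x| `^ p)%:E)%E.
Implicit Types (f phi : R -> R) (a b c m x y : R).
Let p0 : 0 < p. Proof. exact: lt_trans ltr01 p1. Qed.
Let pN0 : p != 0. Proof. by rewrite gt_eqF. Qed.

Lemma flat0_le1 (e x : R) : 0 < e -> flat e 0 x <= 1.
Proof.
move=> e0; have [x0|x0] := leP x 0; first by rewrite flat_le0.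
by rewrite flat_gt0// expr0 invr1 mul1r -expR0 ler_expR oppr_le0 divr_ge0// ltW.
Qed.

(** [f] follows |phi| up to [m] and then drops to 0: a descent is free for the one-sided energy.
    |phi| is smoothed into [r n], and the drop is made by [chi n], which is non-increasing and tends
    to 1 on the left of [m]. *)
Lemma half_test_function phi c m y : 0 < y -> smooth1 phi -> (forall x, x <= c -> phi x = 0) ->
  (\int[mu]_(x in `]-oo, m[%classic) (`|derive1 phi x| `^ p)%:E <
   y%:E * \int[mu]_(x in `]-oo, m[%classic) (`|phi x| `^ p)%:E)%E ->
  exists f, [/\ smooth1 f, forall x, 0 <= f x, forall x, x <= c \/ m <= x -> f x = 0 &
    (\int[mu]_x (pospow p (derive1 f x))%:E < y%:E * E1 f)%E].
Proof.
move=> y0 sphi phi0 lt.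
pose e n := @harmonic R n; have e0 n : 0 < e n by exact: harmonic_pos.
pose r n x := rho (e n) (phi x) + rho (e n) (-1 * phi x).
pose chi n x := flat (e n) 0 (m - x).
pose f n x := r n x * chi n x.
have sr n : smooth1 (r n).
  apply: smooth1D; first exact: (smooth1_comp (rho_smooth (e0 n)) sphi).
  exact: (smooth1_comp (rho_smooth (e0 n)) (smooth1Z (-1) sphi)).
have schi n : smooth1 (chi n) by exact: (smooth1_opp_shift m (flat_smooth 0 (e0 n))).
have sf n : smooth1 (f n) by exact: smooth1M.
have r0 n x : 0 <= r n x by rewrite addr_ge0 ?rho_ge0.
have chi0 n x : 0 <= chi n x by exact: flat_ge0.
have f0 n x : 0 <= f n x by exact: mulr_ge0.
have fout n x : x <= c \/ m <= x -> f n x = 0.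
  case=> h; first by rewrite /f /r phi0// mulr0 !rho_le0// addr0 mul0r.
  by rewrite /f /chi flat_le0 ?mulr0// subr_le0.
have dr n x : is_derive x 1 (r n) ((drho (e n) (phi x) - drho (e n) (-1 * phi x)) * derive1 phi x).
  have d1 := @is_derive1_compE _ (rho (e n)) phi x _ _ (rho_is_derive (phi x) (e0 n)) (smooth1_is_derive x sphi).
  have d2 := @is_derive1_compE _ (rho (e n)) (fun x => -1 * phi x) x _ _
    (rho_is_derive (-1 * phi x) (e0 n)) (is_derive1Z (-1) (smooth1_is_derive x sphi)).
  by apply: is_derive1_eq (is_derive1D d1 d2) _; ring.
have dchi n x : is_derive x 1 (chi n) (- (e n * flat (e n) 2 (m - x))).
  have d1 : is_derive x 1 (fun y => -1 * y + m) (-1) by exact: derive1_affine.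
  have d1' : is_derive x 1 (fun y => m - y) (-1).
    by under eq_fun do rewrite addrC -mulN1r.
  have d2 := @is_derive1_compE _ (flat (e n) 0) (fun y => m - y) x _ _
    (flat_is_derive 0 (m - x) (e0 n)) d1'.
  by apply: is_derive1_eq d2 _; rewrite oppr0 mul0r add0r mulrN1.
have df n x : derive1 (f n) x = r n x * - (e n * flat (e n) 2 (m - x)) +
    chi n x * ((drho (e n) (phi x) - drho (e n) (-1 * phi x)) * derive1 phi x).
  by apply: is_derive1_derive1; exact: is_derive1M.
(* The term containing the derivative of [chi n] is non-positive and can only lower the positive
   part; the other one is at most |phi'| in absolute value. *)
have bound n x : pospow p (derive1 (f n) x) <= (x < m)%R%:R * `|derive1 phi x| `^ p.
  have [xm|mx] := ltP x m; last first.
    rewrite df /chi !flat_le0 ?subr_le0// mulr0 oppr0 mulr0 mul0r addr0 mul0r.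
    by rewrite pospow_le0.
  rewrite mul1r -(pospow_pos _ (normr_ge0 _)); apply: pospow_le; first exact: ltW.
  rewrite df; set D := drho _ _ - drho _ _.
  have h1 : r n x * - (e n * flat (e n) 2 (m - x)) <= 0.
    by rewrite mulr_ge0_le0// oppr_le0 mulr_ge0 ?flat_ge0// ltW.
  have D1 : `|D| <= 1.
    have := drho_ge0 (phi x) (e0 n); have := drho_le1 (phi x) (e0 n).
    have := drho_ge0 (-1 * phi x) (e0 n); have := drho_le1 (-1 * phi x) (e0 n).
    by rewrite /D ler_norml => *; apply/andP; split; lra.
  have h2 : chi n x * (D * derive1 phi x) <= `|derive1 phi x|.
    apply: le_trans (ler_norm _) _; rewrite !normrM (ger0_norm (chi0 n x)) mulrA.
    rewrite ler_piMl// mulr_ile1// ?flat0_le1//.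
  by move: h1 h2; set u := r n x * _; set v := chi n x * _; lra.
set C := (\int[mu]_(x in _) (`|derive1 phi x| `^ p)%:E)%E in lt.
have mI : measurable (`]-oo, m[%classic : set (measurableTypeR R)) by exact: measurable_itv.
have le n : (\int[mu]_x (pospow p (derive1 (f n) x))%:E <= C)%E.
  have Z x : ~ (`]-oo, m[%classic : set R) x -> (pospow p (derive1 (f n) x))%:E = 0%E :> \bar R.
    move=> nx; have := bound n x; have -> : (x < m)%R = false.
      by apply/negbTE/negP => xm; apply: nx; rewrite /= in_itv.
    by rewrite mul0r => h; apply/eqP; rewrite eqe eq_le h pospow_ge0.
  rewrite (integral_support mu Z); apply: le_integral_ge0 => x; first by rewrite lee_fin pospow_ge0.
  by rewrite /= in_itv /= => xm; have := bound n x; rewrite xm mul1r lee_fin.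
(* If no [f n] were suitable, Fatou's lemma would give the reverse of the assumed strict
   inequality. *)
apply: contrapT => nH; move: lt; rewrite ltNge => /negP; apply.
have le2 n : (\int[mu]_(x in `]-oo, m[%classic) (`|f n x| `^ p)%:E <= y^-1%:E * C)%E.
  have h : (y%:E * E1 (f n) <= C)%E.
    apply: le_trans (le n); rewrite leNgt; apply/negP => lt; apply: nH.
    by exists (f n); split => // x; exact: fout.
  have h2 : (\int[mu]_(x in `]-oo, m[%classic) (`|f n x| `^ p)%:E <= E1 (f n))%E.
    have mE := measurable_energy p1 (smooth1_continuous (sf n)).
    by apply: (@ge0_subset_integral _ _ _ mu _ _ mI measurableT _ mE).
  apply: (le_trans h2); apply: (@le_trans _ _ (y^-1%:E * (y%:E * E1 (f n)))%E).
    by rewrite muleA -EFinM mulVf ?gt_eqF// mul1e.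
  by apply: lee_wpmul2l => //; rewrite lee_fin invr_ge0 ltW.
have mf n : measurable_fun (`]-oo, m[%classic : set (measurableTypeR R)) (fun x => (`|f n x| `^ p)%:E).
  by apply: measurable_funS (measurable_energy p1 (smooth1_continuous (sf n))).
have fg0 (n : nat) (x : R) : (`]-oo, m[%classic : set R) x -> (0 <= (`|f n x| `^ p)%:E)%E.
  by move=> _; rewrite lee_fin powR_ge0.
have fat := le_trans (fatou mu mI mf fg0) (limn_einf_le (k := 0%N) (fun n _ => le2 n)).
have EL : (\int[mu]_(x in `]-oo, m[%classic) limn_einf (fun n => (`|f n x| `^ p)%:E))%E =
    (\int[mu]_(x in `]-oo, m[%classic) (`|phi x| `^ p)%:E)%E.
  apply: eq_integral => x; rewrite inE /= in_itv /= => xm.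
  have cpow : continuous (fun s : R => `|s| `^ p) by exact: powR_norm_continuous.
  have H1 : f n x @[n --> \oo] --> `|phi x| * 1.
    apply: cvgM.
      have -> : `|phi x| = Num.max (phi x) 0 + Num.max (-1 * phi x) 0.
        rewrite mulN1r; have [h|h] := leP 0 (phi x).
          by rewrite ger0_norm// (max_r (_ : - phi x <= 0)) ?addr0// oppr_le0.
        by rewrite ltr0_norm// add0r max_l// oppr_ge0 ltW.
      by apply: cvgD; exact: rho_cvg.
    have H := @cvg_expR_harmonic R (m - x).
    by under eq_fun do rewrite /chi flat_gt0 ?subr_gt0// expr0 invr1 mul1r.
  have H2 : (`|f n x| `^ p)%:E @[n --> \oo] --> (`| `|phi x| | `^ p)%:E.
    apply: cvg_EFin; first exact: nearW.
    by move: H1; rewrite mulr1 => H1; exact: (cvg_comp _ _ H1 (cpow _)).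
  by rewrite (cvg_limn_einf_sup H2).1 normr_id.
rewrite EL in fat.
apply: (@le_trans _ _ (y%:E * (y^-1%:E * C))%E).
  by apply: lee_wpmul2l => //; rewrite lee_fin ltW.
by rewrite muleA -EFinM mulfV ?gt_eqF// mul1e.
Qed.

(** A quotient of sums below [y] forces one of the two quotients below [y]; this selects the better
    half of a function. *)
Lemma split_lt (l1 r1 l2 r2 : \bar R) y : 0 <= y -> (0 <= l2)%E -> (0 <= r2)%E ->
  (l1 + r1 < y%:E * (l2 + r2))%E -> (l1 < y%:E * l2)%E \/ (r1 < y%:E * r2)%E.
Proof.
move=> y0 l20 r20 lt; case: (ltP l1 (y%:E * l2)%E) => h1; first by left.
right; rewrite ltNge; apply/negP => h2; move: lt; rewrite ltNge => /negP; apply.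
by rewrite ge0_muleDr//; exact: leeD.
Qed.

(** The right half is reflected about [m], so that both halves end at [m] and fall under
    [half_test_function]. *)
Lemma integral_split (h : R -> \bar R) m : measurable_fun setT h -> (forall x, 0 <= h x)%E ->
  (\int[mu]_x h x = \int[mu]_(x in `]-oo, m[%classic) h x +
    \int[mu]_(x in `]-oo, m[%classic) h (m + m - x)%R)%E.
Proof.
move=> mh h0.
have m1 : measurable (`]-oo, m[%classic : set (measurableTypeR R)) by exact: measurable_itv.
have m2 : measurable (`[m, +oo[%classic : set (measurableTypeR R)) by exact: measurable_itv.
have ET : [set: R] = `]-oo, m[%classic `|` `[m, +oo[%classic.
  apply/seteqP; split => // x _ /=; rewrite !in_itv /= andbT.
  by case: (ltP x m) => ?; [left|right].
rewrite ET ge0_integral_setU//; last 2 first.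
- by apply: measurable_funS mh.
- apply/disj_setPS => x [] /=; rewrite !in_itv /= andbT => h1 h2.
  by move: (lt_le_trans h1 h2); rewrite ltxx.
congr (_ + _)%E.
have mh2 : measurable_fun (`]m, +oo[%classic : set (measurableTypeR R)) h.
  by apply: measurable_funS mh => //; exact: measurable_itv.
rewrite -(integral_itv_obnd_cbnd mh2) [LHS]integral_mkcond [RHS]integral_mkcond.
rewrite -(@integral_reflect R (h \_ `]m, +oo[%classic) (m + m)); last 2 first.
- have m3 : measurable (`]m, +oo[%classic : set (measurableTypeR R)) by exact: measurable_itv.
  exact: (measurable_restrictT h m3).1 mh2.
- by move=> x; rewrite patchE; case: ifP.
apply: eq_integral => x _; rewrite !patchE !mem_setE /= !in_itv /= andbT.
by have -> : (m < m + m - x) = (x < m) by apply/idP/idP => ?; lra.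
Qed.

(** A test function on an interval of length [2 * W] is cut at the middle of an interval carrying
    its support. One half has a quotient below [y], and its length is strictly less than [W], which
    leaves room inside a segment of [Omega]. *)
Lemma one_sided_test W y : 0 < W -> (lambda1p p (2 * W) < y%:E)%E ->
  exists f a b, [/\ [/\ a < b & b - a < W], smooth1 f, forall x, 0 <= f x,
    forall x, x <= a \/ b <= x -> f x = 0 &
    (\int[mu]_x (pospow p (derive1 f x))%:E < y%:E * E1 f)%E].
Proof.
move=> W0 lt; have y0 : 0 < y.
  by rewrite -lte_fin; apply: le_lt_trans lt; exact: lambda1p_ge0.
have [phi [sphi cphi _ lt2]] := lambda1p_approx p1 lt.
have W2 : 0 < 2 * W by rewrite mulr_gt0.
have [c [d [c0 cd dW phi0]]] := csupp_itv W2 cphi.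
pose m := (c + d) / 2.
have cm : c < m by rewrite /m; lra.
have mm : m + m = c + d by rewrite /m; lra.
have mW : m - c < W by rewrite /m; lra.
have cdphi := csupp_derive1 cphi.
have ME (g : R -> R) : continuous g -> measurable_fun setT (fun x => (`|g x| `^ p)%:E : \bar R).
  by move=> cg; exact: measurable_energy.
have cph := smooth1_continuous sphi; have cdp := smooth1_cont sphi.
have g0 (g : R -> R) (x : R) : (0 <= (`|g x| `^ p)%:E)%E by rewrite lee_fin powR_ge0.
have S1 := integral_split m (ME _ cph) (g0 phi).
have S2 := integral_split m (ME _ cdp) (g0 (derive1 phi)).
rewrite S1 S2 in lt2.
have I0 (g : R -> R) : (0 <= \int[mu]_(x in `]-oo, m[%classic) (`|g x| `^ p)%:E)%E.
  by apply: integral_ge0 => x _; rewrite lee_fin powR_ge0.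
case: (split_lt (ltW y0) (I0 _) (I0 (fun x => phi (m + m - x))) lt2) => lt3.
  have [f [sf f0 fout ltf]] := half_test_function y0 sphi (fun x xc => phi0 x (or_introl xc)) lt3.
  by exists f, c, m.
pose phi' x := phi (-1 * x + (m + m)).
have sphi' : smooth1 phi' by exact: smooth1_comp_affine.
have phi'0 x : x <= c -> phi' x = 0.
  by move=> xc; rewrite /phi' phi0//; right; lra.
have [f [sf f0 fout ltf]] : exists f, [/\ smooth1 f, forall x, 0 <= f x, forall x, x <= c \/ m <= x -> f x = 0 &
    (\int[mu]_x (pospow p (derive1 f x))%:E < y%:E * E1 f)%E].
  apply: (half_test_function y0 sphi' phi'0).
  have E x : -1 * x + (m + m) = m + m - x by lra.
  have D1 : derive1 phi' = (fun x => -1 * derive1 phi (-1 * x + (m + m))) by exact: derive1_affineE.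
  have E1' : (\int[mu]_(x in `]-oo, m[%classic) (`|derive1 phi' x| `^ p)%:E =
      \int[mu]_(x in `]-oo, m[%classic) (`|derive1 phi (m + m - x)%R| `^ p)%:E)%E.
    by apply: eq_integral => x _; rewrite D1 mulN1r normrN E.
  have E2' : (\int[mu]_(x in `]-oo, m[%classic) (`|phi' x| `^ p)%:E =
      \int[mu]_(x in `]-oo, m[%classic) (`|phi (m + m - x)%R| `^ p)%:E)%E.
    by apply: eq_integral => x _; rewrite /phi' E.
  by rewrite E1' E2'.
by exists f, c, m.
Qed.

End one_sided_test_function.

(** * The infimum for the one-sided operator of a given direction *)

Section thin_parallelogram.
Context {R : realType}.
Local Notation plane := (R * R)%type.
Local Notation mu1 := (@lebesgue_measure R).
Local Notation mu := (mu1 \x mu1)%E.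
Local Notation mplane := (measurableTypeR R * measurableTypeR R)%type.
Variables (Omega : set plane) (oO : open Omega) (bO : bounded_set Omega) (nO : Omega !=set0).
Variables (p : R) (p1 : 1 < p) (theta : R).
Implicit Types (u v : plane -> R) (a e l x w : plane).
Let p0 : 0 < p. Proof. exact: lt_trans ltr01 p1. Qed.
Let mO : measurable (Omega : set mplane). Proof. exact: open_measurable2. Qed.
Local Notation nr := (nrm mu Omega p).
Local Notation test := (test Omega).
Local Notation dir := (direction theta).
Local Notation W := (width Omega theta).

(** The tube lemma: the segment is compact and [Omega] is open. *)
Lemma segment_tube e w a (b c : R) : (forall t, b <= t <= c -> Omega (t *: e + a)) ->
  exists2 d : R, 0 < d & forall t r, b <= t <= c -> `|r| <= d -> Omega ((t *: e + a) + r *: w).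
Proof.
move=> seg.
have /compact_near_coveringP H := @segment_compact R b c.
have cont : continuous (fun z : R * R => (z.1 *: e + a) + z.2 *: w).
  apply: continuous_addv; last by apply: continuous_scale; exact: continuous_snd.
  apply: continuous_addv; last exact: continuous_cst.
  by apply: continuous_scale; exact: continuous_fst.
have := H R (nbhs (0 : R)) (fun r t => Omega ((t *: e + a) + r *: w)) _.
case.
  move=> t; rewrite /= in_itv /= => tbc.
  have : nbhs (t, 0 : R) ((fun z : R * R => (z.1 *: e + a) + z.2 *: w) @^-1` Omega).
    apply: (cont (t, 0)); apply: open_nbhs_nbhs; split => //=.
    by rewrite scale0r addr0; exact: seg.
  by [].
move=> d /= d0 Hd; exists (d / 2); first exact: divr_gt0.
move=> t r tbc rd; apply: (Hd r); last by rewrite /= in_itv.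
by rewrite /ball /= sub0r normrN; lra.
Qed.

Lemma product_integral (h b : R -> R) (k k0 : R) (w lt lr : plane) :
  continuous h -> (forall t, 0 <= h t) -> continuous b -> (forall t, 0 <= b t) ->
  [/\ dot lt dir = 1, dot lr dir = 0, dot lt w = 0 & dot lr w = 1] ->
  (forall f : plane -> R, continuous f -> (forall x, 0 <= f x) ->
      (\int[mu]_x (f x)%:E = k%:E * \int[mu1]_r \int[mu1]_t (f ((t *: dir + r *: w)%R))%:E)%E) ->
  (\int[mu]_x (h (dot lt x - k0) * b (dot lr x))%:E =
   k%:E * (\int[mu1]_t (h t)%:E * \int[mu1]_r (b r)%:E))%E.
Proof.
move=> ch h0 cb b0 [e1 e2 e3 e4] shear.
have ch' : continuous (fun x => h (dot lt x - k0)).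
  apply: (continuous_compf _ ch); apply: continuous_add; last exact: continuous_cst.
  exact: dot_continuous.
have cb' : continuous (fun x => b (dot lr x)) by apply: (continuous_compf _ cb); exact: dot_continuous.
rewrite (shear _ (continuous_mul ch' cb')); last by move=> x; exact: mulr_ge0.
have mf (g : R -> R) : continuous g -> measurable_fun setT (fun x : R => (g x)%:E).
  by move=> cg; apply/measurable_EFinP; exact: fun_continuous_measurable.
congr (_ * _)%E; rewrite -ge0_integralZl//; [|exact: mf|by move=> r _; rewrite lee_fin|]; last first.
  by apply: integral_ge0 => t _; rewrite lee_fin.
apply: eq_integral => r _.
have E t : h (dot lt (t *: dir + r *: w) - k0) * b (dot lr (t *: dir + r *: w)) = b r * h (t - k0).
  have -> : dot lt (t *: dir + r *: w) = t by rewrite dot_linear e1 -[r *: w]addr0 dot_linear e3 /dot /=; ring.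
  have -> : dot lr (t *: dir + r *: w) = r by rewrite dot_linear e2 -[r *: w]addr0 dot_linear e4 /dot /=; ring.
  by rewrite mulrC.
under eq_integral do rewrite E EFinM.
have chs : continuous (fun t => h (t - k0)).
  apply: (@continuous_compf _ _ _ (fun t => t - k0) h _ ch); apply: continuous_add; last exact: continuous_cst.
  exact: continuous_id.
rewrite ge0_integralZl_EFin//; [|by move=> t _; rewrite lee_fin|exact: mf].
rewrite muleC; congr (_ * _)%E.
rewrite [RHS](integral_affine (- k0) (oner_neq0 R) (mf _ ch)) ?normr1 ?mul1e; last first.
  by move=> x; rewrite lee_fin.
by apply: eq_integral => t _; rewrite mul1r.
Qed.

Lemma pospow_mul_norm (s b : R) : 0 <= b -> pospow p (s * b) = pospow p s * `|b| `^ p.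
Proof. by move=> b0; rewrite mulrC pospowMl// (ger0_norm b0) mulrC. Qed.

Lemma scaled_lt (k ip ie ib y : R) : 0 < k -> 0 < ib -> ip < y * ie ->
  k * (ip * ib) < y * (k * (ie * ib)).
Proof. by move=> k0 ib0 lt; rewrite [ltRHS]mulrCA ltr_pM2l// mulrA ltr_pM2r. Qed.

(** [u] is a one-sided test function of the coordinate along theta times a bump of the transversal
    coordinate. The derivative along theta sees only the first factor, so the integral of the bump
    cancels from the quotient; thinness only serves to stay inside [Omega]. *)
Lemma test_approx (y : R) : (lambda1p p (2 * W) < y%:E)%E ->
  exists u, [/\ test u, 0 < nr u &
    nr (fun x => posdot dir (grad u x)) `^ p < y * nr u `^ p].
Proof.
move=> lty.
have W0 := width_gt0 oO bO theta nO.
have y0 : 0 < y.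
  by rewrite -lte_fin; apply: le_lt_trans lty; exact: lambda1p_ge0.
have [f [a [b [[ab bW] sf f0 fout ltf]]]] := one_sided_test p1 W0 lty.
have ba0 : 0 <= b - a by lra.
have [a0 [b' [c' [bc seg]]]] := width_segment bO ba0 bW.
have [w [lt [lr [k [k0 ee dec shear]]]]] := shear_integral (direction_neq0 theta).
have [e1 e2 e3 e4] := ee.
have [d d0 tube] := segment_tube w seg.
pose t0 := dot lt a0; pose r0 := dot lr a0.
(* The shift [s0] moves the left end [a] of the support of [f] to the beginning [b'] of the segment,
   which is longer than [b - a]. *)
pose B := bump (r0 - d) (r0 + d); pose s0 := t0 + b' - a.
pose F x := f (dot lt x - s0); pose G x := B (dot lr x).
pose u x := F x * G x.
have sfs : smooth1 (fun t => f (t - s0)) by exact: smooth1_shift.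
have sB : smooth1 B by exact: bump_smooth.
have sF : smooth F by exact: (@smooth_linear_comp _ lt _ sfs).
have sG : smooth G by exact: (@smooth_linear_comp _ lr _ sB).
have su : smooth u by exact: smoothM.
pose P (z : R * R) := (z.1 *: dir + a0) + z.2 *: w.
have cP : continuous P.
  apply: continuous_addv; last by apply: continuous_scale; exact: continuous_snd.
  apply: continuous_addv; last exact: continuous_cst.
  by apply: continuous_scale; exact: continuous_fst.
have cu : csupp Omega u.
  exists (P @` (`[b', c']%classic `*` `[- d, d]%classic)); split.
  - apply: continuous_compact; first exact: continuous_subspaceT.
    by apply: compact_setX; exact: segment_compact.
  - move=> _ [[t r] [/= tb rd] <-]; apply: tube; first by rewrite in_itv in tb.
    by rewrite in_itv /= -ler_norml in rd.
  - move=> x nK; apply: contrapT => /eqP; rewrite mulf_eq0 => /norP[Fx Gx]; apply: nK.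
    exists (dot lt x - t0, dot lr x - r0); last first.
      rewrite /P /= !scalerBl {3}(dec x) {1}(dec a0) -/t0 -/r0.
      by rewrite (addrA (_ - _) (t0 *: dir)) subrK -addrA (addrC (r0 *: w)) subrK.
    split; rewrite /= in_itv /=.
      have [h|h] := leP (dot lt x - s0) a; first by rewrite /F fout ?eqxx// in Fx; left.
      have [h'|h'] := leP b (dot lt x - s0); first by rewrite /F fout ?eqxx// in Fx; right.
      by rewrite /s0 in h h'; apply/andP; split; lra.
    have [/andP[h h']|h] := boolP ((r0 - d < dot lr x) && (dot lr x < r0 + d)).
      by apply/andP; split; lra.
    by rewrite /G /B bump_out ?eqxx// in Gx; apply/negP.
have tu : test u by split.
have B0 (t : R) : 0 <= B t by exact: bump_ge0.
have dF x : is_derive x dir F (derive1 f (dot lt x - s0)).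
  have ds t : derivable (fun t => f (t - s0)) t 1 by exact: smooth1_derivable.
  have := linear_is_derive lt dir x ds; rewrite e1 mul1r.
  suff -> : derive1 (fun t => f (t - s0)) (dot lt x) = derive1 f (dot lt x - s0) by [].
  have D := @derive1_affineE _ f 1 (- s0) sf.
  have -> : (fun t => f (t - s0)) = (fun t => f (1 * t + - s0)) by apply/funext => t; rewrite mul1r.
  by rewrite D !mul1r.
have dG x : is_derive x dir G 0.
  have ds t : derivable B t 1 by exact: smooth1_derivable.
  by have := linear_is_derive lr dir x ds; rewrite e2 mul0r.
have du x : dot dir (grad u x) = derive1 f (dot lt x - s0) * G x.
  have [_ <-] := smooth_is_derive dir x su.
  have [_ ->] := is_deriveM (dF x) (dG x).
  by rewrite /GRing.scale /= mulr0 add0r mulrC.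
have cf := smooth1_continuous sf; have cdf := smooth1_cont sf; have cB := smooth1_continuous sB.
have cfp : continuous (fun t => `|f t| `^ p) := continuous_powR_norm p0 cf.
have cBp : continuous (fun t => `|B t| `^ p) := continuous_powR_norm p0 cB.
have cdp : continuous (fun t => pospow p (derive1 f t)) := continuous_pospow p0 cdf.
have nf (g : R -> R) (t : R) : 0 <= `|g t| `^ p by exact: powR_ge0.
have I1 := product_integral s0 cfp (nf f) cBp (nf B) ee shear.
have I2 := product_integral s0 cdp (fun t => pospow_ge0 p _) cBp (nf B) ee shear.
have Lu : Lp mu Omega p u by exact: test_Lp.
have cpd : continuous (fun x => posdot dir (grad u x)) := continuous_max0 (dot_grad_cont (e := dir) tu).
have spd : csupp Omega (fun x => posdot dir (grad u x)).
  by apply: csupp_sub (dot_grad_csupp dir tu) => x dx; rewrite /posdot dx maxxx.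
have Lpd : Lp mu Omega p (fun x => posdot dir (grad u x)) by exact: csupp_Lp2.
have pN0 : p != 0 by rewrite gt_eqF.
have Z1 x : ~ Omega x -> (`|u x| `^ p)%:E = 0%E :> \bar R.
  by move=> nOx; rewrite (csupp_out cu nOx) normr0 powR0.
have Z2 x : ~ Omega x -> (`|posdot dir (grad u x)| `^ p)%:E = 0%E :> \bar R.
  by move=> nOx; rewrite (csupp_out spd nOx) normr0 powR0.
have N1 : (nr u `^ p)%:E = (\int[mu]_x (`|f (dot lt x - s0)| `^ p * `|B (dot lr x)| `^ p)%:E)%E.
  rewrite -(Lp_energy p1 Lu) -(support_Omega Z1); apply: eq_integral => x _.
  by rewrite normrM powRM.
have N2 : (nr (fun x => posdot dir (grad u x)) `^ p)%:E =
    (\int[mu]_x (pospow p (derive1 f (dot lt x - s0)) * `|B (dot lr x)| `^ p)%:E)%E.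
  rewrite -(Lp_energy p1 Lpd) -(support_Omega Z2); apply: eq_integral => x _.
  rewrite /posdot ger0_norm; last by rewrite le_max lexx orbT.
  by congr EFin; rewrite du; exact: (pospow_mul_norm _ (B0 _)).
rewrite I1 in N1; rewrite I2 in N2.
have ab' : a - 1 < b + 1 by lra.
have cfs : csupp (`]a - 1, b + 1[%classic : set R) f.
  exists `[a, b]%classic; split; [exact: segment_compact| |].
    by move=> t /=; rewrite !in_itv /= => /andP[h1 h2]; apply/andP; split; lra.
  move=> t /= nt; apply: fout; rewrite in_itv /= in nt.
  have [h|h] := leP t a; first by left.
  by right; rewrite leNgt; apply/negP => h'; apply: nt; rewrite !ltW.
have iB : (0 < \int[mu1]_r (`|B r| `^ p)%:E < +oo)%E.
  apply/andP; split; last first.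
    apply: (@csupp_energy_lty _ p p1 (`]r0 - d - 1, r0 + d + 1[%classic : set R)) => //.
    by apply: bump_csupp; lra.
  apply: (@integral_gt0 _ (fun r => `|B r| `^ p) r0) => //.
  by rewrite powR_gt0// normr_gt0 gt_eqF// bump_gt0//; lra.
have ifn : (\int[mu1]_t (`|f t| `^ p)%:E < +oo)%E by exact: (csupp_energy_lty p1 cf cfs).
have iP : (0 <= \int[mu1]_t (pospow p (derive1 f t))%:E)%E.
  by apply: integral_ge0 => t _; rewrite lee_fin pospow_ge0.
have if0 : (0 <= \int[mu1]_t (`|f t| `^ p)%:E)%E.
  by apply: integral_ge0 => t _; rewrite lee_fin powR_ge0.
move: ltf iB ifn iP if0 N1 N2.
set ib := (\int[mu1]_r (`|B r| `^ p)%:E)%E; set ie := (\int[mu1]_t (`|f t| `^ p)%:E)%E.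
set ip := (\int[mu1]_t _)%E; clearbody ib ie ip.
case: ie => [ie| |]// ltf + _ + ie0.
case: ib => [ib| |]; [move=> /andP[ib0 _]|by rewrite ltxx andbF|by []].
case: ip ltf => [ip| |]// ltf ip0.
rewrite lte_fin in ib0; rewrite lee_fin in ie0; rewrite lee_fin in ip0.
rewrite -EFinM lte_fin in ltf.
rewrite -!EFinM => -[N1] [N2].
have ie1 : 0 < ie.
  rewrite lt0r ie0 andbT; apply/eqP => z; move: ltf; rewrite z mulr0.
  by rewrite ltNge ip0.
exists u; split=> //.
- rewrite lt0r nrm_ge0 andbT; apply/eqP => z; move: N1; rewrite z powR0// => /esym/eqP.
  by rewrite gt_eqF// !mulr_gt0.
- by rewrite N1 N2; exact: scaled_lt.
Qed.

Lemma lambdaH_H0 : lambdaH Omega p (H0 theta) = lambda1p p (2 * W).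
Proof.
apply/eqP; rewrite eq_le; apply/andP; split; last first.
  have := @lambdaH_lower _ _ oO bO nO _ p1 theta (H0 theta) 1 ler01.
  by rewrite powR1 mul1e; apply => x; rewrite mul1r H0E.
rewrite leNgt; apply/negP => lt.
have [y [lt1 le1]] := ereal_between (lambda1p_ge0 p _) lt.
have [u [tu u0 ltu]] := test_approx lt1.
have Hh (t : R) x : 0 < t -> H0 theta (t *: x) = t * H0 theta x.
  move=> t0; rewrite !H0E /posdot -(maxMl _ (ltW t0)); congr Num.max.
  by rewrite -[t *: x]addr0 dot_linear /dot /=; ring.
have H00 x : 0 <= H0 theta x by rewrite H0E le_max lexx orbT.
have Lpd : Lp mu Omega p (fun x => posdot dir (grad u x)).
  apply: max_Lp => //; apply: dot_measurable => //.
    exact: (test_Lp oO bO p1 (test_partial false tu)).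
  exact: (test_Lp oO bO p1 (test_partial true tu)).
have mH : measurable_fun (Omega : set mplane) (fun x => H0 theta (grad u x)).
  by under eq_fun do rewrite H0E; exact: Lp_measurable Lpd.
have := lambdaH_rayleigh oO bO p1 H00 Hh mH (W01p_test oO bO p1 tu) u0.
have -> : (\int[mu]_(x in Omega) (H0 theta (grad u x) `^ p)%:E =
    (nr (fun x => posdot dir (grad u x)) `^ p)%:E)%E.
  rewrite -(Lp_energy p1 Lpd); apply: eq_integral => x _; rewrite H0E ger0_norm//.
  by rewrite le_max lexx orbT.
move=> le2; have up : 0 < nr u `^ p by rewrite powR_gt0.
have : (y%:E * (nr u `^ p)%:E <= (nr (fun x => posdot dir (grad u x)) `^ p)%:E)%E.
  by apply: le_trans le2; apply: lee_wpmul2r => //; rewrite lee_fin ltW.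
by rewrite -EFinM lee_fin leNgt ltu.
Qed.

End thin_parallelogram.

(** * General anisotropies *)

Section anisotropies.
Context {R : realType}.
Local Notation plane := (R * R)%type.
Implicit Types (H : plane -> R) (x y v : plane) (t s : R).

Lemma anisotropy_ge0 H x : anisotropy H -> 0 <= H x.
Proof. by move=> [H0 _ _]; exact: H0. Qed.

Lemma anisotropy_hom H t x : anisotropy H -> 0 < t -> H (t *: x) = t * H x.
Proof. by move=> [_ _ Hh]; exact: Hh. Qed.

Lemma anisotropy0 H : anisotropy H -> H 0 = 0.
Proof.
move=> aH; have := anisotropy_hom 0 aH (ltr0n R 2); rewrite scaler0 => E; lra.
Qed.

Lemma anisotropyD H x y : anisotropy H -> H (x + y) <= H x + H y.
Proof.
move=> aH; have [_ cvx _] := aH.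
have h0 : 0 <= (2^-1 : R) by rewrite invr_ge0.
have h1 : (2^-1 : R) <= 1 by rewrite invf_le1// ler1n.
have := cvx (Itv01 h0 h1) x y (mem_set I) (mem_set I).
have -> : conv (Itv01 h0 h1) (x : convex_lmodType plane) y = 2^-1 *: (x + y) :> plane.
  rewrite /conv /= /unstable.onem; have -> : 1 - 2^-1 = 2^-1 :> R by lra.
  by rewrite scalerDr.
rewrite (anisotropy_hom _ aH) ?invr_gt0//.
have -> : conv (Itv01 h0 h1) (H x : R^o) (H y) = 2^-1 * (H x + H y).
  rewrite convRE /= /unstable.onem; have -> : 1 - 2^-1 = 2^-1 :> R by lra.
  by rewrite mulrDr.
by rewrite ler_pM2l// invr_gt0.
Qed.

Lemma anisotropy_intro H : (forall x, 0 <= H x) -> (forall x y, H (x + y) <= H x + H y) ->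
  (forall t x, 0 < t -> H (t *: x) = t * H x) -> anisotropy H.
Proof.
move=> H0 HD Hh; split=> // t x y _ _.
have H00 : H 0 = 0 by have := Hh 2 0 (ltr0n R 2); rewrite scaler0 => E; lra.
have Hh' s z : 0 <= s -> H (s *: z) = s * H z.
  by rewrite le_eqVlt => /predU1P[<-|/Hh//]; rewrite scale0r mul0r.
rewrite convRE; apply: le_trans (HD _ _) _.
by rewrite !Hh'// unstable.onem_ge0.
Qed.

Definition circle : set plane := [set x | enorm x = 1].

Lemma circleP x : circle x <-> x.1 ^+ 2 + x.2 ^+ 2 = 1.
Proof.
rewrite /circle /= /enorm; split => [h|->]; last by rewrite sqrtr1.
by rewrite -[LHS]sqr_sqrtr ?h ?expr1n// addr_ge0 ?sqr_ge0.
Qed.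

(** Four values are collected because [H] may differ at opposite vectors. *)
Lemma anisotropy_bound H : anisotropy H ->
  exists2 C, 0 <= C & forall x, H x <= C * (`|x.1| + `|x.2|).
Proof.
move=> aH; pose C := H (1, 0) + H (-1, 0) + H (0, 1) + H (0, -1).
have H0 x : 0 <= H x by exact: anisotropy_ge0.
have C1 : [/\ H (1, 0) <= C, H (-1, 0) <= C, H (0, 1) <= C & H (0, -1) <= C].
  by have := H0 (1, 0); have := H0 (-1, 0); have := H0 (0, 1); have := H0 (0, -1);
    rewrite /C; split; lra.
have [c1 c2 c3 c4] := C1.
exists C; first by have := H0 (1, 0); lra.
have P t v v' : t *: v = - t *: v' -> H v <= C -> H v' <= C -> H (t *: v) <= C * `|t|.
  move=> E hv hv'; have [t0|t0|->] := ltgtP t 0.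
  - by rewrite E (anisotropy_hom _ aH) ?oppr_gt0// (ltr0_norm t0) mulrC ler_wpM2r// oppr_ge0 ltW.
  - by rewrite (anisotropy_hom _ aH)// (gtr0_norm t0) mulrC ler_wpM2r// ltW.
  - by rewrite scale0r anisotropy0// normr0 mulr0.
move=> x; have -> : x = x.1 *: (1, 0) + x.2 *: (0, 1).
  rewrite [LHS]surjective_pairing; congr pair; rewrite /= /GRing.scale /=; ring.
apply: le_trans (anisotropyD _ _ aH) _; rewrite mulrDr; apply: lerD.
  have -> : C * `|(x.1 *: (1, 0) + x.2 *: (0, 1) : plane).1| = C * `|x.1|.
    by rewrite /= /GRing.scale /= mulr1 mulr0 addr0.
  apply: (P _ _ (-1, 0)) => //; congr pair; rewrite /= /GRing.scale /=; ring.
have -> : C * `|(x.1 *: (1, 0) + x.2 *: (0, 1) : plane).2| = C * `|x.2|.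
  by rewrite /= /GRing.scale /= mulr1 mulr0 add0r.
apply: (P _ _ (0, -1)) => //; congr pair; rewrite /= /GRing.scale /=; ring.
Qed.

Lemma circle_norm x : circle x -> `|x.1| <= 1 /\ `|x.2| <= 1.
Proof.
move=> /circleP E; have h1 := sqr_ge0 x.1; have h2 := sqr_ge0 x.2.
have le1 s : s ^+ 2 <= 1 -> `|s| <= 1.
  by rewrite -[X in _ <= X](expr1n _ 2) -real_normK ?num_real// ler_pXn2r ?nnegrE.
by split; apply: le1; lra.
Qed.

Lemma has_sup_circle H : anisotropy H -> has_sup (H @` circle).
Proof.
move=> aH; split.
  by exists (H (1, 0)), (1, 0) => //; apply/circleP; rewrite /= expr1n expr0n addr0.
have [C C0 HC] := anisotropy_bound aH; exists (C * 2) => _ [x cx <-].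
apply: le_trans (HC x) _; rewrite ler_wpM2l//.
by have [] := circle_norm cx; lra.
Qed.

Lemma Hnorm_ge H x : anisotropy H -> circle x -> H x <= Hnorm H.
Proof. by move=> aH cx; apply: (sup_upper_bound (has_sup_circle aH)); exists x. Qed.

Lemma Hnorm_approx H t : anisotropy H -> t < Hnorm H -> exists2 x, circle x & t < H x.
Proof.
move=> aH lt; have d0 : 0 < Hnorm H - t by rewrite subr_gt0.
have [_ [x cx <-]] := sup_adherent d0 (has_sup_circle aH).
by rewrite subKr => ?; exists x.
Qed.

(* Hahn-Banach: a supporting functional at [v] in direction orthogonal to [v]
   takes the supremum of [t * H v - H (t v - w)] on the orthogonal vector [w]. *)
Lemma supporting_functional H v : anisotropy H -> circle v ->
  exists xi : plane, [/\ forall x, dot xi x <= H x & H v ^+ 2 <= xi.1 ^+ 2 + xi.2 ^+ 2].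
Proof.
move=> aH /circleP cv; pose w : plane := (- v.2, v.1).
have Hv t : t * H v <= H (t *: v).
  have [t0|t0|->] := ltgtP t 0.
  - apply: (@le_trans _ _ 0); last exact: anisotropy_ge0.
    by rewrite mulr_le0_ge0 ?anisotropy_ge0// ltW.
  - by rewrite (anisotropy_hom _ aH).
  - by rewrite mul0r scale0r anisotropy0.
pose S := [set t * H v - H (t *: v - w) | t in [set: R]].
(* Every lower candidate for the value at [w] is below every upper one, by subadditivity at the sum
   [(t + t') *: v]. *)
have le t t' : t * H v - H (t *: v - w) <= H (t' *: v + w) - t' * H v.
  have h1 := Hv (t + t').
  have h2 := anisotropyD (t *: v - w) (t' *: v + w) aH.
  have E : t *: v - w + (t' *: v + w) = (t + t') *: v.
    by rewrite scalerDl addrACA addNr addr0.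
  by rewrite E in h2; lra.
have hS : has_sup S.
  split; first by exists (0 * H v - H (0 *: v - w)), 0.
  by exists (H (0 *: v + w) - 0 * H v) => _ [t _ <-]; exact: le.
pose s := sup S.
have s1 t : t * H v - s <= H (t *: v - w).
  have : t * H v - H (t *: v - w) <= s by apply: (sup_upper_bound hS); exists t.
  lra.
have s2 t : t * H v + s <= H (t *: v + w).
  have : s <= H (t *: v + w) - t * H v.
    by apply: ge_sup; [exact: hS.1|move=> _ [t' _ <-]; exact: le].
  lra.
(* ([v], [w]) is orthonormal, so the squared norm of the functional is H(v)^2 + s^2. *)
exists (H v *: v + s *: w); split; last first.
  have -> : (H v *: v + s *: w).1 ^+ 2 + (H v *: v + s *: w).2 ^+ 2 =
      (H v ^+ 2 + s ^+ 2) * (v.1 ^+ 2 + v.2 ^+ 2).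
    by rewrite /w /= /GRing.scale /=; ring.
  by rewrite cv mulr1 lerDl sqr_ge0.
move=> x; pose a := dot v x; pose r := dot w x.
have -> : dot (H v *: v + s *: w) x = a * H v + r * s.
  by rewrite /a /r /dot /w /= /GRing.scale /=; ring.
have -> : x = a *: v + r *: w.
  have E1 : x.1 = a * v.1 + r * w.1 by rewrite -[LHS]mulr1 -cv /a /r /dot /w /=; ring.
  have E2 : x.2 = a * v.2 + r * w.2 by rewrite -[LHS]mulr1 -cv /a /r /dot /w /=; ring.
  by rewrite [LHS]surjective_pairing; congr pair; [exact: E1|exact: E2].
have [r0|r0|->] := ltgtP r 0; last 2 first.
- have -> : a *: v + r *: w = r *: ((a / r) *: v + w).
    by rewrite scalerDr scalerA mulrCA mulfV ?gt_eqF// mulr1.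
  rewrite (anisotropy_hom _ aH)//.
  have -> : a * H v + r * s = r * (a / r * H v + s) by field; rewrite gt_eqF.
  by rewrite ler_pM2l.
- by rewrite mul0r scale0r !addr0.
have r0' : 0 < - r by rewrite oppr_gt0.
have -> : a *: v + r *: w = (- r) *: ((a / (- r)) *: v - w).
  by rewrite scalerBr scalerA mulrCA mulfV ?gt_eqF// mulr1 scaleNr opprK.
rewrite (anisotropy_hom _ aH)//.
have -> : a * H v + r * s = - r * (a / - r * H v - s) by field; rewrite lt_eqF.
by rewrite ler_pM2l.
Qed.

Lemma unit_direction x : circle x -> exists2 theta, theta \in `[0, 2 * pi] & x = direction theta.
Proof.
move=> cx; have [/ler_normlP[h1 h2] _] := circle_norm cx; move/circleP : cx => E.
have x1 : -1 <= x.1 <= 1 by rewrite h2 andbT; lra.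
have pi0 := @pi_gt0 R.
have /acos_def[/andP[a0 api] ca] := x1.
have sa := sin_acos x1.
have x2E : Num.sqrt (1 - x.1 ^+ 2) = `|x.2|.
  by rewrite -E addrC addKr sqrtr_sqr.
rewrite x2E in sa.
have [x20|x20] := leP 0 x.2.
  exists (acos x.1); first by rewrite in_itv /= a0 /=; lra.
  by rewrite [LHS]surjective_pairing /direction ca sa ger0_norm.
exists (2 * pi - acos x.1); first by rewrite in_itv /=; apply/andP; split; lra.
rewrite [LHS]surjective_pairing /direction.
have -> : 2 * pi - acos x.1 = - acos x.1 + pi + pi by lra.
by rewrite !cosDpi !sinDpi cosN sinN ca sa !opprK (ltr0_norm x20) opprK.
Qed.

Lemma polar_direction x : exists2 theta, theta \in `[0, 2 * pi] & x = enorm x *: direction theta.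
Proof.
have pi0 := @pi_gt0 R.
have [x0|x0] := eqVneq (enorm x) 0.
  exists 0; first by rewrite in_itv /= lexx /=; lra.
  rewrite x0 scale0r; move/eqP: x0; rewrite /enorm sqrtr_eq0 => le.
  have := sqr_ge0 x.1; have := sqr_ge0 x.2 => h1 h2.
  have /eqP : x.1 ^+ 2 = 0 by lra. have /eqP : x.2 ^+ 2 = 0 by lra.
  by rewrite !sqrf_eq0 => /eqP e2 /eqP e1; rewrite [x]surjective_pairing e1 e2.
have e0 : 0 < enorm x by rewrite lt_neqAle eq_sym x0 sqrtr_ge0.
have [theta ht E] : exists2 theta, theta \in `[0, 2 * pi] & (enorm x)^-1 *: x = direction theta.
  apply: unit_direction; apply/circleP; rewrite /= /GRing.scale /= !exprMn -mulrDr.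
  rewrite -[X in _ * X]sqr_sqrtr; last by rewrite addr_ge0 ?sqr_ge0.
  by rewrite -exprMn mulVf// expr1n.
by exists theta => //; rewrite -E scalerA mulfV// scale1r.
Qed.

Lemma direction_circle theta : circle (@direction R theta).
Proof. by apply/circleP; rewrite /= cos2Dsin2. Qed.

End anisotropies.

(** * Lower bound for a general anisotropy *)

Section lower_bound.
Context {R : realType}.
Local Notation plane := (R * R)%type.
Variables (Omega : set plane) (oO : open Omega) (bO : bounded_set Omega) (nO : Omega !=set0).
Variables (p : R) (p1 : 1 < p).
Let p0 : 0 < p. Proof. exact: lt_trans ltr01 p1. Qed.

Definition inf_lambda := ereal_inf [set lambda1p p (2 * width Omega theta) |
  theta in [set theta : R | theta \in `[0, 2 * pi]]].

Lemma inf_lambda_le theta : theta \in `[0, 2 * pi] ->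
  (inf_lambda <= lambda1p p (2 * width Omega theta))%E.
Proof. by move=> ht; apply: ereal_inf_lbound; exists theta. Qed.

Lemma inf_lambda_gt0 : (0 < inf_lambda)%E.
Proof.
have [D D0 HD] := width_bounded bO.
apply: (@lt_le_trans _ _ (lambda1p p (2 * D))); first by apply: lambda1p_gt0 => //; rewrite mulr_gt0.
apply: le_ereal_inf_tmp => _ [theta _ <-]; apply: lambda1p_mono => //.
by rewrite ler_pM2l.
Qed.

Lemma zero_angle : (0 : R) \in `[0, 2 * pi].
Proof. by rewrite in_itv /= lexx mulr_ge0// pi_ge0. Qed.

Lemma inf_lambda_fin : inf_lambda = (fine inf_lambda)%:E.
Proof.
rewrite fineK// ge0_fin_numE; last exact: ltW inf_lambda_gt0.
apply: le_lt_trans (inf_lambda_le zero_angle) _; apply: lambda1p_lty => //.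
by rewrite mulr_gt0// width_gt0.
Qed.

(** A functional supporting [H] at a point where [H] exceeds [c] has norm at least [c]. Since [H] is
    also non-negative, it dominates [c] times the positive part of the unit functional of the same
    direction. *)
Lemma lambdaH_ge_approx (H : plane -> R) (c : R) : anisotropy H -> 0 <= c -> c < Hnorm H ->
  ((c `^ p)%:E * inf_lambda <= lambdaH Omega p H)%E.
Proof.
move=> aH c0 cH; have [v cv ltv] := Hnorm_approx aH cH.
have [xi [Hxi le]] := supporting_functional aH cv.
have [theta ht E] := polar_direction xi.
have ce : c <= enorm xi.
  rewrite /enorm; apply: (le_trans (ltW ltv)).
  by rewrite -[H v]ger0_norm ?(anisotropy_ge0 _ aH)// -sqrtr_sqr ler_wsqrtr.
have Hc x : c * posdot (direction theta) x <= H x.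
  have [h|h] := leP (dot (direction theta) x) 0.
    by rewrite /posdot max_r// mulr0 anisotropy_ge0.
  rewrite /posdot max_l ?(ltW h)//; apply: le_trans (Hxi x).
  have -> : dot xi x = enorm xi * dot (direction theta) x.
    by rewrite {1}E /dot /= /GRing.scale /=; ring.
  by rewrite ler_wpM2r// ltW.
apply: le_trans (lambdaH_lower oO bO nO p1 c0 Hc).
by apply: lee_wpmul2l; [rewrite lee_fin powR_ge0|exact: inf_lambda_le].
Qed.

(** The supremum [Hnorm H] is only approached: [c = 1 - harmonic n] tends to 1. *)
Lemma inf_lambda_lower (H : plane -> R) : anisotropy H -> Hnorm H = 1 ->
  (inf_lambda <= lambdaH Omega p H)%E.
Proof.
move=> aH H1; rewrite leNgt; apply/negP => lt.
have l0 : (0 <= lambdaH Omega p H)%E.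
  apply: le_ereal_inf_tmp => _ [u [g [_ _ ->]]]; apply: integral_ge0 => x _.
  by rewrite lee_fin powR_ge0.
have lE : lambdaH Omega p H = (fine (lambdaH Omega p H))%:E.
  by rewrite fineK// ge0_fin_numE//; apply: lt_trans lt _; rewrite inf_lambda_fin ltry.
move: (lt); rewrite ltNge => /negP; apply; rewrite inf_lambda_fin lE lee_fin.
pose c n : R := 1 - harmonic n.
have h n : (c n) `^ p * fine inf_lambda <= fine (lambdaH Omega p H).
  rewrite -lee_fin EFinM -inf_lambda_fin -lE; apply: lambdaH_ge_approx => //.
    by rewrite subr_ge0 /harmonic invf_le1// ler1n.
  by rewrite H1 /c ltrBlDr ltrDl harmonic_pos.
have c1 : c n @[n --> \oo] --> (1 : R).
  rewrite -[X in _ --> X]subr0; apply: cvgB; first exact: cvg_cst.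
  exact: cvg_harmonic.
apply: (ler_cvgn _ _ h); last exact: cvg_cst.
rewrite -[X in _ --> X]mul1r; apply: cvgM; last exact: cvg_cst.
have -> : (1 : R) = 1 `^ p by rewrite powR1.
apply: (cvg_powR p1) => // n.
by rewrite subr_ge0 /harmonic invf_le1// ler1n.
Qed.

End lower_bound.

(** * The one-sided anisotropies *)

Section one_sided_anisotropy.
Context {R : realType}.
Local Notation plane := (R * R)%type.
Local Notation mu1 := (@lebesgue_measure R).
Local Notation mu := (mu1 \x mu1)%E.
Local Notation mplane := (measurableTypeR R * measurableTypeR R)%type.
Variables (Omega : set plane) (oO : open Omega) (bO : bounded_set Omega) (nO : Omega !=set0).
Variables (p : R) (p1 : 1 < p).
Implicit Types (f phi psi u v : plane -> R) (g : plane -> plane) (x y e : plane) (theta alpha c : R).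
Let p0 : 0 < p. Proof. exact: lt_trans ltr01 p1. Qed.
Let pN0 : p != 0. Proof. by rewrite gt_eqF. Qed.
Let mO : measurable (Omega : set mplane). Proof. exact: open_measurable2. Qed.
Local Notation nr := (nrm mu Omega p).
Local Notation LP := (Lp mu Omega p).
Local Notation test := (test Omega).
Local Notation dir := direction.
Local Notation W theta := (width Omega theta).

Lemma posdot_ge0 e x : 0 <= posdot e x.
Proof. by rewrite le_max lexx orbT. Qed.

Lemma posdotZ e x (t : R) : 0 <= t -> posdot e (t *: x) = t * posdot e x.
Proof.
move=> t0; rewrite /posdot -(maxMl _ t0); congr Num.max.
by rewrite /dot /= /GRing.scale /=; ring.
Qed.

Lemma posdotD e x y : posdot e (x + y) <= posdot e x + posdot e y.
Proof.
have -> : posdot e (x + y) = Num.max (dot e x + dot e y) 0.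
  by rewrite /posdot; congr Num.max; rewrite /dot /=; ring.
rewrite ge_max addr_ge0 ?posdot_ge0// andbT.
by apply: lerD; rewrite le_max lexx.
Qed.

Lemma H0_anisotropy theta alpha : 0 < alpha -> anisotropy (fun x => alpha * H0 theta x).
Proof.
move=> a0; apply: anisotropy_intro => [x|x y|t x t0]; rewrite !H0E.
- by rewrite mulr_ge0 ?posdot_ge0// ltW.
- by rewrite -mulrDr ler_pM2l//; exact: posdotD.
- by rewrite posdotZ 1?ltW// mulrCA.
Qed.

Lemma H0_neq0 theta alpha : 0 < alpha -> (fun x => alpha * H0 theta x) <> (fun=> 0).
Proof.
move=> a0 /(congr1 (fun f => f (dir theta))); rewrite H0E /posdot dot_dir max_l//.
by rewrite mulr1 => /eqP; rewrite gt_eqF.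
Qed.

Lemma dot_le1 (a b c d : R) : a ^+ 2 + b ^+ 2 = 1 -> c ^+ 2 + d ^+ 2 = 1 -> a * c + b * d <= 1.
Proof.
move=> h1 h2; have h3 := sqr_ge0 (a - c); have h4 := sqr_ge0 (b - d).
have E : (a - c) ^+ 2 + (b - d) ^+ 2 = (a ^+ 2 + b ^+ 2) + (c ^+ 2 + d ^+ 2) - 2 * (a * c + b * d) by ring.
by rewrite h1 h2 in E; lra.
Qed.

Lemma aeS (P Q : plane -> Prop) : (forall x, P x -> Q x) ->
  {ae mu, forall x, P x} -> {ae mu, forall x, Q x}.
Proof. by move=> PQ; apply: negligibleS => x /= nQ Px; apply: nQ; exact: PQ. Qed.

Lemma H0_Hnorm theta alpha : 0 < alpha -> Hnorm (fun x => alpha * H0 theta x) = alpha.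
Proof.
move=> a0; have aH := H0_anisotropy theta a0; apply/eqP; rewrite eq_le; apply/andP; split.
  apply: ge_sup; first exact: (has_sup_circle aH).1.
  move=> _ [x cx <-]; rewrite H0E ler_piMr ?(ltW a0)// ge_max ler01 andbT.
  by move/circleP : cx => E; exact: (dot_le1 (cos2Dsin2 theta) E).
have := Hnorm_ge aH (direction_circle theta).
by rewrite H0E /posdot dot_dir max_l// mulr1.
Qed.

Lemma lambdaH_H0Z theta alpha : 0 < alpha ->
  lambdaH Omega p (fun x => alpha * H0 theta x) = ((alpha `^ p)%:E * lambda1p p (2 * W theta))%E.
Proof.
move=> a0; apply/eqP; rewrite eq_le; apply/andP; split; last first.
  apply: (lambdaH_lower oO bO nO p1 (ltW a0)) => x; by rewrite H0E.
have ap : 0 < alpha `^ p by rewrite powR_gt0.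
rewrite -(lambdaH_H0 oO bO nO p1) -[alpha `^ p]invrK lee_pdivlMl ?invr_gt0//.
apply: le_ereal_inf_tmp => _ [u [g [Wu Nu ->]]].
rewrite -lee_pdivlMl ?invr_gt0//.
have [Lu [L1 L2] _ _] := Wu.
have mH : measurable_fun (Omega : set mplane) (fun x => H0 theta (g x)).
  have Lpos : LP (fun x => posdot (dir theta) (g x)) by apply: max_Lp => //; exact: dot_measurable.
  by under eq_fun do rewrite H0E; exact: Lp_measurable Lpos.
apply: ereal_inf_lbound; exists u, g; split => //.
rewrite invrK -ge0_integralZl_EFin ?powR_ge0//; last 2 first.
- by move=> x _; rewrite lee_fin powR_ge0.
- have -> : (fun x => (H0 theta (g x) `^ p)%:E) = (fun x => (`|H0 theta (g x)| `^ p)%:E).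
    by apply/funext => x; rewrite ger0_norm// H0E posdot_ge0.
  exact: energy_measurable.
by apply: eq_integral => x _; rewrite -EFinM powRM// ?(ltW a0)// H0E posdot_ge0.
Qed.

Lemma nrm_eq0_ae f : LP f -> nr f = 0 -> {ae mu, forall x, Omega x -> f x = 0}.
Proof.
move=> Lf nf; have mf := Lp_measurable Lf.
have mE := energy_measurable p mf.
have E : (\int[mu]_(x in Omega) `|(`|f x| `^ p)%:E| = 0)%E.
  under eq_integral do rewrite gee0_abs ?lee_fin ?powR_ge0//.
  by rewrite (Lp_energy p1 Lf) nf powR0.
have /(ae_eq_integral_abs _ mO mE) := E.
apply: filterS => x H Ox; have := H Ox; rewrite /cst => -[/eqP].
by rewrite powR_eq0 pN0 andbT normr_eq0 => /eqP.
Qed.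

Lemma box_test (a b c d : R) : (forall x, a <= x.1 <= b -> c <= x.2 <= d -> Omega x) ->
  exists psi, [/\ test psi, forall x, 0 <= psi x &
    forall x, a < x.1 < b -> c < x.2 < d -> 0 < psi x].
Proof.
move=> HO; pose psi x := bump a b (dot (1, 0) x) * bump c d (dot (0, 1) x).
have d1 x : dot (1, 0) x = x.1 :> R by rewrite /dot /= mul1r mul0r addr0.
have d2 x : dot (0, 1) x = x.2 :> R by rewrite /dot /= mul1r mul0r add0r.
exists psi; split.
- split; first by apply: smoothM; apply: smooth_linear_comp; exact: bump_smooth.
  exists (`[a, b]%classic `*` `[c, d]%classic); split.
  + by apply: compact_setX; exact: segment_compact.
  + by move=> x [/=]; rewrite !in_itv /=; exact: HO.
  + move=> x nx; rewrite /psi d1 d2; apply: contrapT => /eqP; rewrite mulf_eq0 => /norP[h1 h2].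
    apply: nx; split; rewrite /= in_itv /=.
      have [/andP[? ?]|h] := boolP (a < x.1 < b); first by rewrite !ltW.
      by rewrite bump_out ?eqxx// in h1; exact/negP.
    have [/andP[? ?]|h] := boolP (c < x.2 < d); first by rewrite !ltW.
    by rewrite bump_out ?eqxx// in h2; exact/negP.
- by move=> x; rewrite mulr_ge0 ?bump_ge0.
- move=> x /andP[h1 h2] /andP[h3 h4]; rewrite /psi d1 d2.
  by rewrite mulr_gt0// bump_gt0.
Qed.

(** Each product [f * psi] is zero almost everywhere. Countably many [psi] suffice, one for every
    rational box that admits a test function positive on it, and every point of [Omega] lies in such
    a box. *)
Lemma nonpos_test_ae f : LP f -> (forall x, 0 <= f x) ->
  (forall psi, test psi -> (forall x, 0 <= psi x) ->
    (\int[mu]_(x in Omega) (f x * psi x))%R <= 0) ->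
  {ae mu, forall x, Omega x -> f x = 0}.
Proof.
move=> Lf f0 Hf; have [M muO] := bounded_measure oO bO.
have A psi : test psi -> (forall x, 0 <= psi x) -> {ae mu, forall x, Omega x -> f x * psi x = 0}.
  move=> tp psi0; have [c c0 pc] := csupp_bound (test_cont tp) tp.2.
  have mp : measurable_fun (Omega : set mplane) psi by apply: continuous_measurable2; exact: test_cont tp.
  have iF := pairing_integrable mO p1 muO Lf mp (fun x _ => pc x).
  have mfp := measurable_int _ iF.
  have E : (\int[mu]_(x in Omega) `|(f x * psi x)%:E| = 0)%E.
    under eq_integral do rewrite gee0_abs ?lee_fin ?mulr_ge0//.
    have fin := integrable_fin_num mO iF.
    have ge : (0 <= \int[mu]_(x in Omega) (f x * psi x)%:E)%E.
      by apply: integral_ge0 => x _; rewrite lee_fin mulr_ge0.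
    apply/eqP; rewrite eq_le ge andbT -(fineK fin) lee_fin.
    exact: Hf.
  have /(ae_eq_integral_abs _ mO mfp) := E.
  by apply: filterS => x H Ox; have := H Ox; rewrite /cst /= => -[].
pose Q := ((rat * rat) * (rat * rat))%type.
pose good (q : Q) psi := [/\ test psi, forall x, 0 <= psi x &
    forall x, ratr q.1.1 < x.1 < ratr q.1.2 -> ratr q.2.1 < x.2 < ratr q.2.2 -> 0 < psi x].
pose P (n : nat) x := forall q : Q, unpickle n = Some q ->
  (exists psi, good q psi) -> ratr q.1.1 < x.1 < ratr q.1.2 -> ratr q.2.1 < x.2 < ratr q.2.2 ->
  Omega x -> f x = 0.
have /ae_foralln : forall n, \forall x \ae mu, P n x.
  move=> n; rewrite /P; case: (unpickle n) => [q|]; last exact: nearW.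
  have [[psi gq]|ng] := pselect (exists psi, good q psi); last first.
    by apply: nearW => x q' [<-].
  have [tp psi0 pos] := gq; apply: (aeS _ (A psi tp psi0)) => x H q' [<-] _ h1 h2 Ox.
  by have /eqP := H Ox; rewrite mulf_eq0 (gt_eqF (pos _ h1 h2)) orbF => /eqP.
apply: filterS => x H Ox.
move: (oO); rewrite openE => /(_ _ Ox)/nbhs_ballP[e /= e0 He].
have lt1 (s : R) : s - e / 2 < s by lra.
have lt2 (s : R) : s < s + e / 2 by lra.
have [a aP] := rat_in_itvoo (lt1 x.1); have [b bP] := rat_in_itvoo (lt2 x.1).
have [c cP] := rat_in_itvoo (lt1 x.2); have [d dP] := rat_in_itvoo (lt2 x.2).
move: aP bP cP dP; rewrite !in_itv /= => /andP[a1 a2] /andP[b1 b2] /andP[c1 c2] /andP[d1 d2].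
have ex : exists psi, good ((a, b), (c, d)) psi.
  apply: box_test => y /= /andP[h1 h2] /andP[h3 h4]; apply: He.
  by split; rewrite /ball /= ltr_norml; apply/andP; split; lra.
by apply: (H (pickle ((a, b), (c, d))) _ (pickleK _) ex) => //=; rewrite ?a2 ?b1 ?c2 ?d1.
Qed.

(** True for test functions by Fubini, and preserved in the limit because the constant 1 is bounded
    on the bounded set [Omega]. *)
Lemma integral_dot_grad u g e : W01p Omega p u g ->
  (\int[mu]_(x in Omega) dot e (g x))%R = 0.
Proof.
move=> Wu; have [phi_ [tphi c0 c1 c2]] := W01p_elim oO bO p1 Wu.
have [Lu [L1 L2] _ _] := Wu; have [M muO] := bounded_measure oO bO.
have Lt i n : LP (partial i (phi_ n)) by apply: test_Lp => //; exact: test_partial.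
have Z i n : (\int[mu]_(x in Omega) partial i (phi_ n) x)%R = 0.
  rewrite Rintegral_support; last exact: (test_partial i (tphi n)).2.
  by rewrite /Rintegral (partial_integral_eq0 oO bO i (tphi n).1 (tphi n).2).
have m1 : measurable_fun (Omega : set mplane) (fun _ : plane => 1 : R) by exact: measurable_cst.
have b1 x : Omega x -> `|1 : R| <= 1 by rewrite normr1.
have lim i h : LP h -> Lp_cvg mu Omega p (fun n => partial i (phi_ n)) h ->
    (\int[mu]_(x in Omega) h x)%R = 0.
  move=> Lh ch; have := pairing_cvg mO p1 muO (Lt i) Lh m1 b1 ch.
  have E k : (\int[mu]_(x in Omega) (k x * 1))%R = (\int[mu]_(x in Omega) k x)%R.
    by apply: eq_Rintegral => x _; rewrite mulr1.
  rewrite E; under eq_fun do rewrite E Z.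
  by move=> cl; exact: (cvg_unique (@norm_hausdorff _ _) cl (cvg_cst _)).
have i1 := Lp_integrable mO p1 muO L1; have i2 := Lp_integrable mO p1 muO L2.
have j1 : mu.-integrable Omega (EFin \o (fun x => e.1 * (g x).1)) by have := integrableZl mO e.1 i1.
have j2 : mu.-integrable Omega (EFin \o (fun x => e.2 * (g x).2)) by have := integrableZl mO e.2 i2.
have E1 := lim false _ L1 c1; have E2 := lim true _ L2 c2.
rewrite (RintegralD mO j1 j2) (RintegralZl e.1 mO i1) (RintegralZl e.2 mO i2).
by rewrite E1 E2 !mulr0 addr0.
Qed.

(* Testing with [tau * psi] for small [tau] shows that the remainder of the
   directional inequality vanishes: the directional derivative is non-negative,
   and its integral is zero. *)
Lemma directional_equality_zero theta u g : W01p Omega p u g ->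
  nr (fun x => posdot (dir theta) (g x)) `^ p = fine (lambda1p p (2 * W theta)) * nr u `^ p ->
  {ae mu, forall x, Omega x -> u x = 0}.
Proof.
move=> Wu E; have [Lu [L1 L2] _ _] := Wu; have [M muO] := bounded_measure oO bO.
have lam0 := lam_gt0 oO bO nO p1 theta.
set lam := fine _ in E lam0.
have Ld := dot_measurable oO p1 (dir theta) L1 L2.
have LN : LP (fun x => Num.max (- dot (dir theta) (g x)) 0).
  have LD : LP (fun x => - dot (dir theta) (g x)).
    have -> : (fun x => - dot (dir theta) (g x)) = (fun x => -1 * dot (dir theta) (g x)).
      by apply/funext => x; rewrite mulN1r.
    exact: LpZ.
  exact: max_Lp.
have N0 x : 0 <= Num.max (- dot (dir theta) (g x)) 0 by rewrite le_max lexx orbT.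
have Nae : {ae mu, forall x, Omega x -> Num.max (- dot (dir theta) (g x)) 0 = 0}.
  apply: nonpos_test_ae => // psi tp psi0.
  set J := Rintegral _ _ _; set C := qcost Omega p theta psi.
  have HJ (n : nat) : p * J <= (2 * (p - 1)) * C * harmonic n.
    (* With this exponent tau^q = (harmonic n)^p = tau * harmonic n, so that after division by tau a
       factor [harmonic n] remains on the cost side. *)
    pose tau : R := (harmonic n) `^ (p - 1).
    have h0 : 0 < @harmonic R n := harmonic_pos n.
    have t0 : 0 < tau by rewrite powR_gt0.
    have := W01p_inequality oO bO nO p1 theta Wu (testZ tau tp) (fun x => mulr_ge0 (ltW t0) (psi0 x)).
    rewrite E lerD2l -/lam.
    have -> : (\int[mu]_(x in Omega) (Num.max (- dot (dir theta) (g x)) 0 * (tau * psi x)))%R = tau * J.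
      have [c c0 pc] := csupp_bound (test_cont tp) tp.2.
      have mp : measurable_fun (Omega : set mplane) psi by apply: continuous_measurable2; exact: test_cont tp.
      have iF := pairing_integrable mO p1 muO LN mp (fun x _ => pc x).
      by rewrite -(RintegralZl tau mO iF); apply: eq_Rintegral => x _; rewrite mulrCA.
    have pp : 0 < p - 1 by rewrite subr_gt0.
    have -> : qcost Omega p theta (fun x => tau * psi x) = tau * harmonic n * C.
      have iD : mu.-integrable Omega (EFin \o (fun x => `|dot (dir theta) (grad psi x)| `^ (p / (p - 1)))).
        apply: csupp_integrableO => //.
          by apply: continuous_powR_norm; [exact: qgt0|exact: dot_grad_cont tp].
        apply: csupp_sub (dot_grad_csupp (dir theta) tp) => x dx.
        by rewrite dx normr0 powR0// gt_eqF// qgt0.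
      rewrite /C /qcost -(RintegralZl _ mO iD); apply: eq_Rintegral => x _.
      have -> : dot (dir theta) (grad (fun x => tau * psi x) x) = tau * dot (dir theta) (grad psi x).
        by rewrite /grad !(partialZ _ _ tp.1) /dot /=; ring.
      rewrite normrM powRM// (gtr0_norm t0); congr (_ * _).
      rewrite {1}/tau -powRrM mulrCA mulfV ?gt_eqF// mulr1.
      by rewrite /tau mulrC mulr_powRB1// ltW.
    have -> : lam * p * (tau * J) = lam * tau * (p * J) by ring.
    have -> : 2 * (lam * (p - 1)) * (tau * harmonic n * C) =
        lam * tau * (2 * (p - 1) * C * harmonic n) by ring.
    by rewrite ler_pM2l// mulr_gt0.
  rewrite -(pmulr_rle0 J p0); apply: (ler_cvgn _ _ HJ); first exact: cvg_cst.
  rewrite -[X in _ --> X](mulr0 (2 * (p - 1) * C)); apply: cvgM; first exact: cvg_cst.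
  exact: cvg_harmonic.
have mN : measurable_fun (Omega : set mplane) (EFin \o (fun x => Num.max (- dot (dir theta) (g x)) 0)).
  by apply/measurable_EFinP; exact: Lp_measurable LN.
have IN : (\int[mu]_(x in Omega) Num.max (- dot (dir theta) (g x)) 0)%R = 0.
  rewrite /Rintegral (ge0_ae_eq_integral (g := cst 0%E) mO mN)//; last 2 first.
  - by move=> x _ /=; rewrite lee_fin.
  - by apply: (aeS _ Nae) => x H Ox /=; rewrite H.
  by rewrite integral0.
have Lpos : LP (fun x => posdot (dir theta) (g x)) by exact: max_Lp.
have IP : (\int[mu]_(x in Omega) posdot (dir theta) (g x))%R = 0.
  have D0 := integral_dot_grad (dir theta) Wu.
  have EE : (\int[mu]_(x in Omega) dot (dir theta) (g x))%R =
     (\int[mu]_(x in Omega) (posdot (dir theta) (g x) - Num.max (- dot (dir theta) (g x)) 0))%R.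
    by apply: eq_Rintegral => x _; rewrite /posdot max0B.
  have iP := Lp_integrable mO p1 muO Lpos; have iN := Lp_integrable mO p1 muO LN.
  by move: D0; rewrite EE (RintegralB mO iP iN) IN subr0.
have Pae : {ae mu, forall x, Omega x -> posdot (dir theta) (g x) = 0}.
  have iP := Lp_integrable mO p1 muO Lpos; have mP := measurable_int _ iP.
  have E0 : (\int[mu]_(x in Omega) `|(posdot (dir theta) (g x))%:E| = 0)%E.
    under eq_integral do rewrite gee0_abs ?lee_fin ?posdot_ge0//.
    by rewrite -(fineK (integrable_fin_num mO iP)) /= -/(Rintegral _ _ _) IP.
  have /(ae_eq_integral_abs _ mO mP) := E0.
  by apply: filterS => x H Ox; have := H Ox; rewrite /cst /= => -[].
have nP : nr (fun x => posdot (dir theta) (g x)) `^ p = 0.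
  have mE := energy_measurable p (Lp_measurable Lpos).
  have := Lp_energy p1 Lpos; rewrite (ge0_ae_eq_integral (g := cst 0%E) mO mE)//.
  - by rewrite integral0 => -[].
  - by apply: (aeS _ Pae) => x H Ox /=; rewrite H// normr0 powR0.
apply: nrm_eq0_ae => //; move: E; rewrite nP => /esym/eqP.
by rewrite mulf_eq0 gt_eqF//= powR_eq0 pN0 andbT => /eqP.
Qed.

Lemma H0_gradient theta alpha y : 0 < dot (dir theta) y ->
  grad (fun x => alpha * H0 theta x) y = alpha *: dir theta.
Proof.
move=> y0.
have D i : partial i (fun x => alpha * H0 theta x) y = alpha * dot (dir theta) (basis_vector i).
  apply: is_derive_partial.
  have H : \near y, (fun x => alpha * dot (dir theta) x) y = alpha * H0 theta y.
    have : nbhs y (dot (dir theta) @^-1` [set s | 0 < s]).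
      apply: (dot_continuous (v := dir theta)); apply: open_nbhs_nbhs; split => //.
        by apply: filterS => z /= z0; rewrite H0E /posdot max_l// ltW.
  apply: (near_eq_is_derive H).
  have ds (t : R) : derivable (fun t => alpha * t) t 1.
    by apply: smooth1_derivable; apply: smooth1Z; exact: smooth1_id.
  have := linear_is_derive (dir theta) (basis_vector i) y ds.
  suff -> : derive1 (fun t => alpha * t) (dot (dir theta) y) = alpha by rewrite mulrC.
  apply: is_derive1_derive1.
  by have := derive1_affine alpha 0 (dot (dir theta) y); under [X in is_derive _ _ X _]eq_fun do rewrite addr0.
rewrite /grad !D [RHS]surjective_pairing.
by congr pair; rewrite /dot /= /GRing.scale /= ?mulr0 ?mulr1 ?addr0 ?add0r.
Qed.

Lemma powR_sq (s : R) : `|s| `^ (p - 2) * s * s = `|s| `^ p.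
Proof.
have [->|s0] := eqVneq s 0; first by rewrite !mulr0 normr0 powR0.
have n0 : 0 < `|s| by rewrite normr_gt0.
rewrite -mulrA -expr2 -real_normK ?num_real// -powR_mulrn ?(ltW n0)// -powRD.
  by rewrite subrK.
by rewrite normr_eq0 s0 implybT.
Qed.

(** Testing the eigenvalue equation with [u] itself, homogeneity turns the flux term into the
    energy, so [u] reaches equality in the directional inequality and must vanish. *)
Lemma H0_not_fundamental theta alpha : 0 < alpha ->
  ~ fundamental Omega p (fun x => alpha * H0 theta x).
Proof.
move=> a0 [aH _ [u [g [Wu [nu _ _ eq]]]]]; apply: nu.
have [Lu [L1 L2] _ _] := Wu.
have Lpos : LP (fun x => posdot (dir theta) (g x)).
  by apply: max_Lp => //; exact: dot_measurable.
apply: (directional_equality_zero (theta := theta) Wu).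
have := eq _ _ Wu; rewrite lambdaH_H0Z//.
have -> : (\int[mu]_(x in Omega) (`|u x| `^ (p - 2) * u x * u x)%:E = (nr u `^ p)%:E)%E.
  by rewrite -(Lp_energy p1 Lu); apply: eq_integral => x _; rewrite powR_sq.
have -> : (\int[mu]_(x in Omega) ((alpha * H0 theta (g x)) `^ (p - 1) *
    dot (grad (fun x => alpha * H0 theta x) (g x)) (g x))%:E =
    \int[mu]_(x in Omega) (`|alpha * posdot (dir theta) (g x)| `^ p)%:E)%E.
  apply: eq_integral => x _; rewrite H0E; congr EFin.
  rewrite ger0_norm; last by rewrite mulr_ge0 ?posdot_ge0// ltW.
  have [h|h] := leP (dot (dir theta) (g x)) 0.
    rewrite /posdot max_r// mulr0 powR0 ?mul0r ?powR0//.
    by rewrite gt_eqF// subr_gt0.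
  rewrite H0_gradient// /posdot max_l ?(ltW h)//.
  have -> : dot (alpha *: dir theta) (g x) = alpha * dot (dir theta) (g x).
    by rewrite /dot /= /GRing.scale /=; ring.
  by rewrite mulrC mulr_powRB1// mulr_ge0// ltW.
rewrite energyZ//; last exact: Lp_measurable Lpos.
rewrite (Lp_energy p1 Lpos) (gtr0_norm a0) -(lamE oO bO nO p1) -!EFinM => -[] /eqP.
rewrite -mulrA => /eqP; apply: mulfI.
by rewrite gt_eqF// powR_gt0.
Qed.

End one_sided_anisotropy.

(** * Compactness *)

Section poincare.
Context {R : realType}.
Local Notation plane := (R * R)%type.
Local Notation mu1 := (@lebesgue_measure R).
Local Notation mu := (mu1 \x mu1)%E.
Local Notation mplane := (measurableTypeR R * measurableTypeR R)%type.
Variables (p : R) (p1 : 1 < p).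
Implicit Types (u : plane -> R) (a b s : R).
Let p0 : 0 < p. Proof. exact: lt_trans ltr01 p1. Qed.
Let pN0 : p != 0. Proof. by rewrite gt_eqF. Qed.

Lemma powRD_le (s t : R) : 0 <= s -> 0 <= t -> (s + t) `^ p <= 2 `^ p * (s `^ p + t `^ p).
Proof.
wlog st : s t / s <= t.
  move=> H s0 t0; have [st|st] := leP s t; first exact: H.
  by rewrite addrC (addrC (s `^ p)); apply: H => //; exact: ltW.
move=> s0 t0; apply: (@le_trans _ _ ((2 * t) `^ p)).
  by apply: ge0_ler_powR; rewrite ?nnegrE ?addr_ge0 ?mulr_ge0 ?(ltW p0)//; lra.
by rewrite powRM// ler_wpM2l ?powR_ge0// lerDr powR_ge0.
Qed.

Local Notation itv a s := (`[a, (a + s)%R[%classic : set R).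

Lemma itv_measurable a s : measurable (itv a s : set (measurableTypeR R)).
Proof. exact: measurable_itv. Qed.

Lemma itv_measure a s : 0 < s -> mu1 (itv a s) = s%:E.
Proof. by move=> s0; rewrite lebesgue_measure_itv /= lte_fin ltrDl s0 -EFinB addrAC subrr add0r. Qed.

(** The fundamental theorem of calculus and Hoelder's inequality; the factor is the p-th power of
    s^(1 - 1/p). *)
Lemma oscillation (f : R -> R) a s x y : 0 < s -> smooth1 f -> itv a s x -> itv a s y ->
  ((`|f x - f y| `^ p)%:E <= (s `^ (p - 1))%:E * \int[mu1]_(t in itv a s) (`|derive1 f t| `^ p)%:E)%E.
Proof.
wlog yx : x y / y <= x.
  move=> H s0 sf Ix Iy; have [yx|/ltW xy] := leP y x; first exact: H.
  by rewrite distrC; exact: H.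
move=> s0 sf; rewrite /= !in_itv /= => /andP[ax xs] /andP[ay ys].
have cd := smooth1_cont sf; have mI := itv_measurable a s.
have cp : continuous (fun t => `|derive1 f t| `^ p) := continuous_powR_norm p0 cd.
have Ld : Lp mu1 (itv a s) p (derive1 f).
  apply/(LpE _ _ p1); split; first exact: fun_continuous_measurable.
  have /integrableP[_] := @continuous_itv_integrable R _ a (a + s) cp.
  apply: le_lt_trans; apply: (@le_trans _ _ (\int[mu1]_(t in itv a s) `|(`|derive1 f t| `^ p)%:E|)%E).
    apply: le_integral_ge0 => t _; first by rewrite lee_fin powR_ge0.
    by rewrite lee_fin ler_norm.
  have mK : measurable (`[a, a + s]%classic : set (measurableTypeR R)) by exact: measurable_itv.
  have mA : measurable_fun (`[a, a + s]%classic : set (measurableTypeR R))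
      (fun t => `|(`|derive1 f t| `^ p)%:E|%E).
    by apply: measurableT_comp => //; apply/measurable_EFinP; exact: fun_continuous_measurable.
  apply: (ge0_subset_integral mu1 mI mK mA) => // t /=.
  by rewrite !in_itv /= => /andP[-> /ltW ->].
have le1 : (`|f x - f y|%:E <= \int[mu1]_(t in itv a s) `|derive1 f t|%:E)%E.
  have E := integral_itv_derive yx (fun t => smooth1_is_derive t sf) cd.
  have mC : measurable (`[y, x]%classic : set (measurableTypeR R)) by exact: measurable_itv.
  have mD : measurable_fun (`[y, x]%classic : set (measurableTypeR R)) (fun t => (derive1 f t)%:E).
    by apply/measurable_EFinP; exact: fun_continuous_measurable.
  have -> : `|f x - f y|%:E = (`|\int[mu1]_(t in `[y, x]) (derive1 f t)%:E|)%E by rewrite E.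
  apply: (le_trans (le_abse_integral mu1 mC mD)).
  have mA : measurable_fun (itv a s : set (measurableTypeR R)) (fun t => `|(derive1 f t)%:E|%E).
    by apply: measurableT_comp => //; apply/measurable_EFinP; exact: fun_continuous_measurable.
  apply: (ge0_subset_integral mu1 mC mI mA) => // t /=.
  by rewrite !in_itv /= => /andP[h1 h2]; rewrite (le_trans ay h1) (le_lt_trans h2 xs).
have := le_trans le1 (integral_le_nrm mI p1 (itv_measure a s0) Ld).
rewrite lee_fin (Lp_energy p1 Ld) -EFinM lee_fin => le2.
have h : `|f x - f y| `^ p <= (nrm mu1 (itv a s) p (derive1 f) * s `^ (1 - p^-1)) `^ p.
  apply: ge0_ler_powR; rewrite ?nnegrE ?(ltW p0)//.
  by rewrite mulr_ge0 ?nrm_ge0 ?powR_ge0.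
apply: (le_trans h); rewrite powRM ?nrm_ge0 ?powR_ge0// mulrC -powRrM mulrBl mul1r mulVf//.
Qed.

Lemma fubini_box (F : plane -> \bar R) (A B : set R) :
  measurable (A : set (measurableTypeR R)) -> measurable (B : set (measurableTypeR R)) ->
  measurable_fun setT (F : mplane -> \bar R) -> (forall x, 0 <= F x)%E ->
  (\int[mu]_(x in A `*` B) F x = \int[mu1]_(x in A) \int[mu1]_(y in B) F (x, y))%E /\
  (\int[mu]_(x in A `*` B) F x = \int[mu1]_(y in B) \int[mu1]_(x in A) F (x, y))%E.
Proof.
move=> mA mB mF F0; have mAB : measurable (A `*` B : set mplane) by exact: measurableX.
have mFr : measurable_fun setT (F \_ (A `*` B) : mplane -> \bar R).
  by apply/(measurable_restrictT F mAB); exact: measurable_funS mF.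
have Fr0 x : (0 <= (F \_ (A `*` B)) x)%E by rewrite patchE; case: ifP.
have E x y : (F \_ (A `*` B)) (x, y) = if x \in A then if y \in B then F (x, y) else 0%E else 0%E.
  by rewrite patchE in_setX /=; case: (x \in A) => //=.
split; rewrite integral_mkcond.
  rewrite (fubini_tonelli1 _ mFr Fr0) [RHS]integral_mkcond; apply: eq_integral => x _.
  rewrite /fubini_F patchE; under eq_integral do rewrite E.
  case: ifPn => xA; last by rewrite integral0.
  by rewrite [RHS]integral_mkcond; apply: eq_integral => y _; rewrite patchE.
rewrite (fubini_tonelli2 _ mFr Fr0) [RHS]integral_mkcond; apply: eq_integral => y _.
rewrite /fubini_G patchE; under eq_integral do rewrite E.
case: ifPn => yB; last by under eq_integral do rewrite if_same; rewrite integral0.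
by rewrite [RHS]integral_mkcond; apply: eq_integral => x _; rewrite patchE.
Qed.

(** Half-open in both variables, so that halving the side gives an exact partition into four
    squares. *)
Definition square a b s : set plane := itv a s `*` itv b s.

Lemma square_measurable a b s : measurable (square a b s : set mplane).
Proof. by apply: measurableX; exact: itv_measurable. Qed.

Lemma square_measure a b s : 0 < s -> mu (square a b s) = (s * s)%:E.
Proof.
move=> s0.
have -> : (s * s)%:E = (mu1 (itv a s) * mu1 (itv b s))%E by rewrite !itv_measure.
exact: (product_measure1E mu1 mu1 (itv_measurable a s) (itv_measurable b s)).
Qed.

Lemma square_Lp a b s u : 0 < s -> continuous u -> Lp mu (square a b s) p u.
Proof.
move=> s0 cu; apply/(LpE _ _ p1); split; first exact: continuous_measurable2.
pose K := (`[a, a + s]%classic `*` `[b, b + s]%classic) : set plane.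
have cK : compact K by apply: compact_setX; exact: segment_compact.
have K0 : K !=set0.
  by exists (a, b); split; rewrite /= in_itv /= lexx lerDl ltW.
have cn : continuous (fun x => `|u x| `^ p) := continuous_powR_norm p0 cu.
have [z _ zmax] := compact_EVT_max K0 cK (continuous_subspaceT cn).
apply: (@le_lt_trans _ _ (\int[mu]_(x in square a b s) (`|u z| `^ p)%:E)%E).
  apply: le_integral_ge0 => x; first by rewrite lee_fin powR_ge0.
  move=> [/=]; rewrite !in_itv /= => /andP[h1 h2] /andP[h3 h4]; rewrite lee_fin.
  by apply: zmax; rewrite inE; split; rewrite /= in_itv /= ?h1 ?h3 ltW.
rewrite integral_cst; last exact: square_measurable.
rewrite (_ : _ (square a b s) = (s * s)%:E); last exact: square_measure.
by rewrite -EFinM ltry.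
Qed.

Lemma integral_pow_le (d : measure_display) (T : measurableType d) (m : {measure set T -> \bar R})
    (D : set T) (mD : measurable D) (M : R) (f : T -> R) : 0 <= M -> m D = M%:E -> Lp m D p f ->
  ((`|\int[m]_(x in D) f x| `^ p)%:E <=
   (M `^ (p - 1))%:E * \int[m]_(x in D) (`|f x| `^ p)%:E)%E.
Proof.
move=> M0 mDM Lf; have iF := Lp_integrable mD p1 mDM Lf.
have h : `|\int[m]_(x in D) f x| <= nrm m D p f * M `^ (1 - p^-1).
  apply: le_trans (le_normr_Rintegral mD iF) _; rewrite -lee_fin.
  have iN : m.-integrable D (EFin \o (fun x => `|f x|)) by have := integrable_abse iF.
  by rewrite /Rintegral fineK; [exact: integral_le_nrm|exact: integrable_fin_num iN].
rewrite (Lp_energy p1 Lf) -EFinM lee_fin.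
apply: (@le_trans _ _ ((nrm m D p f * M `^ (1 - p^-1)) `^ p)).
  by apply: ge0_ler_powR; rewrite ?nnegrE ?(ltW p0)// mulr_ge0 ?nrm_ge0 ?powR_ge0.
by rewrite powRM ?nrm_ge0 ?powR_ge0// mulrC -powRrM mulrBl mul1r mulVf.
Qed.

Definition grad_energy u (D : set plane) : \bar R :=
  (\int[mu]_(x in D) (`|partial false u x| `^ p)%:E + \int[mu]_(x in D) (`|partial true u x| `^ p)%:E)%E.

Lemma grad_energy_ge0 u D : (0 <= grad_energy u D)%E.
Proof. by rewrite adde_ge0//; apply: integral_ge0 => x _; rewrite lee_fin powR_ge0. Qed.

(** Multiplied by |int u|^p, this is 2^p times the area of the square times the p-th power of the
    absolute value of the mean. *)
Definition avg_weight s : R := 2 `^ p * (s * s) * ((s * s)^-1 `^ p).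

Lemma itv_integral_cst a s (c : \bar R) : 0 < s -> (\int[mu1]_(t in itv a s) c = c * s%:E)%E.
Proof.
move=> s0; have mI := itv_measurable a s.
have -> : (\int[mu1]_(t in itv a s) c = c * mu1 (itv a s))%E by exact: (integral_cst mu1 mI c).
by rewrite itv_measure.
Qed.

Lemma itv_integral_affine a s (g : R -> \bar R) (al : R) (c : \bar R) : 0 < s ->
  measurable_fun (itv a s : set (measurableTypeR R)) g -> (forall t, 0 <= g t)%E -> 0 <= al ->
  (0 <= c)%E ->
  (\int[mu1]_(t in itv a s) (al%:E * (g t + c) * s%:E) =
   (al * s)%:E * (\int[mu1]_(t in itv a s) g t + c * s%:E))%E.
Proof.
move=> s0 mg g0 al0 c0; have mI := itv_measurable a s.
have E t : (al%:E * (g t + c) * s%:E = (al * s)%:E * (g t + c))%E.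
  by rewrite muleAC -EFinM.
under eq_integral do rewrite E.
rewrite ge0_integralZl_EFin//; last 3 first.
- by move=> t _; rewrite adde_ge0.
- by apply: emeasurable_funD => //; exact: measurable_cst.
- by rewrite mulr_ge0// ltW.
rewrite ge0_integralD//.
congr (_ * (_ + _))%E.
exact: itv_integral_cst.
Qed.

Lemma leeD_mul (k a b c d : \bar R) : (0 <= c -> 0 <= d -> a <= k * c -> b <= k * d ->
  a + b <= k * (d + c))%E.
Proof. by move=> c0 d0 ac bd; rewrite addeC ge0_muleDr//; exact: leeD. Qed.

(** [g] stands for the energy of one slice, known only to be a non-negative extended real; the
    infinite case is separate. *)
Lemma affine_cancel (s K e : R) (g : \bar R) : 0 < s -> 0 < K -> (0 <= g)%E ->
  (((s * s)^-1)%:E * ((K * s)%:E * (e%:E + g * s%:E)) <= K%:E * (g + (s^-1 * e)%:E))%E.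
Proof.
move=> s0 K0; case: g => [r| _|]//; last by rewrite [X in (_ <= _ * X)%E]addye// gt0_muley ?leey.
move=> r0.
rewrite -?(EFinM, EFinD) lee_fin le_eqVlt; apply/orP; left; apply/eqP.
by field; rewrite gt_eqF.
Qed.

Lemma affine_bound (x y c q K d : R) (g : \bar R) : 0 < q -> 0 < K -> (0 <= g)%E ->
  x <= q * (y + c) -> (y%:E <= K%:E * (g + d%:E))%E ->
  (x%:E <= (q * K)%:E * (g + (d + c / K)%:E))%E.
Proof.
move=> q0 K0; case: g => [r| |]// r0; last first.
  by move=> _ _; rewrite addye// gt0_muley ?leey// lte_fin mulr_gt0.
rewrite -?(EFinM, EFinD) !lee_fin => le1 le2; apply: (le_trans le1).
rewrite -mulrA ler_wpM2l ?(ltW q0)//.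
have -> : K * (r + (d + c / K)) = K * (r + d) + c by field; rewrite gt_eqF.
by rewrite lerD2r.
Qed.

Lemma poincare_arith (q k s e1 e2 c sp w : R) (A B : \bar R) : 0 < s -> 0 < q -> 0 < k ->
  A = e1%:E -> B = (e1 + e2)%:E -> sp = s * k -> w = q * (s * s) * c ->
  ((q * (q * k) * s)%:E * (A + (s^-1 * e2 + c / (q * k))%:E * s%:E) <= (q * q * sp)%:E * B + w%:E)%E.
Proof.
move=> s0 q0 k0 -> -> -> ->; rewrite -?(EFinM, EFinD) lee_fin le_eqVlt; apply/orP; left; apply/eqP.
by field; rewrite !gt_eqF.
Qed.

(* [u x - u y] is bounded along a path made of a horizontal and a vertical
   segment. *)
Lemma square_poincare a b s u : 0 < s -> smooth u ->
  (\int[mu]_(x in square a b s) (`|u x| `^ p)%:E <=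
   (2 `^ p * 2 `^ p * s `^ p)%:E * grad_energy u (square a b s) +
   (avg_weight s * `|\int[mu]_(x in square a b s) u x| `^ p)%:E)%E.
Proof.
move=> s0 su; have cu := smooth_continuous su; have ss : 0 < s * s by rewrite mulr_gt0.
have mS := square_measurable a b s; have LS v cv := @square_Lp a b s v s0 cv.
have muS : mu (square a b s) = (s * s)%:E by exact: square_measure.
pose S := square a b s; pose I := itv a s; pose J := itv b s.
have mI := itv_measurable a s; have mJ := itv_measurable b s.
have cd i := smooth_continuous (smooth_partial i su).
have ME (v : plane -> R) : continuous v -> measurable_fun setT (fun x : mplane => (`|v x| `^ p)%:E).
  by move=> cv; apply/measurable_EFinP; apply: continuous_measurable2; exact: continuous_powR_norm.
have E0 (v : plane -> R) x : (0 <= (`|v x| `^ p)%:E)%E by rewrite lee_fin powR_ge0.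
pose G1 y := (\int[mu1]_(t in I) (`|partial false u (t, y)| `^ p)%:E)%E.
pose G2 x := (\int[mu1]_(t in J) (`|partial true u (x, t)| `^ p)%:E)%E.
have G10 y : (0 <= G1 y)%E by apply: integral_ge0 => t _.
have G20 x : (0 <= G2 x)%E by apply: integral_ge0 => t _.
have mr (v : plane -> R) : continuous v -> measurable_fun setT
    ((fun x : mplane => (`|v x| `^ p)%:E) \_ (S : set mplane)).
  by move=> cv; apply/(measurable_restrictT _ mS); apply: measurable_funS (ME v cv).
have r0 (v : plane -> R) x : (0 <= ((fun x : mplane => (`|v x| `^ p)%:E) \_ (S : set mplane)) x)%E.
  by rewrite patchE; case: ifP.
have mG1 : measurable_fun J (G1 : measurableTypeR R -> \bar R).
  have H : measurable_fun setT (fubini_G mu1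
      ((fun x : mplane => (`|partial false u x| `^ p)%:E) \_ (S : set mplane))).
    by apply: measurable_fun_fubini_tonelli_G; [exact: mr|exact: r0].
  apply: (eq_measurable_fun _ _ (measurable_funS measurableT (@subsetT _ _) H)) => y yJ.
  rewrite /fubini_G /G1 [RHS]integral_mkcond; apply: eq_integral => t _.
  by rewrite !patchE in_setX /= yJ andbT.
have mG2 : measurable_fun I (G2 : measurableTypeR R -> \bar R).
  have H : measurable_fun setT (fubini_F mu1
      ((fun x : mplane => (`|partial true u x| `^ p)%:E) \_ (S : set mplane))).
    by apply: measurable_fun_fubini_tonelli_F; [exact: mr|exact: r0].
  apply: (eq_measurable_fun _ _ (measurable_funS measurableT (@subsetT _ _) H)) => y yJ.
  rewrite /fubini_F /G2 [RHS]integral_mkcond; apply: eq_integral => t _.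
  by rewrite !patchE in_setX /= yJ.
have FE1 : (\int[mu]_(x in S) (`|partial false u x| `^ p)%:E = \int[mu1]_(y in J) G1 y)%E.
  exact: (fubini_box mI mJ (ME _ (cd false)) (E0 _)).2.
have FE2 : (\int[mu]_(x in S) (`|partial true u x| `^ p)%:E = \int[mu1]_(x in I) G2 x)%E.
  exact: (fubini_box mI mJ (ME _ (cd true)) (E0 _)).1.
have slice1 y t t' : I t -> I t' -> ((`|u (t, y) - u (t', y)| `^ p)%:E <= (s `^ (p - 1))%:E * G1 y)%E.
  move=> It It'; have [s1 d1] := smooth_slice (1, 0) (0, y) su.
  have P r : r *: (1, 0) + (0, y) = (r, y) :> plane by congr pair; rewrite /= /GRing.scale /=; ring.
  have := oscillation s0 s1 It It'; rewrite d1 !P; congr (_ <= _ * _)%E.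
  by apply: eq_integral => r _; rewrite P /dot /grad /= mul1r mul0r addr0.
have slice2 x t t' : J t -> J t' -> ((`|u (x, t) - u (x, t')| `^ p)%:E <= (s `^ (p - 1))%:E * G2 x)%E.
  move=> It It'; have [s1 d1] := smooth_slice (0, 1) (x, 0) su.
  have P r : r *: (0, 1) + (x, 0) = (x, r) :> plane by congr pair; rewrite /= /GRing.scale /=; ring.
  have := oscillation s0 s1 It It'; rewrite d1 !P; congr (_ <= _ * _)%E.
  by apply: eq_integral => r _; rewrite P /dot /grad /= mul1r mul0r add0r.
pose K := 2 `^ p * s `^ (p - 1); have K0 : 0 < K by rewrite mulr_gt0// powR_gt0.
have [e1 E1] : exists e1 : R, (\int[mu]_(x in S) (`|partial false u x| `^ p)%:E = e1%:E)%E.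
  by exists (nrm mu S p (partial false u) `^ p); apply: Lp_energy => //; exact: LS.
have [e2 E2] : exists e2 : R, (\int[mu]_(x in S) (`|partial true u x| `^ p)%:E = e2%:E)%E.
  by exists (nrm mu S p (partial true u) `^ p); apply: Lp_energy => //; exact: LS.
have e10 : 0 <= e1 by rewrite -lee_fin -E1; apply: integral_ge0.
have e20 : 0 <= e2 by rewrite -lee_fin -E2; apply: integral_ge0.
pose avg := (s * s)^-1 * (\int[mu]_(x in S) u x)%R; pose c := `|avg| `^ p.
have c0 : 0 <= c by exact: powR_ge0.
(* The intermediate point is (y1, x2): the horizontal leg is charged to the slice at height x2, the
   vertical one to the slice at abscissa y1. *)
have osc x1 x2 y1 y2 : I x1 -> J x2 -> I y1 -> J y2 ->
    ((`|u (x1, x2) - u (y1, y2)| `^ p)%:E <= K%:E * (G2 y1 + G1 x2))%E.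
  move=> h1 h2 h3 h4; have le1 := slice1 x2 _ _ h1 h3; have le2 := slice2 y1 _ _ h2 h4.
  apply: (@le_trans _ _ ((2 `^ p)%:E * ((`|u (x1, x2) - u (y1, x2)| `^ p)%:E +
      (`|u (y1, x2) - u (y1, y2)| `^ p)%:E))%E).
    rewrite -EFinD -EFinM lee_fin; apply: le_trans (powRD_le _ _) => //.
    apply: ge0_ler_powR; rewrite ?nnegrE ?(ltW p0) ?addr_ge0//.
    by apply: le_trans (ler_normD _ _); rewrite addrA subrK.
  rewrite /K EFinM -muleA; apply: lee_wpmul2l; first by rewrite lee_fin powR_ge0.
  exact: leeD_mul (G10 x2) (G20 y1) le1 le2.
(* The deviation from the mean is the mean of the deviations u(x1, x2) - u(y); Hoelder's inequality
   brings the p-th power inside, and [osc] is integrated over y. *)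
have dev x1 x2 : I x1 -> J x2 ->
    ((`|u (x1, x2) - avg| `^ p)%:E <= K%:E * (G1 x2 + (s^-1 * e2)%:E))%E.
  move=> h1 h2.
  have cv : continuous (fun y => u (x1, x2) - u y).
    by move=> y; apply: cvgB; [exact: cvg_cst|exact: cu].
  have Lv := LS _ cv; have iu := Lp_integrable mS p1 muS (LS _ cu).
  have EA : `|u (x1, x2) - avg| `^ p = (s * s)^-1 `^ p * `|\int[mu]_(y in S) (u (x1, x2) - u y)| `^ p.
    have -> : (\int[mu]_(y in S) (u (x1, x2) - u y))%R = (s * s) * (u (x1, x2) - avg).
      have ic : mu.-integrable S (EFin \o (fun _ : plane => u (x1, x2))).
        by apply: (Lp_integrable mS p1 muS); apply: LS; exact: continuous_cst.
      rewrite RintegralB// Rintegral_cst// mulrBr mulVKf ?gt_eqF//; congr (_ - _).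
      by rewrite /= (_ : fine _ = s * s) 1?mulrC// [X in fine X](square_measure _ _ s0).
    rewrite normrM (gtr0_norm ss) powRM ?(ltW ss)// mulrA -powRM ?invr_ge0 ?(ltW ss)//.
    by rewrite mulVf ?gt_eqF// powR1 mul1r.
  have le1 := integral_pow_le mS (ltW ss) muS Lv.
  have le2 : (\int[mu]_(y in S) (`|u (x1, x2) - u y| `^ p)%:E <= (K * s)%:E * (e2%:E + G1 x2 * s%:E))%E.
    rewrite (fubini_box mI mJ (ME _ cv) (E0 _)).1.
    rewrite -E2 FE2 -(itv_integral_affine s0 mG2 G20 (ltW K0) (G10 x2)).
    apply: le_integral_ge0 => y1 Iy1; first by apply: integral_ge0.
    apply: (@le_trans _ _ (\int[mu1]_(y2 in J) (K%:E * (G2 y1 + G1 x2)))%E).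
      by apply: le_integral_ge0 => y2 Jy2 //; exact: osc.
    by rewrite itv_integral_cst.
  have le3 : ((`|u (x1, x2) - avg| `^ p)%:E <=
      ((s * s)^-1 `^ p * (s * s) `^ (p - 1))%:E * ((K * s)%:E * (e2%:E + G1 x2 * s%:E)))%E.
    rewrite EA EFinM EFinM -muleA; apply: lee_wpmul2l; first by rewrite lee_fin powR_ge0.
    by apply: (le_trans le1); apply: lee_wpmul2l => //; rewrite lee_fin powR_ge0.
  apply: (le_trans le3).
  have -> : (s * s)^-1 `^ p * (s * s) `^ (p - 1) = (s * s)^-1.
    apply: (mulfI (lt0r_neq0 ss)); rewrite mulrCA mulr_powRB1 ?(ltW ss)//.
    by rewrite -powRM ?invr_ge0 ?(ltW ss)// mulVf ?mulfV ?lt0r_neq0// powR1.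
  exact: affine_cancel.
have fin x1 x2 : I x1 -> J x2 ->
    ((`|u (x1, x2)| `^ p)%:E <= (2 `^ p * K)%:E * (G1 x2 + (s^-1 * e2 + c / K)%:E))%E.
  move=> h1 h2; have le1 := dev x1 x2 h1 h2.
  have le2 : `|u (x1, x2)| `^ p <= 2 `^ p * (`|u (x1, x2) - avg| `^ p + c).
    apply: le_trans (powRD_le _ _) => //; apply: ge0_ler_powR; rewrite ?nnegrE ?(ltW p0) ?addr_ge0//.
    by apply: le_trans (ler_normD _ _); rewrite subrK.
  exact: affine_bound (powR_gt0 _ _) K0 (G10 x2) le2 le1.
rewrite (fubini_box mI mJ (ME _ cu) (E0 _)).2.
apply: (@le_trans _ _ (\int[mu1]_(x2 in J) ((2 `^ p * K)%:E * (G1 x2 + (s^-1 * e2 + c / K)%:E) * s%:E))%E).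
  apply: le_integral_ge0 => x2 Jx2; first by apply: integral_ge0.
  apply: (@le_trans _ _ (\int[mu1]_(x1 in I) ((2 `^ p * K)%:E * (G1 x2 + (s^-1 * e2 + c / K)%:E)))%E).
    by apply: le_integral_ge0 => x1 Ix1 //; exact: fin.
  by rewrite itv_integral_cst.
have C0 : 0 <= s^-1 * e2 + c / K.
  by rewrite addr_ge0// mulr_ge0// invr_ge0 ltW.
rewrite (itv_integral_affine s0 mG1 G10) ?lee_fin//; last by rewrite mulr_ge0 ?powR_ge0// ltW.
have GE : grad_energy u (square a b s) = (e1 + e2)%:E by exact: (congr2 (fun x y => (x + y)%E) E1 E2).
have FG : (\int[mu1]_(y in J) G1 y)%E = e1%:E by exact: (etrans (esym FE1) E1).
have AW : avg_weight s * `|\int[mu]_(x in S) u x| `^ p = 2 `^ p * (s * s) * c.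
  have n0 : `|(s * s)^-1| = (s * s)^-1 by rewrite gtr0_norm// invr_gt0.
  by rewrite /c /avg normrM powRM// n0 /avg_weight -!mulrA.
have sp : s `^ p = s * s `^ (p - 1) by rewrite mulr_powRB1// ltW.
exact: (poincare_arith s0 (powR_gt0 _ _) (powR_gt0 _ s0) FG GE sp AW).
Qed.

End poincare.

(** A bounded sequence has a cluster point along the ultrafilter, and an ultrafilter contains either
    the preimage of a ball or its complement; the cluster point excludes the complement. *)
Lemma ultrafilter_cauchy (R : realType) (F : set_system nat) (UF : UltraFilter F) (x : nat -> R) (M delta : R) :
  (forall n, `|x n| <= M) -> 0 < delta ->
  exists2 A, F A & forall m n, A m -> A n -> `|x m - x n| <= delta.
Proof.
move=> xM d0; have PF := @ultra_proper _ _ UF.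
have FM : (x @ F) `[- M, M]%classic.
  by apply: nearW => n /=; rewrite in_itv /= -ler_norml.
have [l [_ cl]] := segment_compact (fmap_proper_filter x PF) FM.
have d2 : 0 < delta / 2 by rewrite divr_gt0.
have [FA|FA] := in_ultra_setVsetC (x @^-1` ball l (delta / 2)) UF.
  exists (x @^-1` ball l (delta / 2)) => // m n; rewrite /= /ball /= => h1 h2.
  rewrite (_ : x m - x n = (l - x n) - (l - x m)); last by ring.
  by apply: le_trans (ler_normB _ _) _; lra.
have [y [/= ny By]] := cl (~` ball l (delta / 2)) _ FA (nbhsx_ballx l _ d2).
by exfalso.
Qed.

(** * Compactness of bounded sequences of test functions *)

Section rellich.
Context {R : realType}.
Local Notation plane := (R * R)%type.
Local Notation mu1 := (@lebesgue_measure R).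
Local Notation mu := (mu1 \x mu1)%E.
Local Notation mplane := (measurableTypeR R * measurableTypeR R)%type.
Variables (p : R) (p1 : 1 < p).
Implicit Types (u : plane -> R) (a b s : R).
Let p0 : 0 < p. Proof. exact: lt_trans ltr01 p1. Qed.

Lemma square_split a b s (f : plane -> \bar R) : 0 < s -> (forall x, 0 <= f x)%E ->
  measurable_fun setT (f : mplane -> \bar R) ->
  (\int[mu]_(x in square a b s) f x =
   (\int[mu]_(x in square a b (s / 2)) f x + \int[mu]_(x in square (a + s / 2) b (s / 2)) f x) +
   (\int[mu]_(x in square a (b + s / 2) (s / 2)) f x +
    \int[mu]_(x in square (a + s / 2) (b + s / 2) (s / 2)) f x))%E.
Proof.
move=> s0 f0 mf.
have mS a' b' := @square_measurable R a' b' (s / 2).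
have D : s / 2 + s / 2 = s by lra.
have halves a' : `[a', a' + s[%classic =
    `[a', a' + s / 2[%classic `|` `[a' + s / 2, a' + s / 2 + s / 2[%classic.
  apply/seteqP; split=> t /=; rewrite !in_itv /=.
    move=> /andP[h1 h2]; have [h|h] := ltP t (a' + s / 2); [left|right]; first by rewrite h1.
    by rewrite -addrA D.
  by move=> [|] /andP[h1 h2]; apply/andP; split; lra.
have -> : square a b s = (square a b (s / 2) `|` square (a + s / 2) b (s / 2)) `|`
    (square a (b + s / 2) (s / 2) `|` square (a + s / 2) (b + s / 2) (s / 2)).
  rewrite /square (halves a) (halves b); apply/seteqP; split=> -[x y] /=; first by tauto.
  by tauto.
have dj a' b' a'' b'' : (a' + s / 2 <= a'') || (b' + s / 2 <= b'') ->
    [disjoint square a' b' (s / 2) & square a'' b'' (s / 2)].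
  move=> h; apply/disj_setPS => -[x y] [[A1 A2] [B1 B2]]; move: A1 A2 B1 B2 h.
  rewrite /= !in_itv /= => /andP[h1 h2] /andP[h3 h4] /andP[h5 h6] /andP[h7 h8].
  by move=> /orP[]; lra.
rewrite ge0_integral_setU//; last 4 first.
- by apply: measurableU.
- by apply: measurableU.
- exact: measurable_funS mf.
- apply/disj_setPS => -[x y] [[[_ h]|[_ h]] [[_ h']|[_ h']]]; move: h h'; rewrite /= !in_itv /=;
    by move=> /andP[h1 h2] /andP[h3 h4]; lra.
rewrite ge0_integral_setU//; last 2 first.
- exact: measurable_funS mf.
- by apply: dj; rewrite lexx.
rewrite ge0_integral_setU//; first exact: measurable_funS mf.
by apply: dj; rewrite lexx.
Qed.

Lemma regroup4 (a b c d a' b' c' d' : \bar R) :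
  (((a + b) + (c + d)) + ((a' + b') + (c' + d')) = ((a + a') + (b + b')) + ((c + c') + (d + d')))%E.
Proof. by rewrite addeACA (addeACA a) (addeACA c). Qed.

Lemma quad_arith (k w s1 s2 s3 s4 : R) (g1 g2 g3 g4 : \bar R) : 0 <= k ->
  (0 <= g1 -> 0 <= g2 -> 0 <= g3 -> 0 <= g4 ->
  ((k%:E * g1 + (w * s1)%:E) + (k%:E * g2 + (w * s2)%:E)) +
  ((k%:E * g3 + (w * s3)%:E) + (k%:E * g4 + (w * s4)%:E)) =
  k%:E * ((g1 + g2) + (g3 + g4)) + (w * ((s1 + s2) + (s3 + s4)))%:E)%E.
Proof.
move=> k0 h1 h2 h3 h4; rewrite (ge0_muleDr _ (adde_ge0 h1 h2) (adde_ge0 h3 h4)).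
rewrite (ge0_muleDr _ h1 h2) (ge0_muleDr _ h3 h4) !mulrDr !EFinD.
exact/esym/regroup4.
Qed.

(** Each subdivision halves the side. The gradient energies of the four squares add up to that of
    the large one, so the constant decreases with the side, while only the list of corners grows.
    The list does not depend on [u]. *)
Lemma quadtree n a b s : 0 < s -> exists L : seq (R * R), forall u, smooth u ->
  (\int[mu]_(x in square a b s) (`|u x| `^ p)%:E <=
   (2 `^ p * 2 `^ p * (s / 2 ^+ n) `^ p)%:E * grad_energy p u (square a b s) +
   (avg_weight p (s / 2 ^+ n) *
     \sum_(c <- L) `|\int[mu]_(x in square c.1 c.2 (s / 2 ^+ n)) u x| `^ p)%:E)%E.
Proof.
elim: n a b s => [|n IH] a b s s0.
  exists [:: (a, b)] => u su; rewrite big_seq1 expr0 divr1; exact: square_poincare.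
have s2 : 0 < s / 2 by rewrite divr_gt0.
have [L1 H1] := IH a b _ s2; have [L2 H2] := IH (a + s / 2) b _ s2.
have [L3 H3] := IH a (b + s / 2) _ s2; have [L4 H4] := IH (a + s / 2) (b + s / 2) _ s2.
have hE : s / 2 ^+ n.+1 = s / 2 / 2 ^+ n by rewrite exprS invfM mulrA.
exists ((L1 ++ L2) ++ (L3 ++ L4)) => u su; rewrite hE !big_cat /=.
have M (v : plane -> R) : continuous v -> measurable_fun setT (fun x : mplane => (`|v x| `^ p)%:E).
  by move=> cv; apply/measurable_EFinP; apply: continuous_measurable2; exact: continuous_powR_norm.
have E0 (v : plane -> R) x : (0 <= (`|v x| `^ p)%:E)%E by rewrite lee_fin powR_ge0.
have S v cv := square_split a b s0 (E0 v) (M v cv).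
have GE : grad_energy p u (square a b s) =
    ((grad_energy p u (square a b (s / 2)) + grad_energy p u (square (a + s / 2) b (s / 2))) +
     (grad_energy p u (square a (b + s / 2) (s / 2)) +
      grad_energy p u (square (a + s / 2) (b + s / 2) (s / 2))))%E.
  have S0 := S _ (smooth_continuous (smooth_partial false su)).
  have S1 := S _ (smooth_continuous (smooth_partial true su)).
  exact: etrans (congr2 (fun x y => (x + y)%E) S0 S1) (regroup4 _ _ _ _ _ _ _ _).
rewrite (S _ (smooth_continuous su)).
have le := leeD (leeD (H1 u su) (H2 u su)) (leeD (H3 u su) (H4 u su)).
apply: (le_trans le); rewrite GE -quad_arith//; try exact: grad_energy_ge0.
by rewrite mulr_ge0 ?powR_ge0// mulr_ge0 ?powR_ge0.
Qed.

Lemma small_power (eps c s : R) : 0 < eps -> 0 < c -> 0 < s ->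
  exists n : nat, c * (s / 2 ^+ n) `^ p <= eps.
Proof.
move=> e0 c0 s0; pose d := (eps / c) `^ p^-1.
have d0 : 0 < d by rewrite powR_gt0// divr_gt0.
have [n hn] : exists n : nat, s / d < n%:R by exists (Num.bound (s / d)); exact/archi_boundP/ltW/divr_gt0.
exists n; rewrite mulrC -ler_pdivlMr//.
have -> : eps / c = d `^ p by rewrite -powRrM mulVf ?gt_eqF// powRr1// ltW// divr_gt0.
apply: ge0_ler_powR; rewrite ?nnegrE ?(ltW p0) ?(ltW d0)//.
  by rewrite divr_ge0 ?(ltW s0)// exprn_ge0.
rewrite ler_pdivrMr ?exprn_gt0// mulrC -ler_pdivrMr//; apply: (le_trans (ltW hn)).
by rewrite -natrX ler_nat ltnW// ltn_expl.
Qed.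

Variables (Omega : set plane) (oO : open Omega) (bO : bounded_set Omega).
Local Notation nr := (nrm mu Omega p).
Local Notation test := (test Omega).
Let mO : measurable (Omega : set mplane). Proof. exact: open_measurable2. Qed.

Lemma test_square_integral f (D : set plane) : csupp Omega f -> Omega `<=` D ->
  measurable (D : set mplane) -> continuous f ->
  (\int[mu]_(x in D) (`|f x| `^ p)%:E = \int[mu]_(x in Omega) (`|f x| `^ p)%:E)%E.
Proof.
move=> cf OD mD cc.
rewrite integral_mkcond [RHS]integral_mkcond; apply: eq_integral => x _.
rewrite !patchE; case: ifPn => xD; case: ifPn => xO //.
  by rewrite (csupp_out cf) ?normr0 ?powR0 ?gt_eqF// => /mem_set; rewrite (negPf xO).
by move: xD; rewrite notin_setE => /(_ (OD _ (set_mem xO))).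
Qed.

Lemma coarse_poincare (eps : R) : 0 < eps -> exists (w h : R) (L : seq (R * R)),
  [/\ 0 <= w, 0 < h & forall u, test u ->
    nr u `^ p <= eps * (nr (partial false u) `^ p + nr (partial true u) `^ p) +
      w * \sum_(c <- L) `|\int[mu]_(x in square c.1 c.2 h) u x| `^ p].
Proof.
move=> e0; have [M M0 HM] := bounded_box bO.
(* The extra 1 makes the half-open square contain the closed box of half-side [M]. *)
pose s := 2 * M + 1; have s0 : 0 < s by rewrite /s; lra.
have OS : Omega `<=` square (- M) (- M) s.
  move=> x /HM[]; rewrite !ler_norml => /andP[h1 h2] /andP[h3 h4].
  by split; rewrite /= in_itv /= /s; apply/andP; split; lra.
have c0 : 0 < (2 : R) `^ p * 2 `^ p by rewrite mulr_gt0 ?powR_gt0.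
have [n hn] := small_power e0 c0 s0.
have [L HL] := quadtree n (- M) (- M) s0.
exists (avg_weight p (s / 2 ^+ n)), (s / 2 ^+ n), L; split.
- by rewrite /avg_weight mulr_ge0 ?powR_ge0// mulr_ge0 ?powR_ge0// -expr2 sqr_ge0.
- by rewrite divr_gt0// exprn_gt0.
move=> u tu; have := HL u tu.1.
have Sq := @square_measurable R (- M) (- M) s.
have E v (tv : test v) := etrans (test_square_integral tv.2 OS Sq (test_cont tv))
  (Lp_energy p1 (test_Lp oO bO p1 tv)).
have GE : grad_energy p u (square (- M) (- M) s) =
    (nr (partial false u) `^ p + nr (partial true u) `^ p)%:E.
  exact: (congr2 (fun x y => (x + y)%E) (E _ (test_partial false tu)) (E _ (test_partial true tu))).
rewrite GE (E _ tu) -?(EFinD, EFinM) lee_fin => le1; apply: (le_trans le1).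
by rewrite lerD2r ler_wpM2r// addr_ge0 ?powR_ge0.
Qed.

Variables (phi : nat -> plane -> R) (M : R).
Hypothesis tphi : forall n, test (phi n).
Hypothesis bphi : forall n, nr (phi n) <= M.
Hypothesis bdphi : forall n i, nr (partial i (phi n)) <= M.

Lemma test_average_bound a b h : 0 < h ->
  exists C : R, forall n, `|\int[mu]_(x in square a b h) phi n x| <= C.
Proof.
move=> h0; have mS := @square_measurable R a b h.
have hh : 0 < h * h by rewrite mulr_gt0.
have muS : mu (square a b h) = (h * h)%:E by exact: square_measure.
have M0 : 0 <= M by exact: le_trans (nrm_ge0 _ _ _ _) (bphi 0).
exists (((h * h) `^ (p - 1) * M `^ p) `^ p^-1) => n.
have LS := square_Lp p1 a b h0 (test_cont (tphi n)).
apply: (powR_le_cancel p1) => //; first exact: powR_ge0.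
rewrite -powRrM mulVf ?gt_eqF// powRr1 ?mulr_ge0 ?powR_ge0// -lee_fin.
apply: (le_trans (integral_pow_le p1 mS (ltW hh) muS LS)).
rewrite EFinM; apply: lee_wpmul2l; first by rewrite lee_fin powR_ge0.
apply: (@le_trans _ _ (\int[mu]_x (`|phi n x| `^ p)%:E)%E).
  have mT : measurable_fun setT (fun x : mplane => (`|phi n x| `^ p)%:E).
    apply/measurable_EFinP; apply: continuous_measurable2.
    exact: continuous_powR_norm p0 (test_cont (tphi n)).
  by apply: (ge0_subset_integral mu mS measurableT mT) => // x _; rewrite lee_fin powR_ge0.
rewrite (test_square_integral (tphi n).2 (@subsetT _ _) measurableT (test_cont (tphi n))).
rewrite (Lp_energy p1 (test_Lp oO bO p1 (tphi n))) lee_fin.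
by apply: ge0_ler_powR; rewrite ?nnegrE ?nrm_ge0 ?(ltW p0).
Qed.

(* Along an ultrafilter the averages over all the cells converge, which avoids
   the successive extractions. *)
Lemma ultra_averages (F : set_system nat) (UF : UltraFilter F) h (L : seq (R * R)) delta :
  0 < h -> 0 < delta -> exists2 A, F A & forall m n, A m -> A n ->
  \sum_(c <- L) `|\int[mu]_(x in square c.1 c.2 h) (phi m x - phi n x)| `^ p <= delta.
Proof.
move=> h0; have PF := @ultra_proper _ _ UF.
elim: L delta => [|[a b] L IH] delta d0.
  by exists setT; [exact: filterT|move=> m n _ _; rewrite big_nil ltW].
have d2 : 0 < delta / 2 by rewrite divr_gt0.
have [A FA HA] := IH _ d2; have [C HC] := test_average_bound a b h0.
have d3 : 0 < (delta / 2) `^ p^-1 by rewrite powR_gt0.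
have [B FB HB] := ultrafilter_cauchy UF HC d3.
exists (A `&` B); first exact: filterI.
move=> m n [Am Bm] [An Bn]; rewrite big_cons /=.
have -> : delta = delta / 2 + delta / 2 by field.
apply: lerD; last exact: HA.
have mS := @square_measurable R a b h.
have muS : mu (square a b h) = (h * h)%:E by exact: square_measure.
have iS k := Lp_integrable mS p1 muS (square_Lp p1 a b h0 (test_cont (tphi k))).
rewrite (RintegralB mS (iS m) (iS n)).
apply: (@le_trans _ _ (((delta / 2) `^ p^-1) `^ p)).
  by apply: ge0_ler_powR; rewrite ?nnegrE ?powR_ge0 ?(ltW p0)//; exact: HB.
by rewrite -powRrM mulVf ?gt_eqF// powRr1// ltW.
Qed.

Lemma testB (f g : plane -> R) : test f -> test g -> test (fun x => f x - g x).
Proof.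
move=> tf tg; have := testD tf (testZ (-1) tg).
by congr test; apply/funext => x; rewrite mulN1r.
Qed.

Lemma partialB i (f g : plane -> R) : smooth f -> smooth g ->
  partial i (fun x => f x - g x) = (fun x => partial i f x - partial i g x).
Proof.
move=> sf sg; have := partialD i sf (smoothZ (-1) sg); rewrite partialZ//.
have -> : (fun x => f x + -1 * g x) = (fun x => f x - g x) by apply/funext => x; rewrite mulN1r.
by move=> ->; apply/funext => x; rewrite mulN1r.
Qed.

(** Half of [E] goes to each term; adding 1 to the denominators allows [K] and [w] to be 0. *)
Lemma combine_small (A B K w E : R) : 0 <= E -> 0 <= w -> 0 <= K -> A <= K ->
  B <= E / 2 / (w + 1) -> E / 2 / (K + 1) * A + w * B <= E.
Proof.
move=> E0 w0 K0 AK BE.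
have h t : 0 <= t -> E / 2 / (t + 1) * t <= E / 2.
  move=> t0; rewrite -mulrA ler_piMr ?divr_ge0// mulrC ler_pdivrMr ?ltr_wpDl// mul1r lerDl//.
have h1 : E / 2 / (K + 1) * A <= E / 2 / (K + 1) * K by rewrite ler_wpM2l// !divr_ge0 ?addr_ge0.
have h2 : w * B <= E / 2 / (w + 1) * w by rewrite mulrC ler_wpM2r.
have := h K K0; have := h w w0; lra.
Qed.

Lemma ultra_rellich (F : set_system nat) (UF : UltraFilter F) e : 0 < e ->
  exists2 A, F A & forall m n, A m -> A n -> nr (fun x => phi m x - phi n x) <= e.
Proof.
move=> e0; have M0 : 0 <= M by exact: le_trans (nrm_ge0 _ _ _ _) (bphi 0).
pose K := (2 * M) `^ p + (2 * M) `^ p.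
have K0 : 0 <= K by rewrite addr_ge0 ?powR_ge0.
have ep : 0 < e `^ p by rewrite powR_gt0.
have eps0 : 0 < e `^ p / 2 / (K + 1) by rewrite !divr_gt0// ltr_wpDl.
have [w [h [L [w0 h0 HL]]]] := coarse_poincare eps0.
have del0 : 0 < e `^ p / 2 / (w + 1) by rewrite !divr_gt0// ltr_wpDl.
have [A FA HA] := ultra_averages UF L h0 del0.
exists A => // m n Am An; have tB := testB (tphi m) (tphi n).
apply: (powR_le_cancel p1); [exact: nrm_ge0|exact: ltW|].
apply: (le_trans (HL _ tB)).
have nB i : nr (partial i (fun x => phi m x - phi n x)) `^ p <= (2 * M) `^ p.
  apply: ge0_ler_powR; rewrite ?nnegrE ?nrm_ge0 ?mulr_ge0 ?(ltW p0)//.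
  rewrite (partialB _ (tphi m).1 (tphi n).1).
  have LP k := test_Lp oO bO p1 (test_partial i (tphi k)).
  have := nrmD mO p1 (LP m) (LpZ mO p1 (-1) (LP n)).
  rewrite (nrmZ mO p1 (-1) (LP n)) normrN1 mul1r.
  under [in X in X -> _]eq_fun do rewrite mulN1r.
  by move=> h1; apply: (le_trans h1); have := bdphi m i; have := bdphi n i; lra.
have h1 := lerD (nB false) (nB true); have h2 := HA m n Am An.
exact: (combine_small (ltW ep) w0 K0 h1 h2).
Qed.

(** [sigma k] is picked in the intersection of the first [k + 1] sets of the ultrafilter, beyond
    [k]. It need not be increasing: [k <= sigma k] is enough to keep a sequence minimizing. *)
Lemma rellich : exists sigma : nat -> nat, (forall k, (k <= sigma k)%N) /\
  forall k i j, (k <= i)%N -> (k <= j)%N ->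
    nr (fun x => phi (sigma i) x - phi (sigma j) x) <= k.+1%:R^-1.
Proof.
have [F [UF FT]] := @ultraFilterLemma nat eventually _.
have PF := @ultra_proper _ _ UF.
have /choice[A HA] k : exists A, F A /\ forall m n, A m -> A n ->
    nr (fun x => phi m x - phi n x) <= k.+1%:R^-1.
  by have [|A FA H] := @ultra_rellich F UF k.+1%:R^-1; [rewrite invr_gt0|exists A].
have FB k : F ([set n | forall j, (j <= k)%N -> A j n] `&` [set n | (k <= n)%N]).
  apply: filterI; last by apply: FT; exists k.
  elim: k => [|k IH].
    by apply: filterS (HA 0%N).1 => n An j; rewrite leqn0 => /eqP ->.
  apply: filterS (filterI IH (HA k.+1).1) => n [h1 h2] j.
  by rewrite leq_eqVlt ltnS => /orP[/eqP ->//|]; exact: h1.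
have /choice[sigma Hs] k : exists n, [set n | forall j, (j <= k)%N -> A j n] n /\ (k <= n)%N.
  by have /filter_ex[n [h1 h2]] := FB k; exists n.
exists sigma; split=> [k|k i j ki kj]; first exact: (Hs k).2.
by apply: (HA k).2; [exact: (Hs i).1|exact: (Hs j).1].
Qed.

End rellich.

(** * Strictly convex perturbations *)

Section power_convexity.
Context {R : realType}.
Variables (p : R) (p1 : 1 < p).
Implicit Types (s t r : R).
Let p0 : 0 < p. Proof. exact: lt_trans ltr01 p1. Qed.
Let pm0 : 0 <= p - 1. Proof. by rewrite subr_ge0 ltW. Qed.
Let dpos s := p * pospow (p - 1) s.

(** The convex function lies above its tangents, by the mean value theorem and monotonicity of the
    derivative. *)
Lemma pospow_tangent s t : dpos s * (t - s) <= pospow p t - pospow p s.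
Proof.
have dE r : is_derive r 1 (pospow p) (dpos r) by exact: pospow_is_derive.
have cc : continuous (pospow p) by exact: pospow_continuous.
have mono a b : a <= b -> dpos a <= dpos b.
  by move=> ab; rewrite ler_wpM2l ?(ltW p0)//; exact: pospow_le.
have [st|ts] := leP s t.
  have [c] := MVT_segment st (fun x _ => dE x) (continuous_subspaceT cc).
  by rewrite in_itv /= => /andP[sc ct] ->; rewrite ler_wpM2r ?subr_ge0// mono.
have [c] := MVT_segment (ltW ts) (fun x _ => dE x) (continuous_subspaceT cc).
rewrite in_itv /= => /andP[tc cs] E; rewrite -[X in _ <= X]opprB E -[t - s]opprB mulrN lerN2.
by rewrite ler_wpM2r ?subr_ge0 ?(ltW ts)// mono.
Qed.

Lemma pospow_lip s t : `|pospow p t - pospow p s| <= p * (`|s| + `|t|) `^ (p - 1) * `|t - s|.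
Proof.
have B r : `|r| <= `|s| + `|t| -> dpos r <= p * (`|s| + `|t|) `^ (p - 1).
  move=> h; rewrite ler_wpM2l ?(ltW p0)// /pospow; apply: ge0_ler_powR => //.
  - by rewrite nnegrE le_max lexx orbT.
  - by rewrite nnegrE addr_ge0.
  - by rewrite ge_max addr_ge0// andbT; apply: le_trans (ler_norm _) h.
have D0 r : 0 <= dpos r by rewrite mulr_ge0 ?pospow_ge0// ltW.
have Bs : dpos s <= p * (`|s| + `|t|) `^ (p - 1) by apply: B; rewrite lerDl.
have Bt : dpos t <= p * (`|s| + `|t|) `^ (p - 1) by apply: B; rewrite lerDr.
have T1 := pospow_tangent s t; have T2 := pospow_tangent t s.
have L r : dpos r <= p * (`|s| + `|t|) `^ (p - 1) ->
    `|dpos r * (t - s)| <= p * (`|s| + `|t|) `^ (p - 1) * `|t - s|.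
  by move=> h; rewrite normrM ger0_norm// ler_wpM2r.
have /ler_normlP[A1 A2] := L s Bs; have /ler_normlP[B1 B2] := L t Bt.
rewrite -opprB mulrN in T2.
by rewrite ler_norml; apply/andP; split; lra.
Qed.

Lemma pospow_convex (c d : R) s t : 0 <= c -> 0 <= d -> c + d = 1 ->
  pospow p (c * s + d * t) <= c * pospow p s + d * pospow p t.
Proof.
move=> c0 d0 cd; set m := c * s + d * t.
have T1 := pospow_tangent m s; have T2 := pospow_tangent m t.
have h1 := ler_wpM2l c0 T1; have h2 := ler_wpM2l d0 T2.
have E : c * (dpos m * (s - m)) + d * (dpos m * (t - m)) = 0.
  by rewrite /m (_ : d = 1 - c); [ring|lra].
have h3 : c * (pospow p s - pospow p m) + d * (pospow p t - pospow p m) =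
    c * pospow p s + d * pospow p t - (c + d) * pospow p m by ring.
by rewrite cd mul1r in h3; lra.
Qed.

Lemma powR_norm_convex (c d : R) s t : 0 <= c -> 0 <= d -> c + d = 1 ->
  `|c * s + d * t| `^ p <= c * `|s| `^ p + d * `|t| `^ p.
Proof.
move=> c0 d0 cd; have pN0 : p != 0 by rewrite gt_eqF.
rewrite !(powR_normE _ pN0) opprD -!mulrN !mulrDr.
have h1 := pospow_convex s t c0 d0 cd; have h2 := pospow_convex (- s) (- t) c0 d0 cd; lra.
Qed.

Definition defect s t := (`|s| `^ p + `|t| `^ p) / 2 - `|(s + t) / 2| `^ p.

Lemma defect_ge0 s t : 0 <= defect s t.
Proof.
have h2 : 0 <= (2^-1 : R) by rewrite invr_ge0.
have h : (2^-1 : R) + 2^-1 = 1 by lra.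
have := powR_norm_convex s t h2 h2 h; rewrite -mulrDr (mulrC 2^-1) /defect; lra.
Qed.

(** With b = |r| and midpoint m = (1 + b) / 2, the increment over [m, 1] is strictly larger than the
    slope at m predicts, and the increment over [b, m] is at most that. The case r = -1 has b = 1
    and is direct. *)
Lemma defect_gt0 r : -1 <= r -> r < 1 -> 0 < defect 1 r.
Proof.
move=> rm r1; have pN0 : p != 0 by rewrite gt_eqF.
pose b := `|r|; have b0 : 0 <= b by exact: normr_ge0.
have b1 : b <= 1 by rewrite ler_norml rm ltW.
pose m := (1 + b) / 2.
have m0 : 0 < m by rewrite /m; lra.
have abs : `|(1 + r) / 2| = (1 + r) / 2 by rewrite ger0_norm//; lra.
have [bl|bl] := ltP b 1; last first.
  have r_1 : r = -1.
    have [r0|r0] := leP 0 r; first by rewrite /b ger0_norm// in bl; lra.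
    by rewrite /b ltr0_norm// in bl; lra.
  by rewrite /defect r_1 normrN1 normr1 powR1 subrr mul0r normr0 powR0//; lra.
have m1 : m < 1 by rewrite /m; lra.
have le : `|(1 + r) / 2| `^ p <= m `^ p.
  apply: ge0_ler_powR; rewrite ?nnegrE ?(ltW p0) ?(ltW m0)// abs /m.
  by have := ler_norm r; rewrite -/b; lra.
have [c] := MVT m1 (fun x _ => @pospow_is_derive R p x p1) (continuous_subspaceT (pospow_continuous p0)).
rewrite in_itv /= => /andP[mc c1] E; have T := pospow_tangent m b.
have c0 := lt_trans m0 mc.
have lt : pospow (p - 1) m < pospow (p - 1) c.
  rewrite !pospow_pos ?ltW//; apply: gt0_ltr_powR; rewrite ?nnegrE ?ltW ?subr_gt0//.
have h : p * pospow (p - 1) m * (1 - m) < p * pospow (p - 1) c * (1 - m).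
  by rewrite ltr_pM2r ?subr_gt0// ltr_pM2l.
rewrite /dpos (_ : b - m = - (1 - m)) in T; last by rewrite /m; lra.
rewrite !pospow_pos ?(ltW m0) ?(ltW c0)// in T E h.
rewrite /defect -/b normr1 powR1; rewrite powR1 in E; lra.
Qed.

Lemma defect_continuous : continuous (defect 1).
Proof.
have h := powR_norm_continuous p0.
move=> r; apply: cvgB.
  by apply: cvgM; [apply: cvgD; [exact: cvg_cst|exact: h]|exact: cvg_cst].
apply: (cvg_comp (fun t : R => (1 + t) / 2) (fun t : R => `|t| `^ p)); last exact: h.
by apply: cvgM; [apply: cvgD; [exact: cvg_cst|exact: cvg_id]|exact: cvg_cst].
Qed.

(** A compactness argument valid for every p > 1, where Clarkson's inequalities would distinguish p
    < 2. By homogeneity the larger number becomes 1 and the other one r in [-1, 1]: away from 1 the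
    defect has a positive minimum, which absorbs 2^p, and near 1 the left-hand side is at most
    eta. *)
Lemma uniform_convexity (eta : R) : 0 < eta -> exists2 c, 0 <= c & forall s t,
  `|s - t| `^ p <= eta * (`|s| `^ p + `|t| `^ p) + c * defect s t.
Proof.
move=> e0; pose d := Num.min (eta `^ p^-1) 1.
have d0 : 0 < d by rewrite lt_min ltr01 powR_gt0.
have d1 : d <= 1 by rewrite ge_min lexx orbT.
have de : d `^ p <= eta.
  apply: (@le_trans _ _ ((eta `^ p^-1) `^ p)).
    by apply: ge0_ler_powR; rewrite ?nnegrE ?powR_ge0 ?(ltW p0) ?(ltW d0)// ge_min lexx.
  by rewrite -powRrM mulVf ?gt_eqF// powRr1// ltW.
have K0 : (`[-1, 1 - d]%classic : set R) !=set0 by exists (-1); rewrite /= in_itv /= lexx /=; lra.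
have [r0 r0K rmin] := compact_EVT_min K0 (@segment_compact R (-1) (1 - d))
  (continuous_subspaceT defect_continuous).
pose m := defect 1 r0; have m0 : 0 < m.
  by move: r0K; rewrite inE /= in_itv /= => /andP[h1 h2]; apply: defect_gt0 => //; lra.
have c0 : 0 <= 2 `^ p / m by rewrite divr_ge0 ?powR_ge0// ltW.
exists (2 `^ p / m) => // s t.
wlog ts : s t / `|t| <= `|s|.
  move=> H; have [|/ltW st] := leP `|t| `|s|; first exact: H.
  by have := H t s st; rewrite /defect distrC (addrC t) [_ `^ p + _ `^ p]addrC.
have [s0|s0] := eqVneq s 0.
  have t0 : t = 0 by apply/normr0_eq0/eqP; rewrite -normr_le0 normr_id -[X in _ <= X](@normr0 R R) -s0.
  rewrite s0 t0 subrr normr0 powR0 ?gt_eqF// addr0 mulr0 add0r mulr_ge0//.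
  exact: defect_ge0.
pose r := t / s; have tE : t = s * r by rewrite /r mulrCA mulfV// mulr1.
have sp : 0 < `|s| `^ p by rewrite powR_gt0 ?normr_gt0.
have r1 : `|r| <= 1 by rewrite /r normrM normfV ler_pdivrMr ?normr_gt0// mul1r.
have E1 : `|s - t| `^ p = `|s| `^ p * `|1 - r| `^ p.
  by rewrite tE -[X in `|X - _|]mulr1 -mulrBr normrM powRM.
have E2 : `|t| `^ p = `|s| `^ p * `|r| `^ p by rewrite tE normrM powRM.
have E3 : defect s t = `|s| `^ p * defect 1 r.
  rewrite /defect E2 normr1 powR1 tE.
  have -> : (s + s * r) / 2 = s * ((1 + r) / 2) by field.
  have -> : `|s * ((1 + r) / 2)| `^ p = `|s| `^ p * `|(1 + r) / 2| `^ p by rewrite [in LHS]normrM powRM.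
  by field.
rewrite E1 E2 E3 (_ : eta * _ + _ = `|s| `^ p * (eta * (1 + `|r| `^ p) + 2 `^ p / m * defect 1 r)); last by field; rewrite gt_eqF.
rewrite ler_pM2l//.
have rp : 0 <= `|r| `^ p by exact: powR_ge0.
move: r1; rewrite ler_norml => /andP[r_1 r_2].
have n1 : `|1 - r| = 1 - r by rewrite ger0_norm// subr_ge0.
have D0 := defect_ge0 1 r.
have [rd|rd] := leP r (1 - d).
  have le1 : `|1 - r| `^ p <= 2 `^ p.
    by apply: ge0_ler_powR; rewrite ?nnegrE ?(ltW p0)// n1; lra.
  have le2 : m <= defect 1 r by apply: rmin; rewrite inE /= in_itv /= r_1.
  apply: (le_trans le1); apply: (@le_trans _ _ (2 `^ p / m * m)).
    by rewrite mulfVK ?gt_eqF.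
  apply: (@le_trans _ _ (2 `^ p / m * defect 1 r)); first by rewrite ler_wpM2l.
  by rewrite lerDr mulr_ge0 ?addr_ge0// ltW.
have le1 : `|1 - r| `^ p <= d `^ p.
  by apply: ge0_ler_powR; rewrite ?nnegrE ?(ltW p0) ?(ltW d0)// n1; lra.
apply: (le_trans le1); apply: (le_trans de); apply: (@le_trans _ _ (eta * (1 + `|r| `^ p))).
  by rewrite ler_peMr ?(ltW e0)// lerDl.
by rewrite lerDl mulr_ge0.
Qed.

End power_convexity.

Section perturbed_anisotropy.
Context {R : realType}.
Local Notation plane := (R * R)%type.
Local Notation mu1 := (@lebesgue_measure R).
Local Notation mu := (mu1 \x mu1)%E.
Local Notation mplane := (measurableTypeR R * measurableTypeR R)%type.
Variables (p : R) (p1 : 1 < p).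
Let p0 : 0 < p. Proof. exact: lt_trans ltr01 p1. Qed.
Let pN0 : p != 0. Proof. by rewrite gt_eqF. Qed.

(** Integrates a pointwise inequality between two-term combinations of p-th powers; a single term is
    obtained with a zero coefficient. *)
Lemma energy_le d (T : measurableType d) (m : {measure set T -> \bar R}) (D : set T)
    (mD : measurable D) (f g f' g' : T -> R) (a b a' b' : R) :
  0 <= a -> 0 <= b -> 0 <= a' -> 0 <= b' ->
  Lp m D p f -> Lp m D p g -> Lp m D p f' -> Lp m D p g' ->
  (forall x, a * `|f x| `^ p + b * `|g x| `^ p <= a' * `|f' x| `^ p + b' * `|g' x| `^ p) ->
  a * nrm m D p f `^ p + b * nrm m D p g `^ p <= a' * nrm m D p f' `^ p + b' * nrm m D p g' `^ p.
Proof.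
move=> a0 b0 a'0 b'0 Lf Lg Lf' Lg' H.
have E (c c' : R) h h' : 0 <= c -> 0 <= c' -> Lp m D p h -> Lp m D p h' ->
    (\int[m]_(x in D) (c * `|h x| `^ p + c' * `|h' x| `^ p)%:E =
     (c * nrm m D p h `^ p + c' * nrm m D p h' `^ p)%:E)%E.
  move=> c0 c'0 Lh Lh'.
  have mh := energy_measurable p (Lp_measurable Lh); have mh' := energy_measurable p (Lp_measurable Lh').
  under eq_integral do rewrite EFinD !EFinM.
  rewrite ge0_integralD//; last 4 first.
  - by move=> x _; rewrite mule_ge0 ?lee_fin ?powR_ge0.
  - exact: measurable_funeM.
  - by move=> x _; rewrite mule_ge0 ?lee_fin ?powR_ge0.
  - exact: measurable_funeM.
  rewrite !ge0_integralZl_EFin//; try by move=> x _; rewrite lee_fin powR_ge0.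
  by rewrite (Lp_energy p1 Lh) (Lp_energy p1 Lh') -!EFinM -EFinD.
rewrite -lee_fin -(E _ _ _ _ a0 b0 Lf Lg) -(E _ _ _ _ a'0 b'0 Lf' Lg').
apply: le_integral_ge0 => x _; last by rewrite lee_fin; exact: H.
by rewrite lee_fin addr_ge0// mulr_ge0 ?powR_ge0.
Qed.

Variables (e : plane) (al be : R) (al0 : 0 < al) (be0 : 0 < be).
Implicit Types (x y : plane).

(** The p-th power of the perturbed anisotropy. The one-sided term is degenerate on a half-plane;
    the second term makes [Phi] positive off 0 and controls both components of the gradient. [aniso]
    takes the p-th root to become 1-homogeneous. *)
Definition Phi x := al * pospow p (dot e x) + be * (`|x.1| `^ p + `|x.2| `^ p).

Definition aniso x := Phi x `^ p^-1.

Lemma Phi_ge0 x : 0 <= Phi x.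
Proof. by rewrite addr_ge0// mulr_ge0 ?(ltW al0) ?(ltW be0) ?pospow_ge0// addr_ge0 ?powR_ge0. Qed.

Lemma dotZr (t : R) x : dot e (t *: x) = t * dot e x.
Proof. by rewrite /dot /= /GRing.scale /=; ring. Qed.

Lemma dotDr x y : dot e (x + y) = dot e x + dot e y.
Proof. by rewrite /dot /=; ring. Qed.

Lemma PhiZ (t : R) x : 0 <= t -> Phi (t *: x) = t `^ p * Phi x.
Proof.
move=> t0; rewrite /Phi dotZr pospowMl//= /GRing.scale /= !normrM (ger0_norm t0) !powRM//.
by ring.
Qed.

Lemma Phi_convex (c d : R) x y : 0 <= c -> 0 <= d -> c + d = 1 ->
  Phi (c *: x + d *: y) <= c * Phi x + d * Phi y.
Proof.
move=> c0 d0 cd; rewrite /Phi dotDr !dotZr.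
have h1 := ler_wpM2l (ltW al0) (pospow_convex p1 (dot e x) (dot e y) c0 d0 cd).
have h2 := ler_wpM2l (ltW be0) (powR_norm_convex p1 x.1 y.1 c0 d0 cd).
have h3 := ler_wpM2l (ltW be0) (powR_norm_convex p1 x.2 y.2 c0 d0 cd).
rewrite /= /GRing.scale /=; lra.
Qed.

Lemma Phi_eq0 x : Phi x = 0 -> x = 0.
Proof.
move=> /eqP; rewrite paddr_eq0; last 2 first.
- by rewrite mulr_ge0 ?(ltW al0) ?pospow_ge0.
- by rewrite mulr_ge0 ?(ltW be0)// addr_ge0 ?powR_ge0.
move=> /andP[_]; rewrite mulf_eq0 gt_eqF//= paddr_eq0 ?powR_ge0//.
rewrite !powR_eq0 !normr_eq0 !pN0 !andbT; case: x => a b /= /andP[/eqP -> /eqP ->].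
by [].
Qed.

Lemma Phi0 : Phi 0 = 0.
Proof. by have := PhiZ 0 (lexx 0); rewrite scale0r powR0// mul0r. Qed.

Lemma aniso_ge0 x : 0 <= aniso x.
Proof. exact: powR_ge0. Qed.

Lemma aniso_pow x : aniso x `^ p = Phi x.
Proof. by rewrite -powRrM mulVf// powRr1// Phi_ge0. Qed.

Lemma aniso_gt0 x : x != 0 -> 0 < Phi x.
Proof. by move=> x0; rewrite lt_neqAle Phi_ge0 andbT eq_sym; apply/eqP => /Phi_eq0/eqP; rewrite (negPf x0). Qed.

Lemma anisoZ (t : R) x : 0 < t -> aniso (t *: x) = t * aniso x.
Proof.
move=> t0; rewrite /aniso PhiZ ?(ltW t0)// powRM ?powR_ge0 ?Phi_ge0//.
by rewrite -powRrM mulfV// powRr1// ltW.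
Qed.

(** The gauge argument: [x] and [y] are normalized to the level set [Phi = 1], and their sum is a
    multiple of a convex combination of the normalized vectors, where [Phi] is at most 1. *)
Lemma anisoD x y : aniso (x + y) <= aniso x + aniso y.
Proof.
have [->|x0] := eqVneq x 0; first by rewrite add0r lerDr aniso_ge0.
have [->|y0] := eqVneq y 0; first by rewrite addr0 lerDl aniso_ge0.
have s0 : 0 < aniso x by rewrite powR_gt0// aniso_gt0.
have t0 : 0 < aniso y by rewrite powR_gt0// aniso_gt0.
have [s sE] : exists s, s = aniso x := ex_intro _ (aniso x) erefl.
have [t tE] : exists t, t = aniso y := ex_intro _ (aniso y) erefl.
rewrite -sE -tE in s0 t0 *.
have st : 0 < s + t := addr_gt0 s0 t0.
have E : x + y = (s + t) *: ((s / (s + t)) *: (s^-1 *: x) + (t / (s + t)) *: (t^-1 *: y)).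
  rewrite scalerDr !scalerA; congr (_ + _).
    by rewrite (_ : _ * _ = 1) ?scale1r//; field; rewrite !gt_eqF.
  by rewrite (_ : _ * _ = 1) ?scale1r//; field; rewrite !gt_eqF.
rewrite E anisoZ// -[X in _ <= X]mulr1 ler_pM2l//.
apply: (powR_le_cancel p1); rewrite ?aniso_ge0// aniso_pow powR1.
have c0 : 0 <= s / (s + t) by rewrite divr_ge0 ?ltW.
have d0 : 0 <= t / (s + t) by rewrite divr_ge0 ?ltW.
have cd : s / (s + t) + t / (s + t) = 1 by rewrite -mulrDl mulfV ?gt_eqF.
apply: (le_trans (Phi_convex _ _ c0 d0 cd)).
have U (r : R) z : 0 < r -> r = aniso z -> Phi (r^-1 *: z) = 1.
  move=> r0 rE; rewrite PhiZ ?invr_ge0 ?(ltW r0)// -aniso_pow -rE -powRM ?invr_ge0 ?(ltW r0)//.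
  by rewrite mulVf ?gt_eqF// powR1.
rewrite (U s x s0 sE) (U t y t0 tE) !mulr1 cd; exact: lexx.
Qed.

Lemma aniso_anisotropy : anisotropy aniso.
Proof. by apply: anisotropy_intro; [exact: aniso_ge0|exact: anisoD|exact: anisoZ]. Qed.

Variables (Omega : set plane) (oO : open Omega) (bO : bounded_set Omega).
Let mO : measurable (Omega : set mplane). Proof. exact: open_measurable2. Qed.
Local Notation nr := (nrm mu Omega p).
Local Notation LP := (Lp mu Omega p).
Local Notation test := (test Omega).
Implicit Types (u : plane -> R) (g : plane -> plane).

Definition LP2 g := LP (fun x => (g x).1) /\ LP (fun x => (g x).2).

Definition energy g :=
  al * nr (fun x => posdot e (g x)) `^ p + be * (nr (fun x => (g x).1) `^ p + nr (fun x => (g x).2) `^ p).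

Lemma energy_ge0 g : 0 <= energy g.
Proof. by rewrite addr_ge0// mulr_ge0 ?(ltW al0) ?(ltW be0) ?addr_ge0 ?powR_ge0. Qed.

Lemma LP2_posdot g : LP2 g -> LP (fun x => posdot e (g x)).
Proof. by move=> [L1 L2]; apply: max_Lp => //; exact: dot_measurable. Qed.

Lemma LP2_Phi g : LP2 g -> (\int[mu]_(x in Omega) (Phi (g x))%:E = (energy g)%:E)%E.
Proof.
move=> Lg; have [L1 L2] := Lg; have L3 := LP2_posdot Lg.
have m1 := energy_measurable p (Lp_measurable L1); have m2 := energy_measurable p (Lp_measurable L2).
have m3 := energy_measurable p (Lp_measurable L3).
have E x : (Phi (g x))%:E = (al%:E * (`|posdot e (g x)| `^ p)%:E +
    (be%:E * (`|(g x).1| `^ p)%:E + be%:E * (`|(g x).2| `^ p)%:E))%E.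
  rewrite -!EFinM -!EFinD; congr EFin.
  by rewrite /Phi /pospow (ger0_norm (posdot_ge0 _ _)) mulrDr.
have pos (c : R) (f : plane -> R) x : 0 < c -> (0 <= c%:E * (`|f x| `^ p)%:E)%E.
  by move=> c0; rewrite mule_ge0 ?lee_fin ?powR_ge0// ltW.
under eq_integral do rewrite E.
rewrite ge0_integralD//; last 4 first.
- by move=> x _; exact: (pos al (fun x => posdot e (g x))).
- exact: measurable_funeM.
- by move=> x _; apply: adde_ge0; [exact: (pos be (fun x => (g x).1))|exact: (pos be (fun x => (g x).2))].
- by apply: emeasurable_funD; exact: measurable_funeM.
rewrite ge0_integralD//; last 4 first.
- by move=> x _; exact: (pos be (fun x => (g x).1)).
- exact: measurable_funeM.
- by move=> x _; exact: (pos be (fun x => (g x).2)).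
- exact: measurable_funeM.
have Z (c : R) f : 0 < c -> LP f ->
    (\int[mu]_(x in Omega) (c%:E * (`|f x| `^ p)%:E) = (c * nr f `^ p)%:E)%E.
  move=> c0 Lf; rewrite ge0_integralZl_EFin ?(ltW c0)// ?(Lp_energy p1 Lf)//.
  exact: energy_measurable (Lp_measurable Lf).
by rewrite (Z _ _ al0 L3) (Z _ _ be0 L1) (Z _ _ be0 L2) -!EFinD /energy mulrDr.
Qed.

Lemma LP2_aniso_measurable g : LP2 g -> measurable_fun (Omega : set mplane) (fun x => aniso (g x)).
Proof.
move=> Lg; apply: (measurableT_comp (measurable_powR _)).
have [L1 L2] := Lg; have L3 := LP2_posdot Lg.
have m1 := (measurable_EFinP _ _).1 (energy_measurable p (Lp_measurable L1)).
have m2 := (measurable_EFinP _ _).1 (energy_measurable p (Lp_measurable L2)).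
have m3 := (measurable_EFinP _ _).1 (energy_measurable p (Lp_measurable L3)).
have -> : (fun x => Phi (g x)) = (fun x => al * `|posdot e (g x)| `^ p +
    be * (`|(g x).1| `^ p + `|(g x).2| `^ p)).
  by apply/funext => x; rewrite /Phi /pospow (ger0_norm (posdot_ge0 _ _)).
apply: measurable_funD; apply: measurable_funM => //; try exact: measurable_cst.
exact: measurable_funD.
Qed.

Lemma aniso_energy g : LP2 g -> (\int[mu]_(x in Omega) (aniso (g x) `^ p)%:E = (energy g)%:E)%E.
Proof. by move=> Lg; under eq_integral do rewrite aniso_pow; exact: LP2_Phi. Qed.

Local Notation Lam := (fine (lambdaH Omega p aniso)).
Hypothesis nO : Omega !=set0.

(** Finiteness needs one non-zero admissible function; [test_approx] in the direction 0 supplies a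
    test function. *)
Lemma lambda_aniso_fin : lambdaH Omega p aniso = Lam%:E /\ 0 <= Lam.
Proof.
have l0 : (0 <= lambdaH Omega p aniso)%E.
  by apply: le_ereal_inf_tmp => _ [u [g [_ _ ->]]]; apply: integral_ge0 => x _; rewrite lee_fin powR_ge0.
suff lty : (lambdaH Omega p aniso < +oo)%E by split; [rewrite fineK// ge0_fin_numE|exact: fine_ge0].
have W0 : 0 < 2 * width Omega 0 by rewrite mulr_gt0// width_gt0.
have lfin : (lambda1p p (2 * width Omega 0) < (fine (lambda1p p (2 * width Omega 0)) + 1)%:E)%E.
  rewrite EFinD fineK; last by rewrite ge0_fin_numE ?lambda1p_ge0// lambda1p_lty.
  by rewrite lteDl// fin_numE -ltNye -ltey (lt_le_trans _ (lambda1p_ge0 _ _))// lambda1p_lty.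
have [u [tu u0 _]] := test_approx oO bO nO p1 lfin.
have T i := test_Lp oO bO p1 (test_partial i tu).
have Lg : LP2 (grad u) by split; [exact: (T false)|exact: (T true)].
have := lambdaH_rayleigh oO bO p1 aniso_ge0 anisoZ (LP2_aniso_measurable Lg) (W01p_test oO bO p1 tu) u0.
rewrite (aniso_energy Lg); case: (lambdaH Omega p aniso) l0 => [r _ _|_|]//; first exact: ltry.
by rewrite gt0_mulye// lte_fin powR_gt0.
Qed.

Lemma energy_lower u g : W01p Omega p u g -> Lam * nr u `^ p <= energy g.
Proof.
move=> Wu; have [_ L _ _] := Wu; have := nrm_ge0 mu Omega p u.
rewrite le_eqVlt => /orP[/eqP <-|u0]; first by rewrite powR0// mulr0 energy_ge0.
have := lambdaH_rayleigh oO bO p1 aniso_ge0 anisoZ (LP2_aniso_measurable L) Wu u0.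
by rewrite (aniso_energy L) lambda_aniso_fin.1 -EFinM lee_fin.
Qed.

Lemma energy_cvg (phi_ : nat -> plane -> R) g : (forall n, test (phi_ n)) -> LP2 g ->
  Lp_cvg mu Omega p (fun n => partial false (phi_ n)) (fun x => (g x).1) ->
  Lp_cvg mu Omega p (fun n => partial true (phi_ n)) (fun x => (g x).2) ->
  energy (grad (phi_ n)) @[n --> \oo] --> energy g.
Proof.
move=> tphi Lg c1 c2; have [L1 L2] := Lg.
have T i n : LP (partial i (phi_ n)) by apply: test_Lp => //; exact: test_partial.
have c3 : Lp_cvg mu Omega p (fun n x => posdot e (grad (phi_ n) x)) (fun x => posdot e (g x)).
  have := posdot_cvg oO bO p1 e tphi L1 L2 c1 c2 (normr1 R).
  have -> : (fun x => Num.max (1 * dot e (g x)) 0) = (fun x => posdot e (g x)).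
    by apply/funext => x; rewrite mul1r.
  have -> // : (fun (n : nat) x => Num.max (1 * dot e (grad (phi_ n) x)) 0) =
      (fun (n : nat) x => posdot e (grad (phi_ n) x)).
  by apply/funext => n; apply/funext => x; rewrite mul1r.
have P f_ f : (forall n, LP (f_ n)) -> LP f -> Lp_cvg mu Omega p f_ f ->
    nr (f_ n) `^ p @[n --> \oo] --> nr f `^ p.
  by move=> Lf_ Lf cf; apply: cvg_powR => //; [move=> n; exact: nrm_ge0|exact: nrm_ge0|exact: Lp_cvg_nrm].
apply: cvgD; (apply: cvgM; first exact: cvg_cst).
  apply: P => //; last exact: LP2_posdot.
  by move=> n; apply: LP2_posdot; split; [exact: (T false)|exact: (T true)].
by apply: cvgD; apply: P => //; [exact: (T false)|exact: (T true)].
Qed.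

Lemma energyZ2 (c : R) g : 0 < c -> LP2 g -> energy (fun x => c *: g x) = c `^ p * energy g.
Proof.
move=> c0 Lg; have [L1 L2] := Lg; have L3 := LP2_posdot Lg.
have P f : LP f -> nr (fun x => c * f x) `^ p = c `^ p * nr f `^ p.
  by move=> Lf; rewrite nrmZ// gtr0_norm// powRM ?nrm_ge0// ltW.
have E3 : (fun x => posdot e (c *: g x)) = (fun x => c * posdot e (g x)).
  by apply/funext => x; rewrite posdotZ// ltW.
rewrite /energy E3 (P _ L3) (P (fun x => (g x).1) L1) (P (fun x => (g x).2) L2).
by ring.
Qed.

(** A minimizing sequence of normalized test functions, the class for which [rellich] is
    available. *)
Lemma minimizing_test (d : R) : 0 < d ->
  exists phi, [/\ test phi, nr phi = 1 & energy (grad phi) <= Lam + d].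
Proof.
move=> d0; have [lE l0] := lambda_aniso_fin.
have lt : (lambdaH Omega p aniso < (Lam + d)%:E)%E by rewrite [X in (X < _)%E]lE lte_fin ltrDl.
have [_ [u [g [Wu Nu ->]]] ltE] := ereal_inf_lt lt.
have [_ L _ _] := Wu; rewrite (aniso_energy L) lte_fin in ltE.
have nu : nr u = 1 by rewrite /nrm Nu.
have [phi_ [tphi c0 c1 c2]] := W01p_elim oO bO p1 Wu.
have [Lu _ _ _] := Wu.
have cn := Lp_cvg_nrm mO p1 (fun n => test_Lp oO bO p1 (tphi n)) Lu c0.
have cE := energy_cvg tphi L c1 c2.
have cnp : nr (phi_ n) `^ p @[n --> \oo] --> nr u `^ p.
  by apply: cvg_powR => //; [move=> n; exact: nrm_ge0|exact: nrm_ge0].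
have cD : energy (grad (phi_ n)) - (Lam + d) * nr (phi_ n) `^ p @[n --> \oo] -->
    energy g - (Lam + d) * nr u `^ p.
  by apply: cvgB => //; apply: cvgM => //; exact: cvg_cst.
rewrite nu powR1 mulr1 in cD.
have lt0 : energy g - (Lam + d) < 0 by rewrite subr_lt0.
have u0 : 0 < nr u by rewrite nu.
have [n [h1 h2]] := filter_ex (filterI (cvgr_lt _ cD _ lt0) (cvgr_gt _ cn _ u0)).
exists (fun x => (nr (phi_ n))^-1 * phi_ n x).
have c_0 : 0 < (nr (phi_ n))^-1 by rewrite invr_gt0.
have Ln := test_Lp oO bO p1 (tphi n).
split; first exact: testZ.
  by rewrite nrmZ// gtr0_norm// mulVf// gt_eqF.
have -> : grad (fun x => (nr (phi_ n))^-1 * phi_ n x) = (fun x => (nr (phi_ n))^-1 *: grad (phi_ n) x).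
  by apply/funext => x; rewrite /grad !(partialZ _ _ (tphi n).1).
have T i := test_Lp oO bO p1 (test_partial i (tphi n)).
rewrite energyZ2//; last by split; [exact: (T false)|exact: (T true)].
have np : 0 < nr (phi_ n) `^ p by rewrite powR_gt0.
rewrite subr_lt0 in h1; have h3 := ltW h1.
have -> : (nr (phi_ n))^-1 `^ p = (nr (phi_ n) `^ p)^-1.
  apply: (mulfI (lt0r_neq0 np)); rewrite mulfV ?gt_eqF// -powRM ?invr_ge0 ?(ltW h2)//.
  by rewrite mulfV ?gt_eqF// powR1.
by rewrite mulrC ler_pdivrMr.
Qed.

End perturbed_anisotropy.

(** * Existence of a minimizer for the perturbed anisotropy *)

Section minimizer.
Context {R : realType}.
Local Notation plane := (R * R)%type.
Local Notation mu1 := (@lebesgue_measure R).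
Local Notation mu := (mu1 \x mu1)%E.
Local Notation mplane := (measurableTypeR R * measurableTypeR R)%type.
Variables (p : R) (p1 : 1 < p).
Let p0 : 0 < p. Proof. exact: lt_trans ltr01 p1. Qed.
Let pN0 : p != 0. Proof. by rewrite gt_eqF. Qed.
Variables (e : plane) (al be : R) (al0 : 0 < al) (be0 : 0 < be).
Variables (Omega : set plane) (oO : open Omega) (bO : bounded_set Omega) (nO : Omega !=set0).
Let mO : measurable (Omega : set mplane). Proof. exact: open_measurable2. Qed.
Local Notation nr := (nrm mu Omega p).
Local Notation LP := (Lp mu Omega p).
Local Notation test := (test Omega).
Local Notation aniso := (aniso p e al be).
Local Notation energy := (energy p e al be Omega).
Local Notation Lam := (fine (lambdaH Omega p aniso)).
Implicit Types (u : plane -> R) (g : plane -> plane).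

Lemma bool_le_sum (f : bool -> R) i : (forall j, 0 <= f j) -> f i <= f false + f true.
Proof. by move=> f0; case: i; rewrite ?lerDr ?lerDl f0. Qed.

Definition mid (f h : plane -> R) x := (f x + h x) / 2.

Lemma mid_test f h : test f -> test h -> test (mid f h).
Proof.
move=> tf th; have := testZ 2^-1 (testD tf th); congr test.
by apply/funext => x; rewrite /mid mulrC.
Qed.

Lemma mid_Lp f h : LP f -> LP h -> LP (mid f h).
Proof.
move=> Lf Lh; have := LpZ mO p1 2^-1 (LpD mO p1 Lf Lh); congr (Lp mu Omega p).
by apply/funext => x; rewrite /mid mulrC.
Qed.

Lemma mid_partial i f h : test f -> test h -> partial i (mid f h) = mid (partial i f) (partial i h).
Proof.
move=> tf th; have -> : mid f h = (fun x => 2^-1 * (f x + h x)).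
  by apply/funext => x; rewrite /mid mulrC.
rewrite (partialZ _ _ (smoothD tf.1 th.1)) (partialD _ tf.1 th.1).
by apply/funext => x; rewrite /mid mulrC.
Qed.

(** The integral over [Omega] of [defect p (f x) (h x)]. *)
Definition nr_defect f h := (nr f `^ p + nr h `^ p) / 2 - nr (mid f h) `^ p.

Lemma Lp0 : LP (fun=> 0).
Proof. by apply: test_Lp => //; exact: test0. Qed.

Lemma nr_defect_ge0 f h : LP f -> LP h -> 0 <= nr_defect f h.
Proof.
move=> Lf Lh; have Lm := mid_Lp Lf Lh.
have h2 : 0 <= (2^-1 : R) by rewrite invr_ge0.
have H x : 1 * `|mid f h x| `^ p + 0 * `|(0 : R)| `^ p <= 2^-1 * `|f x| `^ p + 2^-1 * `|h x| `^ p.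
  rewrite mul0r addr0 mul1r; have := defect_ge0 p1 (f x) (h x).
  rewrite /defect /mid; lra.
have := energy_le p1 mO ler01 (lexx 0) h2 h2 Lm Lp0 Lf Lh H.
rewrite mul0r addr0 mul1r /nr_defect; lra.
Qed.

Lemma nr_uniform_convexity (eta : R) : 0 < eta -> exists2 c, 0 <= c & forall f h, LP f -> LP h ->
  nr (fun x => f x - h x) `^ p <= eta * (nr f `^ p + nr h `^ p) + c * nr_defect f h.
Proof.
move=> eta0; have [c c0 H] := uniform_convexity p1 eta0; exists c => // f h Lf Lh.
have k0 : 0 <= eta + c / 2 by rewrite addr_ge0 ?divr_ge0// ltW.
have Lm := mid_Lp Lf Lh; have Lb := LpB mO p1 Lf Lh.
have G x : 1 * `|f x - h x| `^ p + c * `|mid f h x| `^ p <=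
    (eta + c / 2) * `|f x| `^ p + (eta + c / 2) * `|h x| `^ p.
  by rewrite mul1r; have := H (f x) (h x); rewrite /defect /mid; lra.
have := energy_le p1 mO ler01 c0 k0 k0 Lb Lm Lf Lh G; rewrite /nr_defect mul1r; lra.
Qed.

Lemma half_arith (A B C C' r : R) : A = 1 -> A <= B + C -> C = `|2^-1| * C' -> C' <= r ->
  1 - r / 2 <= B.
Proof. by rewrite ger0_norm ?invr_ge0// => -> h E h'; rewrite E in h; lra. Qed.

Lemma defect_arith (a b L d Z Y Pm Pf Ph m0 m1 f0 f1 h0 h1 : R) : 0 <= a -> Z <= Y ->
  Y <= a * Pm + b * (m0 + m1) -> a * Pf + b * (f0 + f1) <= L + d -> a * Ph + b * (h0 + h1) <= L + d ->
  Pm <= 2^-1 * Pf + 2^-1 * Ph ->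
  b * (((f0 + h0) / 2 - m0) + ((f1 + h1) / 2 - m1)) <= L + d - Z.
Proof.
move=> a0 h1' h2 h3 h4 h5; have := ler_wpM2l a0 h5; lra.
Qed.

Lemma drop_zero (a b c : R) : 1 * a + 0 * b <= c -> a <= c.
Proof. by rewrite mul1r mul0r addr0. Qed.

Lemma mulr_powR_le (L a b : R) : 0 <= L -> 0 <= a -> a <= b -> L * a `^ p <= L * b `^ p.
Proof.
move=> L0 a0 ab; apply: ler_wpM2l => //.
by apply: ge0_ler_powR; rewrite ?nnegrE ?(ltW p0)// (le_trans a0).
Qed.

(* The null term gives the statement the shape required by [energy_le]. *)
Lemma posdot_mid (g h : plane) :
  1 * `|posdot e (2^-1 *: (g + h))| `^ p + 0 * `|(0 : R)| `^ p <=
  2^-1 * `|posdot e g| `^ p + 2^-1 * `|posdot e h| `^ p.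
Proof.
have h2 : 0 <= (2^-1 : R) by rewrite invr_ge0.
rewrite mul0r addr0 mul1r !(ger0_norm (posdot_ge0 _ _)).
have -> : posdot e (2^-1 *: (g + h)) = Num.max (2^-1 * dot e g + 2^-1 * dot e h) 0.
  by rewrite /posdot; congr Num.max; rewrite /dot /= /GRing.scale /=; ring.
by apply: pospow_convex => //; lra.
Qed.

Lemma grad_mid f h x : test f -> test h -> grad (mid f h) x = 2^-1 *: (grad f x + grad h x).
Proof.
move=> tf th; rewrite /grad (mid_partial _ tf th) (mid_partial _ tf th) /mid.
by congr pair; rewrite /= /GRing.scale /= mulrC.
Qed.

(* The midpoint of two almost minimizing functions is almost minimizing, hence
   the energies of their gradients have a small midpoint defect. *)
Lemma gradient_defect (phi psi : plane -> R) (d r : R) : test phi -> test psi -> nr phi = 1 ->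
  energy (grad phi) <= Lam + d -> energy (grad psi) <= Lam + d ->
  nr (fun x => phi x - psi x) <= r -> 0 <= r -> r <= 1 ->
  be * (nr_defect (partial false phi) (partial false psi) +
        nr_defect (partial true phi) (partial true psi)) <= Lam + d - Lam * (1 - r / 2) `^ p.
Proof.
move=> tf th n1 ef eh nd r0 r1.
have [_ L0] := lambda_aniso_fin p1 e al0 be0 oO bO nO.
have r2 : 0 <= 1 - r / 2 by rewrite subr_ge0 ler_pdivrMr// mul1r (le_trans r1)// ler1n.
have tm := mid_test tf th; have Lf := test_Lp oO bO p1 tf; have Lh := test_Lp oO bO p1 th.
have Lm := mid_Lp Lf Lh.
have low := energy_lower p1 e al0 be0 oO bO nO (W01p_test oO bO p1 tm).
have nm : 1 - r / 2 <= nr (mid phi psi).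
  have := nrmD mO p1 Lm (LpZ mO p1 2^-1 (LpB mO p1 Lf Lh)).
  have -> : (fun x => mid phi psi x + 2^-1 * (phi x - psi x)) = phi.
    by apply/funext => x; rewrite /mid; field.
  by move=> h; exact: (half_arith n1 h (nrmZ mO p1 2^-1 (LpB mO p1 Lf Lh)) nd).
have le1 : Lam * (1 - r / 2) `^ p <= Lam * nr (mid phi psi) `^ p.
  exact: mulr_powR_le L0 r2 nm.
have T i f (t : test f) := test_Lp oO bO p1 (test_partial i t).
have G f (t : test f) : LP2 p Omega (grad f) by split; [exact: (T false _ t)|exact: (T true _ t)].
have h2 : 0 <= (2^-1 : R) by rewrite invr_ge0.
have H x : 1 * `|posdot e (grad (mid phi psi) x)| `^ p + 0 * `|(0 : R)| `^ p <=
    2^-1 * `|posdot e (grad phi x)| `^ p + 2^-1 * `|posdot e (grad psi x)| `^ p.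
  by rewrite (grad_mid _ tf th); exact: posdot_mid.
have := energy_le p1 mO ler01 (lexx 0) h2 h2 (LP2_posdot p1 e oO (G _ tm)) Lp0
  (LP2_posdot p1 e oO (G _ tf)) (LP2_posdot p1 e oO (G _ th)) H.
move/drop_zero => pos.
have E i : nr (partial i (mid phi psi)) = nr (mid (partial i phi) (partial i psi)) by rewrite mid_partial.
rewrite /nr_defect -(E false) -(E true).
exact: (defect_arith (ltW al0) le1 low ef eh pos).
Qed.

Lemma defect_rate_cvg (L : R) : L + harmonic n - L * (1 - harmonic n / 2) `^ p @[n --> \oo] --> 0.
Proof.
have ch := @cvg_harmonic R.
have -> : 0 = L + 0 - L * 1 `^ p by rewrite powR1 mulr1 addr0 subrr.
apply: cvgB; first by apply: cvgD => //; exact: cvg_cst.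
apply: cvgM; first exact: cvg_cst.
apply: cvg_powR => // [n|].
  have : @harmonic R n <= 1 by rewrite /harmonic /= invf_le1// ler1n.
  by lra.
have : 1 - harmonic n / 2 @[n --> \oo] --> (1 - 0 / 2 : R).
  by apply: cvgB; [exact: cvg_cst|apply: cvgM => //; exact: cvg_cst].
by rewrite mul0r subr0.
Qed.

(** No weak topology is involved: [rellich] makes a minimizing sequence Cauchy in L^p,
    [gradient_defect] then makes the midpoint defects of the gradients small, and uniform convexity
    makes the gradients Cauchy as well. *)
Lemma minimizer_exists : exists u g,
  [/\ W01p Omega p u g, nr u = 1 & energy g = Lam].
Proof.
have [_ L0] := lambda_aniso_fin p1 e al0 be0 oO bO nO.
have /choice[phi Hphi] n : exists phi, [/\ test phi, nr phi = 1 & energy (grad phi) <= Lam + harmonic n].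
  by apply: minimizing_test => //; exact: harmonic_pos.
have tphi n : test (phi n) by case: (Hphi n).
have nphi n : nr (phi n) = 1 by case: (Hphi n).
have ephi n : energy (grad (phi n)) <= Lam + harmonic n by case: (Hphi n).
have LP1 i n := test_Lp oO bO p1 (test_partial i (tphi n)).
pose K := (Lam + 1) / be; have K0 : 0 <= K by rewrite divr_ge0 ?addr_ge0// ltW.
have h1 n : @harmonic R n <= 1 by rewrite /harmonic /= invf_le1// ler1n.
have bK n i : nr (partial i (phi n)) `^ p <= K.
  rewrite /K ler_pdivlMr// mulrC; apply: (@le_trans _ _ (energy (grad (phi n)))); last first.
    by apply: le_trans (ephi n) _; rewrite lerD2l.
  apply: (@le_trans _ _ (be * (nr (partial false (phi n)) `^ p + nr (partial true (phi n)) `^ p))).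
    rewrite ler_wpM2l ?(ltW be0)//.
    exact: (bool_le_sum i (fun j => powR_ge0 (nr (partial j (phi n))) p)).
  by rewrite /energy lerDr mulr_ge0 ?powR_ge0// ltW.
pose M := Num.max 1 (K `^ p^-1).
have bphi n : nr (phi n) <= M by rewrite nphi le_max lexx.
have bdphi n i : nr (partial i (phi n)) <= M.
  rewrite le_max; apply/orP; right; apply: (powR_le_cancel p1); rewrite ?nrm_ge0 ?powR_ge0//.
  by rewrite -powRrM mulVf// powRr1.
have [sigma [ks Hs]] := rellich p1 oO bO tphi bphi bdphi.
pose psi n := phi (sigma n).
have cauchy0 (d : R) : 0 < d -> exists n0 : nat, forall m n, (n0 <= m)%N -> (n0 <= n)%N ->
    nr (fun x => psi m x - psi n x) <= d.
  move=> d0; have [n0 _ Hn] := cvgr_lt _ (@cvg_harmonic R) _ d0; exists n0 => m n hm hn.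
  by apply: le_trans (Hs n0 m n hm hn) _; apply/ltW/(Hn n0) => /=.
have cauchy1 i (d : R) : 0 < d -> exists n0 : nat, forall m n, (n0 <= m)%N -> (n0 <= n)%N ->
    nr (fun x => partial i (psi m) x - partial i (psi n) x) <= d.
  move=> d0; pose D := d `^ p; have D0 : 0 < D by rewrite powR_gt0.
  (* [K + K] bounds the sum of the two energies, so [eta] spends half of [D]; the other half is left
     for the defect term, through [t0]. *)
  pose eta := D / 2 / (K + K + 1); have eta0 : 0 < eta by rewrite !divr_gt0// ltr_wpDl ?addr_ge0.
  have [c c0 Hc] := nr_uniform_convexity eta0.
  have t0 : 0 < be * (D / 2 / (c + 1)) by rewrite mulr_gt0// !divr_gt0// ltr_wpDl.
  have [n0 _ Hn] := cvgr_lt _ (defect_rate_cvg Lam) _ t0.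
  exists n0 => m n hm hn; have := Hn n0 (leqnn _) => /= /ltW rate.
  have es k : (n0 <= k)%N -> energy (grad (psi k)) <= Lam + harmonic n0.
    move=> nk; apply: le_trans (ephi _) _; rewrite lerD2l; apply: harmonic_mono.
    exact: leq_trans nk (ks k).
  have hr : 0 <= (@harmonic R n0) by exact/ltW/harmonic_pos.
  have gd := gradient_defect (tphi (sigma m)) (tphi (sigma n)) (nphi _) (es m hm) (es n hn)
    (Hs n0 m n hm hn) hr (h1 n0).
  have nd j := nr_defect_ge0 (LP1 j (sigma m)) (LP1 j (sigma n)).
  have dle : nr_defect (partial i (psi m)) (partial i (psi n)) <= D / 2 / (c + 1).
    rewrite -(ler_pM2l be0); apply: le_trans rate; apply: le_trans gd.
    rewrite ler_wpM2l ?(ltW be0)//.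
    exact: (bool_le_sum i nd).
  apply: (powR_le_cancel p1); [exact: nrm_ge0|exact: ltW|].
  apply: (le_trans (Hc _ _ (LP1 i (sigma m)) (LP1 i (sigma n)))).
  apply: combine_small dle; [exact: ltW|exact: c0|exact: addr_ge0|].
  by apply: lerD; exact: bK.
have [u Lu cu] := Lp_complete mO p1 (fun n => test_Lp oO bO p1 (tphi (sigma n))) cauchy0.
have [g1 L1 c1] := Lp_complete mO p1 (fun n => LP1 false (sigma n)) (cauchy1 false).
have [g2 L2 c2] := Lp_complete mO p1 (fun n => LP1 true (sigma n)) (cauchy1 true).
pose g (x : plane) : plane := (g1 x, g2 x).
have Wu : W01p Omega p u g.
  exact: (W01p_intro oO bO p1 Lu (L1 : LP (fun x => (g x).1)) (L2 : LP (fun x => (g x).2))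
    (fun n => tphi (sigma n)) cu c1 c2).
exists u, g; have nu : nr u = 1.
  have := Lp_cvg_nrm mO p1 (fun n => test_Lp oO bO p1 (tphi (sigma n))) Lu cu.
  have -> : (fun n => nr (phi (sigma n))) = (fun=> 1) by apply/funext => n.
  by move=> c; apply/esym; exact: (cvg_unique _ (@cvg_cst _ _ _ _ _) c).
split=> //; apply/eqP; rewrite eq_le; apply/andP; split; last first.
  by have := energy_lower p1 e al0 be0 oO bO nO Wu; rewrite nu powR1 mulr1.
have Lg : LP2 p Omega g by split.
have cE : energy (grad (phi (sigma n))) @[n --> \oo] --> energy g.
  exact: (@energy_cvg R p p1 e al be Omega oO bO (fun n => phi (sigma n)) g (fun n => tphi (sigma n)) Lg c1 c2).
have ch : Lam + harmonic n @[n --> \oo] --> Lam + 0.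
  by apply: cvgD; [exact: cvg_cst|exact: cvg_harmonic].
rewrite addr0 in ch; apply: (ler_cvgn cE ch) => n.
by apply: le_trans (ephi _) _; rewrite lerD2l; apply: harmonic_mono; exact: ks.
Qed.

End minimizer.

(** * Derivatives of integrals of p-th powers *)

Section power_derivative.
Context {R : realType}.
Variables (p : R) (p1 : 1 < p).
Let p0 : 0 < p. Proof. exact: lt_trans ltr01 p1. Qed.
Let pN0 : p != 0. Proof. by rewrite gt_eqF. Qed.
Let pm0 : 0 < p - 1. Proof. by rewrite subr_gt0. Qed.
Implicit Types (s t a b : R).

(** The function |s|^(p - 2) s, written without the exponent [p - 2], which may be negative;
    continuity at 0 is then immediate. *)
Definition signed_power s := pospow (p - 1) s - pospow (p - 1) (- s).

Lemma signed_powerE s : signed_power s = `|s| `^ (p - 2) * s.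
Proof.
have pm : p - 1 != 0 by rewrite gt_eqF.
have E t : 0 < t -> t `^ (p - 2) * t = t `^ (p - 1).
  move=> t0; rewrite -[X in _ * X](powRr1 (ltW t0)) -powRD; last by rewrite (gt_eqF t0) implybT.
  by congr (_ `^ _); lra.
rewrite /signed_power; have [s0|s0|->] := ltgtP s 0.
- rewrite pospow_le0 ?(ltW s0)// pospow_pos ?oppr_ge0 ?(ltW s0)// sub0r ltr0_norm//.
  by rewrite -E ?oppr_gt0// mulrN opprK.
- by rewrite (pospow_le0 _ (_ : - s <= 0)) ?oppr_le0 ?(ltW s0)// subr0 pospow_pos ?(ltW s0)// gtr0_norm// E.
- by rewrite oppr0 subrr mulr0.
Qed.

Lemma signed_power_continuous : continuous signed_power.
Proof.
have c := pospow_continuous pm0; move=> s; apply: cvgB; first exact: c.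
exact: (cvg_comp -%R (pospow (p - 1)) (cvgN cvg_id) (c (- s))).
Qed.

Lemma powR_norm_is_derive s : is_derive s 1 (fun t : R => `|t| `^ p) (p * signed_power s).
Proof.
have -> : (fun t : R => `|t| `^ p) = (fun t => pospow p t + pospow p (- t)).
  by apply/funext => t; rewrite powR_normE.
have d1 := pospow_is_derive s p1; have d2 := pospow_is_derive (- s) p1.
have d3 : is_derive s 1 (fun t => pospow p (- t)) (- (p * pospow (p - 1) (- s))).
  have E (t : R) : -1 * t + 0 = - t by rewrite mulN1r addr0.
  have d2' : is_derive (-1 * s + 0) 1 (pospow p) (p * pospow (p - 1) (- s)) by rewrite E.
  have := is_derive1_compE (g := fun y => -1 * y + 0) d2' (derive1_affine (-1) 0 s).
  by under eq_fun do rewrite E; move=> H; apply: (is_derive1_eq H); rewrite mulrN1.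
by apply: (is_derive1_eq (is_derive1D d1 d3)); rewrite mulrBr.
Qed.

Lemma powR_norm_lip s t : `| `|t| `^ p - `|s| `^ p| <= (2 * p) * (`|s| + `|t|) `^ (p - 1) * `|t - s|.
Proof.
rewrite !(powR_normE _ pN0); have h1 := pospow_lip p1 s t; have h2 := pospow_lip p1 (- s) (- t).
rewrite !normrN (_ : - t - - s = - (t - s)) ?normrN in h2; last by ring.
have := ler_normD (pospow p t - pospow p s) (pospow p (- t) - pospow p (- s)).
have -> : pospow p t - pospow p s + (pospow p (- t) - pospow p (- s)) =
  pospow p t + pospow p (- t) - (pospow p s + pospow p (- s)) by ring.
move: h1 h2; rewrite -!mulrA (mulrA p) => h1 h2 h3; lra.
Qed.

Lemma harmonic_dnbhs : @harmonic R n @[n --> \oo] --> 0^'.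
Proof.
move=> A; rewrite /dnbhs /= => HA.
have := @cvg_harmonic R _ HA; case=> N _ HN; exists N => // n Nn.
by apply: (HN n Nn); rewrite gt_eqF// harmonic_pos.
Qed.

Lemma quotient_cvg (k : R -> R) a b d : is_derive a 1 k d ->
  (harmonic n)^-1 * (k (a + harmonic n * b) - k a) @[n --> \oo] --> d * b.
Proof.
move=> dk; have dG : is_derive (0 : R) 1 (fun t => k (b * t + a)) (d * b).
  have dk' : is_derive (b * 0 + a) 1 k d by rewrite mulr0 add0r.
  exact: (is_derive1_compE (g := fun t => b * t + a) dk' (derive1_affine b a 0)).
have [D E] := dG; have := cvg_comp _ _ harmonic_dnbhs D; rewrite -[X in _ --> X]E.
apply: cvg_trans; apply: near_eq_cvg; apply: nearW => n /=.
have E1 : b * (n.+1%:R^-1%:A + 0) + a = a + n.+1%:R^-1 * b by rewrite addr0 /GRing.scale /= mulr1; ring.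
by rewrite E1 mulr0 add0r.
Qed.

Section integrals.
Context {d : measure_display} {T : measurableType d}.
Variables (m : {measure set T -> \bar R}) (D : set T) (mD : measurable D).
Variables (k k' : R -> R) (C : R) (C0 : 0 <= C).
Hypothesis k_lip : forall s t, `|k t - k s| <= C * (`|s| + `|t|) `^ (p - 1) * `|t - s|.
Hypothesis k_der : forall s, is_derive s 1 k (k' s).
Hypothesis k'_cont : continuous k'.
Hypothesis k0 : k 0 = 0.
Implicit Types (f h : T -> R).

Lemma power_comp_measurable f : measurable_fun D f -> measurable_fun D (fun x => k (f x)).
Proof.
move=> mf; apply: (measurableT_comp _ mf); apply: continuous_measurable_fun.
exact: is_derive_continuous k_der.
Qed.

Lemma power_integrable f : Lp m D p f -> m.-integrable D (EFin \o (fun x => k (f x))).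
Proof.
move=> Lf; have mf := Lp_measurable Lf.
apply/integrableP; split; first by apply/measurable_EFinP; exact: power_comp_measurable.
apply: (@le_lt_trans _ _ (\int[m]_(x in D) (C%:E * (`|f x| `^ p)%:E))%E).
  apply: le_integral_ge0 => // x _; rewrite /= -EFinM lee_fin.
  have := k_lip 0 (f x); rewrite k0 !subr0 normr0 add0r -mulrA.
  by rewrite -[X in _ * X]mulrC mulr_powRB1.
rewrite ge0_integralZl_EFin//; last exact: energy_measurable.
by rewrite (Lp_energy p1 Lf) -EFinM ltry.
Qed.

(** Dominated convergence of the difference quotients, stated for an abstract [k] so as to serve
    both [pospow p] and the p-th power of the absolute value. The steps [harmonic n] are
    positive. *)
Lemma power_derivative f h : Lp m D p f -> Lp m D p h ->
  m.-integrable D (EFin \o (fun x => k' (f x) * h x)) /\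
  (harmonic n)^-1 * ((\int[m]_(x in D) k (f x + harmonic n * h x))%R -
    (\int[m]_(x in D) k (f x))%R) @[n --> \oo] --> (\int[m]_(x in D) (k' (f x) * h x))%R.
Proof.
move=> Lf Lh; have mf := Lp_measurable Lf; have mh := Lp_measurable Lh.
have Ln n : Lp m D p (fun x => f x + harmonic n * h x) by apply: LpD => //; exact: LpZ.
have i0 := power_integrable Lf; have in_ n := power_integrable (Ln n).
pose q n x := (harmonic n)^-1 * (k (f x + harmonic n * h x) - k (f x)).
have La f' : Lp m D p f' -> Lp m D p (fun x => `|f' x|).
  move=> Lf'; have mf' := Lp_measurable Lf'.
  have ma : measurable_fun D (fun x => `|f' x|) by exact: measurableT_comp.
  have le x : D x -> `|(`|f' x|)| <= `|f' x| by rewrite normr_id.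
  exact: (Lp_le p1 ma Lf' le).1.
(* As [harmonic n <= 1], both |f| + |f + harmonic n * h| and |h| are at most [w], so the Lipschitz
   bound of [k] dominates the quotients by C * w^p. *)
pose w x := 2 * `|f x| + `|h x|.
have Lw : Lp m D p w by apply: LpD => //; [apply: LpZ => //; exact: La|exact: La].
have w0 x : 0 <= w x by rewrite addr_ge0// mulr_ge0.
have bound n x : `|q n x| <= C * `|w x| `^ p.
  have h0 := @harmonic_pos R n; have h1 : @harmonic R n <= 1 by rewrite /harmonic /= invf_le1// ler1n.
  rewrite /q normrM gtr0_norm ?invr_gt0// mulrC ler_pdivrMr//.
  apply: (le_trans (k_lip _ _)); rewrite addrAC subrr add0r normrM (gtr0_norm h0) mulrA mulrAC.
  rewrite ler_pM2r// -mulrA ler_wpM2l//.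
  rewrite (ger0_norm (w0 x)) -(mulr_powRB1 (w0 x) p0) mulrC; apply: ler_pM; rewrite ?powR_ge0//.
    by rewrite /w lerDr mulr_ge0.
  apply: (ge0_ler_powR (ltW pm0)); rewrite ?nnegrE ?addr_ge0//.
  have := ler_normD (f x) (harmonic n * h x); rewrite normrM (gtr0_norm h0).
  have : harmonic n * `|h x| <= `|h x| by rewrite ler_piMl.
  by rewrite /w; lra.
have cq x : q n x @[n --> \oo] --> k' (f x) * h x by exact: quotient_cvg.
have mq n : measurable_fun D (q n).
  by apply: measurable_funM => //; apply: measurable_funB; apply: power_comp_measurable; case: (Ln n).
have mk' : measurable_fun D (fun x => k' (f x) * h x).
  apply: measurable_funM => //; apply: (measurableT_comp _ mf).
  exact: continuous_measurable_fun.
have iw : m.-integrable D (fun x => (C * `|w x| `^ p)%:E).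
  have mw := energy_measurable p (Lp_measurable Lw).
  apply/integrableP; split.
    by apply/measurable_EFinP; apply: measurable_funM => //; exact/measurable_EFinP.
  under eq_integral do rewrite gee0_abs ?lee_fin ?mulr_ge0 ?powR_ge0// EFinM.
  rewrite ge0_integralZl_EFin//.
  by rewrite (Lp_energy p1 Lw) -EFinM ltry.
have lim_bound x : `|k' (f x) * h x| <= C * `|w x| `^ p.
  apply: (@ler_cvgn _ (fun n => `|q n x|) (fun=> C * `|w x| `^ p)) => //.
  - by apply: cvg_norm; exact: cq.
  - exact: cvg_cst.
have ik' : m.-integrable D (EFin \o (fun x => k' (f x) * h x)).
  apply: (le_integrable mD _ _ iw); first exact/measurable_EFinP.
  by move=> x _; rewrite /= lee_fin [X in _ <= X]ger0_norm ?mulr_ge0 ?powR_ge0.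
split=> //.
have cqE x : D x -> (q n x)%:E @[n --> \oo] --> (k' (f x) * h x)%:E.
  by move=> _; apply: cvg_EFin; [exact: nearW|exact: cq].
have bE n x : D x -> (`|(q n x)%:E| <= (C * `|w x| `^ p)%:E)%E by move=> _; rewrite lee_fin.
have cE : (\int[m]_(x in D) (q n x)%:E)%E @[n --> \oo] --> (\int[m]_(x in D) (k' (f x) * h x)%:E)%E.
  apply: (@dominated_cvg _ _ _ m D mD (fun n x => (q n x)%:E) (fun x => (k' (f x) * h x)%:E)
    (fun x => (C * `|w x| `^ p)%:E)) => //.
  by move=> n; exact/measurable_EFinP.
have E n : (harmonic n)^-1 * ((\int[m]_(x in D) k (f x + harmonic n * h x))%R -
    (\int[m]_(x in D) k (f x))%R) = fine (\int[m]_(x in D) (q n x)%:E).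
  rewrite -RintegralB// -RintegralZl//.
  by have := integrableB mD (in_ n) i0.
under eq_cvg do rewrite E.
apply: fine_cvg; apply: cvg_trans cE _; rewrite /Rintegral fineK//.
exact: integrable_fin_num ik'.
Qed.

End integrals.

End power_derivative.

(** * The minimizer is an eigenfunction *)

Section euler_lagrange.
Context {R : realType}.
Local Notation plane := (R * R)%type.
Local Notation mu1 := (@lebesgue_measure R).
Local Notation mu := (mu1 \x mu1)%E.
Local Notation mplane := (measurableTypeR R * measurableTypeR R)%type.
Variables (p : R) (p1 : 1 < p).
Let p0 : 0 < p. Proof. exact: lt_trans ltr01 p1. Qed.
Let pN0 : p != 0. Proof. by rewrite gt_eqF. Qed.
Let pm0 : 0 < p - 1. Proof. by rewrite subr_gt0. Qed.
Variables (e : plane) (al be : R) (al0 : 0 < al) (be0 : 0 < be).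
Local Notation aniso := (aniso p e al be).
Local Notation Phi := (Phi p e al be).
Implicit Types (x v : plane).

(** The vector H^(p - 1) grad H for H = [aniso], that is grad Phi / p, in a form that makes sense at
    0 too. *)
Definition flux x : plane :=
  (al * pospow (p - 1) (dot e x) * e.1 + be * signed_power p x.1,
   al * pospow (p - 1) (dot e x) * e.2 + be * signed_power p x.2).

Lemma dot_flux x v : dot (flux x) v =
  al * (pospow (p - 1) (dot e x) * dot e v) + be * (signed_power p x.1 * v.1 + signed_power p x.2 * v.2).
Proof. by rewrite /flux /dot /=; ring. Qed.

Lemma flux0 : flux 0 = 0.
Proof.
have h : pospow (p - 1) (0 : R) = 0 by rewrite pospow_le0 ?gt_eqF.
have d0 : dot e 0 = 0 by rewrite /dot /= !mulr0 addr0.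
by rewrite /flux /signed_power d0 oppr0 h subrr !mulr0 !mul0r addr0.
Qed.

Lemma dot10 x : dot (1, 0) x = x.1. Proof. by rewrite /dot /= mul1r mul0r addr0. Qed.

Lemma dot01 x : dot (0, 1) x = x.2. Proof. by rewrite /dot /= mul1r mul0r add0r. Qed.

Lemma PhiE x : Phi x = al * pospow p (dot e x) +
  be * (`|dot (1, 0) x| `^ p + `|dot (0, 1) x| `^ p).
Proof. by rewrite dot10 dot01. Qed.

Lemma dot_differentiable (l x : plane) : differentiable (dot l) x.
Proof.
have lin : linear (dot l : plane -> R^o).
  by move=> k a b; rewrite /dot /= /GRing.scale /=; ring.
pose L := GRing.isLinear.Build _ _ _ _ (dot l : plane -> R^o) lin.
pose f : {linear plane -> R^o} := HB.pack (dot l : plane -> R^o) L.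
rewrite (_ : dot l = f) //; apply: linear_differentiable; exact: dot_continuous.
Qed.

Lemma Phi_is_derive x v : is_derive x v Phi (p * dot (flux x) v).
Proof.
have dk1 (t : R) : derivable (pospow p) t 1 by case: (pospow_is_derive t p1).
have dk2 (t : R) : derivable (fun s : R => `|s| `^ p) t 1 by case: (powR_norm_is_derive p1 t).
have D1 := linear_is_derive e v x dk1.
have D2 := linear_is_derive (1, 0) v x dk2.
have D3 := linear_is_derive (0, 1) v x dk2.
have E1 s : derive1 (pospow p) s = p * pospow (p - 1) s.
  by rewrite derive1E; have [_ ->] := pospow_is_derive s p1.
have E2 (s : R) : derive1 (fun s : R => `|s| `^ p) s = p * signed_power p s.
  by rewrite derive1E; have [_ ->] := powR_norm_is_derive p1 s.
rewrite E1 in D1; rewrite !E2 in D2 D3.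
have D := is_deriveD (is_deriveZ al D1) (is_deriveZ be (is_deriveD D2 D3)).
have -> : Phi = (al \*: (fun y => pospow p (dot e y)) +
  be \*: ((fun y : plane => `|dot (1, 0) y| `^ p) + (fun y : plane => `|dot (0, 1) y| `^ p))).
  by apply/funext => y; rewrite PhiE.
have -> : p * dot (flux x) v = al *: (dot e v * (p * pospow (p - 1) (dot e x))) +
  be *: (dot (1, 0) v * (p * signed_power p (dot (1, 0) x)) +
         dot (0, 1) v * (p * signed_power p (dot (0, 1) x))).
  rewrite dot_flux /GRing.scale /=.
  by rewrite !dot10 !dot01; ring.
exact: D.
Qed.

Lemma aniso_is_derive x v : x != 0 ->
  is_derive x v aniso (Phi x `^ (p^-1 - 1) * dot (flux x) v).
Proof.
move=> x0; have P0 := aniso_gt0 p1 e al0 be0 x0.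
apply/slice0_is_derive; have := Phi_is_derive x v => /slice0_is_derive D.
have P0' : 0 < (fun h : R => Phi (h *: v + x)) 0 by rewrite /= scale0r add0r.
have D2 := is_derive1_powR p^-1 P0'.
have := is_derive1_compE (g := fun h : R => Phi (h *: v + x)) D2 D.
move=> H; apply: (is_derive1_eq H); rewrite /= scale0r add0r; field.
by [].
Qed.

Lemma aniso_grad x : x != 0 -> grad aniso x = Phi x `^ (p^-1 - 1) *: flux x.
Proof.
move=> x0; have G i := is_derive_partial (aniso_is_derive (basis_vector i) x0).
rewrite /grad !G; congr pair; rewrite /dot /= /GRing.scale /=; ring.
Qed.

(** At 0 both sides vanish, whatever value [grad aniso 0] has; elsewhere the powers of [Phi] have
    exponents (p - 1) / p and 1 / p - 1, which cancel. *)
Lemma aniso_flux x v : aniso x `^ (p - 1) * dot (grad aniso x) v = dot (flux x) v.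
Proof.
have [->|x0] := eqVneq x 0.
  by rewrite /aniso Phi0// powR0 ?invr_eq0// powR0 ?gt_eqF// mul0r flux0 /dot /= !mul0r addr0.
have P0 := aniso_gt0 p1 e al0 be0 x0.
rewrite aniso_grad// /aniso -powRrM.
have -> : dot (Phi x `^ (p^-1 - 1) *: flux x) v = Phi x `^ (p^-1 - 1) * dot (flux x) v.
  by rewrite /dot /= /GRing.scale /=; ring.
rewrite mulrA -powRD; last by rewrite (gt_eqF P0) implybT.
have -> : p^-1 * (p - 1) + (p^-1 - 1) = 0 by field.
by rewrite powRr0 mul1r.
Qed.

Lemma aniso_differentiable x : x != 0 -> differentiable aniso x.
Proof.
move=> x0; have P0 := aniso_gt0 p1 e al0 be0 x0.
have dl (l : plane) := dot_differentiable l x.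
have dk1 (t : R) : differentiable (pospow p) t.
  by apply/derivable1_diffP; case: (pospow_is_derive t p1).
have dk2 (t : R) : differentiable (fun s : R => `|s| `^ p) t.
  by apply/derivable1_diffP; case: (powR_norm_is_derive p1 t).
have dk3 : differentiable (fun s : R => s `^ p^-1) (Phi x).
  by apply/derivable1_diffP; case: (is_derive1_powR p^-1 P0).
have dP : differentiable Phi x.
  have -> : Phi = (al \*: (pospow p \o dot e) +
    be \*: (((fun s : R => `|s| `^ p) \o dot (1, 0)) + ((fun s : R => `|s| `^ p) \o dot (0, 1)))).
    by apply/funext => y; rewrite PhiE.
  apply: differentiableD; apply: differentiableZ; first exact: differentiable_comp.
  by apply: differentiableD; exact: differentiable_comp.
exact: (differentiable_comp dP dk3).
Qed.

Variables (Omega : set plane) (oO : open Omega) (bO : bounded_set Omega) (nO : Omega !=set0).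
Let mO : measurable (Omega : set mplane). Proof. exact: open_measurable2. Qed.
Local Notation nr := (nrm mu Omega p).
Local Notation LP := (Lp mu Omega p).
Local Notation energy := (energy p e al be Omega).
Local Notation Lam := (fine (lambdaH Omega p aniso)).
Local Notation I f := (\int[mu]_(x in Omega) f x)%R.

Lemma energyE g : LP2 p Omega g -> energy g =
  al * I (fun x => pospow p (dot e (g x))) + be * (I (fun x => `|(g x).1| `^ p) + I (fun x => `|(g x).2| `^ p)).
Proof.
move=> Lg; have [L1 L2] := Lg; have L3 := LP2_posdot p1 e oO Lg.
rewrite /energy -(Rint_energy p1 L1) -(Rint_energy p1 L2) -(Rint_energy p1 L3).
have E x : `|posdot e (g x)| `^ p = pospow p (dot e (g x)) by rewrite (ger0_norm (posdot_ge0 _ _)).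
by under eq_Rintegral do rewrite E.
Qed.

Lemma ge0_cvgn (f : nat -> R) (l : R) : f n @[n --> \oo] --> l -> (forall n, 0 <= f n) -> 0 <= l.
Proof. by move=> c f0; apply: (@ler_cvgn _ (fun=> 0) f 0 l) => //; exact: cvg_cst. Qed.

Lemma combination_cvg (a b L l1 l2 l3 l4 : R) (f1 f2 f3 f4 : nat -> R) :
  f1 n @[n --> \oo] --> l1 -> f2 n @[n --> \oo] --> l2 -> f3 n @[n --> \oo] --> l3 ->
  f4 n @[n --> \oo] --> l4 ->
  (forall n, 0 <= a * f1 n + b * (f2 n + f3 n) - L * f4 n) -> 0 <= a * l1 + b * (l2 + l3) - L * l4.
Proof.
move=> c1 c2 c3 c4; apply: ge0_cvgn; apply: cvgB; last by apply: cvgM => //; exact: cvg_cst.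
by apply: cvgD; (apply: cvgM; first exact: cvg_cst) => //; exact: cvgD.
Qed.

Lemma variation_arith (a b L t A A' B1 B1' B2 B2' D D' E E' : R) : 0 < t ->
  E = a * A + b * (B1 + B2) -> E' = a * A' + b * (B1' + B2') -> E = L * D -> L * D' <= E' ->
  0 <= a * (t^-1 * (A' - A)) + b * (t^-1 * (B1' - B1) + t^-1 * (B2' - B2)) - L * (t^-1 * (D' - D)).
Proof.
move=> t0 h1 h2 h3 h4.
have -> : a * (t^-1 * (A' - A)) + b * (t^-1 * (B1' - B1) + t^-1 * (B2' - B2)) - L * (t^-1 * (D' - D)) =
  t^-1 * ((a * A' + b * (B1' + B2')) - L * D' - ((a * A + b * (B1 + B2)) - L * D)) by ring.
rewrite -h1 -h2 mulr_ge0 ?invr_ge0 ?(ltW t0)// h3; lra.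
Qed.

Lemma pospow_variation f h : LP f -> LP h ->
  mu.-integrable Omega (EFin \o (fun x => p * pospow (p - 1) (f x) * h x)) /\
  (harmonic n)^-1 * (I (fun x => pospow p (f x + harmonic n * h x)) - I (fun x => pospow p (f x)))
    @[n --> \oo] --> I (fun x => p * pospow (p - 1) (f x) * h x).
Proof.
have c : continuous (fun s : R => p * pospow (p - 1) s).
  by move=> s; apply: cvgM; [exact: cvg_cst|exact: pospow_continuous].
apply: (power_derivative p1 mO (ltW p0) (pospow_lip p1) (fun s => pospow_is_derive s p1) c).
by rewrite pospow_le0.
Qed.

Lemma norm_variation f h : LP f -> LP h ->
  mu.-integrable Omega (EFin \o (fun x => p * signed_power p (f x) * h x)) /\
  (harmonic n)^-1 * (I (fun x => `|f x + harmonic n * h x| `^ p) - I (fun x => `|f x| `^ p))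
    @[n --> \oo] --> I (fun x => p * signed_power p (f x) * h x).
Proof.
have c : continuous (fun s : R => p * signed_power p s).
  by move=> s; apply: cvgM; [exact: cvg_cst|exact: signed_power_continuous].
have C0 : 0 <= 2 * p by rewrite mulr_ge0// ltW.
apply: (power_derivative p1 mO C0 (powR_norm_lip p1) (powR_norm_is_derive p1) c).
by rewrite normr0 powR0.
Qed.

(** The energy minus [Lam] times the p-th power of the norm is non-negative and vanishes at [u], so
    its difference quotients along positive steps are non-negative. *)
Lemma first_variation u g phi dphi : W01p Omega p u g -> W01p Omega p phi dphi ->
  energy g = Lam * nr u `^ p ->
  0 <= al * I (fun x => p * pospow (p - 1) (dot e (g x)) * dot e (dphi x)) +
    be * (I (fun x => p * signed_power p (g x).1 * (dphi x).1) +
          I (fun x => p * signed_power p (g x).2 * (dphi x).2)) -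
    Lam * I (fun x => p * signed_power p (u x) * phi x).
Proof.
move=> Wu Wp E.
have [Lu Lg _ _] := Wu; have [Lphi Ld _ _] := Wp.
have [L1 L2] := Lg; have [M1 M2] := Ld.
have L3 := dot_measurable oO p1 e L1 L2; have M3 := dot_measurable oO p1 e M1 M2.
have [_ cP] := pospow_variation L3 M3.
have [_ c1] := norm_variation L1 M1; have [_ c2] := norm_variation L2 M2.
have [_ cu] := norm_variation Lu Lphi.
apply: (combination_cvg cP c1 c2 cu) => n.
have Wn := W01p_lin oO bO p1 (harmonic n) Wu Wp.
have [Ln LG _ _] := Wn.
have low := energy_lower p1 e al0 be0 oO bO nO Wn.
rewrite -(Rint_energy p1 Ln) in low; rewrite -(Rint_energy p1 Lu) in E.
have EG := energyE LG.
have Ed : (fun x => pospow p (dot e (g x + harmonic n *: dphi x))) =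
    (fun x => pospow p (dot e (g x) + harmonic n * dot e (dphi x))).
  by apply/funext => x; rewrite dotDr dotZr.
rewrite Ed in EG.
exact: (variation_arith (harmonic_pos n) (energyE Lg) EG E low).
Qed.

Lemma variation_integrable g phi dphi u : LP u -> LP2 p Omega g -> LP phi -> LP2 p Omega dphi ->
  [/\ mu.-integrable Omega (EFin \o (fun x => p * pospow (p - 1) (dot e (g x)) * dot e (dphi x))),
      mu.-integrable Omega (EFin \o (fun x => p * signed_power p (g x).1 * (dphi x).1)),
      mu.-integrable Omega (EFin \o (fun x => p * signed_power p (g x).2 * (dphi x).2)) &
      mu.-integrable Omega (EFin \o (fun x => p * signed_power p (u x) * phi x))].
Proof.
move=> Lu [L1 L2] Lphi [M1 M2].
have L3 := dot_measurable oO p1 e L1 L2; have M3 := dot_measurable oO p1 e M1 M2.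
split; [exact: (pospow_variation L3 M3).1|exact: (norm_variation L1 M1).1|exact: (norm_variation L2 M2).1|].
exact: (norm_variation Lu Lphi).1.
Qed.

Lemma RintegralM1 (f h : plane -> R) : mu.-integrable Omega (EFin \o f) -> (forall x, h x = - f x) ->
  I h = - I f.
Proof.
move=> iF hf; have -> : h = (fun x => -1 * f x) by apply/funext => x; rewrite hf mulN1r.
by rewrite RintegralZl// mulN1r.
Qed.

Lemma opposite_arith (a b L i1 i2 i3 i4 j1 j2 j3 j4 : R) : j1 = - i1 -> j2 = - i2 -> j3 = - i3 ->
  j4 = - i4 -> 0 <= a * i1 + b * (i2 + i3) - L * i4 -> 0 <= a * j1 + b * (j2 + j3) - L * j4 ->
  a * i1 + b * (i2 + i3) = L * i4.
Proof. by move=> -> -> -> -> h1 h2; lra. Qed.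

(** The one-sided first variation is applied to [phi] and to its opposite. *)
Lemma euler_lagrange u g phi dphi : W01p Omega p u g -> W01p Omega p phi dphi ->
  energy g = Lam * nr u `^ p ->
  mu.-integrable Omega (EFin \o (fun x => dot (flux (g x)) (dphi x))) /\
  mu.-integrable Omega (EFin \o (fun x => signed_power p (u x) * phi x)) /\
  I (fun x => dot (flux (g x)) (dphi x)) = Lam * I (fun x => signed_power p (u x) * phi x).
Proof.
move=> Wu Wp E; have [Lu Lg _ _] := Wu; have [Lphi Ld _ _] := Wp.
have Wm := W01pZ oO bO p1 (-1) Wp.
have [i1 i2 i3 i4] := variation_integrable Lu Lg Lphi Ld.
have h1 := first_variation Wu Wp E; have h2 := first_variation Wu Wm E.
have n1 : I (fun x => p * pospow (p - 1) (dot e (g x)) * dot e (-1 *: dphi x)) =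
    - I (fun x => p * pospow (p - 1) (dot e (g x)) * dot e (dphi x)).
  by apply: RintegralM1 i1 _ => x; rewrite dotZr; ring.
have n2 : I (fun x => p * signed_power p (g x).1 * (-1 *: dphi x).1) =
    - I (fun x => p * signed_power p (g x).1 * (dphi x).1).
  by apply: RintegralM1 i2 _ => x; rewrite /= /GRing.scale /=; ring.
have n3 : I (fun x => p * signed_power p (g x).2 * (-1 *: dphi x).2) =
    - I (fun x => p * signed_power p (g x).2 * (dphi x).2).
  by apply: RintegralM1 i3 _ => x; rewrite /= /GRing.scale /=; ring.
have n4 : I (fun x => p * signed_power p (u x) * (-1 * phi x)) =
    - I (fun x => p * signed_power p (u x) * phi x).
  by apply: RintegralM1 i4 _ => x; ring.
have EL := opposite_arith n1 n2 n3 n4 h1 h2.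
have iZ (c : R) f : mu.-integrable Omega (EFin \o f) ->
    mu.-integrable Omega (EFin \o (fun x : plane => c * f x)).
  by move=> iF; have := integrableZl mO c iF.
have iD f h : mu.-integrable Omega (EFin \o f) -> mu.-integrable Omega (EFin \o h) ->
    mu.-integrable Omega (EFin \o (fun x : plane => f x + h x)).
  by move=> iF iH; have := integrableD mO iF iH.
have i23 := iD _ _ i2 i3; have ja := iZ al _ i1; have jb := iZ be _ i23.
have it := iZ p^-1 _ (iD _ _ ja jb); have iu := iZ p^-1 _ i4.
have Ef : (fun x => dot (flux (g x)) (dphi x)) = (fun x => p^-1 *
    (al * (p * pospow (p - 1) (dot e (g x)) * dot e (dphi x)) +
     be * (p * signed_power p (g x).1 * (dphi x).1 + p * signed_power p (g x).2 * (dphi x).2))).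
  by apply/funext => x; rewrite dot_flux; field.
have Eu : (fun x => signed_power p (u x) * phi x) = (fun x => p^-1 * (p * signed_power p (u x) * phi x)).
  by apply/funext => x; field.
rewrite Ef Eu; split=> //; split=> //.
rewrite (RintegralZl _ mO (iD _ _ ja jb)) (RintegralZl _ mO i4) (RintegralD mO ja jb).
rewrite (RintegralZl _ mO i1) (RintegralZl _ mO i23) (RintegralD mO i2 i3) EL.
by rewrite mulrCA.
Qed.

(** The explicit formula for the gradient is measurable on all of [Omega] and agrees with
    [grad aniso (g x)] where [aniso (g x)] is non-zero. *)
Lemma flux_measurable g (mg1 : measurable_fun (Omega : set mplane) (fun x => (g x).1))
    (mg2 : measurable_fun (Omega : set mplane) (fun x => (g x).2)) :
  measurable_fun ((Omega `&` [set x | aniso (g x) != 0]) : set mplane) (fun x => grad aniso (g x)).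
Proof.
have m1 (s : R) : 0 < s -> measurable_fun setT (pospow s : measurableTypeR R -> R).
  by move=> s0; apply: continuous_measurable_fun; exact: pospow_continuous.
have m2 : measurable_fun setT (signed_power p : measurableTypeR R -> R).
  by apply: continuous_measurable_fun; exact: signed_power_continuous.
have m3 : measurable_fun setT ((fun s : R => `|s| `^ p) : measurableTypeR R -> R).
  by apply: continuous_measurable_fun; exact: powR_norm_continuous.
have md : measurable_fun (Omega : set mplane) (fun x => dot e (g x)).
  by apply: measurable_funD; apply: measurable_funM.
have mP : measurable_fun (Omega : set mplane) (fun x => Phi (g x)).
  apply: measurable_funD; apply: measurable_funM => //; first exact: measurableT_comp (m1 _ p0) md.
  by apply: measurable_funD; [exact: measurableT_comp m3 mg1|exact: measurableT_comp m3 mg2].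
have mPp : measurable_fun (Omega : set mplane) (fun x => Phi (g x) `^ (p^-1 - 1)).
  exact: (measurableT_comp (measurable_powR _)).
have mF i : measurable_fun (Omega : set mplane) (fun x => Phi (g x) `^ (p^-1 - 1) * dot (basis_vector i) (flux (g x))).
  have mdp := measurableT_comp (m1 _ pm0) md.
  have mf1 := measurableT_comp m2 mg1; have mf2 := measurableT_comp m2 mg2.
  apply: measurable_funM => //; apply: measurable_funD; apply: measurable_funM => //;
    by apply: measurable_funD; apply: measurable_funM => //; apply: measurable_funM.
pose F i := (fun x => Phi (g x) `^ (p^-1 - 1) * dot (basis_vector i) (flux (g x))) \_ Omega.
have mFr i : measurable_fun setT (F i : mplane -> R) by apply/(measurable_restrictT _ mO); exact: mF.
have mT : measurable_fun setT ((fun x => (F false x, F true x)) : mplane -> mplane).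
  exact: (measurable_fun_pair (mFr false) (mFr true)).
have GE : {in Omega `&` [set x | aniso (g x) != 0], (fun x => (F false x, F true x)) =1 (fun x => grad aniso (g x))}.
  move=> x; rewrite inE => -[Ox /= nx]; have x0 : g x != 0.
    by apply: contra_neq nx => ->; rewrite /aniso Phi0// powR0// invr_eq0.
  have GF i : F i x = partial i aniso (g x).
    rewrite /F patchE mem_set// (is_derive_partial (aniso_is_derive (basis_vector i) x0)).
    by congr (_ * _); rewrite /dot mulrC (mulrC (basis_vector i).2).
  by rewrite /grad !GF.
by apply: (eq_measurable_fun _ GE); apply: measurable_funS mT.
Qed.

Theorem aniso_fundamental : fundamental Omega p aniso.
Proof.
have aA := aniso_anisotropy p1 e al0 be0.
split=> //.
  move=> /(congr1 (fun f => f (1, 0))); have h : ((1, 0) : plane) != 0.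
    by apply/eqP => /(congr1 fst) /=; apply/eqP; exact: oner_neq0.
  have := aniso_gt0 p1 e al0 be0 h => P0 H.
  by have := powR_gt0 p^-1 P0; rewrite (H : Phi (1, 0) `^ p^-1 = 0) ltxx.
have [u [g [Wu nu Eg]]] := minimizer_exists p1 e al0 be0 oO bO nO.
exists u, g; split=> //; have [Lu Lg _ _] := Wu; have [L1 L2] := Lg.
have nz x : aniso (g x) != 0 -> g x != 0.
  by apply: contra_neq => ->; rewrite /aniso Phi0// powR0// invr_eq0.
split.
- move=> ae0; have mE := energy_measurable p (Lp_measurable Lu).
  have := Lp_energy p1 Lu; rewrite nu powR1.
  rewrite (ae_eq_integral (fun=> 0%E)) ?integral0//.
  + by move=> /esym/eqP; rewrite onee_eq0.
  + by apply: (aeS _ ae0) => x H Ox; rewrite H// normr0 powR0.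
- by apply: aeW => x _ h; apply: aniso_differentiable; exact: nz.
- exact: flux_measurable (Lp_measurable L1) (Lp_measurable L2).
move=> phi dphi Wp.
have E : energy g = Lam * nr u `^ p by rewrite nu powR1 mulr1.
have [i1 [i2 EL]] := euler_lagrange Wu Wp E.
have [lE _] := lambda_aniso_fin p1 e al0 be0 oO bO nO.
have E1 x : aniso (g x) `^ (p - 1) * dot (grad aniso (g x)) (dphi x) = dot (flux (g x)) (dphi x).
  exact: aniso_flux.
have E2 x : `|u x| `^ (p - 2) * u x * phi x = signed_power p (u x) * phi x by rewrite signed_powerE.
under eq_integral do rewrite E1.
under [in RHS]eq_integral do rewrite E2.
have F f : mu.-integrable Omega (EFin \o f) -> (\int[mu]_(x in Omega) (f x)%:E = (I f)%:E)%E.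
  by move=> iF; rewrite /Rintegral fineK//; exact: integrable_fin_num iF.
by rewrite (F _ i1) (F _ i2) lE -EFinM EL.
Qed.

End euler_lagrange.

(** * The optimal constant *)

Section optimal_constant.
Context {R : realType}.
Local Notation plane := (R * R)%type.
Local Notation mu1 := (@lebesgue_measure R).
Local Notation mu := (mu1 \x mu1)%E.
Variables (Omega : set plane) (oO : open Omega) (bO : bounded_set Omega) (nO : Omega !=set0).
Variables (p : R) (p1 : 1 < p).
Let p0 : 0 < p. Proof. exact: lt_trans ltr01 p1. Qed.
Local Notation nr := (nrm mu Omega p).
Implicit Types (H : plane -> R) (theta : R).

Lemma anisotropyZ H (c : R) : 0 < c -> anisotropy H -> anisotropy (fun x => c * H x).
Proof.
move=> c0 aH; apply: anisotropy_intro => [x|x y|t x t0].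
- by rewrite mulr_ge0 ?(ltW c0)// anisotropy_ge0.
- by rewrite -mulrDr ler_pM2l// anisotropyD.
- by rewrite (anisotropy_hom _ aH t0) mulrCA.
Qed.

Lemma HnormZ_le H (c : R) : 0 < c -> anisotropy H -> Hnorm (fun x => c * H x) <= c * Hnorm H.
Proof.
move=> c0 aH; have aZ := anisotropyZ c0 aH.
apply: ge_sup; first exact: (has_sup_circle aZ).1.
by move=> _ [x cx <-]; rewrite ler_pM2l//; exact: Hnorm_ge.
Qed.

Lemma HnormZ H (c : R) : 0 < c -> anisotropy H -> Hnorm (fun x => c * H x) = c * Hnorm H.
Proof.
move=> c0 aH; apply/eqP; rewrite eq_le HnormZ_le//=.
have ci : 0 < c^-1 by rewrite invr_gt0.
have := HnormZ_le ci (anisotropyZ c0 aH).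
have -> : (fun x => c^-1 * (c * H x)) = H by apply/funext => x; rewrite mulKf// gt_eqF.
by rewrite -(ler_pM2l c0) mulrA mulfV ?gt_eqF// mul1r.
Qed.

(** Multiples stay in the family, so that normalizing [Hnorm] to 1 keeps [aniso_fundamental]
    applicable. *)
Lemma anisoZl e (al be c : R) : 0 < al -> 0 < be -> 0 < c ->
  aniso p e (c `^ p * al) (c `^ p * be) = (fun x => c * aniso p e al be x).
Proof.
move=> al0 be0 c0; apply/funext => x; rewrite /aniso.
have -> : Phi p e (c `^ p * al) (c `^ p * be) x = c `^ p * Phi p e al be x by rewrite /Phi; ring.
rewrite powRM ?powR_ge0 ?Phi_ge0// -powRrM mulfV ?gt_eqF// powRr1//.
exact: ltW.
Qed.

Lemma rayleigh_arith (q A B U b y L : R) : 0 <= q -> q <= 1 -> 0 <= A -> 0 <= B -> 0 <= b -> 0 < U ->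
  L * U <= q * 1 * A + q * b * B -> A + b * B <= y * U -> L <= y.
Proof.
move=> q0 q1 A0 B0 b0 U0 h1 h2; rewrite -(ler_pM2r U0); apply: (le_trans h1).
have -> : q * 1 * A + q * b * B = q * (A + b * B) by ring.
apply: le_trans h2; apply: ler_piMl => //.
by rewrite addr_ge0// mulr_ge0.
Qed.

(** The test function of the one-sided problem has finite full gradient energy, so a small
    perturbation keeps its quotient below [y]. Normalizing divides by [Hnorm N >= 1], which can only
    lower the quotient. *)
Lemma fundamental_approx theta (y : R) : (lambda1p p (2 * width Omega theta) < y%:E)%E ->
  exists H, [/\ fundamental Omega p H, Hnorm H = 1 & (lambdaH Omega p H <= y%:E)%E].
Proof.
move=> ly; have [u [tu u0 lt]] := test_approx oO bO nO p1 ly.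
pose e := @direction R theta.
pose A := nr (fun x => posdot e (grad u x)) `^ p.
pose B := nr (partial false u) `^ p + nr (partial true u) `^ p.
pose U := nr u `^ p.
have A0 : 0 <= A by exact: powR_ge0.
have B0 : 0 <= B by rewrite addr_ge0 ?powR_ge0.
have U0 : 0 < U by rewrite powR_gt0.
(* The slack [y * U - A] is spread over [B]; the added 1 covers [B = 0]. *)
pose b := (y * U - A) / (B + 1).
have b0 : 0 < b by rewrite divr_gt0 ?subr_gt0// ltr_wpDl.
have le : A + b * B <= y * U.
  rewrite -lerBrDl /b -mulrA ler_piMr ?subr_ge0 ?(ltW lt)//.
  by rewrite mulrC ler_pdivrMr ?ltr_wpDl// mul1r lerDl.
pose N := aniso p e 1 b; have aN : anisotropy N by exact: aniso_anisotropy.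
have N1 : 1 <= Hnorm N.
  apply: le_trans (Hnorm_ge aN (direction_circle theta)).
  apply: (powR_le_cancel p1); rewrite ?aniso_ge0// powR1 (aniso_pow p1 e ltr01 b0).
  rewrite /Phi dot_dir pospow_pos// powR1 mul1r lerDl.
  by rewrite mulr_ge0 ?(ltW b0)// addr_ge0 ?powR_ge0.
have Np : 0 < Hnorm N by exact: lt_le_trans ltr01 N1.
pose c := (Hnorm N)^-1; have c0 : 0 < c by rewrite invr_gt0.
have c1 : c <= 1 by rewrite invf_le1.
have q0 : 0 < c `^ p by rewrite powR_gt0.
have q1 : c `^ p <= 1.
  have -> : 1 = 1 `^ p :> R by rewrite powR1.
  by apply: ge0_ler_powR; rewrite ?nnegrE ?(ltW p0) ?(ltW c0).
have al0 : 0 < c `^ p * 1 by rewrite mulr1.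
have be0 : 0 < c `^ p * b by rewrite mulr_gt0.
exists (aniso p e (c `^ p * 1) (c `^ p * b)); split.
- exact: aniso_fundamental.
- by rewrite anisoZl// HnormZ// mulVf// gt_eqF.
have low := energy_lower p1 e al0 be0 oO bO nO (W01p_test oO bO p1 tu).
rewrite (lambda_aniso_fin p1 e al0 be0 oO bO nO).1 lee_fin.
exact: (rayleigh_arith (ltW q0) q1 A0 B0 (ltW b0) U0 low le).
Qed.

Lemma Lambda_minE : Lambda_min Omega p = inf_lambda Omega p.
Proof.
apply/eqP; rewrite eq_le; apply/andP; split; last first.
  apply: le_ereal_inf_tmp => _ [H [[aH _ _] H1] <-]; exact: inf_lambda_lower.
apply: le_ereal_inf_tmp => _ [theta _ <-].
have W0 : 0 < 2 * width Omega theta by rewrite mulr_gt0// width_gt0.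
have lE : lambda1p p (2 * width Omega theta) = (fine (lambda1p p (2 * width Omega theta)))%:E.
  by rewrite fineK// ge0_fin_numE ?lambda1p_ge0// lambda1p_lty.
rewrite lE; apply/lee_addgt0Pr => d d0; rewrite -EFinD.
have lt : (lambda1p p (2 * width Omega theta) < (fine (lambda1p p (2 * width Omega theta)) + d)%:E)%E.
  by rewrite [X in (X < _)%E]lE lte_fin ltrDl.
have [H [fH H1 le]] := fundamental_approx lt.
by apply: le_trans le; apply: ereal_inf_lbound; exists H.
Qed.

(** [max_width_angle] does not confine its angle to [0, pi]; an arbitrary angle is brought back to
    one turn through its unit vector. *)
Lemma direction_reduce theta : exists2 theta', theta' \in `[0, 2 * pi] &
  width Omega theta <= width Omega theta'.
Proof.
have [t' ht' E] := unit_direction (direction_circle theta).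
exists t' => //; apply: (width_sign bO (normr1 R)); by rewrite scale1r.
Qed.

Lemma half_turn theta : theta \in `[0, 2 * pi] -> exists2 theta', theta' \in `[0, pi] &
  width Omega theta <= width Omega theta'.
Proof.
rewrite in_itv /= => /andP[t0 t2]; have [tp|tp] := leP theta pi.
  by exists theta; rewrite ?in_itv /= ?t0.
exists (theta - pi); first by rewrite in_itv /= subr_ge0 (ltW tp) /= lerBlDr; lra.
apply: (width_sign bO (s := -1)); first by rewrite normrN1.
rewrite /direction -{1 2}(subrK pi theta) cosDpi sinDpi.
by congr pair; rewrite /= /GRing.scale /= mulN1r.
Qed.

(** [lambda1p] decreases with the length, so the largest width gives the smallest eigenvalue. *)
Lemma max_width_lambda theta0 : (forall theta, theta \in `[0, 2 * pi] -> width Omega theta <= width Omega theta0) ->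
  lambda1p p (2 * width Omega theta0) = inf_lambda Omega p.
Proof.
move=> H; apply/eqP; rewrite eq_le; apply/andP; split.
  apply: le_ereal_inf_tmp => _ [theta ht <-]; apply: lambda1p_mono => //.
  by rewrite ler_pM2l//; exact: H.
have [t' ht' le] := direction_reduce theta0.
apply: (le_trans (inf_lambda_le Omega p ht')); apply: lambda1p_mono => //.
by rewrite ler_pM2l.
Qed.

Lemma max_width_angleP theta0 : max_width_angle Omega theta0 ->
  forall theta, theta \in `[0, 2 * pi] -> width Omega theta <= width Omega theta0.
Proof. by move=> H theta /half_turn[t' ht' le]; apply: (le_trans le); exact: H. Qed.

(** A width larger than the one at [theta1] would give, by [lambda1p_strict], an eigenvalue below
    the infimum. Half turns bring the maximal angle into [0, pi]. *)
Lemma attained_optimal : (exists2 theta1, theta1 \in `[0, 2 * pi] &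
    lambda1p p (2 * width Omega theta1) = inf_lambda Omega p) <-> optimal_design Omega.
Proof.
split=> [[t1 ht1 E]|[t0 ht0 H]].
  have [t0 ht0 le] := half_turn ht1; exists t0 => // theta; rewrite in_itv /= => /andP[h1 h2].
  have pi0 := @pi_gt0 R.
  have ht : theta \in `[0, 2 * pi] by rewrite in_itv /= h1 /=; lra.
  apply: le_trans le; rewrite leNgt; apply/negP => lt.
  have W1 : 0 < 2 * width Omega t1 by rewrite mulr_gt0// width_gt0.
  have lt2 : 2 * width Omega t1 < 2 * width Omega theta by rewrite ltr_pM2l.
  have := lambda1p_strict p1 W1 lt2; rewrite E ltNge => /negP; apply.
  exact: inf_lambda_le.
exists t0; last exact: max_width_lambda (max_width_angleP H).
by move: ht0; rewrite !in_itv /= => /andP[-> h] /=; have := @pi_gt0 R; lra.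
Qed.

End optimal_constant.

Theorem theorem1p6 (R : realType) (p : R) (hp : 1 < p) (Omega : set (R * R))
    (dom : domain Omega) (bnd : bounded_set Omega) :
  [/\ (0 < Lambda_min Omega p)%E,
      Lambda_min Omega p =
        ereal_inf [set lambda1p p (2 * width Omega theta) |
                   theta in `[0, 2 * pi]],
      (exists2 theta1, theta1 \in `[0, 2 * pi] &
         lambda1p p (2 * width Omega theta1) =
         ereal_inf [set lambda1p p (2 * width Omega theta) |
                    theta in `[0, 2 * pi]]) <->
      optimal_design Omega &
      forall theta0, max_width_angle Omega theta0 ->
        forall alpha, 0 < alpha ->
          extremal Omega p (fun x => alpha * H0 theta0 x) /\
          ~ fundamental Omega p (fun x => alpha * H0 theta0 x)].
Proof.
have [oO _ nO] := dom.
split.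
- by rewrite Lambda_minE//; exact: inf_lambda_gt0.
- exact: Lambda_minE.
- exact: attained_optimal.
- move=> theta0 Ht alpha a0; split; last exact: H0_not_fundamental.
  split; [exact: H0_anisotropy|exact: H0_neq0|].
  rewrite lambdaH_H0Z// H0_Hnorm// Lambda_minE//.
  by rewrite (max_width_lambda bnd hp (max_width_angleP bnd Ht)) muleC.
Qed.
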